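(* Let $\Sigma_{\mathrm{mix}}(A)$ be the sum of $c_A(\{\gamma\})$ over all conjugacy classes $\{\gamma\}$ of $\Gamma$ whose elements have at least one hyperbolic coordinate, no parabolic coordinate, and do not fix a cusp of $\Gamma$ (mixed and totally hyperbolic classes). For such a class let $T_\gamma=\sum_{\sigma\in\{\gamma\}}\int_F k(z,\sigma z)u(z)\,d\mu(z)$. Then as $A\to\infty$ \[\Sigma_{\mathrm{mix}}(A)=\sum_{\{\gamma\}}T_\gamma+o(A),\] $T_\gamma=0$ for all but finitely many such classes, and if the first $m$ coordinates of $\gamma$ are hyperbolic and the remaining $n-m$ are elliptic then \begin{align*}T_\gamma=(2\pi)^{n-m}F_\gamma(0,\dots,0)\int_0^\infty\!\!\cdots\!\int_0^\infty\int_{-\pi/2}^{\pi/2}\!\!\cdots\!\int_{-\pi/2}^{\pi/2}&\psi\big(N(\vartheta_1,\gamma^{(1)}),\dots,N(\vartheta_m,\gamma^{(m)}),S(r_{m+1},\theta_\gamma^{(m+1)}),\dots,S(r_n,\theta_\gamma^{(n)})\big)\\&\times\prod_{k=1}^m f_{\lambda_k}(\vartheta_k)\frac{d\vartheta_k}{\cos^2\vartheta_k}\prod_{k=m+1}^n g_{\lambda_k}(r_k)\sinh r_k\,dr_k,\end{align*} where \[F_\gamma(0,\dots,0)=\int_{(\log r_1,\dots,\log r_m)\in P_\gamma}u\big(\varrho_\gamma^{(1)}(r_1i),\dots,\varrho_\gamma^{(m)}(r_mi),\varrho_\gamma^{(m+1)}i,\dots,\varrho_\gamma^{(n)}i\big)\prod_{k=1}^m\frac{dr_k}{r_k}.\]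 For other distributions of the hyperbolic and elliptic coordinates the analogous formula (with coordinates permuted accordingly) holds.
   Context: Let $n\ge2$. $PSL(2,\mathbb{R})^n$ acts coordinatewise by Möbius transformations on $\mathbb{H}^n$ and on $(\mathbb{R}\cup\{\infty\})^n$; operations on vectors are coordinatewise; $Na=\prod_k a^{(k)}$; $z=x+iy\in\mathbb{H}^n$, $d\mu(z)=\prod_k y_k^{-2}dx_kdy_k$. $\Gamma\le PSL(2,\mathbb{R})^n$ is a discrete irreducible subgroup (no element $\ne 1$ has a coordinate equal to the identity) with finite-volume fundamental domain and at least one cusp. For $\rho\in PSL(2,\mathbb{R})^n$, let $t(\rho)=\{b:\begin{pmatrix}1&b\\0&1\end{pmatrix}\in\rho^{-1}\Gamma\rho\}$ and $\Lambda(\rho)$ the set of $\varepsilon\in(\mathbb{R}^+)^n$ such that some element of $\rho^{-1}\Gamma\rho$ acts as $z\mapsto\varepsilon z+b$; $\rho\infty$ is a cusp if $t(\rho)$ is a lattice and $\Lambda(\rho)\cong\mathbb{Z}^{n-1}$. Fix a finite complete set $\mathcal{S}$ of inequivalent cusps, scaling elements $\sigma_\kappa$ ($\sigma_\kappa\infty=\kappa$), $\mathbf{t}_\kappa=t(\sigma_\kappa)$, $\Lambda_\kappa=\Lambda(\sigma_\kappa)$, $V=\{a:\sum a^{(k)}=0\}$. The fundamental domain is $F=F_0\cup\bigcup_{\kappa\in\mathcal{S}}F_\kappa$, $F_0$ compact, $F_\kappa=\sigma_\kappa(\{z:Ny>C,\ x\in P_\kappa,\ \log(y/(Ny)^{1/n})\in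 Q_\kappa\})$ with $P_\kappa$, $Q_\kappa$ fundamental parallelotopes of $\mathbf{t}_\kappa$ and of $\log\Lambda_\kappa\subset V$, and $C$ chosen so these cusp pieces are disjoint and meet each orbit at most once; $F_A=F_0\cup\bigcup_\kappa\{z\in F_\kappa:N(\operatorname{Im}\sigma_\kappa^{-1}z)\le A\}$. $u$ is a smooth nonconstant $\Gamma$-invariant function with $(\Delta_k+\lambda_k)u=0$, $\Delta_k=y_k^2(\partial^2_{x_k}+\partial^2_{y_k})$, $\lambda_k=s_k(1-s_k)$, $\operatorname{Re}s_k<1$, and $u(\sigma_\kappa z)=o(e^{2\pi y_k})$ as $y_k\to\infty$. Fix $\psi\in C_c^\infty(\mathbb{R}^n)$, $k(z,w)=\psi\big((|z_k-w_k|^2/(\operatorname{Im}z_k\operatorname{Im}w_k))_{k=1}^n\big)$, and $c_A(\{\gamma\})=\sum_{\sigma\in\{\gamma\}}\int_{F_A}k(z,\sigma z)u(z)\,d\mu(z)$. $D(N)=\operatorname{diag}(N^{1/2},N^{-1/2})$, $R(\theta)=\begin{pmatrix}\cos\theta&\sin\theta\\-\sin\theta&\cos\theta\end{pmatrix}$. For $\gamma$ with first $m$ coordinates hyperbolic and the rest elliptic, $\varrho_\gamma\in PSL(2,\mathbb{R})^n$ satisfies $\varrho_\gamma^{-1}\gamma\varrho_\gamma=(D(N_\gamma^{(1)}),\dots,D(N_\gamma^{(m)}),R(\theta_\gamma^{(m+1)}),\dots,R(\theta_\gamma^{(n)}))$ with $N_\gamma^{(k)}>1$, $\theta_\gamma^{(l)}\in[0,\pi)$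 (determined by the class). The centralizer $C(\gamma)$ of $\gamma$ in $\Gamma$ is free abelian of rank $m$ with fixed generators $\gamma_1,\dots,\gamma_m$, and $\varrho_\gamma^{-1}\gamma_i\varrho_\gamma=(D(N_{\gamma_i}^{(1)}),\dots,D(N_{\gamma_i}^{(m)}),R(\cdot),\dots,R(\cdot))$ with $N_{\gamma_i}^{(k)}>0$; $P_\gamma$ is the fundamental parallelepiped of the lattice in $\mathbb{R}^m$ spanned by $(\log N_{\gamma_i}^{(1)},\dots,\log N_{\gamma_i}^{(m)})$, $i=1,\dots,m$. $N(\vartheta,\gamma^{(k)})=(N_\gamma^{(k)}+(N_\gamma^{(k)})^{-1}-2)/\cos^2\vartheta$, $S(r,\theta)=(2\sinh r\sin\theta)^2$. $f_\lambda$ is the solution on $(-\pi/2,\pi/2)$ of $F''(\vartheta)=\frac{\lambda}{\cos^2\vartheta}F(\vartheta)$ with $f_\lambda(0)=1$, $f_\lambda'(0)=0$; $g_\lambda$ is the unique solution on $[0,\infty)$ of $g''+\frac{\cosh r}{\sinh r}g'=\lambda g$ with $g(0)=1$.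
   Formalization: In the formula for T_γ, f_{λ_k} and g_{λ_k} are replaced by f_{−λ_k} and g_{−λ_k}: since (Δ_k+λ_k)u=0, the averages of u solve the stated ODEs with parameter −λ_k, and the formula with +λ_k fails whenever λ_k≠0 and F_γ(0,…,0)≠0 for suitable ψ. *)

(* Defs.v *)
From HB Require Import structures.
From mathcomp Require Import all_boot all_order all_algebra.
From mathcomp Require Import generic_quotient complex.
From mathcomp Require Import all_classical all_reals all_analysis.

Set Implicit Arguments.
Unset Strict Implicit.
Unset Printing Implicit Defensive.
Import Order.TTheory GRing.Theory Num.Theory.
Import numFieldNormedType.Exports.
Local Open Scope classical_set_scope.
Local Open Scope ring_scope.
Local Open Scope complex_scope.

Notation normc := ComplexField.Normc.normc.

Section SL2.
Variable R : realType.

Record SL2 := MkSL2 { SL2_mx :> 'M[R]_2; _ : \det SL2_mx == 1 }.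
HB.instance Definition _ := [isSub for SL2_mx].
HB.instance Definition _ := [Choice of SL2 by <:].

Lemma det_SL2 (A : SL2) : \det A = 1.
Proof. exact/eqP/(valP A). Qed.

Lemma SL2_unit (A : SL2) : (A : 'M[R]_2) \in unitmx.
Proof. by rewrite unitmxE det_SL2 unitr1. Qed.

Fact SL2_one_subproof : \det (1%:M : 'M[R]_2) == 1.
Proof. by rewrite det1. Qed.
Definition SL2_one := MkSL2 SL2_one_subproof.

Fact SL2_mul_subproof (A B : SL2) : \det (A *m B) == 1.
Proof. by rewrite det_mulmx !det_SL2 mulr1. Qed.
Definition SL2_mul A B := MkSL2 (SL2_mul_subproof A B).

Fact SL2_inv_subproof (A : SL2) : \det (invmx A) == 1.
Proof. by rewrite det_inv det_SL2 invr1. Qed.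
Definition SL2_inv A := MkSL2 (SL2_inv_subproof A).

Fact SL2_mulA : associative SL2_mul.
Proof. by move=> A B C; apply/val_inj/mulmxA. Qed.
Fact SL2_mul1 : left_id SL2_one SL2_mul.
Proof. by move=> A; apply/val_inj/mul1mx. Qed.
Fact SL2_mulr1 : right_id SL2_one SL2_mul.
Proof. by move=> A; apply/val_inj/mulmx1. Qed.
Fact SL2_mulV : left_inverse SL2_one SL2_inv SL2_mul.
Proof. by move=> A; apply/val_inj/mulVmx/SL2_unit. Qed.
Fact SL2_mulrV : right_inverse SL2_one SL2_inv SL2_mul.
Proof. by move=> A; apply/val_inj/mulmxV/SL2_unit. Qed.
HB.instance Definition _ :=
  isGroup.Build SL2 SL2_mulA SL2_mul1 SL2_mulr1 SL2_mulV SL2_mulrV.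

Definition SL2_sim (A B : SL2) : bool :=
  (SL2_mx A == SL2_mx B) || (SL2_mx A == - SL2_mx B).

Fact SL2_sim_equiv : equiv_class_of SL2_sim.
Proof.
rewrite /SL2_sim; split=> [A|A B|B A C].
- by rewrite eqxx.
- by rewrite eq_sym; congr (_ || _); rewrite -eqr_oppLR eq_sym.
- by case/orP=> /eqP-> /orP[]/eqP->; rewrite ?opprK eqxx ?orbT.
Qed.
Canonical SL2_sim_equivRel := EquivRelPack SL2_sim_equiv.

Definition PSL2 := {eq_quot SL2_sim}%qT.
HB.instance Definition _ := Choice.on PSL2.
HB.instance Definition _ := EqQuotient.on PSL2.

Definition PSL2_one : PSL2 := (\pi_PSL2 SL2_one)%qT.
Definition PSL2_mul (g h : PSL2) : PSL2 :=
  (\pi_PSL2 (SL2_mul (repr g) (repr h)))%qT.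
Definition PSL2_inv (g : PSL2) : PSL2 := (\pi_PSL2 (SL2_inv (repr g)))%qT.

Lemma PSL2_eqP (A B : SL2) : reflect (\pi_PSL2 A = \pi_PSL2 B)%qT (SL2_sim A B).
Proof. by apply: (iffP idP) => /eqmodP. Qed.

Lemma repr_sim (A : SL2) : SL2_sim (repr (\pi_PSL2 A)%qT) A.
Proof. by apply/PSL2_eqP; rewrite reprK. Qed.

Lemma pi_mulE (A B : SL2) :
  PSL2_mul (\pi_PSL2 A)%qT (\pi_PSL2 B)%qT = (\pi_PSL2 (SL2_mul A B))%qT.
Proof.
apply/PSL2_eqP; rewrite /SL2_sim /=.
case/orP: (repr_sim A) => /eqP ->; case/orP: (repr_sim B) => /eqP ->;
  by rewrite ?mulmxN ?mulNmx ?opprK eqxx ?orbT.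
Qed.

Lemma pi_invE (A : SL2) : PSL2_inv (\pi_PSL2 A)%qT = (\pi_PSL2 (SL2_inv A))%qT.
Proof.
apply/PSL2_eqP; rewrite /SL2_sim /=.
case/orP: (repr_sim A) => /eqP ->; first by rewrite eqxx.
by rewrite -scaleN1r invmxZ ?unitmxZ ?unitrN1 ?SL2_unit // invrN1 scaleN1r eqxx orbT.
Qed.

Lemma PSL2_lift (g : PSL2) : exists A : SL2, g = (\pi_PSL2 A)%qT.
Proof. by exists (repr g); rewrite reprK. Qed.

Fact PSL2_mulA : associative PSL2_mul.
Proof.
move=> f g h; have [A ->] := PSL2_lift f; have [B ->] := PSL2_lift g.
by have [C ->] := PSL2_lift h; rewrite !pi_mulE SL2_mulA.
Qed.
Fact PSL2_mul1 : left_id PSL2_one PSL2_mul.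
Proof. by move=> g; have [A ->] := PSL2_lift g; rewrite pi_mulE SL2_mul1. Qed.
Fact PSL2_mulr1 : right_id PSL2_one PSL2_mul.
Proof. by move=> g; have [A ->] := PSL2_lift g; rewrite pi_mulE SL2_mulr1. Qed.
Fact PSL2_mulV : left_inverse PSL2_one PSL2_inv PSL2_mul.
Proof.
by move=> g; have [A ->] := PSL2_lift g; rewrite pi_invE pi_mulE SL2_mulV.
Qed.
Fact PSL2_mulrV : right_inverse PSL2_one PSL2_inv PSL2_mul.
Proof.
by move=> g; have [A ->] := PSL2_lift g; rewrite pi_invE pi_mulE SL2_mulrV.
Qed.
HB.instance Definition _ :=
  isGroup.Build PSL2 PSL2_mulA PSL2_mul1 PSL2_mulr1 PSL2_mulV PSL2_mulrV.

End SL2.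

(* Lebesgue measure on R^n, with R^n carried by n-tuples (whose product
   sigma-algebra is the one of the library). *)
Section lebesgue_tuple.
Variable R : realType.
Local Notation RT := (measurableTypeR R).

Definition tuple_cons n (p : RT * n.-tuple RT) : n.+1.-tuple RT :=
  [tuple of p.1 :: p.2].
Definition tuple_uncons n (t : n.+1.-tuple RT) : RT * n.-tuple RT :=
  (thead t, [tuple of behead t]).

Lemma tuple_consK n : cancel (@tuple_cons n) (@tuple_uncons n).
Proof. by case=> x t; rewrite /tuple_uncons theadE; congr pair; exact: val_inj. Qed.

Lemma measurable_tuple_cons n : measurable_fun setT (@tuple_cons n).
Proof. exact: measurable_cons. Qed.

Lemma measurable_tuple_uncons n : measurable_fun setT (@tuple_uncons n).
Proof.
apply/measurable_fun_pairP; split; first exact: measurable_tnth.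
exact: measurable_behead.
Qed.

Section step.
Variables (n : nat).
Variable mu : {sigma_finite_measure set (n.-tuple RT) -> \bar R}.

Definition leb_step : set (n.+1.-tuple RT) -> \bar R :=
  pushforward (@lebesgue_measure R \x mu)%E (@tuple_cons n).

Let leb_step0 : leb_step set0 = 0%E.
Proof. by rewrite /leb_step /pushforward preimage_set0 measure0. Qed.

Let leb_step_ge0 A : (0 <= leb_step A)%E.
Proof. exact: (measure_ge0 (@lebesgue_measure R \x mu)%E). Qed.

Let leb_step_sigma_additive : semi_sigma_additive leb_step.
Proof.
move=> F mF tF mUF; rewrite /leb_step /pushforward preimage_bigcup.
apply: measure_semi_sigma_additive.
- by move=> k; rewrite -[X in measurable X]setTI; exact: measurable_tuple_cons.
- apply/trivIsetP => /= i j _ _ ij; rewrite -preimage_setI.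
  by move/trivIsetP : tF => /(_ _ _ _ _ ij) ->//; rewrite preimage_set0.
- rewrite -preimage_bigcup -[X in measurable X]setTI.
  exact: measurable_tuple_cons.
Qed.

HB.instance Definition _ := isMeasure.Build _ _ _ leb_step
  leb_step0 leb_step_ge0 leb_step_sigma_additive.

Let leb_step_sigma_finite : sigma_finite setT leb_step.
Proof.
have /sigma_finiteP[F [FT ndF Foo]] := sigma_finiteT (@lebesgue_measure R).
have /sigma_finiteP[G [GT ndG Goo]] := sigma_finiteT mu.
exists (fun k => @tuple_uncons n @^-1` (F k `*` G k)).
  rewrite -preimage_bigcup (_ : \bigcup_i _ = setT) ?preimage_setT//.
  rewrite -setXTT FT GT predeqE => -[x y]; split.
    by move=> [i _ [/= ? ?]]; split; exists i.
  move=> [/= [i _ Fx] [j _ Gy]]; exists (maxn i j) => //; split.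
    by move: x Fx; exact/subsetPset/ndF/leq_maxl.
  by move: y Gy; exact/subsetPset/ndG/leq_maxr.
move=> k; have [mF Fk] := Foo k; have [mG Gk] := Goo k; split.
  rewrite -[X in measurable X]setTI.
  by apply: measurable_tuple_uncons => //; exact: measurableX.
have -> : leb_step (@tuple_uncons n @^-1` (F k `*` G k)) =
    (@lebesgue_measure R \x mu)%E (F k `*` G k).
  rewrite /leb_step /pushforward; congr product_measure1; apply/seteqP.
  by split=> p; rewrite /preimage /mkset tuple_consK.
by rewrite product_measure1E// lte_mul_pinfty// ge0_fin_numE.
Qed.

HB.instance Definition _ := Measure_isSigmaFinite.Build _ _ _ leb_step
  leb_step_sigma_finite.
End step.

Fixpoint leb n : {sigma_finite_measure set (n.-tuple RT) -> \bar R} :=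
  if n is n'.+1 then leb_step (leb n') else \d_ [tuple].

Lemma leb_box n (D : 'I_n -> set RT) : (forall i, measurable (D i)) ->
  leb n [set t | forall i, D i (tnth t i)] =
  (\prod_(i < n) @lebesgue_measure R (D i))%E.
Proof.
elim: n D => [|n IH] D mD.
  rewrite big_ord0 /= diracE mem_set // => -[]; by [].
rewrite big_ord_recl -(IH (fun i => D (lift ord0 i))) // /leb -/leb /= /leb_step /pushforward.
set E := [set t : n.-tuple _ | _].
have mE : measurable E.
  rewrite (_ : E = \bigcap_(i in [set: 'I_n]) ((@tnth _ _)^~ i @^-1` D (lift ord0 i)))%classic; last first.
    by apply/seteqP; split=> t /= H i; [by move=> _; exact: H|exact: (H i I)].
  apply: fin_bigcap_measurable => // i _; rewrite -[X in measurable X]setTI; exact: measurable_tnth.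
rewrite -product_measure1E //; congr product_measure1.
apply/seteqP; split=> -[x t] /= H.
  split; first by have := H ord0.
  by move=> i /=; have := H (lift ord0 i); rewrite /tuple_cons tnthS.
by move=> i; case: (unliftP ord0 i) => [j|] ->; [rewrite tnthS; exact: H.2|exact: H.1].
Qed.

End lebesgue_tuple.

Section complex_valued.
Variable R : realType.

Definition cintegral d (T : measurableType d) (mu : {measure set T -> \bar R})
    (D : set T) (f : T -> R[i]) : R[i] :=
  (\int[mu]_(x in D) complex.Re (f x)) +i* (\int[mu]_(x in D) complex.Im (f x)).

Definition cintegrable d (T : measurableType d)
    (mu : {measure set T -> \bar R}) (D : set T) (f : T -> R[i]) : Prop :=
  mu.-integrable D (fun x => (complex.Re (f x))%:E) /\
  mu.-integrable D (fun x => (complex.Im (f x))%:E).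

(* The unordered sum of the family, meaningful only when it is summable. *)
Definition rsum (I : choiceType) (D : set I) (f : I -> R) : R :=
  fine (\esum_(i in D) (Num.max (f i) 0)%:E
        - \esum_(i in D) (Num.max (- f i) 0)%:E)%E.

Definition csum (I : choiceType) (D : set I) (f : I -> R[i]) : R[i] :=
  rsum D (fun i => complex.Re (f i)) +i* rsum D (fun i => complex.Im (f i)).

Definition csummable (I : choiceType) (D : set I) (f : I -> R[i]) : Prop :=
  summable D (fun i => (normc (f i))%:E).

Variable V : normedModType R.

Definition cderivable (f : V -> R[i]) (x v : V) : Prop :=
  derivable (fun y => complex.Re (f y)) x v /\
  derivable (fun y => complex.Im (f y)) x v.

Definition cderive (v : V) (f : V -> R[i]) (x : V) : R[i] :=
  'D_v (fun y => complex.Re (f y)) x +i* 'D_v (fun y => complex.Im (f y)) x.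

Fixpoint iter_derive (vs : seq V) (f : V -> R) : V -> R :=
  if vs is v :: vs' then fun x => 'D_v (iter_derive vs' f) x else f.

(* C^infinity on the open set U of the finite-dimensional space V: all iterated
   directional derivatives exist and are continuous on U. *)
Definition smooth_on (U : set V) (f : V -> R) : Prop :=
  forall (vs : seq V) (x : V), U x ->
    {for x, continuous (iter_derive vs f)} /\
    forall v, derivable (iter_derive vs f) x v.

Definition csmooth_on (U : set V) (f : V -> R[i]) : Prop :=
  smooth_on U (fun x => complex.Re (f x)) /\
  smooth_on U (fun x => complex.Im (f x)).

Definition compact_support (f : V -> R[i]) : Prop :=
  compact (closure [set x | f x != 0]).

End complex_valued.

Notation PSL2n R n := {ffun 'I_n -> PSL2 R}.

Section moebius.
Variable R : realType.

Definition mx2 (a b c d : R) : 'M[R]_2 :=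
  \matrix_(i, j) (if i == 0 then (if j == 0 then a else b)
                            else (if j == 0 then c else d)).

(* The class of the matrix A, meaningful only when \det A = 1. *)
Definition psl2 (A : 'M[R]_2) : PSL2 R := (\pi_(PSL2 R) (insubd (SL2_one R) A))%qT.

Definition transl_mx (b : R) : 'M[R]_2 := mx2 1 b 0 1.
Definition dil_mx (N : R) : 'M[R]_2 := mx2 (Num.sqrt N) 0 0 (Num.sqrt N)^-1.
Definition rot_mx (t : R) : 'M[R]_2 := mx2 (cos t) (sin t) (- sin t) (cos t).

(* The choice of the representative repr g does not matter below: replacing a
   matrix by its opposite changes neither the action nor the absolute value of
   the trace. *)
Definition moebius (g : PSL2 R) (z : R[i]) : R[i] :=
  let A := SL2_mx (repr g) in
  ((A 0 0)%:C * z + (A 0 1)%:C) / ((A 1 0)%:C * z + (A 1 1)%:C).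

Lemma moebius_pi (A : SL2 R) (z : R[i]) : moebius (\pi_(PSL2 R) A)%qT z =
  ((SL2_mx A 0 0)%:C * z + (SL2_mx A 0 1)%:C) /
  ((SL2_mx A 1 0)%:C * z + (SL2_mx A 1 1)%:C).
Proof.
rewrite /moebius; case/orP: (repr_sim A) => /eqP -> //.
by rewrite !mxE !rmorphN !mulNr -!opprD invrN mulrNN.
Qed.

(* None is the point at infinity. *)
Definition moebius_bd (g : PSL2 R) (x : option R) : option R :=
  let A := SL2_mx (repr g) in
  match x with
  | None => if A 1 0 == 0 then None else Some (A 0 0 / A 1 0)
  | Some t => if A 1 0 * t + A 1 1 == 0 then None
              else Some ((A 0 0 * t + A 0 1) / (A 1 0 * t + A 1 1))
  end.

Definition hyperbolic (g : PSL2 R) : Prop := 2 < `|\tr (SL2_mx (repr g))|.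
Definition elliptic (g : PSL2 R) : Prop := `|\tr (SL2_mx (repr g))| < 2.
Definition parabolic (g : PSL2 R) : Prop :=
  g <> 1%g /\ `|\tr (SL2_mx (repr g))| = 2.

(* g and h have lifts to SL(2,R) with entries at distance < e; these are basic
   neighbourhoods for the quotient topology. *)
Definition psl2_near (e : R) (g h : PSL2 R) : Prop :=
  exists A B : SL2 R, [/\ g = (\pi_(PSL2 R) A)%qT, h = (\pi_(PSL2 R) B)%qT &
    forall i j, `|SL2_mx A i j - SL2_mx B i j| < e].

Variable n : nat.

Definition act (g : PSL2n R n) (z : 'rV[R[i]]_n) : 'rV[R[i]]_n :=
  \row_k moebius (g k) (z 0 k).

Definition act_bd (g : PSL2n R n) (x : {ffun 'I_n -> option R}) :
    {ffun 'I_n -> option R} :=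
  [ffun k => moebius_bd (g k) (x k)].

Definition infty : {ffun 'I_n -> option R} := [ffun => None].

Definition Hn : set 'rV[R[i]]_n := [set z | forall k, 0 < complex.Im (z 0 k)].

Definition mkz (x y : 'I_n -> R) : 'rV[R[i]]_n := \row_k (x k +i* y k).
Definition re (z : 'rV[R[i]]_n) : 'rV[R]_n := \row_k complex.Re (z 0 k).
Definition im (z : 'rV[R[i]]_n) : 'rV[R]_n := \row_k complex.Im (z 0 k).
Definition vnorm (a : 'rV[R]_n) : R := \prod_k a 0 k.

Definition dxdy := (leb R n \x leb R n)%E.
Definition dens (y : n.-tuple R) : R := (\prod_k tnth y k ^+ 2)^-1.
Definition coords (D : set 'rV[R[i]]_n) : set (n.-tuple R * n.-tuple R) :=
  [set p | D (mkz (tnth p.1) (tnth p.2))].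

Definition hvol (D : set 'rV[R[i]]_n) : \bar R :=
  (\int[dxdy]_(p in coords D) (dens p.2)%:E)%E.

Definition hintegral (D : set 'rV[R[i]]_n) (f : 'rV[R[i]]_n -> R[i]) : R[i] :=
  cintegral dxdy (coords D)
    (fun p => (dens p.2)%:C * f (mkz (tnth p.1) (tnth p.2))).

Definition hintegrable (D : set 'rV[R[i]]_n) (f : 'rV[R[i]]_n -> R[i]) : Prop :=
  cintegrable dxdy (coords D)
    (fun p => (dens p.2)%:C * f (mkz (tnth p.1) (tnth p.2))).

(* Functions on Hn as functions of (x, y) in R^n x R^n. *)
Definition on_xy (T : Type) (f : 'rV[R[i]]_n -> T) (p : 'rV[R]_n * 'rV[R]_n) : T :=
  f (mkz (fun k => p.1 0 k) (fun k => p.2 0 k)).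

Definition upper_xy : set ('rV[R]_n * 'rV[R]_n) := [set p | on_xy Hn p].

Definition dir_x (k : 'I_n) : 'rV[R]_n * 'rV[R]_n := (delta_mx 0 k, 0).
Definition dir_y (k : 'I_n) : 'rV[R]_n * 'rV[R]_n := (0, delta_mx 0 k).

Definition laplacian (k : 'I_n) (u : 'rV[R[i]]_n -> R[i])
    (p : 'rV[R]_n * 'rV[R]_n) : R[i] :=
  (p.2 0 k ^+ 2)%:C *
  (cderive (dir_x k) (cderive (dir_x k) (on_xy u)) p +
   cderive (dir_y k) (cderive (dir_y k) (on_xy u)) p).

Definition set_im (z : 'rV[R[i]]_n) (k : 'I_n) (t : R) : 'rV[R[i]]_n :=
  \row_j (if j == k then complex.Re (z 0 j) +i* t else z 0 j).

End moebius.

Section lattices.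
Variable R : realType.

Definition lattice_basis m n (B : 'M[R]_(m, n)) (L : set 'rV[R]_n) : Prop :=
  row_free B /\ L = [set map_mx intr a *m B | a in [set: 'rV[int]_m]].

Definition is_lattice n (L : set 'rV[R]_n) : Prop :=
  exists B : 'M[R]_n, lattice_basis B L.

Definition parallelotope m n (B : 'M[R]_(m, n)) : set 'rV[R]_n :=
  [set v | exists2 c : 'rV[R]_m, (forall i, 0 <= c 0 i < 1) & v = c *m B].

End lattices.

Section groups.
Variables (R : realType) (n : nat).
Local Notation G := (PSL2n R n).
Local Notation bd := {ffun 'I_n -> option R}.
Variable Gam : set G.

Definition is_subgroup : Prop :=
  [/\ Gam 1%g, forall g h, Gam g -> Gam h -> Gam (g * h)%g &
      forall g, Gam g -> Gam (g^-1)%g].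

Definition is_discrete : Prop :=
  forall g, Gam g -> exists2 e : R, 0 < e &
    forall h, Gam h -> (forall k, psl2_near e (g k) (h k)) -> h = g.

Definition is_irreducible : Prop :=
  forall g, Gam g -> g <> 1%g -> forall k, g k <> 1%g.

Definition is_fundamental_domain (F : set 'rV[R[i]]_n) : Prop :=
  [/\ F `<=` @Hn R n,
      measurable (coords F),
      forall z, @Hn R n z -> exists2 g, Gam g & F (act g z) &
      forall g, Gam g -> g <> 1%g -> hvol (F `&` (act g @` F)) = 0%E].

Definition transl_set (rho : G) : set 'rV[R]_n :=
  [set b | exists2 g, Gam g &
     (rho^-1 * g * rho)%g = [ffun k => psl2 (transl_mx (b 0 k))]].

Definition mult_set (rho : G) : set 'rV[R]_n :=
  [set e | (forall k, 0 < e 0 k) /\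
     exists2 g, Gam g & exists b : 'rV[R]_n, forall z, @Hn R n z -> forall k,
       act (rho^-1 * g * rho)%g z 0 k = (e 0 k)%:C * z 0 k + (b 0 k)%:C].

Definition log_mult_set (rho : G) : set 'rV[R]_n :=
  [set \row_k ln (e 0 k) | e in mult_set rho].

(* The group mult_set rho (under coordinatewise product) is isomorphic to Z^m. *)
Definition mult_set_iso (rho : G) (m : nat) : Prop :=
  exists phi : 'rV[int]_m -> 'rV[R]_n,
    [/\ injective phi,
        forall a b k, phi (a + b) 0 k = phi a 0 k * phi b 0 k &
        range phi = mult_set rho].

Definition is_cusp (kappa : bd) : Prop :=
  exists rho : G, [/\ act_bd rho (@infty R n) = kappa,
    is_lattice (transl_set rho) & mult_set_iso rho n.-1].

Definition complete_cusps (S : set bd) : Prop :=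
  [/\ forall kappa, S kappa -> is_cusp kappa,
      forall kappa kappa', S kappa -> S kappa' ->
        (exists2 g, Gam g & act_bd g kappa = kappa') -> kappa = kappa' &
      forall kappa, is_cusp kappa ->
        exists2 kappa', S kappa' & exists2 g, Gam g & act_bd g kappa = kappa'].

Definition cusp_piece (sigma : G) (P : 'M[R]_n) (Q : 'M[R]_(n.-1, n)) (C : R) :
    set 'rV[R[i]]_n :=
  act sigma @` [set z | [/\ @Hn R n z, C < vnorm (im z),
    parallelotope P (re z) &
    parallelotope Q (\row_k ln (im z 0 k / (vnorm (im z)) `^ (n%:R^-1)))]].

Section domain.
Variables (S : set bd) (sigma : bd -> G).
Variables (P : bd -> 'M[R]_n) (Q : bd -> 'M[R]_(n.-1, n)) (C : R).

Definition piece (kappa : bd) : set 'rV[R[i]]_n :=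
  cusp_piece (sigma kappa) (P kappa) (Q kappa) C.

Definition separated_pieces : Prop :=
  (forall kappa kappa', S kappa -> S kappa' -> kappa <> kappa' ->
     piece kappa `&` piece kappa' = set0) /\
  (forall kappa z g, S kappa -> Gam g ->
     piece kappa z -> piece kappa (act g z) -> act g z = z).

Variable F0 : set 'rV[R[i]]_n.

Definition fdomain : set 'rV[R[i]]_n :=
  F0 `|` \bigcup_(kappa in S) piece kappa.

Definition fdomain_upto (A : R) : set 'rV[R[i]]_n :=
  F0 `|` \bigcup_(kappa in S)
    (piece kappa `&` [set z | vnorm (im (act (sigma kappa)^-1%g z)) <= A]).

End domain.

Definition conj_class (g : G) : set G :=
  [set (h^-1 * g * h)%g | h in Gam].

Definition mixed (g : G) : Prop :=
  [/\ Gam g, exists k, hyperbolic (g k), forall k, ~ parabolic (g k) &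
      forall kappa, is_cusp kappa -> act_bd g kappa <> kappa].

Definition mixed_classes : set (set G) :=
  [set conj_class g | g in mixed].

Definition centralizer (g : G) : set G :=
  [set h | Gam h /\ (h * g = g * h)%g].

Definition zpow (g : G) (a : int) : G :=
  match a with Posz k => (g ^+ k)%g | Negz k => (g ^- k.+1)%g end.

Definition free_abelian_basis m (K : set G) (b : 'I_m -> G) : Prop :=
  [/\ forall i, K (b i),
      forall i j, (b i * b j = b j * b i)%g &
      forall g, K g ->
        exists! a : 'rV[int]_m, g = (\prod_(i < m) zpow (b i) (a ord0 i))%g].

End groups.

Section mix_formula.
Variables (R : realType) (n : nat).

Definition sinh (r : R) : R := (expR r - expR (- r)) / 2.
Definition cosh (r : R) : R := (expR r + expR (- r)) / 2.

Definition cderive1 : (R -> R[i]) -> R -> R[i] := @cderive R R^o 1.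

(* A function F of the angle alone on the upper half plane, where
   z = r e^(i (pi/2 - t)), satisfies Delta F = cos(t)^2 F''(t), and a function g
   of the hyperbolic distance r to a point satisfies
   Delta g = g'' + (cosh r / sinh r) g'.  So if (Delta + lam) u = 0 the averages
   of u are governed by these equations with parameter - lam, the eigenvalue of
   Delta. *)
Definition f_solution (lam : R[i]) (f : R -> R[i]) : Prop :=
  [/\ f 0 = 1, cderive1 f 0 = 0 &
      forall t : R, - (pi / 2) < t < pi / 2 ->
        [/\ @cderivable R R^o f t 1, @cderivable R R^o (cderive1 f) t 1 &
            cderive1 (cderive1 f) t = lam / (cos t ^+ 2)%:C * f t]].

(* The equation is singular at 0; a solution on [0, +oo[ is a continuous function
   on [0, +oo[ that satisfies it on ]0, +oo[. *)
Definition g_solution (lam : R[i]) (g : R -> R[i]) : Prop :=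
  [/\ g 0 = 1,
      {within `[0, +oo[, continuous (fun r => complex.Re (g r))},
      {within `[0, +oo[, continuous (fun r => complex.Im (g r))} &
      forall r : R, 0 < r ->
        [/\ @cderivable R R^o g r 1, @cderivable R R^o (cderive1 g) r 1 &
            cderive1 (cderive1 g) r + (cosh r / sinh r)%:C * cderive1 g r =
              lam * g r]].

Definition point_pair (psi : 'rV[R]_n -> R[i]) (z w : 'rV[R[i]]_n) : R[i] :=
  psi (\row_k (normc (z 0 k - w 0 k) ^+ 2 /
               (complex.Im (z 0 k) * complex.Im (w 0 k)))).

Section class_sums.
Variables (psi : 'rV[R]_n -> R[i]) (u : 'rV[R[i]]_n -> R[i]).

Definition class_fun (g : PSL2n R n) (z : 'rV[R[i]]_n) : R[i] :=
  point_pair psi z (act g z) * u z.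

Definition class_sum (D : set 'rV[R[i]]_n) (X : set (PSL2n R n)) : R[i] :=
  csum X (fun g => hintegral D (class_fun g)).

Definition class_sum_converges (D : set 'rV[R[i]]_n) (X : set (PSL2n R n)) :
    Prop :=
  (forall g, X g -> hintegrable D (class_fun g)) /\
  csummable X (fun g => hintegral D (class_fun g)).

End class_sums.

Definition hyp_dist (t N : R) : R := (N + N^-1 - 2) / cos t ^+ 2.
Definition ell_dist (r theta : R) : R := (2 * sinh r * sin theta) ^+ 2.

(* h : 'I_m -> 'I_n lists the hyperbolic coordinates of a group element. *)
Variables (m : nat) (h : 'I_m -> 'I_n).

Definition mix_domain : set (n.-tuple R) :=
  [set v | forall k, if k \in codom h then - (pi / 2) < tnth v k < pi / 2
                     else 0 < tnth v k].

Definition mix_integrand (psi : 'rV[R]_n -> R[i]) (N theta : 'I_n -> R)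
    (f g : 'I_n -> R -> R[i]) (v : n.-tuple R) : R[i] :=
  psi (\row_k (if k \in codom h then hyp_dist (tnth v k) (N k)
               else ell_dist (tnth v k) (theta k))) *
  \prod_k (if k \in codom h
           then f k (tnth v k) * ((cos (tnth v k) ^+ 2)^-1)%:C
           else g k (tnth v k) * (sinh (tnth v k))%:C).

(* The point whose h i-th coordinate is rho (r_i i) for i < m and whose other
   coordinates are rho i. *)
Definition period_point (rho : PSL2n R n) (r : m.-tuple R) : 'rV[R[i]]_n :=
  \row_k moebius (rho k)
    (0 +i* (if [pick i | h i == k] is Some i then tnth r i else 1)).

Definition period_domain (B : 'M[R]_m) : set (m.-tuple R) :=
  [set r | (forall i, 0 < tnth r i) /\ parallelotope B (\row_i ln (tnth r i))].

Definition period_integrand (u : 'rV[R[i]]_n -> R[i]) (rho : PSL2n R n)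
    (r : m.-tuple R) : R[i] :=
  u (period_point rho r) * (\prod_i (tnth r i)^-1)%:C.

End mix_formula.

(* Main.v *)
(* Because psi has compact support, an element that moves a point high in a cusp only
   slightly maps the horoball to itself and so fixes the cusp. Hence the classes considered
   here see only a compact part of F: finitely many group elements contribute, and the
   truncated sums are eventually constant. Writing a class as the cosets of the centralizer
   C(gamma) turns the sum over the class of the integrals over F into one integral over a
   fundamental domain of C(gamma). After conjugation by rho, log-polar coordinates at the
   geodesics (hyperbolic coordinates) and geodesic polar coordinates at i (elliptic ones)
   make k(z, gamma z) independent of the radii of the former and the angles of the latter.
   The average of u over a period cell of those variables satisfies the equation of
   f_lambda or g_lambda in each remaining variable; after symmetrization under
   theta -> -theta, uniqueness makes it F_gamma(0,...,0) times the product of these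
   solutions. *)
Require Import Defs.
From HB Require Import structures.
From mathcomp Require Import all_boot all_order all_algebra.
From mathcomp Require Import generic_quotient complex.
From mathcomp Require Import all_classical all_reals all_analysis.
From mathcomp Require Import measurable_realfun.
From mathcomp Require Import ring lra.
Set Implicit Arguments.
Unset Strict Implicit.
Unset Printing Implicit Defensive.
Import Order.TTheory GRing.Theory Num.Theory.
Import numFieldNormedType.Exports.
Local Open Scope classical_set_scope.
Local Open Scope ring_scope.
Local Open Scope complex_scope.
Local Notation Re := complex.Re.
Local Notation Im := complex.Im.
Local Notation mfunT := (measurable_fun setT).

(** Three facts have to be derived before the averaging can start. Multipliers have norm 1, because
    they act on the translation lattice by integer matrices. An element that keeps one point of a
    horoball inside it fixes the cusp, although separation only speaks about points of the pieces.
    The logarithms of the generators are linearly independent, which makes the period cell a bounded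
    set. Hyperbolic and elliptic coordinates are treated alike: each has conformal coordinates (a,
    v) in which the centralizer translates a. Periodicity makes the second a-derivative of u average
    to 0, so the Laplace equation becomes an ordinary equation in v. The generators also turn the
    elliptic angles while they dilate, so the cell includes a full turn of each angle; at v = 0
    these angles have no effect and give the factor 2 pi each. The equation in the radius is
    singular at 0: boundedness rules out the logarithmic solution and determines the average without
    symmetrization. The equation in the angle is regular, and only the even part is determined by
    the value at 0. *)

Section measurable_functions.
Context (R : realType).

(** Inversion is continuous only away from 0; the default value at 0 is split off as a separate
    case. *)
Lemma measurable_invr : mfunT (fun x : R => x^-1).
Proof.
rewrite (_ : (fun x => _) = (fun x => if x == 0 then 0 else x^-1)); last first.
 by apply/funext=> x; case: eqP=> // ->; rewrite invr0.
apply: measurable_fun_if => //; first exact: measurable_fun_eqr.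
rewrite setTI (_ : _ @^-1` _ = [set x | x != 0]); last first.
 by apply/seteqP; split=> x /=; [move=> ->|move=> /negbTE].
apply: open_continuous_measurable_fun.
 by rewrite (_ : [set x | _] = ~` [set 0]); [exact/closed_openC/closed_eq|apply/seteqP; split=> x /= /eqP].
by move=> x; rewrite inE => x0; apply: inv_continuous.
Qed.

Lemma measurable_cosr : mfunT (@cos R).
Proof. by apply: continuous_measurable_fun; exact: continuous_cos. Qed.
Lemma measurable_sinr : mfunT (@sin R).
Proof. by apply: continuous_measurable_fun; exact: continuous_sin. Qed.
Lemma measurable_sqrtr : mfunT (@Num.sqrt R).
Proof. by apply: continuous_measurable_fun; exact: sqrt_continuous. Qed.

End measurable_functions.

(** Recursion on the shape of the function. A function variable is resolved through a
    [measurable_fun] hypothesis of the context, which is why later proofs first place the facts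
    about [sinh], [cosh] or a density there. *)
Ltac meas :=
 lazymatch goal with
 | |- measurable_fun _ (fun _ => (_, _)) => apply: measurable_fun_pair; meas
 | |- measurable_fun _ (fun _ => _%:E) => apply/measurable_EFinP; meas
 | |- measurable_fun _ (fun _ => (_ * _)%E) => apply: emeasurable_funM; meas
 | |- measurable_fun _ (fun _ => _ * _) => apply: measurable_funM; meas
 | |- measurable_fun _ (fun _ => _ - _) => apply: measurable_funB; meas
 | |- measurable_fun _ (fun _ => _ + _) => first [apply: measurable_funD | apply: emeasurable_funD]; meas
 | |- measurable_fun _ (fun _ => - _) => apply: measurable_funN; meas
 | |- measurable_fun _ (fun _ => _ ^+ _) => apply: measurable_funX; meas
 | |- measurable_fun _ (fun _ => _^-1) => apply: (measurableT_comp (@measurable_invr _)); meas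
 | |- measurable_fun _ (fun _ => _ && _) => apply: measurable_and; meas
 | |- measurable_fun _ (fun _ => _ < _) => apply: measurable_fun_ltr; meas
 | |- measurable_fun _ (fun _ => _ <= _) => apply: measurable_fun_ler; meas
 | |- measurable_fun _ (Order.lt _) => apply: measurable_fun_ltr; meas
 | |- measurable_fun _ (Order.le _) => apply: measurable_fun_ler; meas
 | |- measurable_fun _ (GRing.mul _) => apply: measurable_funM; meas
 | |- measurable_fun _ (fun _ => if _ then _ else _) => apply: measurable_fun_ifT; meas
 | |- measurable_fun _ (fun _ => cos _) => apply: (measurableT_comp (@measurable_cosr _)); meas
 | |- measurable_fun _ (fun _ => sin _) => apply: (measurableT_comp (@measurable_sinr _)); meas
 | |- measurable_fun _ (fun _ => expR _) => apply: (measurableT_comp (@measurable_expR _)); meas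
 | |- measurable_fun _ (fun _ => Num.sqrt _) => apply: (measurableT_comp (@measurable_sqrtr _)); meas
 | |- measurable_fun _ (fun _ => tnth _ ?i) => apply: (measurableT_comp (measurable_tnth i)); meas
 | |- measurable_fun _ (fun _ => fst _) => first [done | apply: (measurableT_comp measurable_fst); meas]
 | |- measurable_fun _ (fun _ => snd _) => first [done | apply: (measurableT_comp measurable_snd); meas]
 | |- measurable_fun _ (fun _ => ?f _) => first
   [ done | exact: measurable_tnth | match goal with H : measurable_fun _ f |- _ => apply: (measurableT_comp H); meas end ]
 | _ => first [done | exact: measurable_id | idtac]
 end.

(** * Moebius action and discreteness *)

Section moebius_action.
Variable R : realType.
Implicit Types (A B : SL2 R) (g h : PSL2 R) (z w : R[i]) (x y : R).

Lemma det_mx22 (A : 'M[R]_2) : \det A = A 0 0 * A 1 1 - A 0 1 * A 1 0.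
Proof.
rewrite (expand_det_row _ 0) !big_ord_recl big_ord0 addr0 /cofactor !det_mx11 !mxE /=.
rewrite expr0 expr1 mul1r mulN1r mulrN.
congr (_ * A _ _ - A _ _ * A _ _); exact: val_inj.
Qed.

Lemma SL2_detE A : A 0 0 * A 1 1 - A 0 1 * A 1 0 = 1.
Proof. by rewrite -det_mx22 det_SL2. Qed.

Lemma mulmx22 (A B : 'M[R]_2) i j : (A *m B) i j = A i 0 * B 0 j + A i 1 * B 1 j.
Proof.
rewrite mxE !big_ord_recl big_ord0 addr0.
by congr (_ + A _ _ * B _ _); exact: val_inj.
Qed.

Lemma mul_ffun_groupE n (g h : PSL2n R n) k : (g * h)%g k = (g k * h k)%g.
Proof. by rewrite ffunE. Qed.

Lemma inv_ffun_groupE n (g : PSL2n R n) k : (g^-1)%g k = (g k)^-1%g.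
Proof. by rewrite ffunE. Qed.

Lemma one_ffun_groupE n k : (1%g : PSL2n R n) k = 1%g.
Proof. by rewrite ffunE. Qed.

(** This is |cz + d|^2 at z = x + iy. The action is written as a pair of real rational functions so
    that [field] and the measurability of real functions apply. *)
Definition mdenom A x y := (A 1 0 * x + A 1 1) ^+ 2 + (A 1 0 * y) ^+ 2.
Definition moebius_re A x y :=
 ((A 0 0 * x + A 0 1) * (A 1 0 * x + A 1 1) + A 0 0 * A 1 0 * y ^+ 2) /
 mdenom A x y.
Definition moebius_im A x y := y / mdenom A x y.

(** Restoring the determinant turns the composition and invariance formulas into identities in free
    entries, which [field] checks without the relation ad - bc = 1. *)
Lemma moebius_imE A x y :
 moebius_im A x y = y * (A 0 0 * A 1 1 - A 0 1 * A 1 0) / mdenom A x y.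
Proof. by rewrite SL2_detE mulr1. Qed.

Lemma mdenom_gt0 A x y : 0 < y -> 0 < mdenom A x y.
Proof.
move=> y0; rewrite lt0r addr_ge0 ?sqr_ge0 // andbT /mdenom.
apply/negP; rewrite paddr_eq0 ?sqr_ge0 // !sqrf_eq0 mulf_eq0 (gt_eqF y0) orbF.
case/andP=> /eqP + /eqP c0; rewrite c0 mul0r add0r => d0.
by have := SL2_detE A; rewrite c0 d0 !mulr0 subrr => /esym/eqP; rewrite oner_eq0.
Qed.

Lemma complex_eqP z w :
 Re z = Re w -> Im z = Im w -> z = w.
Proof. by case: z => a b; case: w => c d /= -> ->. Qed.

Lemma moebius_xy A x y : 0 < y ->
 moebius (\pi_(PSL2 R) A)%qT (x +i* y) = moebius_re A x y +i* moebius_im A x y.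
Proof.
move=> y0; have d0 := mdenom_gt0 A x y0; have dA := SL2_detE A.
rewrite moebius_pi; apply: (canLR (mulfK _)).
 apply/eqP=> -[]; simpc => /eqP e1 /eqP.
 rewrite mulf_eq0 (gt_eqF y0) orbF => /eqP e2.
 by move: d0; rewrite /mdenom (eqP e1) e2 mul0r expr0n addr0 ltxx.
rewrite moebius_imE /moebius_re.
have dn0 : mdenom A x y != 0 by rewrite gt_eqF.
move: dn0; rewrite /mdenom => dn0.
by apply: complex_eqP; simpc => /=; field.
Qed.

Lemma moebiusE g z : 0 < Im z ->
 moebius g z = moebius_re (repr g) (Re z) (Im z) +i*
        moebius_im (repr g) (Re z) (Im z).
Proof. by case: z => x y /= y0; rewrite -moebius_xy // reprK. Qed.

Lemma moebius_im_gt0 A x y : 0 < y -> 0 < moebius_im A x y.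
Proof. by move=> y0; rewrite divr_gt0 // mdenom_gt0. Qed.

Lemma Im_moebius_gt0 g z : 0 < Im z -> 0 < Im (moebius g z).
Proof. by move=> z0; rewrite moebiusE // moebius_im_gt0. Qed.

Lemma PSL2_mulE g h : (g * h)%g = PSL2_mul g h. Proof. by []. Qed.
Lemma PSL2_invE g : (g^-1)%g = PSL2_inv g. Proof. by []. Qed.

Lemma moebius_mul g h z : 0 < Im z ->
 moebius (g * h)%g z = moebius g (moebius h z).
Proof.
case: z => x y /= y0; have [A ->] := PSL2_lift g; have [B ->] := PSL2_lift h.
have d1 := mdenom_gt0 B x y0.
rewrite PSL2_mulE pi_mulE !moebius_xy //; last exact: moebius_im_gt0.
have d2 := mdenom_gt0 A (moebius_re B x y) (moebius_im_gt0 B x y0).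
have d3 := mdenom_gt0 (SL2_mul A B) x y0.
have dB := SL2_detE B.
have dE : mdenom (SL2_mul A B) x y =
  mdenom A (moebius_re B x y) (moebius_im B x y) * mdenom B x y.
 rewrite [in RHS]/mdenom [in RHS](moebius_imE B) /moebius_re.
 move: d1; rewrite /mdenom => /lt0r_neq0 d1.
 by rewrite /SL2_mul /= !mulmx22; field.
apply: complex_eqP=> /=; last by rewrite {1}/moebius_im dE /moebius_im invfM mulrA mulrAC.
rewrite {1}/moebius_re dE /SL2_mul /= !mulmx22 [RHS]/moebius_re.
move: d2 => /lt0r_neq0; set d := mdenom A _ _ => d2.
rewrite (moebius_imE B) /moebius_re.
move: d1 d2 => /lt0r_neq0 + d2; rewrite /mdenom => d1.
by field; rewrite d1 d2.
Qed.

Lemma pi_SL2_one : (\pi_(PSL2 R) (SL2_one R))%qT = 1%g. Proof. by []. Qed.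

Lemma moebius1 z : moebius 1%g z = z.
Proof.
rewrite -pi_SL2_one moebius_pi /= !mxE /= mul0r add0r mul1r addr0.
by rewrite divr1.
Qed.

Lemma moebiusK g z : 0 < Im z -> moebius g^-1%g (moebius g z) = z.
Proof. by move=> z0; rewrite -moebius_mul // mulVg moebius1. Qed.

Lemma moebiusVK g z : 0 < Im z -> moebius g (moebius g^-1%g z) = z.
Proof. by move=> z0; rewrite -moebius_mul // mulgV moebius1. Qed.

(** Equals 2 cosh d - 2 for the hyperbolic distance d; this is the argument of [psi] in each
    coordinate. *)
Definition sqdist x y x' y' : R := ((x - x') ^+ 2 + (y - y') ^+ 2) / (y * y').

Lemma normc_sqr z : normc z ^+ 2 = Re z ^+ 2 + Im z ^+ 2.
Proof. by case: z => a b; rewrite /normc sqr_sqrtr // addr_ge0 ?sqr_ge0. Qed.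

Lemma sqdistE z w : normc (z - w) ^+ 2 / (Im z * Im w) =
 sqdist (Re z) (Im z) (Re w) (Im w).
Proof. by rewrite normc_sqr; case: z => a b; case: w => c d. Qed.

Lemma sqdist_moebius A x y x' y' : 0 < y -> 0 < y' ->
 sqdist (moebius_re A x y) (moebius_im A x y)
     (moebius_re A x' y') (moebius_im A x' y') = sqdist x y x' y'.
Proof.
move=> y0 y'0; rewrite /sqdist.
have := mdenom_gt0 A x y0; have := mdenom_gt0 A x' y'0.
set d := mdenom A x y; set d' := mdenom A x' y' => d'0 d0.
transitivity ((((A 0 0 * A 1 1 - A 0 1 * A 1 0) * (x - x')) ^+ 2 +
  ((A 0 0 * A 1 1 - A 0 1 * A 1 0) * (y - y')) ^+ 2) / (y * y')); last first.
 by rewrite SL2_detE !mul1r.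
have -> : moebius_im A x y * moebius_im A x' y' = y / d * (y' / d') by [].
rewrite 2!moebius_imE /moebius_re -/d -/d'.
move: d'0 d0 => /lt0r_neq0 + /lt0r_neq0; rewrite /d /d' /mdenom => d1 d2.
move: y0 y'0 => /lt0r_neq0 y0 /lt0r_neq0 y'0.
by field; rewrite d1 d2 y0 y'0.
Qed.

(** The numerator is |c z^2 + (d - a) z - b|^2: the powers of |cz + d| in the difference and in the
    imaginary part cancel, and a polynomial in the entries remains. *)
Lemma sqdist_moebius_self A x y : 0 < y ->
 sqdist x y (moebius_re A x y) (moebius_im A x y) =
 ((A 1 0 * (x ^+ 2 - y ^+ 2) + (A 1 1 - A 0 0) * x - A 0 1) ^+ 2 +
  (2 * A 1 0 * x * y + (A 1 1 - A 0 0) * y) ^+ 2) / y ^+ 2.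
Proof.
move=> y0; rewrite /sqdist.
have dm := mdenom_gt0 A x y0.
have -> : y * moebius_im A x y = y * (y / mdenom A x y) by [].
rewrite moebius_imE /moebius_re.
move: dm; rewrite /mdenom => /lt0r_neq0 dm.
move: y0 => /lt0r_neq0 y0.
by field; rewrite y0 dm.
Qed.

(** Fixed points are zeros of the real quadratic polynomial c z^2 + (d - a) z - b, which has at most
    one zero in the upper half plane unless it vanishes identically. *)
Lemma moebius_fix2 g z w : 0 < Im z -> 0 < Im w -> z <> w ->
 moebius g z = z -> moebius g w = w -> g = 1%g.
Proof.
have [A ->] := PSL2_lift g; case: z => x y; case: w => x' y' /= y0 y'0 zw.
rewrite !moebius_xy // => -[e1 e2] [e3 e4].
have H x0 y1 : 0 < y1 -> moebius_re A x0 y1 = x0 -> moebius_im A x0 y1 = y1 ->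
  A 1 0 * (x0 ^+ 2 - y1 ^+ 2) + (A 1 1 - A 0 0) * x0 - A 0 1 = 0 /\
  2 * A 1 0 * x0 + (A 1 1 - A 0 0) = 0.
 move=> y10 h1 h2; have := sqdist_moebius_self A x0 y10.
 rewrite h1 h2 /sqdist !subrr expr0n addr0 mul0r => /esym/eqP.
 rewrite mulf_eq0 invr_eq0 sqrf_eq0 (gt_eqF y10) orbF paddr_eq0 ?sqr_ge0 //.
 rewrite !sqrf_eq0 => /andP[/eqP h3 /eqP h4]; split=> //.
 by apply: (mulIf (lt0r_neq0 y10)); rewrite mulrDl h4 mul0r.
have [{e1 e2}h1 h2] := H _ _ y0 e1 e2; have [{e3 e4}h3 h4] := H _ _ y'0 e3 e4.
have c0 : A 1 0 = 0.
 apply/eqP/negPn/negP=> c0; apply: zw.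
 have ex : x = x'.
  have : 2 * A 1 0 * (x - x') = 0 by rewrite mulrBr; apply/eqP; rewrite subr_eq0; apply/eqP; lra.
  by move=> /eqP; rewrite !mulf_eq0 pnatr_eq0 (negbTE c0) /= subr_eq0 => /eqP.
 subst x'; have : A 1 0 * (y ^+ 2 - y' ^+ 2) = 0 by lra.
 move=> /eqP; rewrite mulf_eq0 (negbTE c0) subr_eq0 eqrXn2 ?ltW //=.
 by move=> /eqP ->.
have ad : A 1 1 = A 0 0 by move: h2; rewrite c0; lra.
have b0 : A 0 1 = 0 by move: h1; rewrite c0 ad; lra.
rewrite -pi_SL2_one; apply/PSL2_eqP; rewrite /SL2_sim.
have := SL2_detE A; rewrite c0 ad mulr0 subr0 -expr2 => /eqP.
rewrite sqrf_eq1 => aE.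
have AE : SL2_mx A = (A 0 0)%:M.
 apply/matrixP=> i j; rewrite !mxE.
 case: i => -[|[|//]] i0; case: j => -[|[|//]] j0 /=; rewrite ?mulr1n ?mulr0n.
 - by congr (SL2_mx A _ _); exact: val_inj.
 - by rewrite -b0; congr (SL2_mx A _ _); exact: val_inj.
 - by rewrite -c0; congr (SL2_mx A _ _); exact: val_inj.
 - by rewrite -ad; congr (SL2_mx A _ _); exact: val_inj.
by rewrite AE; case/orP: aE => /eqP ->; rewrite /SL2_one /= ?eqxx // raddfN /= eqxx orbT.
Qed.

End moebius_action.

Section bounded_moebius.
Variable R : realType.
Implicit Types (A B : SL2 R) (g h : PSL2 R) (x y M : R).

(** From (y - y')^2 <= M y y' follows y^2 <= (M + 2) y y'. *)
Lemma sqdist_im_ge x y x' y' M : 0 < y -> 0 < y' -> sqdist x y x' y' <= M ->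
 y <= (M + 2) * y'.
Proof.
move=> y0 y'0; rewrite /sqdist ler_pdivrMr ?mulr_gt0// => h.
rewrite -(ler_pM2l y0); have := sqr_ge0 (x - x'); have := sqr_ge0 y'; nra.
Qed.

Lemma sqdistC x y x' y' : sqdist x y x' y' = sqdist x' y' x y.
Proof. by rewrite /sqdist [y' * y]mulrC; congr (_ / _); ring. Qed.

(** A compact exhaustion of the upper half plane by a single parameter. *)
Definition in_box M x y : Prop := [/\ `|x| <= M, M^-1 <= y & y <= M].

Lemma in_box_gt0 M x y : 1 <= M -> in_box M x y -> 0 < y.
Proof. by move=> M1 [_ + _]; apply: lt_le_trans; rewrite invr_gt0; lra. Qed.

Lemma in_box_le M M' x y : 1 <= M -> M <= M' -> in_box M x y -> in_box M' x y.
Proof.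
move=> M1 MM' [h1 h2 h3]; split; try exact: le_trans MM'.
by apply: le_trans h2; rewrite lef_pV2 ?posrE//; lra.
Qed.

Lemma in_box_near M N x y x' y' : 1 <= M -> 0 <= N -> in_box M x y -> 0 < y' ->
 sqdist x y x' y' <= N -> in_box (2 * M * (N + 2)) x' y'.
Proof.
move=> M1 N0 hb y'0 hs; have y0 := in_box_gt0 M1 hb; case: hb => hx hy1 hy2.
have M0 : 0 < M by lra.
have h1 := sqdist_im_ge y0 y'0 hs.
have h2 : y' <= (N + 2) * y by apply: sqdist_im_ge y'0 y0 _; rewrite sqdistC; exact: hs.
have hy' : y' <= (N + 2) * M by apply: le_trans h2 _; rewrite ler_pM2l//; lra.
split.
- have hd : (x - x') ^+ 2 <= ((N + 2) * M) ^+ 2.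
  move: hs; rewrite /sqdist ler_pdivrMr ?mulr_gt0// => hs.
  apply: le_trans (_ : N * (y * y') <= _); first by have := sqr_ge0 (y - y'); lra.
  apply: le_trans (_ : (N + 2) * (M * ((N + 2) * M)) <= _); last by rewrite expr2; nra.
  apply: ler_pM => //; [by rewrite mulr_ge0 ?(ltW y0) ?(ltW y'0)|lra|].
  by apply: ler_pM => //; [exact: ltW|exact: ltW].
 have N2 : 0 <= (N + 2) * M by rewrite mulr_ge0//; lra.
 have : `|x - x'| <= (N + 2) * M by rewrite -ler_sqr ?nnegrE// ?real_normK ?num_real.
 move: hx; rewrite !ler_norml => /andP[a1 a2] /andP[a3 a4]; apply/andP; split; nra.
- have m0 : 0 < M^-1 by rewrite invr_gt0.
 have : M^-1 <= (N + 2) * y' by exact: le_trans h1.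
 move=> h; have N2 : 0 < N + 2 by lra.
 apply: le_trans (_ : (M * (N + 2))^-1 <= _).
  by rewrite lef_pV2 ?posrE ?mulr_gt0// ?ltr0n// -mulrA ler_peMl ?mulr_ge0 ?(ltW M0) ?(ltW N2)// ler1n.
 by rewrite invfM ler_pdivrMr// mulrC.
- by apply: le_trans hy' _; nra.
Qed.

(** Conjugation by the affine map that sends i to x + iy gives a matrix of determinant 1 with
    entries a', b', g, d'. The displacement is then (d' - a')^2 + (b' + g)^2, the sum of the squares
    of the entries minus 2, so all entries are bounded; undoing the conjugation costs powers of
    M. *)
Lemma entries_bound (a b c d x y M N : R) : 1 <= M -> 0 <= N -> `|x| <= M ->
 M^-1 <= y -> y <= M -> a * d - b * c = 1 ->
 (c * (x ^+ 2 - y ^+ 2) + (d - a) * x - b) ^+ 2 +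
 (2 * c * x * y + (d - a) * y) ^+ 2 <= N * y ^+ 2 ->
 [/\ `|a| <= 8 * (4 + 4 * N) * M ^+ 3, `|b| <= 8 * (4 + 4 * N) * M ^+ 3,
   `|c| <= 8 * (4 + 4 * N) * M ^+ 3 & `|d| <= 8 * (4 + 4 * N) * M ^+ 3].
Proof.
move=> M1 N0 hx hy1 hy2 hdet hs; have M0 : 0 < M by lra.
have y0 : 0 < y by apply: lt_le_trans hy1; rewrite invr_gt0.
pose a' := a - c * x; pose d' := d + c * x; pose g := c * y.
pose b' := (b + (a - d) * x - c * x ^+ 2) / y.
have hb' : b' * y = b + (a - d) * x - c * x ^+ 2 by rewrite /b' mulfVK// gt_eqF.
have h1 : (d' - a') ^+ 2 + (b' + g) ^+ 2 <= N.
 rewrite -(ler_pM2r (exprn_gt0 2 y0)); apply: le_trans hs.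
 have -> : ((d' - a') ^+ 2 + (b' + g) ^+ 2) * y ^+ 2 = ((d' - a') * y) ^+ 2 + (b' * y + g * y) ^+ 2 by ring.
 by rewrite hb' /d' /a' /g le_eqVlt; apply/orP; left; apply/eqP; ring.
have h2 : a' * d' - b' * g = 1.
 have -> : b' * g = b' * y * c by rewrite /g; ring.
 by rewrite hb' -hdet /a' /d'; ring.
pose L := 4 + 4 * N.
have L4 : 4 <= L by rewrite /L; lra.
have sq (t : R) : t ^+ 2 <= N + 4 -> `|t| <= L.
 move=> ht; rewrite -ler_sqr ?nnegrE//; last lra.
 rewrite real_normK ?num_real//; apply: le_trans ht _; rewrite /L expr2; nra.
have q1 := sqr_ge0 (d' - a'); have q2 := sqr_ge0 (b' + g).
have q3 := sqr_ge0 (d' + a'); have q4 := sqr_ge0 (b' - g).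
have ha : `|a'| <= L by apply: sq; nra.
have hd : `|d'| <= L by apply: sq; nra.
have hb : `|b'| <= L by apply: sq; nra.
have hg : `|g| <= L by apply: sq; nra.
have hp : `|d' - a'| <= L by apply: sq; nra.
have hc : `|c| <= L * M.
 have -> : c = g * y^-1 by rewrite /g mulfK// gt_eqF.
 rewrite normrM ler_pM// ger0_norm ?invr_ge0 ?(ltW y0)//.
 by rewrite -[leRHS]invrK lef_pV2 ?posrE ?invr_gt0.
have hcx : `|c * x| <= L * M * M by rewrite normrM ler_pM.
have hcxx : `|c * x ^+ 2| <= L * M * M * M by rewrite expr2 mulrA normrM ler_pM.
have hby : `|b' * y| <= L * M by rewrite normrM ler_pM// gtr0_norm.
have hpx : `|(d' - a') * x| <= L * M by rewrite normrM ler_pM.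
have L0 : 0 <= L by lra.
have LM1 : L * M <= L * M ^+ 3 by rewrite ler_wpM2l// exprS ler_peMr ?(ltW M0)// exprn_ege1.
have LM2 : L * M * M <= L * M ^+ 3.
 by rewrite -mulrA ler_wpM2l// !exprS expr0 mulr1 ler_wpM2l ?(ltW M0)// ler_peMr ?(ltW M0).
have LM0 : L <= L * M ^+ 3 by rewrite ler_peMr// exprn_ege1.
have LM3 : L * M * M * M = L * M ^+ 3 by ring.
have F0 : 0 <= L * M ^+ 3 by rewrite mulr_ge0// exprn_ge0// ltW.
have bE : b = b' * y + (d' - a') * x - c * x ^+ 2 by rewrite hb' /d' /a'; ring.
have aE : a = a' + c * x by rewrite /a'; ring.
have dE : d = d' - c * x by rewrite /d'; ring.
rewrite -/L -!mulrA; move: hc hcx hcxx hby hpx ha hd LM1 LM2 LM0 F0; rewrite LM3.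
rewrite bE aE dE; move: (b' * y) (c * x) (c * x ^+ 2) ((d' - a') * x) => t1 t2 t3 t4.
rewrite !ler_norml => /andP[k1 k2] /andP[k3 k4] /andP[k5 k6] /andP[k7 k8] /andP[k9 k10].
move=> /andP[k11 k12] /andP[k13 k14] l1 l2 l3 l4.
clear -k1 k2 k3 k4 k5 k6 k7 k8 k9 k10 k11 k12 k13 k14 l1 l2 l3 l4.
split; apply/andP; split; lra.
Qed.

Lemma ord2_ind (P : 'I_2 -> Prop) : P 0 -> P 1 -> forall i, P i.
Proof.
move=> P0 P1 [[|[|//]] hi].
 by rewrite (_ : Ordinal hi = 0)//; exact: val_inj.
by rewrite (_ : Ordinal hi = 1)//; exact: val_inj.
Qed.

Lemma SL2_entries_le A x y M N : 1 <= M -> 0 <= N -> in_box M x y ->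
 sqdist x y (moebius_re A x y) (moebius_im A x y) <= N ->
 forall i j, `|A i j| <= 8 * (4 + 4 * N) * M ^+ 3.
Proof.
move=> M1 N0 hb hs; have y0 := in_box_gt0 M1 hb; case: hb => hx hy1 hy2.
move: hs; rewrite sqdist_moebius_self// ler_pdivrMr ?exprn_gt0// => hs.
have [ha hb hc hd] := entries_bound M1 N0 hx hy1 hy2 (SL2_detE A) hs.
by elim/ord2_ind; elim/ord2_ind.
Qed.

Lemma sqdist_moebius_self_box A M : 1 <= M -> exists2 N, 0 <= N &
 forall x y, in_box M x y -> sqdist x y (moebius_re A x y) (moebius_im A x y) <= N.
Proof.
move=> M1; have M0 : 0 < M by lra.
pose E := `|A 0 0| + `|A 0 1| + `|A 1 0| + `|A 1 1|.
have E0 : 0 <= E by rewrite !addr_ge0.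
pose K := 10 * E * M ^+ 2.
exists (2 * K ^+ 2 * M ^+ 2).
 by rewrite !mulr_ge0 ?exprn_ge0 ?(ltW M0)// mulr_ge0// exprn_ge0// ltW.
move=> x y hb; have y0 := in_box_gt0 M1 hb; case: hb => hx hy1 hy2.
rewrite sqdist_moebius_self// ler_pdivrMr ?exprn_gt0//.
have hy : 1 <= M * y by rewrite mulrC -ler_pdivrMr// mul1r.
have hE i j : `|A i j| <= E.
 have := normr_ge0 (A 0 0); have := normr_ge0 (A 0 1); have := normr_ge0 (A 1 0).
 have := normr_ge0 (A 1 1).
 by move: i j; rewrite /E; elim/ord2_ind; elim/ord2_ind; lra.
have hy' : `|y| <= M by rewrite gtr0_norm.
have M2 : M <= M ^+ 2 by rewrite expr2 ler_peMr// ltW.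
have hMM (t u : R) : `|t| <= M -> `|u| <= M -> `|t * u| <= M ^+ 2.
 by move=> *; rewrite normrM expr2 ler_pM.
have hEM (t u : R) : `|t| <= E -> `|u| <= M ^+ 2 -> `|t * u| <= E * M ^+ 2.
 by move=> *; rewrite normrM ler_pM.
have hM (t : R) : `|t| <= M -> `|t| <= M ^+ 2 by move=> h; exact: le_trans M2.
have M12 : 1 <= M ^+ 2 by rewrite exprn_ege1.
have sqK (t : R) : `|t| <= K -> t ^+ 2 <= K ^+ 2.
 by move=> ht; rewrite -[t ^+ 2]real_normK ?num_real// ler_sqr// ?nnegrE// (le_trans _ ht).
have b1 : `|A 1 0 * (x ^+ 2 - y ^+ 2) + (A 1 1 - A 0 0) * x - A 0 1| <= K.
 have := hEM _ _ (hE 1 0) (hMM _ _ hx hx); have := hEM _ _ (hE 1 0) (hMM _ _ hy' hy').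
 have := hEM _ _ (hE 1 1) (hM _ hx); have := hEM _ _ (hE 0 0) (hM _ hx).
 have : `|A 0 1| <= E * M ^+ 2 by apply: le_trans (hE 0 1) _; rewrite ler_peMr.
 rewrite /K -expr2 -expr2 mulrBl mulrBr -[10 * E * _]mulrA.
 have : 0 <= E * M ^+ 2 by rewrite mulr_ge0// exprn_ge0// ltW.
 move: (E * M ^+ 2) => F; rewrite !ler_norml => F0.
 move=> /andP[k1 k2] /andP[k3 k4] /andP[k5 k6] /andP[k7 k8] /andP[k9 k10].
 by clear -F0 k1 k2 k3 k4 k5 k6 k7 k8 k9 k10; apply/andP; split; lra.
have b2 : `|2 * A 1 0 * x * y + (A 1 1 - A 0 0) * y| <= K.
 have := hEM _ _ (hE 1 0) (hMM _ _ hx hy').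
 have := hEM _ _ (hE 1 1) (hM _ hy'); have := hEM _ _ (hE 0 0) (hM _ hy').
 rewrite /K mulrBl -[10 * E * _]mulrA.
 have -> : 2 * A 1 0 * x * y = 2 * (A 1 0 * (x * y)) by ring.
 have : 0 <= E * M ^+ 2 by rewrite mulr_ge0// exprn_ge0// ltW.
 move: (E * M ^+ 2) => F; rewrite !ler_norml => F0.
 move=> /andP[k1 k2] /andP[k3 k4] /andP[k5 k6].
 by clear -F0 k1 k2 k3 k4 k5 k6; apply/andP; split; lra.
apply: le_trans (_ : 2 * K ^+ 2 <= _).
 by have := sqK _ b1; have := sqK _ b2; lra.
have K2 : 0 <= 2 * K ^+ 2 by rewrite mulr_ge0// sqr_ge0.
rewrite -[leRHS]mulrA -exprMn -[leLHS]mulr1.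
by rewrite ler_wpM2l// exprn_ege1.
Qed.

(** The displacement is bounded on the box, and points at bounded distance from a box lie in a
    larger box. *)
Lemma moebius_box A M : 1 <= M -> exists2 M', 1 <= M' &
 forall x y, in_box M x y -> in_box M' (moebius_re A x y) (moebius_im A x y).
Proof.
move=> M1; have [N N0 hN] := sqdist_moebius_self_box A M1.
exists (2 * M * (N + 2)); first nra.
move=> x y hb; have y0 := in_box_gt0 M1 hb.
apply: in_box_near M1 N0 hb _ (hN _ _ hb).
exact: moebius_im_gt0.
Qed.

End bounded_moebius.

Section discrete.
Variables (R : realType) (n : nat) (Gam : set (PSL2n R n)).
Hypotheses (Gam_group : is_subgroup Gam)
 (Gam_discrete : is_discrete Gam).

Lemma SL2_invE (A : SL2 R) i j : SL2_inv A i j = mx2 (A 1 1) (- A 0 1) (- A 1 0) (A 0 0) i j.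
Proof.
have h : mx2 (A 1 1) (- A 0 1) (- A 1 0) (A 0 0) *m A = 1%:M.
 apply/matrixP=> k l; rewrite mulmx22; have dA := SL2_detE A.
 move: k l; elim/ord2_ind; elim/ord2_ind; rewrite !mxE /= ?mulr1n ?mulr0n -?dA; ring.
suff -> : SL2_mx (SL2_inv A) = mx2 (A 1 1) (- A 0 1) (- A 1 0) (A 0 0) by [].
rewrite /= -[invmx _]mul1mx -h -mulmxA mulmxV ?mulmx1//.
exact: SL2_unit.
Qed.

(** Pigeonhole: the entries are sorted into cells of width [dl]. Two elements with the same cells
    have g^-1 h within 2 M [dl] of 1 in every entry, which is below the radius [e] of discreteness
    at the identity. *)
Lemma finite_bounded (M : R) :
 finite_set [set g | Gam g /\ forall k i j, `|SL2_mx (repr (g k)) i j| <= M].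
Proof.
have [G1 Gm Gi] := Gam_group.
have [e e0 he] := Gam_discrete G1.
have [M0|M0] := ltP M 0.
 (* A negative bound excludes every element, except for n = 0, where the condition is empty but the
    group is trivial. *)
 case: (posnP n) => [n0|n0].
  apply: (@sub_finite_set _ _ [set 1%g]); last exact: finite_set1.
  by move=> g _ /=; apply/ffunP=> -[i hi]; exfalso; move: hi; rewrite n0.
 rewrite (_ : [set g | _] = set0)//; apply/seteqP; split=> // g [_ /(_ (Ordinal n0) 0 0)].
 by move=> h; have := le_lt_trans (le_trans (normr_ge0 _) h) M0; rewrite ltxx.
pose dl := e / (2 * M + 1) / 2.
have M21 : 0 < 2 * M + 1 by lra.
have dl0 : 0 < dl by rewrite !divr_gt0.
pose Nn := (Num.truncn (2 * M / dl)).+1.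
pose phi (g : PSL2n R n) : {ffun 'I_n * 'I_2 * 'I_2 -> 'I_Nn} :=
 [ffun p => inord (Num.truncn ((SL2_mx (repr (g p.1.1)) p.1.2 p.2 + M) / dl))].
set X := [set g | _].
have inj : {in X &, injective phi}.
 move=> g h; rewrite !inE => -[Gg bg] [Gh bh] /ffunP pgh.
 have close k i j : `|SL2_mx (repr (g k)) i j - SL2_mx (repr (h k)) i j| < dl.
  have := pgh (k, i, j); rewrite !ffunE /= => /(congr1 val).
  have rng t : `|t| <= M -> 0 <= (t + M) / dl /\ (Num.truncn ((t + M) / dl) < Nn)%N.
   rewrite ler_norml => /andP[t1 t2]; split; first by rewrite divr_ge0 ?(ltW dl0)//; lra.
   by rewrite ltnS le_truncn// ler_pM2r ?invr_gt0//; lra.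
  have [p1 q1] := rng _ (bg k i j); have [p2 q2] := rng _ (bh k i j).
  rewrite /= !inordK// => eq.
  have := truncn_itv p1; have := truncn_itv p2; rewrite eq.
  move=> /andP[a1 a2] /andP[a3 a4].
  have : `|(SL2_mx (repr (g k)) i j + M) / dl - (SL2_mx (repr (h k)) i j + M) / dl| < 1.
   move: a2 a4; rewrite -natr1 ltr_norml => a2 a4; apply/andP; split; lra.
  rewrite -mulrBl normrM [`|dl^-1|]gtr0_norm ?invr_gt0// ltr_pdivrMr// mul1r.
  by rewrite (_ : _ + M - _ = SL2_mx (repr (g k)) i j - SL2_mx (repr (h k)) i j); last ring.
 suff : (g^-1 * h)%g = 1%g by move=> /(congr1 (fun t => g * t)%g); rewrite mulgA mulgV mul1g mulg1.
 apply: he; first by apply: Gm => //; exact: Gi.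
 move=> k; exists (SL2_one R), (SL2_mul (SL2_inv (repr (g k))) (repr (h k))); split.
 - by rewrite one_ffun_groupE.
 - by rewrite mul_ffun_groupE inv_ffun_groupE -pi_mulE -pi_invE !reprK.
 move=> i j; set A := repr (g k); set B := repr (h k).
 have -> : SL2_mx (SL2_one R) i j = SL2_mx (SL2_mul (SL2_inv A) A) i j.
  by congr (SL2_mx _ _ _); rewrite SL2_mulV.
 rewrite /= !mulmx22 opprD addrACA -!mulrBr.
 have bA i' j' : `|SL2_inv A i' j'| <= M.
  rewrite SL2_invE !mxE; do 2 case: ifP=> _; rewrite ?normrN; exact: bg.
 apply: le_lt_trans (ler_normD _ _) _; rewrite !normrM.
 apply: le_lt_trans (_ : M * dl + M * dl < _).
  by apply: lerD; apply: ler_pM; rewrite ?bA// ltW// close.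
 have h2 : (2 * M + 1) * dl = e / 2 by rewrite /dl; field; rewrite gt_eqF.
 nra.
rewrite -(eq_finite_set (inj_card_eq inj)); exact: finite_finset.
Qed.

Definition csq (z w : R[i]) : R :=
 sqdist (Re z) (Im z) (Re w) (Im w).

Definition in_boxes (M : R) (z : 'rV[R[i]]_n) : Prop :=
 forall k, in_box M (Re (z 0 k)) (Im (z 0 k)).

Lemma in_boxes_Hn M z : 1 <= M -> in_boxes M z -> @Hn R n z.
Proof. by move=> M1 hz k; exact: in_box_gt0 (hz k). Qed.

(** Proper discontinuity in quantitative form: a bounded displacement of a point of a fixed box
    bounds the matrix entries. *)
Lemma finite_close (M N : R) : 1 <= M -> 0 <= N ->
 finite_set [set g | Gam g /\ exists2 z, in_boxes M z &
  forall k, csq (z 0 k) (act g z 0 k) <= N].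
Proof.
move=> M1 N0; apply: sub_finite_set (finite_bounded (8 * (4 + 4 * N) * M ^+ 3)).
move=> g [Gg [z hz hN]]; split=> // k; have z0 := in_boxes_Hn M1 hz.
apply: SL2_entries_le M1 N0 (hz k) _.
by have := hN k; rewrite /csq mxE moebiusE.
Qed.

Lemma countable_group : countable Gam.
Proof.
rewrite (_ : Gam = \bigcup_M [set g | Gam g /\ forall k i j, `|SL2_mx (repr (g k)) i j| <= M%:R]).
 by apply: bigcup_countable => // M _; apply: finite_set_countable; exact: finite_bounded.
apply/seteqP; split=> [g Gg|g [M _ []]//].
pose S : R := \sum_k \sum_i \sum_j `|SL2_mx (repr (g k)) i j|.
have S0 : 0 <= S by do 3 (apply: sumr_ge0 => ? _); exact: normr_ge0.
exists (Num.truncn S).+1 => //; split=> // k i j.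
apply: le_trans (_ : S <= _); last first.
 by have /andP[_ /ltW] := truncn_itv S0.
rewrite /S (bigD1 k)//= (bigD1 i)//= (bigD1 j)//= -!addrA lerDl.
by rewrite !addr_ge0 ?sumr_ge0// => *; rewrite ?sumr_ge0// => *; rewrite ?sumr_ge0.
Qed.

End discrete.

Arguments csq {R}.
Arguments in_boxes {R n}.

(** * Affine elements and the multipliers of a cusp *)

Section affine_maps.
Variable R : realType.
Implicit Types (g h : PSL2 R) (e b t : R).

Definition acts_affinely h e b : Prop :=
 forall z : R[i], 0 < Im z -> moebius h z = e%:C * z + b%:C.

Lemma affine_xy e b (z : R[i]) : e%:C * z + b%:C =
 (e * Re z + b) +i* (e * Im z).
Proof. by case: z => x y; simpc. Qed.

(** The imaginary part is multiplied by e, so |cz + d|^2 is the constant 1/e; comparing z = i with z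
    = 2i forces c = 0. *)
Lemma acts_affinely_lower0 h e b : acts_affinely h e b -> SL2_mx (repr h) 1 0 = 0.
Proof.
move=> hh; set A := repr h.
have im y : 0 < y -> mdenom A 0 y = e^-1.
 move=> y0; have := hh (0 +i* y) y0; rewrite moebiusE// affine_xy => -[_] /=.
 rewrite /moebius_im mulrC -/A => /(mulIf (lt0r_neq0 y0)) <-; by rewrite invrK.
have := im 1 ltr01; rewrite -(im 2) ?ltr0n// /mdenom !mulr0 !add0r mulr1 => h12.
by apply/eqP; rewrite -sqrf_eq0; apply/eqP; move: h12; rewrite exprMn; lra.
Qed.

Lemma lower0_pi (A : SL2 R) : SL2_mx (repr (\pi_(PSL2 R) A)%qT) 1 0 = 0 <-> A 1 0 = 0.
Proof.
case/orP: (repr_sim A) => /eqP ->//; rewrite mxE.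
by split=> [/eqP|->]; rewrite ?oppr0// oppr_eq0 => /eqP.
Qed.

Lemma lower0_mul g h : SL2_mx (repr g) 1 0 = 0 -> SL2_mx (repr h) 1 0 = 0 ->
 SL2_mx (repr (g * h)%g) 1 0 = 0.
Proof.
move=> g0 h0; rewrite -[g]reprK -[h]reprK PSL2_mulE pi_mulE; apply/lower0_pi.
by rewrite /= mulmx22 g0 h0 mul0r mulr0 addr0.
Qed.

Lemma lower0_inv g : SL2_mx (repr g) 1 0 = 0 -> SL2_mx (repr g^-1%g) 1 0 = 0.
Proof.
move=> g0; rewrite -[g]reprK PSL2_invE pi_invE; apply/lower0_pi.
by rewrite SL2_invE !mxE /= g0 oppr0.
Qed.

(** The action is faithful on the quotient by signs; the two test points i and 2i suffice. *)
Lemma PSL2_ext g h : (forall z : R[i], 0 < Im z -> moebius g z = moebius h z) -> g = h.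
Proof.
move=> e; suff : (h^-1 * g)%g = 1%g by move=> /mulg1_eq; rewrite invgK.
have fx z : 0 < Im z -> moebius (h^-1 * g)%g z = z.
 by move=> z0; rewrite moebius_mul// e// moebiusK.
apply: (@moebius_fix2 R _ (0 +i* 1) (0 +i* 2)); rewrite ?fx //= ?ltr0n//.
by case; lra.
Qed.

Lemma psl2_pi (A : 'M[R]_2) (hA : \det A == 1) : psl2 A = (\pi_(PSL2 R) (MkSL2 hA))%qT.
Proof. by rewrite /psl2; congr (\pi_(PSL2 R) _)%qT; apply: val_inj; rewrite insubdK. Qed.

Lemma det_mx2 (a b c d : R) : \det (mx2 a b c d) = a * d - b * c.
Proof. by rewrite det_mx22 !mxE. Qed.

Lemma moebius_transl t (z : R[i]) : moebius (psl2 (transl_mx t)) z = z + t%:C.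
Proof.
have h : \det (transl_mx t) == 1 by rewrite det_mx2 mulr1 mulr0 subr0.
by rewrite (psl2_pi h) moebius_pi /= !mxE /= mul0r add0r divr1 mul1r.
Qed.

Lemma moebius_dil e (z : R[i]) : 0 < e -> moebius (psl2 (dil_mx e)) z = e%:C * z.
Proof.
move=> e0; have s0 : 0 < Num.sqrt e by rewrite sqrtr_gt0.
have h : \det (dil_mx e) == 1 by rewrite det_mx2 mulr0 subr0 divff// gt_eqF.
rewrite (psl2_pi h) moebius_pi /= !mxE /= mul0r add0r addr0.
rewrite -[in RHS](sqr_sqrtr (ltW e0)) expr2 rmorphM /=.
rewrite -(fmorphV (real_complex R)) /= invrK mulrC mulrA.
by rewrite -rmorphM.
Qed.

Lemma moebius_bd_fix (r h : PSL2 R) : SL2_mx (repr h) 1 0 = 0 ->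
 moebius_bd (r * h * r^-1)%g (moebius_bd r None) = moebius_bd r None.
Proof.
move=> h0; set g := (r * h * r^-1)%g.
set S := repr r; set H := repr h in h0; set G := repr g.
have dS := SL2_detE S; have dH := SL2_detE H.
(* The first column of a lift of r represents the image of infinity and is an eigenvector of a lift
   of r h r^-1. The sign ambiguity of the lifts only changes the eigenvalue [la]. *)
have [la [la0 e0 e1]] : exists la : R, [/\ la != 0, G 0 0 * S 0 0 + G 0 1 * S 1 0 = la * S 0 0 &
  G 1 0 * S 0 0 + G 1 1 * S 1 0 = la * S 1 0].
 have : (g * r)%g = (r * h)%g by rewrite /g mulgVK.
 rewrite !PSL2_mulE -[g]reprK -[r]reprK -[h]reprK !pi_mulE => /PSL2_eqP.
 rewrite -/S -/G -/H; case/orP=> /eqP /matrixP e.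
  exists (H 0 0); split.
  - by apply/eqP=> a0; move: dH; rewrite h0 a0 mul0r mulr0 subrr => /eqP; rewrite eq_sym oner_eq0.
  - by have := e 0 0; rewrite /= !mulmx22 h0 mulr0 addr0 [S 0 0 * _]mulrC.
  - by have := e 1 0; rewrite /= !mulmx22 h0 mulr0 addr0 [S 1 0 * H 0 0]mulrC.
 exists (- H 0 0); split.
 - by apply/eqP=> /eqP; rewrite oppr_eq0 => /eqP a0; move: dH; rewrite h0 a0 mul0r mulr0 subrr => /eqP; rewrite eq_sym oner_eq0.
 - by have := e 0 0; rewrite /= [RHS]mxE !mulmx22 h0 mulr0 addr0 => ->; ring.
 - by have := e 1 0; rewrite /= [RHS]mxE !mulmx22 h0 mulr0 addr0 => ->; ring.
rewrite /moebius_bd -/S -/G; have [s0|s0] := eqVneq (SL2_mx S 1 0) 0.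
 have S00 : S 0 0 != 0.
  by apply/eqP=> a0; move: dS; rewrite s0 a0 mul0r mulr0 subrr => /eqP; rewrite eq_sym oner_eq0.
 move: e1; rewrite s0 !mulr0 addr0 => /eqP; rewrite mulf_eq0 (negbTE S00) orbF.
 by move=> ->.
have -> : G 1 0 * (S 0 0 / S 1 0) + G 1 1 = la.
 by apply: (mulIf s0); rewrite mulrDl mulrA mulfVK.
have -> : G 0 0 * (S 0 0 / S 1 0) + G 0 1 = la * (S 0 0 / S 1 0).
 by apply: (mulIf s0); rewrite mulrDl mulrA !mulfVK// mulrA mulfVK.
by rewrite (negbTE la0) mulrC mulKf.
Qed.

End affine_maps.

Section row_spaces.
Variable R : realType.

(** Dimension count: the rows are n - 1 independent vectors in the kernel of the all-one column,
    which has rank n - 1. *)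
Lemma sum0_row_span n (Q : 'M[R]_(n.-1, n)) : (0 < n)%N -> row_free Q ->
 (forall i, \sum_j Q i j = 0) ->
 forall v : 'rV[R]_n, \sum_j v 0 j = 0 -> exists c, v = c *m Q.
Proof.
move=> n0 fQ sQ v sv; pose one : 'cV[R]_n := const_mx 1.
have m1 m (A : 'M[R]_(m, n)) : (forall i, \sum_j A i j = 0) -> A *m one = 0.
 move=> hA; apply/matrixP=> i j; rewrite !mxE -[RHS](hA i).
 by apply: eq_bigr=> k _; rewrite mxE mulr1.
have r1 : \rank one = 1%N.
 apply/eqP; rewrite eqn_leq rank_leq_col lt0n mxrank_eq0; apply/negP=> /eqP /matrixP.
 by move=> /(_ (Ordinal n0) 0); rewrite !mxE => /eqP; rewrite oner_eq0.
have sub : (Q <= kermx one)%MS by apply/sub_kermxP/m1.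
have : (kermx one <= Q)%MS.
 by rewrite -(mxrank_leqif_sup sub) (eqP fQ) mxrank_ker r1 subn1.
move=> hk; apply/submxP; apply: submx_trans hk; apply/sub_kermxP/m1 => i.
by rewrite -[RHS]sv; apply: eq_bigr=> j _; rewrite ord1.
Qed.

Lemma ln_prod (I : Type) (s : seq I) (F : I -> R) : (forall i, 0 < F i) ->
 ln (\prod_(i <- s) F i) = \sum_(i <- s) ln (F i).
Proof.
move=> F0; elim: s => [|i s IH]; first by rewrite !big_nil ln1.
have p0 : 0 < \prod_(j <- s) F j.
 by elim: s {IH} => [|j s IH]; rewrite ?big_nil ?big_cons ?ltr01// mulr_gt0.
by rewrite !big_cons lnM ?posrE// IH.
Qed.

Lemma floor_shift m (c : 'rV[R]_m) : exists a : 'rV[int]_m,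
 forall i, 0 <= (c + map_mx intr a) 0 i < 1.
Proof.
exists (\row_i - Num.floor (c 0 i)) => i; rewrite !mxE rmorphN /=.
have /andP[h1 h2] := floor_itv (c 0 i); rewrite subr_ge0 h1 /=.
by move: h2; rewrite rmorphD /=; lra.
Qed.

End row_spaces.

Section multipliers.
Variables (R : realType) (n : nat) (Gam : set (PSL2n R n)).
Hypothesis Gam_group : is_subgroup Gam.
Variables (rho : PSL2n R n) (P : 'M[R]_n).
Hypothesis P_basis : lattice_basis P (transl_set Gam rho).

Lemma mult_setP (e : 'rV[R]_n) : mult_set Gam rho e ->
 (forall k, 0 < e 0 k) /\ exists2 g, Gam g & exists b : 'rV[R]_n,
  forall k, acts_affinely ((rho^-1 * g * rho)%g k) (e 0 k) (b 0 k).
Proof.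
move=> [e0 [g Gg [b hb]]]; split=> //; exists g => //; exists b => k z z0.
pose zz : 'rV[R[i]]_n := \row_j (if j == k then z else 0 +i* 1).
have : @Hn R n zz by move=> j; rewrite mxE; case: eqP=> // _ /=; exact: ltr01.
by move=> /hb/(_ k); rewrite !mxE eqxx.
Qed.

Lemma mult_setV (e : 'rV[R]_n) : mult_set Gam rho e ->
 mult_set Gam rho (\row_k (e 0 k)^-1).
Proof.
move=> /mult_setP[e0 [g Gg [b hb]]]; split=> [k|]; first by rewrite mxE invr_gt0.
exists (g^-1)%g; first by have [_ _] := Gam_group; apply.
exists (\row_k (- (b 0 k / e 0 k))) => z z0 k; rewrite !mxE.
have -> : (rho^-1 * g^-1 * rho)%g k = (((rho^-1 * g * rho)%g k)^-1)%g.
 by rewrite -inv_ffun_groupE !invgM invgK mulgA.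
set h := (rho^-1 * g * rho)%g k; have en0 : e 0 k != 0 by rewrite gt_eqF.
set w := moebius h^-1%g (z 0 k).
have w0 : 0 < Im w by exact: Im_moebius_gt0.
have : z 0 k = (e 0 k)%:C * w + (b 0 k)%:C by rewrite -hb// moebiusVK.
move=> ->; rewrite !affine_xy /=; apply: complex_eqP=> /=; field => //.
Qed.

(** Conjugating the translation by t with z -> e z + b gives the translation by e t. *)
Lemma mult_set_transl (e t : 'rV[R]_n) : mult_set Gam rho e -> transl_set Gam rho t ->
 transl_set Gam rho (t *m diag_mx e).
Proof.
move=> /mult_setP[e0 [g Gg [b hb]]] [ga Gga /ffunP hga].
have [_ Gm Gi] := Gam_group.
exists (g * ga * g^-1)%g; first by apply: (Gm); [exact: (Gm)|exact: (Gi)].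
apply/ffunP=> k; rewrite [RHS]ffunE.
have -> : (rho^-1 * (g * ga * g^-1) * rho)%g =
  ((rho^-1 * g * rho) * (rho^-1 * ga * rho) * (rho^-1 * g * rho)^-1)%g.
 by rewrite !invgM invgK !mulgA !mulgK.
rewrite 2!mul_ffun_groupE inv_ffun_groupE (hga k) [X in (_ * X * _)%g]ffunE.
apply: PSL2_ext => w w0; set h := (rho^-1 * g * rho)%g k.
have i0 : 0 < Im (moebius h^-1%g w) by exact: Im_moebius_gt0.
rewrite moebius_mul// moebius_mul// !moebius_transl.
rewrite hb; last by move: i0; case: (moebius _ _) => x y /=; rewrite addr0.
rewrite mulrDr addrAC -hb// moebiusVK//; congr (_ + _).
by rewrite -rmorphM mul_mx_diag !mxE mulrC.
Qed.

(** Multiplication by e maps the translation lattice into itself, so in the basis P it is an integer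
    matrix with the same determinant. *)
Lemma mult_set_int_norm (e : 'rV[R]_n) : mult_set Gam rho e ->
 exists m : int, \prod_k e 0 k = m%:~R.
Proof.
move=> he; have [fP LP] := P_basis.
have row_in i : transl_set Gam rho (row i P).
 rewrite LP; exists (delta_mx 0 i) => //.
 by rewrite map_delta_mx rowE.
have ha i : exists a : 'rV[int]_n, map_mx intr a *m P = row i P *m diag_mx e.
 have := mult_set_transl he (row_in i).
 by rewrite {1}LP=> -[a _ <-]; exists a.
have [a aP] := choice ha.
pose M : 'M[int]_n := \matrix_i a i.
have eM : P *m diag_mx e = map_mx intr M *m P.
 apply/row_matrixP=> i; rewrite row_mul -aP row_mul -map_row rowK.
 by [].
exists (\det M).
have dP : \det P != 0 by rewrite -unitfE -unitmxE -row_free_unit.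
have := congr1 determinant eM; rewrite !det_mulmx det_diag det_map_mx mulrC.
by move=> /(mulIf dP).
Qed.

(** The norms of e and of its inverse are positive integers with product 1. Hence multipliers
    preserve horoballs, and their logarithms lie in the hyperplane of sum 0. *)
Lemma mult_set_norm (e : 'rV[R]_n) : mult_set Gam rho e -> \prod_k e 0 k = 1.
Proof.
move=> he; have [m em] := mult_set_int_norm he.
have [m' em'] := mult_set_int_norm (mult_setV he).
have [e0 _] := he.
have p0 : 0 < \prod_k e 0 k by apply: prodr_gt0.
have pq : (\prod_k e 0 k) * \prod_k (\row_k (e 0 k)^-1 : 'rV[R]_n) 0 k = 1.
 rewrite -big_split /= big1// => k _; rewrite mxE divff// gt_eqF//.
move: pq p0; rewrite em em' -intrM ltr0z => /(_ =P 1%:~R); rewrite eqr_int => /eqP mm m0.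
have m'0 : 0 < m' by rewrite -(pmulr_rgt0 _ m0) mm.
have m1 : m <= 1.
 by rewrite -mm ler_peMr// ?(ltW m0)// -gtz0_ge1.
by rewrite (_ : m = 1)//; apply/eqP; rewrite eq_le m1 /= -gtz0_ge1.
Qed.

End multipliers.

(** * Cusps *)

Section cusps.
Variables (R : realType) (n : nat) (Gam : set (PSL2n R n)).
Hypotheses (n0 : (0 < n)%N)
 (Gam_group : is_subgroup Gam)
 (Gam_discrete : is_discrete Gam).

Lemma act_mul (g h : PSL2n R n) z : @Hn R n z -> act (g * h)%g z = act g (act h z).
Proof.
by move=> z0; apply/rowP=> k; rewrite !mxE mul_ffun_groupE moebius_mul.
Qed.

Lemma act_Hn (g : PSL2n R n) z : @Hn R n z -> @Hn R n (act g z).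
Proof. by move=> z0 k; rewrite mxE Im_moebius_gt0. Qed.

Lemma act1 z : act (1%g : PSL2n R n) z = z.
Proof. by apply/rowP=> k; rewrite !mxE one_ffun_groupE moebius1. Qed.

Lemma actK (g : PSL2n R n) z : @Hn R n z -> act g^-1%g (act g z) = z.
Proof. by move=> z0; rewrite -act_mul// mulVg act1. Qed.

Lemma csq_act (g : PSL2n R n) z w : @Hn R n z -> @Hn R n w ->
 forall k, csq (act g z 0 k) (act g w 0 k) = csq (z 0 k) (w 0 k).
Proof.
move=> z0 w0 k; rewrite !mxE /csq !moebiusE// ?w0// /= sqdist_moebius//.
Qed.

Section reduction.
Variables (rho : PSL2n R n) (P : 'M[R]_n) (Q : 'M[R]_(n.-1, n)) (C : R).
Hypotheses (P_basis : lattice_basis P (transl_set Gam rho))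
 (Q_basis : lattice_basis Q (log_mult_set Gam rho))
 (C0 : 0 < C).

(* The stabilizer of the cusp moves every point of the horoball into the cusp
  piece: first correct the ratios of the imaginary parts by a multiplier, then the
  real parts by a translation. *)
Lemma reduce_to_piece w : @Hn R n w -> C < vnorm (im w) ->
 exists2 s, Gam s &
  (forall k, SL2_mx (repr ((rho^-1 * s * rho)%g k)) 1 0 = 0) /\
  cusp_piece rho P Q C (act s (act rho w)).
Proof.
move=> w0 Cw; have [_ Gm _] := Gam_group.
have [fP LP] := P_basis; have [fQ LQ] := Q_basis.
have im0 k : 0 < im w 0 k by rewrite mxE; exact: w0.
have N0 : 0 < vnorm (im w) by apply: lt_trans Cw.
pose nrm := (vnorm (im w)) `^ (n%:R^-1).
have nrm0 : 0 < nrm by rewrite powR_gt0.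
pose v : 'rV[R]_n := \row_k ln (im w 0 k / nrm).
have rowQ i : exists2 e, mult_set Gam rho e & \row_k ln (e 0 k) = row i Q.
 have : log_mult_set Gam rho (row i Q).
  by rewrite LQ; exists (delta_mx 0 i) => //; rewrite map_delta_mx rowE.
 by move=> [e he <-]; exists e.
have sQ i : \sum_j Q i j = 0.
 have [e he /rowP eQ] := rowQ i.
 have [e0 _] := he.
 rewrite (eq_bigr (fun j => ln (e 0 j))); last by move=> j _; have := eQ j; rewrite !mxE.
 by rewrite -ln_prod// (mult_set_norm Gam_group P_basis he) ln1.
(* Dividing by the n-th root of the norm is exactly what puts the vector of logarithms into the span
   of Q. *)
have sv : \sum_j v 0 j = 0.
 rewrite (eq_bigr (fun j => ln (im w 0 j) - ln nrm)); last first.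
  by move=> j _; rewrite mxE ln_div// posrE.
 rewrite big_split /= sumr_const card_ord -ln_prod// -/(vnorm (im w)) /nrm ln_powR.
 rewrite -mulr_natr; field.
 by rewrite pnatr_eq0 -lt0n.
have [c vE] := sum0_row_span n0 fQ sQ sv.
(* The integer vector [a] names a multiplier that moves the coordinates of [v] in the basis Q into
   [0, 1); [a'] below does the same for the real parts and P. The later translation leaves the
   imaginary parts as they are. *)
have [a ha] := floor_shift c.
have [e he eE] : exists2 e, mult_set Gam rho e & \row_k ln (e 0 k) = map_mx intr a *m Q.
 have : log_mult_set Gam rho (map_mx intr a *m Q) by rewrite LQ; exists a.
 by move=> [e he <-]; exists e.
have [e0 [g Gg [b hb]]] := mult_setP he.
pose w1 := act (rho^-1 * g * rho)%g w.
have w10 : @Hn R n w1 by exact: act_Hn.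
have w1E k : w1 0 k = (e 0 k)%:C * w 0 k + (b 0 k)%:C by rewrite mxE hb//; exact: w0.
have im1 k : im w1 0 k = e 0 k * im w 0 k by rewrite [LHS]mxE w1E affine_xy [in RHS]mxE.
have N1 : vnorm (im w1) = vnorm (im w).
 rewrite /vnorm (eq_bigr (fun k => e 0 k * im w 0 k)) ?big_split//=.
 by rewrite (mult_set_norm Gam_group P_basis he) mul1r.
have uP : P \in unitmx by rewrite -row_free_unit.
have [a' ha'] := floor_shift (re w1 *m invmx P).
have : transl_set Gam rho (map_mx intr a' *m P) by rewrite LP; exists a'.
move=> [t Gt tE].
pose w2 := act (rho^-1 * t * rho)%g w1.
have w20 : @Hn R n w2 by exact: act_Hn.
have w2E k : w2 0 k = w1 0 k + ((map_mx intr a' *m P) 0 k)%:C.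
 by rewrite [LHS]mxE tE ffunE moebius_transl.
have im2 k : im w2 0 k = im w1 0 k.
 by rewrite [LHS]mxE w2E [in RHS]mxE; case: (w1 0 k) => x y /=; rewrite addr0.
have N2 : vnorm (im w2) = vnorm (im w1) by apply: eq_bigr=> k _.
exists (t * g)%g; first exact: (Gm).
have trE : (rho^-1 * (t * g) * rho)%g = ((rho^-1 * t * rho) * (rho^-1 * g * rho))%g.
 by rewrite !mulgA mulgK.
split.
 move=> k; apply: (@acts_affinely_lower0 R _ (e 0 k) (b 0 k + (map_mx intr a' *m P) 0 k)).
 move=> z z0; rewrite trE mul_ffun_groupE moebius_mul// (congr1 (fun f : PSL2n R n => f k) tE) ffunE.
 by rewrite moebius_transl hb// rmorphD addrA.
exists w2; last first.
 have ->: act (t * g)%g (act rho w) = act rho (act (rho^-1 * (t * g) * rho)%g w).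
  by rewrite -!act_mul// !mulgA mulgV mul1g.
 by rewrite trE act_mul.
split=> //.
- by rewrite N2 N1.
- exists (re w1 *m invmx P + map_mx intr a'); first exact: ha'.
 rewrite mulmxDl mulmxKV//; apply/rowP=> k; rewrite [LHS]mxE w2E [RHS]mxE [re w1 0 k]mxE.
 by case: (w1 0 k) => x y.
- exists (c + map_mx intr a); first exact: ha.
 rewrite mulmxDl -eE -vE; apply/rowP=> k; rewrite [LHS]mxE im2 im1 N2 N1 -/nrm -mulrA.
 by rewrite lnM ?posrE ?divr_gt0// [RHS]mxE [X in _ = X + _]mxE [X in _ = _ + X]mxE addrC.
Qed.

End reduction.

Lemma continuous_prod_at (T : topologicalType) (I : Type) (r : seq I)
  (F : I -> T -> R) (x : T) : (forall i, {for x, continuous (F i)}) ->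
 {for x, continuous (fun t => \prod_(i <- r) F i t)}.
Proof.
move=> hF; elim: r => [|i r IH].
 rewrite (_ : (fun t => _) = cst 1); first exact: cst_continuous.
 by apply/funext=> t; rewrite big_nil.
rewrite (_ : (fun t => _) = (fun t => F i t * \prod_(j <- r) F j t)).
 by apply: continuousM; [exact: hF|exact: IH].
by apply/funext=> t; rewrite big_cons.
Qed.

(** The sum of the individual constants, plus 1, is a bound for every coordinate and avoids a
    maximum over a possibly empty index set. *)
Lemma common_bound (Pr : 'I_n -> R -> Prop) :
 (forall k M M', 1 <= M -> M <= M' -> Pr k M -> Pr k M') ->
 (forall k, exists2 M, 1 <= M & Pr k M) -> exists2 M, 1 <= M & forall k, Pr k M.
Proof.
move=> mono H.
have /choice[M HM] : forall k, exists M, 1 <= M /\ Pr k M by move=> k; have [M] := H k; exists M.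
have M1 k : 1 <= M k by have [] := HM k.
have hM k : Pr k (M k) by have [] := HM k.
exists (1 + \sum_k M k).
 by rewrite lerDl sumr_ge0// => k _; apply: le_trans (M1 k).
move=> k; apply: mono (hM k) => //; rewrite (bigD1 k)//= addrCA lerDl.
by rewrite addr_ge0// sumr_ge0// => i _; apply: le_trans (M1 i).
Qed.

Lemma im_den_cont (A : SL2 R) (x y : R) : 0 < y ->
 {for 0, continuous (fun t : R => moebius_im A x (y + t))}.
Proof.
move=> y0; apply: cvgM; first by apply: cvgD; [exact: cvg_cst|exact: cvg_id].
apply: cvgV; first by rewrite addr0 gt_eqF// mdenom_gt0.
apply: cvgD; first exact: cvg_cst.
apply: (@cvg_comp _ _ _ (fun t : R => A 1 0 * (y + t)) (fun u => u ^+ 2)); last exact: exprn_continuous.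
by apply: cvgM; [exact: cvg_cst|apply: cvgD; [exact: cvg_cst|exact: cvg_id]].
Qed.

Section separation.
Variables (S : set {ffun 'I_n -> option R}) (sigma : {ffun 'I_n -> option R} -> PSL2n R n)
 (P : {ffun 'I_n -> option R} -> 'M[R]_n).
Variables (Q : {ffun 'I_n -> option R} -> 'M[R]_(n.-1, n)) (C : R).
Hypotheses (sigma_infty : forall kappa, S kappa ->
 act_bd (sigma kappa) (@infty R n) = kappa)
 (P_basis : forall kappa, S kappa ->
 lattice_basis (P kappa) (transl_set Gam (sigma kappa)))
 (Q_basis : forall kappa, S kappa ->
 lattice_basis (Q kappa) (log_mult_set Gam (sigma kappa)))
 (C0 : 0 < C)
 (C_separates : separated_pieces Gam S sigma P Q C).

(* Near a point [z] of the horoball that [g] moves within the horoball, [g w] lies in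
  the orbit of [w] under the stabilizer of the cusp by the separation hypothesis.  By
  discreteness only finitely many elements of the stabilizer occur, so one of them
  agrees with [g] at two points and hence equals [g]. *)
Lemma horoball_stabilizer kappa z g : S kappa -> @Hn R n z -> Gam g ->
 C < vnorm (im z) -> C < vnorm (im (act ((sigma kappa)^-1 * g * sigma kappa)%g z)) ->
 act_bd g kappa = kappa.
Proof.
move=> Sk z0 Gg hz hgz; set rho := sigma kappa.
have [G1 Gm Gi] := Gam_group.
set h := (rho^-1 * g * rho)%g in hgz.
(* Moving up keeps the point in the horoball and changes every coordinate at once, so different
   parameters give points that differ in each coordinate. *)
pose ws (t : R) : 'rV[R[i]]_n := \row_k (Re (z 0 k) +i* (Im (z 0 k) + t)).
have ws0 t : 0 <= t -> @Hn R n (ws t).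
 by move=> t0 k; rewrite mxE /= ltr_pwDl// z0.
have wsC t : 0 <= t -> C < vnorm (im (ws t)).
 move=> t0; apply: lt_le_trans hz _; apply: ler_prod => k _.
 by rewrite !mxE /= lerDl t0 andbT ltW// z0.
have [e e0 hwC] : exists2 e : R, 0 < e & forall t, 0 <= t < e -> C < vnorm (im (act h (ws t))).
 pose V t := \prod_k moebius_im (repr (h k)) (Re (z 0 k)) (Im (z 0 k) + t).
 have VE t : 0 <= t -> vnorm (im (act h (ws t))) = V t.
  move=> t0; apply: eq_bigr=> k _; rewrite !mxE moebiusE//=.
  by rewrite ltr_pwDl// z0.
 have wz : ws 0 = z by apply/rowP=> k; rewrite mxE addr0; case: (z 0 k).
 have V0 : C < V 0 by rewrite -VE// wz.
 have Vc : {for 0, continuous V}.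
  by apply: continuous_prod_at => k; apply: im_den_cont; exact: z0.
 have /nbhs_ballP[e /= e0 he] := Vc _ (lt_nbhsr V0).
 exists e => // t /andP[t0 te]; rewrite VE//; apply: he.
 by rewrite /ball /= sub0r normrN ger0_norm.
(* Infinitely many sample points; the shift by 2 keeps them strictly below [e]. *)
have tj (j : nat) : 0 <= e / j.+2%:R < e.
 by rewrite divr_ge0 ?(ltW e0)//= ltr_pdivrMr// ltr_pMr// ltr1n.
(* Both the sample point and its image under g can be moved into the piece by the stabilizer.
   Separation makes the two results equal, so g acts on the sample point as the stabilizer element
   s2^-1 s1. *)
have orbit j : exists s, [/\ Gam s, forall k, SL2_mx (repr ((rho^-1 * s * rho)%g k)) 1 0 = 0 &
  act g (act rho (ws (e / j.+2%:R))) = act s (act rho (ws (e / j.+2%:R)))].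
 set w := ws _; have /andP[t0 t1] := tj j.
 have w0 : @Hn R n w by exact: ws0.
 have [s1 G1s [l1 p1]] := reduce_to_piece (P_basis Sk) (Q_basis Sk) C0 w0 (wsC _ t0).
 have [s2 G2s [l2 p2]] := reduce_to_piece (P_basis Sk) (Q_basis Sk) C0
  (act_Hn h w0) (hwC _ (tj j)).
 have rw0 : @Hn R n (act rho w) by exact: act_Hn.
 have rhE : act rho (act h w) = act g (act rho w).
  by rewrite -!act_mul// /h !mulgA mulgV mul1g.
 rewrite -/rho rhE in p1 p2.
 have [_ /(_ kappa _ (s2 * g * s1^-1)%g Sk _ p1)] := C_separates.
 have -> : act (s2 * g * s1^-1)%g (act s1 (act rho w)) = act s2 (act g (act rho w)).
  by rewrite -act_mul// mulgVK// act_mul.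
 move=> /(_ _ p2) => eq; exists (s2^-1 * s1)%g; split.
 - by apply: (Gm) => //; exact: (Gi).
 - move=> k; have -> : (rho^-1 * (s2^-1 * s1) * rho)%g = ((rho^-1 * s2 * rho)^-1 * (rho^-1 * s1 * rho))%g.
   by rewrite !invgM invgK !mulgA mulgK.
  by rewrite mul_ffun_groupE inv_ffun_groupE; apply: lower0_mul => //; exact: lower0_inv.
 - rewrite act_mul// -eq; last by apply: (Gm); [apply: (Gm)|exact: (Gi)].
  by rewrite actK//; exact: act_Hn.
have [s hs] := choice orbit.
have [M M1 hM] : exists2 M, 1 <= M & forall k t, 0 <= t < e ->
  in_box M (Re (ws t 0 k)) (Im (ws t 0 k)).
 apply: (common_bound (Pr := fun k M => forall t, 0 <= t < e ->
  in_box M (Re (ws t 0 k)) (Im (ws t 0 k)))) => [k M M' M1 MM' H t /H|k].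
  exact: in_box_le.
 have y0 := z0 k; set x := Re (z 0 k); set y := Im (z 0 k) in y0.
 exists (1 + `|x| + y + y^-1 + e).
  by rewrite -!addrA lerDl !addr_ge0 ?invr_ge0// ltW.
 have iy0 : 0 < y^-1 by rewrite invr_gt0.
 have ax0 := normr_ge0 x.
 move=> t /andP[t0 te]; rewrite mxE /=; split; [lra| |lra].
 apply: le_trans (_ : y <= _); last lra.
 by rewrite -[leRHS]invrK lef_pV2 ?posrE//; lra.
have [M' M'1 hM'] : exists2 M', 1 <= M' & forall k t, 0 <= t < e ->
  in_box M' (Re (act rho (ws t) 0 k)) (Im (act rho (ws t) 0 k)).
 apply: (common_bound (Pr := fun k M => forall t, 0 <= t < e ->
  in_box M (Re (act rho (ws t) 0 k)) (Im (act rho (ws t) 0 k)))) => [k L L' L1 LL' H t /H|k].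
  exact: in_box_le.
 have [L L1 hL] := moebius_box (repr (rho k)) M1; exists L => // t t01.
 have /andP[t0 _] := t01.
 by have := hL _ _ (hM k t t01); rewrite [act _ _ _ _]mxE moebiusE//; exact: ws0.
have [N N0 hN] : exists2 N, 0 <= N & forall k t, 0 <= t < e ->
  csq (ws t 0 k) (act h (ws t) 0 k) <= N.
 have [N N1 hN] : exists2 N, 1 <= N & forall k t, 0 <= t < e ->
  csq (ws t 0 k) (act h (ws t) 0 k) <= N.
  apply: (common_bound (Pr := fun k N => forall t, 0 <= t < e ->
   csq (ws t 0 k) (act h (ws t) 0 k) <= N)) => [k L L' _ LL' H t /H|k].
   by move=> /le_trans; apply.
  have [L L1 hL] := sqdist_moebius_self_box (repr (h k)) M1; exists (1 + L).
   by rewrite lerDl.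
  move=> t t01; have /andP[t0 _] := t01.
  have := hL _ _ (hM k t t01); rewrite /csq [act _ _ _ _]mxE moebiusE//=; last exact: ws0.
  by move=> /le_trans; apply; rewrite lerDr.
 by exists N => //; apply: le_trans N1.
have fs : finite_set (range s).
 apply: sub_finite_set (finite_close Gam_group Gam_discrete M'1 N0) => _ [j _ <-].
 have [Gs _ es] := hs j; split=> //; have t01 := tj j.
 have w0 : @Hn R n (ws (e / j.+2%:R)) by apply: ws0; case/andP: t01.
 exists (act rho (ws (e / j.+2%:R))) => k; first exact: hM'.
 rewrite -es; have -> : act g (act rho (ws (e / j.+2%:R))) = act rho (act h (ws (e / j.+2%:R))).
  by rewrite -!act_mul// /h !mulgA mulgV mul1g.
 by rewrite csq_act//; [exact: hN|exact: act_Hn].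
(* Infinitely many indices and finitely many values of [s]. *)
have [j [j' [jj' ss]]] : exists j j', j <> j' /\ s j = s j'.
 apply: contrapT => H; have : infinite_set (range s).
  have inj : injective s.
   by move=> j j' ss; apply: contrapT => jj'; apply: H; exists j, j'.
  by rewrite (eq_finite_set (inj_card_eq (in2W inj))); exact: infinite_nat.
 by [].
have [_ l1 e1] := hs j; have [_ _ e2] := hs j'.
have gs : g = s j.
 apply/ffunP=> k; suff : ((s j)^-1 * g)%g k = 1%g.
  by rewrite mul_ffun_groupE inv_ffun_groupE => /mulg1_eq; rewrite invgK.
 have /andP[tj0 _] := tj j; have /andP[tj'0 _] := tj j'.
 have fx t : 0 <= t -> act g (act rho (ws t)) = act (s j) (act rho (ws t)) ->
   moebius (((s j)^-1 * g)%g k) (act rho (ws t) 0 k) = act rho (ws t) 0 k.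
  move=> t0 /(congr1 (act (s j)^-1%g)); have w0 := act_Hn rho (ws0 _ t0).
  by rewrite actK// -act_mul// => /rowP/(_ k); rewrite [LHS]mxE.
 apply: moebius_fix2 (fx _ tj0 e1) (fx _ tj'0 _); last by rewrite ss.
 - exact/act_Hn/ws0.
 - exact/act_Hn/ws0.
 move=> /(congr1 (moebius (rho k)^-1%g)).
 have := ws0 _ tj0 k; have := ws0 _ tj'0 k.
 rewrite ![act rho _ 0 k]mxE => p1 p2; rewrite !moebiusK// !mxE => -[] /addrI.
 move=> /(mulfI (lt0r_neq0 e0)) /invr_inj /eqP; rewrite eqr_nat => /eqP [] /jj'.
 by [].
rewrite gs -(sigma_infty Sk); apply/ffunP=> k; rewrite !ffunE -/rho.
have := moebius_bd_fix (rho k) (l1 k).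
suff -> : (rho k * (rho^-1 * s j * rho)%g k * (rho k)^-1)%g = s j k by [].
by rewrite !mul_ffun_groupE inv_ffun_groupE !mulgA mulgV mul1g mulgK.
Qed.

End separation.

End cusps.

(** * Densities, substitution and Lebesgue measure on tuples *)

Section density.
Local Open Scope ereal_scope.
Context d (T : measurableType d) (R : realType) (mu : {measure set T -> \bar R}).
Import HBNNSimple.
Variables (f : T -> R).
Hypotheses (mf : mfunT f)
 (f0 : forall x, (0 <= f x)%R).

(** The two proofs are arguments so that the structure of a measure can be attached to the term. *)
Definition density (mf : mfunT f) (f0 : forall x, (0 <= f x)%R)
 (A : set T) : \bar R := \int[mu]_(x in A) (f x)%:E.

Let density0 : density mf f0 set0 = 0.
Proof. by rewrite /density integral_set0. Qed.
Let density_ge0 A : 0 <= density mf f0 A.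
Proof. by apply: integral_ge0 => x _; rewrite lee_fin. Qed.
Let density_sigma : semi_sigma_additive (density mf f0).
Proof.
apply: semi_sigma_additive_nng_induced => [|x]; last by rewrite lee_fin.
exact/measurable_EFinP.
Qed.
HB.instance Definition _ := isMeasure.Build _ _ _ (density mf f0)
 density0 density_ge0 density_sigma.

Import HBNNSimple.

(** Checked on indicator functions, extended to simple functions by linearity and to [g] by monotone
    convergence. *)
Lemma ge0_integral_density (g : T -> \bar R) : mfunT g ->
 (forall x, 0 <= g x) ->
 \int[density mf f0]_x g x = \int[mu]_x (g x * (f x)%:E).
Proof.
move=> mg g0.
pose g_ := nnsfun_approx measurableT mg.
transitivity (limn (fun n => \int[density mf f0]_x (g_ n x)%:E)).
 rewrite -monotone_convergence//.
 - by apply: eq_integral=> x _; apply/esym/cvg_lim => //; apply: cvg_nnsfun_approx.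
 - by move=> n; exact/measurable_EFinP.
 - by move=> n x _; rewrite lee_fin.
 - by move=> x _ m n mn; rewrite lee_fin; exact/lefP/nd_nnsfun_approx.
transitivity (limn (fun n => \int[mu]_x ((g_ n x)%:E * (f x)%:E))); last first.
 rewrite -monotone_convergence//.
 - apply: eq_integral=> x _; apply/cvg_lim => //.
  apply: cvgeZr => //; exact: cvg_nnsfun_approx.
 - by move=> n; apply: emeasurable_funM; exact/measurable_EFinP.
 - by move=> n x _; rewrite mule_ge0// lee_fin.
 - move=> x _ m n mn; rewrite lee_pmul// ?lee_fin//.
  exact/lefP/nd_nnsfun_approx.
congr (limn _); apply/funext=> n.
under [in LHS]eq_integral do rewrite fimfunE -fsumEFin//.
rewrite [LHS](@ge0_integral_fsum _ _ _ _ _ measurableT _ (fun k x => (k * \1_(g_ n @^-1` [set k]) x)%:E))//; last 2 first.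
 - by move=> r; exact/measurable_EFinP/measurableT_comp.
 - by move=> r x _; rewrite nnfun_muleindic_ge0.
under [in RHS]eq_integral.
 move=> x _; rewrite fimfunE -fsumEFin// ge0_mule_fsuml; last first.
  by move=> r; rewrite nnfun_muleindic_ge0.
 over.
rewrite ge0_integral_fsum//; last 2 first.
 - move=> r; apply: emeasurable_funM; last exact/measurable_EFinP.
  exact/measurable_EFinP/measurableT_comp.
 - by move=> r x _; rewrite mule_ge0 ?lee_fin// -lee_fin EFinM nnfun_muleindic_ge0.
apply: eq_fsbigr => r _.
rewrite integralZl_indic_nnsfun// integral_indic// setIT /density.
under [in RHS]eq_integral do rewrite EFinM -muleA.
have [r0|r0] := ltP r 0%R.
 rewrite preimage_nnfun0// measure0 mule0.
 by rewrite integral0_eq// => x _; rewrite indicE in_set0 mul0e mule0.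
rewrite ge0_integralZl//; last 2 first.
 - apply: emeasurable_funM; last exact/measurable_EFinP.
  exact/measurable_EFinP.
 - by move=> x _; rewrite mule_ge0// lee_fin.
congr (_ * _); rewrite [LHS]integral_mkcond.
apply: eq_integral=> x _; rewrite patchE indicE.
by case: ifP=> _; rewrite ?mul1e ?mul0e.
Qed.

End density.

Lemma ge0_integral_image d1 d2 (X : measurableType d1) (Y : measurableType d2)
  (R : realType) (phi : X -> Y) (mu : {measure set X -> \bar R})
  (nu : {measure set Y -> \bar R}) :
 mfunT phi ->
 (forall A, measurable A -> mu (phi @^-1` A) = nu A) ->
 forall f, mfunT f -> (forall x, 0 <= f x)%E ->
 (\int[nu]_y f y = \int[mu]_x f (phi x))%E.
Proof.
move=> mphi H f mf f0.
pose phi' : {mfun X >-> Y} := HB.pack phi (isMeasurableFun.Build _ _ _ _ _ mphi).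
rewrite (eq_measure_integral (pushforward mu phi')); last first.
 by move=> A mA _; rewrite -H.
by rewrite ge0_integral_pushforward // preimage_setT.
Qed.

Section substitution.
Local Open Scope ereal_scope.
Context (R : realType).
Local Notation mu := (@lebesgue_measure R).

(** The push-forward under F of the measure with density F' gives ]c, d] the length d - c by the
    fundamental theorem of calculus, so it is Lebesgue measure by uniqueness. This avoids
    approximating the integrand. *)
Lemma ge0_substitution_onto (I : set R) (F F' G : R -> R) :
 open I -> (forall x y z, I x -> I z -> (x <= y <= z)%R -> I y) ->
 (forall t, I (G t)) -> (forall t, F (G t) = t) ->
 (forall x, I x -> is_derive x 1%R F (F' x)) ->
 (forall x, I x -> {for x, continuous F'}) ->
 (forall x, I x -> (0 <= F' x)%R) ->
 (forall x y, I x -> I y -> (x < y)%R -> (F x < F y)%R) ->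
 forall g : R -> \bar R, mfunT g -> (forall x, 0 <= g x) ->
 \int[mu]_x g x = \int[mu]_(x in I) (g (F x) * (F' x)%:E).
Proof.
move=> oI cI GI FG dF cF' F'0 incF.
have mI : measurable I by exact: open_measurable.
have cF x : I x -> {for x, continuous F}.
 by move=> /dF[dx _]; exact/differentiable_continuous/derivable1_diffP.
have GF x : I x -> G (F x) = x.
 move=> Ix; have := FG (F x); apply: contraPP=> /eqP.
 rewrite neq_lt => /orP[] h.
  by have := incF _ _ (GI _) Ix h; rewrite FG ltxx.
 by have := incF _ _ Ix (GI _) h; rewrite FG ltxx.
have Gle c x : I x -> (G c < x)%R = (c < F x)%R.
 move=> Ix; apply/idP/idP=> h; first by rewrite -(FG c); apply: incF.
 rewrite ltNge; apply/negP; rewrite le_eqVlt => /orP[/eqP xe|xG].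
  by move: h; rewrite xe FG ltxx.
 by have := incF _ _ Ix (GI c) xG; rewrite FG ltNge (ltW h).
have Gge c x : I x -> (x <= G c)%R = (F x <= c)%R.
 by move=> Ix; rewrite !leNgt Gle.
have mF : measurable_fun I F.
 apply: open_continuous_measurable_fun => // x; rewrite inE; exact: cF.
have mF' : measurable_fun I F'.
 apply: open_continuous_measurable_fun => // x; rewrite inE; exact: cF'.
(* F and F' are controlled on I only; extension by 0 gives globally measurable functions without
   changing the integral. *)
pose f := patch (fun=> 0%R) I F'.
pose F1 := patch (fun=> 0%R) I F.
have mf : mfunT f.
 by apply/(measurable_restrict _ mI measurableT); rewrite setTI.
have mF1 : mfunT F1.
 by apply/(measurable_restrict _ mI measurableT); rewrite setTI.
have f0 x : (0 <= f x)%R.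
 by rewrite /f patchE; case: ifPn => // /set_mem /F'0.
move=> g mg g0.
have mF2 : @measurable_fun _ _ R (measurableTypeR R) setT F1 by exact: mF1.
pose F2 : {mfun R >-> measurableTypeR R} :=
 HB.pack (F1 : R -> measurableTypeR R) (isMeasurableFun.Build _ _ _ _ _ mF2).
transitivity (\int[density mu mf f0]_x g (F1 x)); last first.
 rewrite ge0_integral_density//=; last exact: measurableT_comp.
 rewrite [RHS]integral_mkcond; apply: eq_integral=> x _.
 by rewrite patchE /f /F1 !patchE; case: ifPn => // _; rewrite mule0.
apply: ge0_integral_image => // A mA.
apply/esym/(@lebesgue_measure_unique R (pushforward (density mu mf f0) F2)) => // _ [[c d] _ <-] /=.
rewrite /pushforward /density.
rewrite lebesgue_measure_itv/= lte_fin; case: ifPn => [cd|]; last first.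
 rewrite -leNgt => dc; rewrite (_ : F1 @^-1` _ = set0) ?integral_set0//.
 by rewrite -subset0 => x /=; rewrite in_itv/= => /andP[/lt_le_trans/[apply]]; rewrite ltNge dc.
have Gcd : (G c < G d)%R by rewrite Gle// FG.
transitivity (\int[mu]_(x in `[G c, G d]) (F' x)%:E).
 rewrite (@continuous_FTC2 R F' F)//.
 - by rewrite !FG.
 - apply: continuous_in_subspaceT => x; rewrite inE/= in_itv/= => h.
  by apply: cF'; apply: (cI _ _ _ (GI c) (GI d)).
 - split.
  + move=> x; rewrite in_itv/= => /andP[h1 h2].
   have /dF[] // : I x by apply: (cI _ _ _ (GI c) (GI d)); rewrite ?(ltW h1)// ltW.
  + by apply: cvg_at_right_filter; apply: cF.
  + by apply: cvg_at_left_filter; apply: cF.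
 - move=> x; rewrite in_itv/= => /andP[h1 h2].
  rewrite derive1E; apply: derive_val; apply: dF.
  by apply: (cI _ _ _ (GI c) (GI d)); rewrite ?(ltW h1)// ltW.
rewrite -integral_itv_obnd_cbnd; last first.
 apply/measurable_EFinP; apply: measurable_funS mF' => // x /=; rewrite in_itv/= => /andP[h1 h2].
 by apply: (cI _ _ _ (GI c) (GI d)); rewrite (ltW h1).
rewrite [LHS]integral_mkcond [RHS]integral_mkcond; apply: eq_integral=> x _.
rewrite !patchE /f /F1.
have [Ix|nIx] := pselect (I x).
 rewrite [in RHS]/preimage/= patchE (mem_set Ix).
 rewrite (_ : (x \in `]G c, G d]%classic) = (x \in [set t | `]c, d]%classic (patch (fun=> 0%R) I F t)]))//.
 apply/idP/idP; rewrite !inE/= !in_itv/= patchE (mem_set Ix) Gle// Gge//.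
rewrite patchE (memNset nIx); rewrite memNset ?if_same//= in_itv/=.
move=> /andP[h1 h2]; apply: nIx.
by apply: (cI _ _ _ (GI c) (GI d)); rewrite ?(ltW h1)// ltW.
Qed.

End substitution.

Section lebesgue_tuple_integral.
Local Open Scope ereal_scope.
Context (R : realType).
Local Notation RT := (measurableTypeR R).
Local Notation mu := (@lebesgue_measure R).

Lemma measurable_ge0_integral_prod d1 d2 d3 (X : measurableType d1) (Y : measurableType d2) (Z : measurableType d3)
  (a : {sigma_finite_measure set Y -> \bar R}) (b : {sigma_finite_measure set Z -> \bar R})
  (F : X * (Y * Z) -> \bar R) : mfunT F -> (forall r, 0 <= F r) ->
 mfunT (fun x => \int[(a \x b)]_q F (x, q)).
Proof.
move=> mF F0; rewrite (_ : (fun x => _) = fun x => \int[a]_y \int[b]_z F (x, (y, z))).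
 apply: (@measurable_fun_fubini_tonelli_F _ _ _ _ _ a (fun r => \int[b]_z F (r.1, (r.2, z)))).
  by apply: (@measurable_fun_fubini_tonelli_F _ _ _ _ _ b (fun r => F (r.1.1, (r.1.2, r.2)))) => //; meas.
 by move=> r; apply: integral_ge0.
by apply/funext=> x; rewrite fubini_tonelli1//; meas.
Qed.

Lemma ge0_integral_leb0 (G : 0.-tuple RT -> \bar R) :
 (forall t, 0 <= G t) -> \int[leb R 0]_t G t = G [tuple].
Proof.
move=> G0; rewrite [LHS]integral_dirac//=; first by rewrite diracE mem_set// mul1e.
move=> _ Y mY; rewrite setTI.
have [h|h] := pselect (Y (G [tuple])).
 rewrite (_ : _ @^-1` _ = setT)//; apply/seteqP; split=> // t _ /=.
 by rewrite (tuple0 t).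
rewrite (_ : _ @^-1` _ = set0)//; apply/seteqP; split=> // t /=.
by rewrite (tuple0 t).
Qed.

Lemma ge0_integral_lebS n (G : n.+1.-tuple RT -> \bar R) :
 mfunT G -> (forall t, 0 <= G t) ->
 \int[leb R n.+1]_t G t = \int[mu]_x \int[leb R n]_t G (tuple_cons (x, t)).
Proof.
move=> mG G0; have mc := @measurable_tuple_cons R n.
rewrite (@ge0_integral_image _ _ _ _ _ (@tuple_cons R n) (mu \x leb R n)%E (leb R n.+1))//.
by rewrite fubini_tonelli1//; exact: measurableT_comp.
Qed.

(** Regroups the variables as a plane of first coordinates times the rest, the induction step for
    coordinatewise maps of the plane. *)
Lemma ge0_integral_lebSS n (G : n.+1.-tuple RT * n.+1.-tuple RT -> \bar R) :
 mfunT G -> (forall t, 0 <= G t) ->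
 \int[(leb R n.+1 \x leb R n.+1)%E]_t G t =
 \int[(mu \x mu)%E]_p \int[(leb R n \x leb R n)%E]_q
   G (tuple_cons (p.1, q.1), tuple_cons (p.2, q.2)).
Proof.
move=> mG G0; have mc := @measurable_tuple_cons R n.
pose H (r : (RT * RT) * (n.-tuple RT * n.-tuple RT)) := G (tuple_cons (r.1.1, r.2.1), tuple_cons (r.1.2, r.2.2)).
have mH : mfunT H by rewrite /H; meas.
rewrite [LHS]fubini_tonelli1// ge0_integral_lebS; last 2 first.
- exact: measurable_fun_fubini_tonelli_F.
- by move=> t; apply: integral_ge0.
rewrite [RHS]fubini_tonelli1; last 2 first.
- by apply: (measurable_ge0_integral_prod (leb R n) (leb R n) mH) => r; exact: G0.
- by move=> p; apply: integral_ge0.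
apply: eq_integral=> x _; rewrite /fubini_F.
transitivity (\int[leb R n]_s \int[mu]_y \int[leb R n]_t H ((x, y), (s, t))).
 by apply: eq_integral=> s _; rewrite ge0_integral_lebS//; meas.
pose K (r : n.-tuple RT * RT) := \int[leb R n]_t H ((x, r.2), (r.1, t)).
rewrite (fubini_tonelli K)/K; last 2 first.
- apply: (measurable_fun_fubini_tonelli_F (fun r : (n.-tuple RT * RT) * n.-tuple RT => H ((x, r.1.2), (r.1.1, r.2)))) => //.
  by meas.
 by move=> r; exact: G0.
- by move=> r; apply: integral_ge0 => t _; exact: G0.
apply: eq_integral=> y _; rewrite [RHS]fubini_tonelli1//.
apply: (measurableT_comp mH (g := fun q => ((x, y), q))); exact: measurable_fun_pair.
Qed.

End lebesgue_tuple_integral.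

(** * Polar coordinates and invariant measure *)

Section coordinate_change.
Local Open Scope ereal_scope.
Context (R : realType).
Local Notation RT := (measurableTypeR R).
Local Notation mu := (@lebesgue_measure R).

Definition map_fun n (Z : 'I_n -> R -> R) (t : n.-tuple RT) : n.-tuple RT :=
 [tuple Z i (tnth t i) | i < n].

Definition map_fun2 n (Z : 'I_n -> R * R -> R * R)
  (p : n.-tuple RT * n.-tuple RT) : n.-tuple RT * n.-tuple RT :=
 ([tuple (Z i (tnth p.1 i, tnth p.2 i)).1 | i < n],
  [tuple (Z i (tnth p.1 i, tnth p.2 i)).2 | i < n]).

Lemma tnth_tuple_cons0 n (x : RT) (t : n.-tuple RT) :
 tnth (tuple_cons (x, t)) ord0 = x.
Proof. by []. Qed.

Lemma tnth_tuple_consS n (x : RT) (t : n.-tuple RT) i :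
 tnth (tuple_cons (x, t)) (lift ord0 i) = tnth t i.
Proof. by rewrite /tuple_cons tnthS. Qed.

Lemma map_fun_cons n Z (x : RT) (t : n.-tuple RT) :
 map_fun Z (tuple_cons (x, t)) =
 tuple_cons (Z ord0 x, map_fun (fun i => Z (lift ord0 i)) t).
Proof.
apply: eq_from_tnth=> i; rewrite tnth_mktuple.
by case: (unliftP ord0 i) => [j|] ->; rewrite ?tnth_tuple_consS ?tnth_mktuple.
Qed.

Lemma map_fun2_cons n Z (x y : RT) (s t : n.-tuple RT) :
 let q := map_fun2 (fun i => Z (lift ord0 i)) (s, t) in
 map_fun2 Z (tuple_cons (x, s), tuple_cons (y, t)) =
 (tuple_cons ((Z ord0 (x, y)).1, q.1), tuple_cons ((Z ord0 (x, y)).2, q.2)).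
Proof.
congr pair; apply: eq_from_tnth=> i; rewrite tnth_mktuple /=;
by case: (unliftP ord0 i) => [j|] ->; rewrite ?tnth_tuple_consS ?tnth_mktuple.
Qed.

Lemma measurable_map_fun n (Z : 'I_n -> R -> R) :
 (forall i, mfunT (Z i)) -> mfunT (map_fun Z).
Proof.
move=> mZ; apply/measurable_fun_tnthP=> i.
rewrite (_ : _ \o _ = fun t => Z i (tnth t i)).
 by apply: (measurableT_comp (mZ i)); exact: measurable_tnth.
by apply/funext=> t /=; rewrite tnth_mktuple.
Qed.

Lemma measurable_tnth2 n i :
 mfunT (fun p : n.-tuple RT * n.-tuple RT => (tnth p.1 i, tnth p.2 i)).
Proof. by meas. Qed.

Lemma measurable_map_fun2 n (Z : 'I_n -> R * R -> R * R) :
 (forall i, mfunT (Z i)) -> mfunT (map_fun2 Z).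
Proof.
move=> mZ; apply: measurable_fun_pair; apply/measurable_fun_tnthP=> i; have m := mZ i.
 rewrite (_ : _ \o _ = fun p => (Z i (tnth p.1 i, tnth p.2 i)).1); first by meas.
 by apply/funext=> t /=; rewrite tnth_mktuple.
rewrite (_ : _ \o _ = fun p => (Z i (tnth p.1 i, tnth p.2 i)).2); first by meas.
by apply/funext=> t /=; rewrite tnth_mktuple.
Qed.

Lemma measurable_prod_tnth n (d : 'I_n -> R -> R) :
 (forall i, mfunT (d i)) ->
 mfunT (fun t : n.-tuple RT => \prod_i d i (tnth t i))%R.
Proof.
move=> md; apply: measurable_prod => i _.
by apply: (measurableT_comp (md i)); exact: measurable_tnth.
Qed.

Lemma measurable_prod_tnth2 n (d : 'I_n -> R * R -> R) :
 (forall i, mfunT (d i)) ->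
 mfunT (fun p : n.-tuple RT * n.-tuple RT =>
  \prod_i d i (tnth p.1 i, tnth p.2 i))%R.
Proof.
move=> md; apply: measurable_prod => i _.
by apply: (measurableT_comp (md i)); exact: measurable_tnth2.
Qed.

(** Induction on n with Tonelli: the one-dimensional formula is used in the first coordinate, after
    the induction hypothesis in the others. *)
Lemma ge0_leb_coordinate_change n (j Z : 'I_n -> R -> R) :
 (forall i, mfunT (j i)) -> (forall i x, 0 <= j i x)%R ->
 (forall i, mfunT (Z i)) ->
 (forall i (g : R -> \bar R), mfunT g -> (forall x, 0 <= g x) ->
  \int[mu]_x g x = \int[mu]_x (g (Z i x) * (j i x)%:E)) ->
 forall G : n.-tuple RT -> \bar R, mfunT G -> (forall t, 0 <= G t) ->
 \int[leb R n]_t G t = \int[leb R n]_t (G (map_fun Z t) * (\prod_i j i (tnth t i))%:E).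
Proof.
elim: n j Z => [|n IH] j Z mj j0 mZ H G mG G0.
 rewrite !ge0_integral_leb0 ?big_ord0//; last by move=> t; rewrite big_ord0 mule1.
 by rewrite mule1 (tuple0 (map_fun _ _)).
have mc := @measurable_tuple_cons R n.
have prod0 m (e : 'I_m -> R -> R) (t : m.-tuple RT) : (forall i x, 0 <= e i x)%R ->
  0 <= (\prod_i e i (tnth t i))%:E.
 by move=> e0; rewrite lee_fin prodr_ge0.
have mp := measurable_prod_tnth mj; have mm := measurable_map_fun mZ.
rewrite !ge0_integral_lebS; last 4 first.
- by apply: emeasurable_funM; [meas|apply/measurable_EFinP].
- by move=> t; rewrite mule_ge0// prod0.
- exact: mG.
- exact: G0.
pose j' (i : 'I_n) := j (lift ord0 i); pose Z' (i : 'I_n) := Z (lift ord0 i).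
have mp' : mfunT (fun t : n.-tuple RT => \prod_i j' i (tnth t i))%R.
 by apply: measurable_prod_tnth => i; exact: mj.
have mm' : mfunT (map_fun Z') by apply: measurable_map_fun => i; exact: mZ.
pose g (r : RT * n.-tuple RT) := G (tuple_cons (r.1, map_fun Z' r.2)) * (\prod_i j' i (tnth r.2 i))%:E.
have mg : mfunT g.
 apply: emeasurable_funM; first by meas.
 by apply/measurable_EFinP; exact: (measurableT_comp mp' measurable_snd).
have g0 r : 0 <= g r by rewrite mule_ge0// prod0// => i; exact: j0.
transitivity (\int[mu]_x \int[leb R n]_t g (x, t)).
 apply: eq_integral=> x _.
 rewrite (IH j' Z' (fun i => mj _) (fun i => j0 _) (fun i => mZ _) (fun i => H _) (fun t => G (tuple_cons (x, t))))//.
 by meas.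
rewrite (H ord0); last 2 first.
- exact: (measurable_fun_fubini_tonelli_F g).
- by move=> x; apply: integral_ge0.
apply: eq_integral=> x _; rewrite -ge0_integralZr//; last 2 first.
- by apply: (measurableT_comp mg (g := fun t => (Z ord0 x, t))); exact: measurable_fun_pair.
- by rewrite lee_fin.
apply: eq_integral=> t _; rewrite /g /= map_fun_cons big_ord_recl EFinM -muleA; congr (_ * _).
by rewrite muleC; congr (_ * _%:E); apply: eq_bigr=> i _; rewrite tnth_tuple_consS.
Qed.

(** The density [d] on the left allows the formula to be applied to dx dy / y^2, both for isometries
    and for polar coordinates. *)
Lemma ge0_leb2_coordinate_change n (d j : 'I_n -> R * R -> R) (Z : 'I_n -> R * R -> R * R) :
 (forall i, mfunT (d i)) -> (forall i x, 0 <= d i x)%R ->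
 (forall i, mfunT (j i)) -> (forall i x, 0 <= j i x)%R ->
 (forall i, mfunT (Z i)) ->
 (forall i (g : R * R -> \bar R), mfunT g -> (forall x, 0 <= g x) ->
  \int[(mu \x mu)]_p (g p * (d i p)%:E) = \int[(mu \x mu)]_p (g (Z i p) * (j i p)%:E)) ->
 forall G : n.-tuple RT * n.-tuple RT -> \bar R, mfunT G -> (forall t, 0 <= G t) ->
 \int[(leb R n \x leb R n)]_p (G p * (\prod_i d i (tnth p.1 i, tnth p.2 i))%:E) =
 \int[(leb R n \x leb R n)]_p (G (map_fun2 Z p) * (\prod_i j i (tnth p.1 i, tnth p.2 i))%:E).
Proof.
elim: n d j Z => [|n IH] d j Z md d0 mj j0 mZ H G mG G0.
 apply: eq_integral=> -[s t] _; rewrite !big_ord0; congr (G _ * _).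
 by rewrite /map_fun2; congr pair; apply: eq_from_tnth=> -[].
have mc := @measurable_tuple_cons R n.
have prod0 m (e : 'I_m -> R * R -> R) (s t : m.-tuple RT) : (forall i x, 0 <= e i x)%R ->
  0 <= (\prod_i e i (tnth s i, tnth t i))%:E.
 by move=> e0; rewrite lee_fin prodr_ge0.
have mpd := measurable_prod_tnth2 md; have mpj := measurable_prod_tnth2 mj.
have mm := measurable_map_fun2 mZ.
rewrite !ge0_integral_lebSS; first last.
- by move=> t; rewrite mule_ge0// prod0.
- by apply: emeasurable_funM => //; apply/measurable_EFinP.
- by move=> t; rewrite mule_ge0// prod0.
- by apply: emeasurable_funM; [meas|apply/measurable_EFinP].
pose cc (r : (RT * RT) * (n.-tuple RT * n.-tuple RT)) :=
 (tuple_cons (r.1.1, r.2.1), tuple_cons (r.1.2, r.2.2)).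
have mcc : mfunT cc by rewrite /cc; meas.
pose j' (i : 'I_n) := j (lift ord0 i); pose Z' (i : 'I_n) := Z (lift ord0 i); pose d' (i : 'I_n) := d (lift ord0 i).
have mpd' := measurable_prod_tnth2 (fun i => md _ : mfunT (d' i)).
have mpj' := measurable_prod_tnth2 (fun i => mj _ : mfunT (j' i)).
have mm' : mfunT (map_fun2 Z') by apply: measurable_map_fun2 => i; exact: mZ.
pose g r := G (cc (r.1, map_fun2 Z' r.2)) * (\prod_i j' i (tnth r.2.1 i, tnth r.2.2 i))%:E.
have mg : mfunT g.
 apply: emeasurable_funM; first by meas.
 by apply/measurable_EFinP; exact: (measurableT_comp mpj' measurable_snd).
have g0 r : 0 <= g r by rewrite mule_ge0// prod0// => i; exact: j0.
have mp2 (p : RT * RT) : mfunT (fun q : n.-tuple RT * n.-tuple RT => (p, q)) by exact: measurable_fun_pair.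
transitivity (\int[(mu \x mu)]_p ((\int[(leb R n \x leb R n)]_q g (p, q)) * (d ord0 p)%:E)).
 apply: eq_integral=> p _; have mGc : mfunT (fun q => G (cc (p, q))) by meas.
 rewrite -(IH d' j' Z' (fun i => md _) (fun i => d0 _) (fun i => mj _) (fun i => j0 _)
  (fun i => mZ _) (fun i => H _) (fun q => G (cc (p, q))) mGc (fun q => G0 _)) -ge0_integralZr//; first last.
 - by rewrite lee_fin.
 - by move=> t _; rewrite mule_ge0// prod0// => i; exact: d0.
 - by apply: emeasurable_funM => //; apply/measurable_EFinP.
 apply: eq_integral=> q _; rewrite big_ord_recl EFinM -muleA; congr (_ * _).
 rewrite muleC; congr (_%:E * _%:E).
  by apply: eq_bigr=> i _; rewrite !tnth_tuple_consS.
 by rewrite !tnth_tuple_cons0 -surjective_pairing.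
rewrite H; last 2 first.
- exact: (measurable_ge0_integral_prod (leb R n) (leb R n) mg g0).
- by move=> p; apply: integral_ge0.
apply: eq_integral=> p _; rewrite -ge0_integralZr//; first last.
- by rewrite lee_fin.
- exact: measurableT_comp.
apply: eq_integral=> -[s t] _.
rewrite map_fun2_cons big_ord_recl EFinM -muleA; congr (G _ * _).
 by rewrite /cc /=; case: p.
rewrite muleC; congr (_%:E * _%:E).
 by rewrite !tnth_tuple_cons0 -surjective_pairing.
by apply: eq_bigr=> i _; rewrite !tnth_tuple_consS.
Qed.

End coordinate_change.

Section plane_integrals.
Local Open Scope ereal_scope.
Context (R : realType).
Local Notation mu := (@lebesgue_measure R).
Implicit Types (g : R * R -> \bar R) (p q : R * R).

Lemma ge0_substitution_ind (I : pred R) (F F' G : R -> R) :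
 open [set x | I x] -> (forall x y z, I x -> I z -> (x <= y <= z)%R -> I y) ->
 (forall t, I (G t)) -> (forall t, F (G t) = t) ->
 (forall x, I x -> is_derive x 1%R F (F' x)) ->
 (forall x, I x -> {for x, continuous F'}) ->
 (forall x, I x -> (0 <= F' x)%R) ->
 (forall x y, I x -> I y -> (x < y)%R -> (F x < F y)%R) ->
 forall g : R -> \bar R, mfunT g -> (forall x, 0 <= g x) ->
 \int[mu]_x g x = \int[mu]_x (g (F x) * (if I x then F' x else 0%R)%:E).
Proof.
move=> oI cI GI FG dF cF' F'0 incF g mg g0.
rewrite (ge0_substitution_onto oI cI GI FG dF cF' F'0 incF)// integral_mkcond.
apply: eq_integral=> x _; rewrite patchE (_ : (x \in _) = I x).
 by case: (I x) => //; rewrite mule0.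
by apply/idP/idP; rewrite inE.
Qed.

Lemma ge0_integral_shift (c : R) (g : R -> \bar R) : mfunT g ->
 (forall x, 0 <= g x) -> \int[mu]_x g x = \int[mu]_x g (x + c)%R.
Proof.
move=> mg g0.
transitivity (\int[mu]_x (g (x + c)%R * (if predT x then 1 else 0)%R%:E)); last first.
 by apply: eq_integral=> x _; rewrite mule1.
apply: (@ge0_substitution_ind predT (fun x => x + c)%R (fun=> 1%R) (fun x => x - c)%R) => //=.
- by rewrite (_ : [set _ | true] = setT); [exact: openT|apply/seteqP].
- by move=> t; rewrite subrK.
- move=> x _; apply: is_derive_eq; by rewrite addr0.
- by move=> x _; exact: cst_continuous.
- by move=> x y _ _ xy; rewrite ltrD2r.
Qed.

Lemma ge0_integral_scale (c : R) (g : R -> \bar R) : (0 < c)%R -> mfunT g ->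
 (forall x, 0 <= g x) -> \int[mu]_x g x = \int[mu]_x (g (c * x)%R * c%:E).
Proof.
move=> c0 mg g0.
apply: (@ge0_substitution_ind predT (fun x => c * x)%R (fun=> c) (fun x => c^-1 * x)%R) => //=.
- by rewrite (_ : [set _ | true] = setT); [exact: openT|apply/seteqP].
- by move=> t; rewrite mulVKf// gt_eqF.
- move=> x _; apply: is_derive_eq; by rewrite /GRing.scale/= mulr1.
- by move=> x _; exact: cst_continuous.
- by move=> x _; exact: ltW.
- by move=> x y _ _ xy; rewrite ltr_pM2l.
Qed.

Lemma ge0_integral_opp (g : R -> \bar R) : mfunT g ->
 (forall x, 0 <= g x) -> \int[mu]_x g x = \int[mu]_x g (- x)%R.
Proof.
move=> mg g0; apply: (@ge0_integral_image _ _ _ _ R (fun x : measurableTypeR R => - x : measurableTypeR R)%R mu mu) => //.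
 by apply: continuous_measurable_fun; exact: opp_continuous.
exact: lebesgue_measureN.
Qed.

Lemma ge0_integral_expR (g : R -> \bar R) : mfunT g ->
 (forall x, 0 <= g x) ->
 \int[mu]_x g x = \int[mu]_x (g (ln x) * (if 0 < x then x^-1 else 0)%R%:E).
Proof.
move=> mg g0; apply: (@ge0_substitution_ind _ (@ln R) (fun x => x^-1)%R expR) => //.
- by move=> x y z x0 _ /andP[xy _]; exact: lt_le_trans xy.
- by move=> t; exact: expR_gt0.
- exact: expRK.
- by move=> x x0; apply: inv_continuous; rewrite gt_eqF.
- by move=> x x0; rewrite invr_ge0 ltW.
- by move=> x y x0 y0; rewrite ltr_ln.
Qed.

Definition in_pihalf (th : R) : bool := (- (pi / 2) < th < pi / 2)%R.

Lemma open_in_pihalf : open [set x : R | in_pihalf x].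
Proof.
rewrite (_ : [set x | _] = `](- (pi / 2))%R, (pi / 2)%R[%classic); first exact: interval_open.
by apply/seteqP; split=> x /=; rewrite in_itv.
Qed.

Lemma measurable_in_pihalf : mfunT in_pihalf.
Proof. by apply: measurable_and; exact: measurable_fun_ltr. Qed.

Lemma ge0_integral_tan (c : R) (g : R -> \bar R) : (0 < c)%R -> mfunT g ->
 (forall x, 0 <= g x) ->
 \int[mu]_x g x =
 \int[mu]_th (g (c * tan th)%R * (if in_pihalf th then c / cos th ^+ 2 else 0)%R%:E).
Proof.
move=> c0 mg g0.
have cn0 x : in_pihalf x -> cos x != 0%R by move=> h; rewrite gt_eqF// cos_gt0_pihalf.
apply: (@ge0_substitution_ind _ (fun th => c * tan th)%R (fun x => c / cos x ^+ 2)%R (fun x => atan (c^-1 * x)%R)) => //.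
- exact: open_in_pihalf.
- move=> x y z /andP[x1 _] /andP[_ z1] /andP[xy yz]; apply/andP; split.
  exact: lt_le_trans xy.
 exact: le_lt_trans z1.
- by move=> t; rewrite /in_pihalf; have [] := atan_def (c^-1 * t)%R.
- by move=> t; rewrite atanK mulVKf// gt_eqF.
- move=> x /cn0 x0; have := is_derive_tan x0 => dt.
 by apply: is_derive_eq.
- move=> x /cn0 x0; apply: cvgM; first exact: cvg_cst.
 apply: cvgV; first by rewrite expf_neq0.
 by apply: (@continuous_comp _ _ _ (@cos R) (fun y => y ^+ 2)%R); [exact: continuous_cos|exact: exprn_continuous].
- by move=> x /cn0 x0; rewrite divr_ge0 ?sqr_ge0// ltW.
- by move=> x y hx hy xy; rewrite ltr_pM2l// ltr_tan// in_itv.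
Qed.

Definition hdens p : R := if (0 < p.2)%R then (p.2 ^+ 2)^-1%R else 0%R.

(** Log-polar coordinates with the angle measured from the imaginary axis, so that the axis of a
    dilation is the line of angle 0. The area dx dy / y^2 becomes dt dv / cos^2 v. *)
Definition hyp_polar q : R * R := (expR q.1 * sin q.2, expR q.1 * cos q.2)%R.
Definition hpolar_jac q : R :=
 if in_pihalf q.2 then (cos q.2 ^+ 2)^-1%R else 0%R.

Lemma measurable_hdens : mfunT hdens.
Proof. by rewrite /hdens; meas. Qed.

Lemma hdens_ge0 p : (0 <= hdens p)%R.
Proof. by rewrite /hdens; case: ifP=> // _; rewrite invr_ge0 sqr_ge0. Qed.

Lemma measurable_hyp_polar : mfunT hyp_polar.
Proof. by rewrite /hyp_polar; meas. Qed.

Lemma measurable_hpolar_jac : mfunT hpolar_jac.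
Proof. have mi := measurable_in_pihalf; by rewrite /hpolar_jac; meas. Qed.

Lemma hpolar_jac_ge0 p : (0 <= hpolar_jac p)%R.
Proof. by rewrite /hpolar_jac; case: ifP=> // _; rewrite invr_ge0 sqr_ge0. Qed.

Lemma ge0_plane_swap g : mfunT g -> (forall p, 0 <= g p) ->
 \int[mu \x mu]_p g p = \int[mu]_y \int[mu]_x g (x, y).
Proof. by move=> mg g0; rewrite fubini_tonelli2. Qed.

Lemma ge0_plane_iter g : mfunT g -> (forall p, 0 <= g p) ->
 \int[mu \x mu]_p g p = \int[mu]_x \int[mu]_y g (x, y).
Proof. by move=> mg g0; rewrite fubini_tonelli1. Qed.

Lemma measurable_sectl d (T : measurableType d) (h : R * R -> T) x :
 mfunT h -> mfunT (fun y => h (x, y)).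
Proof. by move=> mh; apply: (measurableT_comp mh (g := fun y => (x, y))); exact: measurable_fun_pair. Qed.

Lemma measurable_sectr d (T : measurableType d) (h : R * R -> T) y :
 mfunT h -> mfunT (fun x => h (x, y)).
Proof. by move=> mh; apply: (measurableT_comp mh (g := fun x => (x, y))); exact: measurable_fun_pair. Qed.

Lemma ge0_integral_hyp_polar g : mfunT g -> (forall p, 0 <= g p) ->
 \int[mu \x mu]_p (g p * (hdens p)%:E) =
 \int[mu \x mu]_q (g (hyp_polar q) * (hpolar_jac q)%:E).
Proof.
move=> mg g0; have md := measurable_hdens; have mp := measurable_hyp_polar.
have mj := measurable_hpolar_jac; have mi := measurable_in_pihalf.
pose w q : R := (if (0 < q.2) && in_pihalf q.1 then (q.2 * cos q.1 ^+ 2)^-1 else 0)%R.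
pose T q := (q.2 * (sin q.1 / cos q.1), q.2)%R.
pose gw q := g (T q) * (w q)%:E.
have mgw : mfunT gw by rewrite /gw /T /w; meas.
have gw0 q : 0 <= gw q.
 by rewrite mule_ge0// lee_fin /w; case: ifP=> // /andP[y0 _]; rewrite invr_ge0 mulr_ge0 ?sqr_ge0 ?ltW.
have mgd : mfunT (fun p => g p * (hdens p)%:E) by meas.
have gd0 p : 0 <= g p * (hdens p)%:E by rewrite mule_ge0// lee_fin hdens_ge0.
pose gj q := g (hyp_polar q) * (hpolar_jac q)%:E.
have mgj : mfunT gj by rewrite /gj; meas.
have gj0 q : 0 <= gj q by rewrite mule_ge0// lee_fin hpolar_jac_ge0.
rewrite (ge0_plane_swap mgd gd0).
(* For fixed y the substitution is x = y tan th; after exchanging the integrals, y = e^t cos th for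
   fixed th. *)
transitivity (\int[mu]_y \int[mu]_th gw (th, y)).
 apply: eq_integral=> y _; have [y0|y0] := ltP 0%R y; last first.
  under eq_integral do rewrite /hdens/= ltNge y0 mule0.
  by under [RHS]eq_integral do rewrite /gw/w/= ltNge y0 mule0.
 rewrite (@ge0_integral_tan y)//; last exact: (measurable_sectr y mgd).
 apply: eq_integral=> th _; rewrite -muleA -EFinM /gw /T /hdens /w /= y0 /=.
 case: ifPn => // h; last by rewrite mulr0.
 congr (_ * _%:E); have c0 : cos th != 0%R by rewrite gt_eqF// cos_gt0_pihalf.
 by field; rewrite c0 gt_eqF.
rewrite -(ge0_plane_swap mgw gw0) (ge0_plane_iter mgw gw0) (ge0_plane_swap mgj gj0).
apply: eq_integral=> th _; case hth: (in_pihalf th); last first.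
 under eq_integral do rewrite /gw/w/= hth andbF mule0.
 by under [RHS]eq_integral do rewrite /gj/hpolar_jac/= hth mule0.
have c0 : (0 < cos th)%R by rewrite cos_gt0_pihalf.
have ms := measurable_sectr th mgj.
rewrite [RHS](@ge0_integral_shift (- ln (cos th)))// [RHS]ge0_integral_expR//; last first.
 by apply: (measurableT_comp ms); exact: measurable_funB.
apply: eq_integral=> y _; rewrite /gj -muleA -EFinM /gw /w /hpolar_jac /= hth andbT.
case: ifPn => y0; last by rewrite mulr0 !mule0.
rewrite /hyp_polar /T /= expRD expRN !lnK//.
congr (g _ * _%:E); last by field; rewrite !gt_eqF.
by congr pair; field; rewrite gt_eqF.
Qed.

End plane_integrals.

Section plane_maps.
Local Open Scope ereal_scope.
Context (R : realType).
Local Notation mu := (@lebesgue_measure R).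
Implicit Types (g : R * R -> \bar R) (p q : R * R).

Lemma ge0_integral_eq_off (a b : R) (k k' : R -> \bar R) :
 mfunT k -> mfunT k' ->
 (forall x, 0 <= k x) -> (forall x, 0 <= k' x) ->
 (forall x, x <> a -> x <> b -> k x = k' x) ->
 \int[mu]_x k x = \int[mu]_x k' x.
Proof.
move=> mk mk' k0 k'0 e; apply: ge0_ae_eq_integral=> //.
exists [set a; b]; split.
- by apply: measurableU; exact: measurable_set1.
- apply: countable_lebesgue_measure0; apply: finite_set_countable.
 exact: finite_set2.
- move=> x /= nx; apply: contrapT => /not_orP[xa xb]; apply: nx => _; exact: e.
Qed.

Lemma measurable_sinh : mfunT (@Defs.sinh R).
Proof. by rewrite /Defs.sinh; meas. Qed.

Lemma measurable_cosh : mfunT (@Defs.cosh R).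
Proof. by rewrite /Defs.cosh; meas. Qed.

Lemma cosh2_sinh2 (r : R) : (cosh r ^+ 2 - sinh r ^+ 2 = 1)%R.
Proof.
rewrite /cosh /sinh; have := expRxMexpNx_1 r; set a := expR r; set b := expR (- r) => ab.
rewrite (_ : _ - _ = a * b)%R //; by field.
Qed.

Lemma cosh_gt0 (r : R) : (0 < cosh r)%R.
Proof. by rewrite divr_gt0// addr_gt0// expR_gt0. Qed.

Lemma sinh_gt0 (r : R) : (0 < r)%R -> (0 < sinh r)%R.
Proof. by move=> r0; rewrite divr_gt0// subr_gt0 ltr_expR gtrN. Qed.

Lemma sinh_lt_cosh (r : R) : (sinh r < cosh r)%R.
Proof. by rewrite /sinh /cosh ltr_pM2r// ltrD2l (lt_trans _ (expR_gt0 _))// oppr_lt0 expR_gt0. Qed.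

Lemma sinhN (r : R) : (sinh (- r) = - sinh r)%R.
Proof. by rewrite /sinh opprK -mulNr opprB. Qed.
Lemma coshN (r : R) : (cosh (- r) = cosh r)%R.
Proof. by rewrite /cosh opprK addrC. Qed.

Lemma ell_den_gt0 (r th : R) : (0 < cosh r - sinh r * cos th)%R.
Proof.
rewrite subr_gt0; apply: le_lt_trans (_ : `|sinh r| < _)%R.
 apply: le_trans (ler_norm _) _; rewrite normrM ler_piMr// ler_norml.
 by rewrite cos_geN1 cos_le1.
by rewrite ltr_norml sinh_lt_cosh andbT ltrNl -sinhN -coshN sinh_lt_cosh.
Qed.

Lemma is_derive_sinh (r : R) : is_derive r 1%R (@Defs.sinh R) (cosh r).
Proof.
rewrite /Defs.sinh; apply: is_derive_eq.
by rewrite !scaler0 add0r /cosh mulrN1 opprK /GRing.scale/= mulrC.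
Qed.

Lemma is_derive_cosh (r : R) : is_derive r 1%R (@Defs.cosh R) (sinh r).
Proof.
rewrite /Defs.cosh; apply: is_derive_eq.
by rewrite !scaler0 add0r /sinh mulrN1 /GRing.scale/= mulrC.
Qed.

(** Geodesic polar coordinates at i, with q.2 the distance from i. They come from the point (cosh r,
    sinh r sin th, sinh r cos th) of the hyperboloid, where 1/y is the first minus the third
    coordinate and x/y the second. *)
Definition ell_polar q : R * R :=
 let d := (cosh q.2 - sinh q.2 * cos q.1)%R in (sinh q.2 * sin q.1 / d, d^-1)%R.
Definition ell_polar_jac q : R :=
 if (- (pi / 2) <= q.1 < 3 * (pi / 2))%R && (0 < q.2)%R then sinh q.2 else 0%R.

Lemma measurable_ell_polar : mfunT ell_polar.
Proof.
have ms := measurable_sinh; have mc := measurable_cosh.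
by rewrite /ell_polar; meas.
Qed.

Lemma measurable_ell_polar_jac : mfunT ell_polar_jac.
Proof.
have ms := measurable_sinh; have mc := measurable_cosh.
by rewrite /ell_polar_jac; meas.
Qed.

Lemma ell_polar_jac_ge0 p : (0 <= ell_polar_jac p)%R.
Proof. by rewrite /ell_polar_jac; case: ifP=> // /andP[_ r0]; rewrite ltW// sinh_gt0. Qed.

(** Inverse of the chart X1 = x/y, X2 = (x^2 + y^2 - 1)/(2y) of the hyperboloid model, with X0 =
    sqrt(1 + X1^2 + X2^2) and 1/y = X0 - X2. The invariant area is dX1 dX2 / X0, and geodesic polar
    coordinates at i become Euclidean ones of radius sinh r. *)
Definition hyperboloid (p : R * R) : R * R :=
 let y := (Num.sqrt (1 + p.1 ^+ 2 + p.2 ^+ 2) - p.2)^-1%R in (p.1 * y, y)%R.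

Lemma measurable_hyperboloid : mfunT hyperboloid.
Proof. by rewrite /hyperboloid; meas. Qed.

Lemma ge0_integral_hyperboloid g : mfunT g -> (forall p, 0 <= g p) ->
 \int[mu \x mu]_p (g p * (hdens p)%:E) =
 \int[mu \x mu]_p (g (hyperboloid p) * (Num.sqrt (1 + p.1 ^+ 2 + p.2 ^+ 2))^-1%R%:E).
Proof.
move=> mg g0; have md := @measurable_hdens R; have mH := measurable_hyperboloid.
pose w q : R := (if 0 < q.2 then q.2^-1 else 0)%R.
pose T q := (q.1 * q.2, q.2)%R.
pose gw q := g (T q) * (w q)%:E.
have mgw : mfunT gw by rewrite /gw /T /w; meas.
have gw0 q : 0 <= gw q by rewrite mule_ge0// lee_fin /w; case: ifP=> // y0; rewrite invr_ge0 ltW.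
have mgd : mfunT (fun p => g p * (hdens p)%:E) by meas.
have gd0 p : 0 <= g p * (hdens p)%:E by rewrite mule_ge0// lee_fin hdens_ge0.
pose gh p := g (hyperboloid p) * (Num.sqrt (1 + p.1 ^+ 2 + p.2 ^+ 2))^-1%R%:E.
have mgh : mfunT gh by rewrite /gh; meas.
have gh0 p : 0 <= gh p by rewrite mule_ge0// lee_fin invr_ge0 sqrtr_ge0.
rewrite (ge0_plane_swap mgd gd0).
transitivity (\int[mu]_y \int[mu]_x gw (x, y)).
 apply: eq_integral=> y _; have [y0|y0] := ltP 0%R y; last first.
  under eq_integral do rewrite /hdens/= ltNge y0 mule0.
  by under [RHS]eq_integral do rewrite /gw/w/= ltNge y0 mule0.
 rewrite (@ge0_integral_scale R y)//; last exact: (measurable_sectr y mgd).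
 apply: eq_integral=> x _; rewrite -muleA -EFinM /gw /T /hdens /w /= y0 mulrC.
 by congr (_ * _%:E); field; rewrite gt_eqF.
rewrite -(ge0_plane_swap mgw gw0) (ge0_plane_iter mgw gw0) (ge0_plane_iter mgh gh0).
apply: eq_integral=> x _.
(* Here [x] already stands for X1, and [F] is X2 as a function of y, with inverse [G]. *)
pose F (y : R) := (((x ^+ 2 + 1) * y - y^-1) / 2)%R.
pose F' (y : R) := ((x ^+ 2 + 1 + y ^- 2) / 2)%R.
pose s (q : R) := Num.sqrt (1 + x ^+ 2 + q ^+ 2)%R.
have arg_gt0 (q : R) : (0 < 1 + x ^+ 2 + q ^+ 2)%R.
 by rewrite -addrA ltr_wpDr// addr_ge0 ?sqr_ge0.
have s2 (q : R) : (s q ^+ 2 = 1 + x ^+ 2 + q ^+ 2)%R by rewrite sqr_sqrtr// ltW.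
have sq (q : R) : (0 < s q - q)%R.
 rewrite subr_gt0; apply: le_lt_trans (ler_norm _) _.
 rewrite -sqrtr_sqr ltr_sqrt// ltrDr; have := sqr_ge0 x; lra.
pose G (q : R) := (s q - q)^-1%R.
have s0 (q : R) : (0 < s q)%R by rewrite sqrtr_gt0.
have xp : (0 < x ^+ 2 + 1)%R by apply: ltr_wpDl => //; exact: sqr_ge0.
have e1 (q : R) : ((x ^+ 2 + 1) = (s q - q) * (s q + q))%R.
 by rewrite (_ : _ * _ = s q ^+ 2 - q ^+ 2)%R; [rewrite s2; ring|ring].
rewrite [RHS](@ge0_substitution_ind R (fun y => 0 < y)%R F F' G _ _ _ _ _ _ _ _ (fun q : R => gh (x, q))).
- apply: eq_integral=> y _; rewrite /gw /w /=; case: ifPn => y0; last by rewrite !mule0.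
 have sF : s (F y) = (((x ^+ 2 + 1) * y + y^-1) / 2)%R.
  rewrite /s (_ : 1 + _ + _ = (((x ^+ 2 + 1) * y + y^-1) / 2) ^+ 2)%R.
   by rewrite sqrtr_sqr ger0_norm// divr_ge0// addr_ge0 ?invr_ge0 ?mulr_ge0 ?(ltW xp) ?(ltW y0).
  by rewrite /F; field; rewrite gt_eqF.
 have yE : ((s (F y) - F y)^-1 = y)%R.
  rewrite (_ : s (F y) - F y = y^-1)%R ?invrK// sF /F; field.
  by rewrite gt_eqF.
 rewrite /gh -muleA -EFinM /hyperboloid /= -/(s (F y)) yE /T /=; congr (_ * _%:E).
 rewrite sF /F'; field; rewrite !gt_eqF//.
 by apply: ltr_wpDl => //; rewrite !mulr_ge0// ?(ltW y0)// ltW.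
- exact: open_gt.
- by move=> y a b a0 _ /andP[ab _]; exact: lt_le_trans ab.
- by move=> q; rewrite /G invr_gt0.
- move=> q; rewrite /F /G invrK (e1 q); field; rewrite gt_eqF//.
- move=> y y0; have yn0 : y != 0%R by rewrite gt_eqF.
 have dV : is_derive y 1%R (fun y : R => y^-1)%R (- y ^- 2 *: 1)%R by apply: is_deriveV.
 apply: is_derive_eq; rewrite /F' /GRing.scale/=.
 by field.
- move=> y y0; apply: cvgM; last exact: cvg_cst.
 apply: cvgD; first exact: cvg_cst.
 apply: cvgV; first by rewrite expf_neq0// gt_eqF.
 exact: exprn_continuous.
- by move=> y y0; rewrite /F' divr_ge0// !addr_ge0 ?sqr_ge0// invr_ge0 sqr_ge0.
- move=> y z y0 z0 yz; rewrite /F ltr_pM2r// ltrB//.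
  by rewrite ltr_pM2l.
 by rewrite ltf_pV2.
- exact: (measurable_sectl x mgh).
- by move=> q; exact: gh0.
Qed.

Lemma ge0_integral_sinh (g : R -> \bar R) : mfunT g ->
 (forall x, 0 <= g x) ->
 \int[mu]_t g t =
 \int[mu]_r (g (ln (sinh r)) * (if 0 < r then cosh r / sinh r else 0)%R%:E).
Proof.
move=> mg g0.
have cs y : {for y, continuous (@Defs.sinh R)}.
 by have [dx _] := is_derive_sinh y; exact/differentiable_continuous/derivable1_diffP.
have cc y : {for y, continuous (@Defs.cosh R)}.
 by have [dx _] := is_derive_cosh y; exact/differentiable_continuous/derivable1_diffP.
pose A (x : R) := ln (x + Num.sqrt (1 + x ^+ 2))%R.
have sA (x : R) : sinh (A x) = x.
 have s2 : (Num.sqrt (1 + x ^+ 2) ^+ 2 = 1 + x ^+ 2)%R.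
  by rewrite sqr_sqrtr// addr_ge0// sqr_ge0.
 have xs : (`|x| < Num.sqrt (1 + x ^+ 2))%R.
  by rewrite -sqrtr_sqr ltr_sqrt ?ltrDr// ltr_wpDr ?sqr_ge0.
 have x0 : (0 < x + Num.sqrt (1 + x ^+ 2))%R.
  by rewrite -ltrBlDl sub0r; apply: le_lt_trans xs; rewrite -normrN ler_norm.
 rewrite /sinh /A expRN lnK//.
 set q := Num.sqrt _ in s2 x0 *.
 have h : (1 = (x + q) * (q - x))%R.
  by rewrite (_ : _ * _ = q ^+ 2 - x ^+ 2)%R; [rewrite s2; ring|ring].
 have -> : ((x + q)^-1 = q - x)%R.
  by apply: (mulfI (lt0r_neq0 x0)); rewrite -h divff// gt_eqF.
 by field.
apply: (@ge0_substitution_ind R (fun r => 0 < r)%R (fun r => ln (sinh r)) (fun r => cosh r / sinh r)%R (fun t => A (expR t))) => //.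
- by move=> x y z x0 _ /andP[xy _]; exact: lt_le_trans xy.
- move=> t; rewrite ln_gt0// ltr_pwDl ?expR_gt0//.
 by rewrite -[leLHS]sqrtr1 ler_sqrt ?lerDl ?sqr_ge0// addr_ge0 ?sqr_ge0.
- by move=> t; rewrite sA expRK.
- move=> r r0; have s0 := sinh_gt0 r0; have dl := is_derive1_ln s0.
 have ds := is_derive_sinh r.
 by have := is_derive1_comp (f := @ln R) (g := @Defs.sinh R); rewrite mulrC; apply.
- move=> r r0; apply: cvgM; first exact: cc.
 by apply: cvgV; [rewrite gt_eqF// sinh_gt0|exact: cs].
- by move=> r r0; rewrite divr_ge0 ?ltW ?sinh_gt0 ?cosh_gt0.
- move=> x y x0 y0 xy; rewrite ltr_ln ?posrE ?sinh_gt0//.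
 rewrite ltr_pM2r// ltrB ?ltr_expR//.
 by rewrite ltrN2.
Qed.

(** A radial integral in Euclidean polar coordinates with radius sinh r, whose area element is sinh
    r cosh r dr dth. *)
Definition polar_slice (h : R * R -> \bar R) (th : R) : \bar R :=
 \int[mu]_r (h (sinh r * sin th, sinh r * cos th)%R * (if 0 < r then sinh r * cosh r else 0)%R%:E).

Lemma polar_slice_ge0 h th : (forall p, 0 <= h p) -> 0 <= polar_slice h th.
Proof.
move=> h0; apply: integral_ge0 => r _; rewrite mule_ge0// lee_fin.
by case: ifP=> // r0; rewrite mulr_ge0 ?ltW ?sinh_gt0 ?cosh_gt0.
Qed.

Lemma measurable_polar_slice h : mfunT h -> (forall p, 0 <= h p) ->
 mfunT (polar_slice h).
Proof.
move=> mh h0; have ms := measurable_sinh; have mc := measurable_cosh.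
apply: (@measurable_fun_fubini_tonelli_F _ _ _ _ _ mu (fun p : R * R => h (sinh p.2 * sin p.1, sinh p.2 * cos p.1)%R *
 (if 0 < p.2 then sinh p.2 * cosh p.2 else 0)%R%:E)); first by meas.
move=> p; rewrite mule_ge0// lee_fin.
by case: ifP=> // r0; rewrite mulr_ge0 ?ltW ?sinh_gt0 ?cosh_gt0.
Qed.

(** The log-polar formula for dx dy / y^2, applied to h y^2, is the Euclidean polar formula on the
    half plane. *)
Lemma ge0_integral_upper_polar h : mfunT h -> (forall p, 0 <= h p) ->
 \int[mu \x mu]_p (h p * (if 0 < p.2 then 1 else 0)%R%:E) =
 \int[mu]_th (polar_slice h th * (if in_pihalf th then 1 else 0)%R%:E).
Proof.
move=> mh h0; have mp := @measurable_hyp_polar R; have mj := @measurable_hpolar_jac R.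
have mg : mfunT (fun p : R * R => h p * (p.2 ^+ 2)%:E) by meas.
have g0 p : 0 <= h p * (p.2 ^+ 2)%:E by rewrite mule_ge0// lee_fin sqr_ge0.
transitivity (\int[mu \x mu]_p (h p * (p.2 ^+ 2)%:E * (hdens p)%:E)).
 apply: eq_integral=> p _; rewrite -muleA -EFinM; congr (_ * _%:E).
 by rewrite /hdens; case: ifP=> y0; rewrite ?mulr0// divff// expf_neq0// gt_eqF.
rewrite (ge0_integral_hyp_polar mg g0).
pose gj q := h (hyp_polar q) * ((hyp_polar q).2 ^+ 2)%:E * (hpolar_jac q)%:E.
have mgj : mfunT gj by rewrite /gj; meas.
have gj0 q : 0 <= gj q by rewrite mule_ge0// lee_fin hpolar_jac_ge0.
rewrite (ge0_plane_swap mgj gj0); apply: eq_integral=> th _; rewrite /gj /hpolar_jac /=.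
case: ifPn => hth; last by under eq_integral do rewrite mule0; rewrite integral0 mule0.
rewrite mule1 ge0_integral_sinh; last 2 first.
- by have := measurable_sectr th mgj; rewrite /gj /hpolar_jac /= hth.
- by move=> t; have := gj0 (t, th); rewrite /gj /hpolar_jac /= hth.
apply: eq_integral=> r _; case: ifPn => r0; last by rewrite !mule0.
rewrite /hyp_polar /= lnK ?posrE ?sinh_gt0// -!muleA -!EFinM; congr (_ * _%:E).
by field; rewrite !gt_eqF ?sinh_gt0 ?cos_gt0_pihalf.
Qed.

Lemma ge0_integral_opp2 g : mfunT g -> (forall p, 0 <= g p) ->
 \int[mu \x mu]_p g p = \int[mu \x mu]_p g (- p.1, - p.2)%R.
Proof.
move=> mg g0; have mo : mfunT (fun p : R * R => g (- p.1, - p.2)%R) by meas.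
rewrite (ge0_plane_iter mg g0) (ge0_plane_iter mo (fun p => g0 _)) ge0_integral_opp; last 2 first.
- exact: (@measurable_fun_fubini_tonelli_F _ _ _ _ _ mu g mg g0).
- by move=> x; apply: integral_ge0.
by apply: eq_integral=> x _; rewrite ge0_integral_opp//; exact: measurable_sectl.
Qed.

(** The reflection p -> -p maps the lower half plane to the upper one and shifts the angle by pi.
    The real axis and the boundary directions are null sets. *)
Lemma ge0_integral_polar h : mfunT h -> (forall p, 0 <= h p) ->
 \int[mu \x mu]_p h p =
 \int[mu]_th (polar_slice h th * (if - (pi / 2) <= th < 3 * (pi / 2) then 1 else 0)%R%:E).
Proof.
move=> mh h0; have mi := @measurable_in_pihalf R.
pose up (p : R * R) : R := (if 0 < p.2 then 1 else 0)%R.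
pose op (p : R * R) := (- p.1, - p.2)%R.
have mop : mfunT op by rewrite /op; meas.
have mhu : mfunT (fun p => h p * (up p)%:E) by rewrite /up; meas.
have mho : mfunT (fun p => h p * (up (op p))%:E) by rewrite /up; meas.
have up0 p : (0 <= up p)%R by rewrite /up; case: ifP.
have hu0 p : 0 <= h p * (up p)%:E by rewrite mule_ge0// lee_fin.
have ho0 p : 0 <= h p * (up (op p))%:E by rewrite mule_ge0// lee_fin.
transitivity (\int[mu \x mu]_p (h p * (up p)%:E + h p * (up (op p))%:E)).
 have ms := emeasurable_funD mhu mho.
 have s0 p : 0 <= h p * (up p)%:E + h p * (up (op p))%:E by rewrite adde_ge0.
 rewrite (ge0_plane_iter mh h0) (ge0_plane_iter ms s0).
 apply: eq_integral=> x _; apply: (@ge0_integral_eq_off 0%R 0%R) => //.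
 - exact: measurable_sectl.
 - exact: (measurable_sectl x ms).
 - move=> y /eqP y0 _; rewrite /up /op /= oppr_gt0.
  by case: ltrgt0P y0 => // _ _; rewrite mule1 mule0 ?adde0 ?add0e.
rewrite ge0_integralD//.
have mK := measurable_polar_slice mh h0; have K0 th := polar_slice_ge0 th h0.
pose i1 (th : R) : R := (if in_pihalf th then 1 else 0)%R.
have i0 th : (0 <= i1 th)%R by rewrite /i1; case: ifP.
have mi1 : mfunT i1 by rewrite /i1; meas.
have -> : \int[mu \x mu]_p (h p * (up (op p))%:E) = \int[mu]_th (polar_slice h th * (i1 (th - pi))%:E).
 rewrite (ge0_integral_opp2 mho ho0).
 under eq_integral do rewrite [op _]/op /= !opprK -surjective_pairing.
 rewrite (ge0_integral_upper_polar (h := fun p => h (op p)))//; last exact: measurableT_comp.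
 rewrite [RHS](@ge0_integral_shift R pi); [|by meas|by move=> th; rewrite mule_ge0// lee_fin].
 apply: eq_integral=> th _; rewrite addrK; congr (_ * _).
 by apply: eq_integral=> r _; rewrite /op /= sinDpi cosDpi !mulrN.
rewrite ge0_integral_upper_polar// -ge0_integralD//; first last.
- by meas.
- by move=> th _; rewrite mule_ge0// lee_fin.
- by meas.
- by move=> th _; rewrite mule_ge0// lee_fin; exact: i0.
have mi3 : mfunT (fun th : R => if - (pi / 2) <= th < 3 * (pi / 2) then 1 else 0 : R)%R by meas.
apply: (@ge0_integral_eq_off (- (pi / 2))%R (pi / 2)%R).
- by meas.
- by apply: emeasurable_funM => //; apply/measurable_EFinP.
- by move=> th; rewrite adde_ge0// mule_ge0// lee_fin; exact: i0.
- by move=> th; rewrite mule_ge0// lee_fin; case: ifP.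
move=> th /eqP th1 /eqP th2; rewrite -ge0_muleDr ?lee_fin//; last exact: i0.
congr (_ * _); rewrite -EFinD; congr _%:E; rewrite /i1 /in_pihalf.
have p0 := pi_gt0 R.
have bE (b c : bool) : b = c -> (if b then 1 else 0)%R = (if c then 1 else 0)%R :> R by move=> ->.
have [a1|a1] := leP th (- (pi / 2))%R.
 have a2 : (th < - (pi / 2))%R by rewrite lt_neqAle th1.
 rewrite /= add0r [in RHS]leNgt a2 /=; apply: (bE _ false).
 by apply/negbTE/negP=> /andP[]; lra.
rewrite (ltW a1) /=; have [a2|a2] := ltP th (pi / 2)%R.
 rewrite (bE (_ < th - pi < _)%R false) ?addr0; first by rewrite (_ : (th < _)%R = true)//; lra.
 by apply/negbTE/negP=> /andP[]; lra.
have a3 : (pi / 2 < th)%R by rewrite lt_neqAle eq_sym th2.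
by rewrite add0r; apply: bE; apply/idP/idP=> [/andP[]|] ?; [lra|apply/andP; split; lra].
Qed.

Lemma ge0_integral_ell_polar g : mfunT g -> (forall p, 0 <= g p) ->
 \int[mu \x mu]_p (g p * (hdens p)%:E) =
 \int[mu \x mu]_q (g (ell_polar q) * (ell_polar_jac q)%:E).
Proof.
move=> mg g0; rewrite (ge0_integral_hyperboloid mg g0); have mH := measurable_hyperboloid.
have mp := measurable_ell_polar; have mj := measurable_ell_polar_jac.
rewrite ge0_integral_polar; [|by meas|by move=> p; rewrite mule_ge0// lee_fin invr_ge0 sqrtr_ge0].
rewrite ge0_plane_iter; [|by meas|by move=> p; rewrite mule_ge0// lee_fin ell_polar_jac_ge0].
apply: eq_integral=> th _; rewrite /ell_polar_jac /=.
case: ifPn => _; last by under [RHS]eq_integral do rewrite mule0; rewrite integral0 mule0.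
rewrite mule1; apply: eq_integral=> r _; case: ifPn => r0 /=; last by rewrite !mule0.
have sE : Num.sqrt (1 + (sinh r * sin th) ^+ 2 + (sinh r * cos th) ^+ 2)%R = cosh r.
 rewrite (_ : 1 + _ + _ = cosh r ^+ 2)%R; first by rewrite sqrtr_sqr gtr0_norm// cosh_gt0.
 have -> (a b c : R) : (1 + (a * b) ^+ 2 + (a * c) ^+ 2 = 1 + a ^+ 2 * (c ^+ 2 + b ^+ 2))%R by ring.
 by rewrite cos2Dsin2 mulr1 -(cosh2_sinh2 r) subrK.
rewrite sE -muleA -EFinM /hyperboloid /= sE /ell_polar /=; congr (_ * _%:E).
by field; rewrite gt_eqF// cosh_gt0.
Qed.

End plane_maps.

Section moebius_invariance.
Local Open Scope ereal_scope.
Context (R : realType).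
Local Notation mu := (@lebesgue_measure R).

Definition preserves_hyp (T : R * R -> R * R) : Prop :=
 mfunT T /\
 forall g : R * R -> \bar R, mfunT g -> (forall p, 0 <= g p) ->
  \int[mu \x mu]_p (g p * (hdens p)%:E) =
  \int[mu \x mu]_p (g (T p) * (hdens p)%:E).

Lemma preserves_hyp_comp T T' : preserves_hyp T -> preserves_hyp T' ->
 preserves_hyp (T \o T').
Proof.
move=> [mT HT] [mT' HT']; split; first exact: measurableT_comp.
move=> g mg g0; rewrite (HT g mg g0) (HT' (g \o T))//; last by move=> p; exact: g0.
exact: measurableT_comp.
Qed.

Lemma preserves_hyp_eq (T T' : R * R -> R * R) : mfunT T' ->
 (forall p, (0 < p.2)%R -> T p = T' p) -> preserves_hyp T -> preserves_hyp T'.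
Proof.
move=> mT' e [mT HT]; split=> // g mg g0; rewrite (HT g mg g0).
apply: eq_integral=> p _; rewrite /hdens; case: ifPn => [h|]; last by rewrite !mule0.
by rewrite (e _ h).
Qed.

Lemma preserves_hyp_transl (b : R) : preserves_hyp (fun p => (p.1 + b, p.2)%R).
Proof.
have md := @measurable_hdens R.
have mT : mfunT (fun p : R * R => (p.1 + b, p.2)%R) by meas.
split=> // g mg g0.
have mgd : mfunT (fun p => g p * (hdens p)%:E) by meas.
have mgT : mfunT (fun p : R * R => g (p.1 + b, p.2)%R * (hdens p)%:E) by meas.
have d0 p q : 0 <= g p * (hdens q)%:E by rewrite mule_ge0// lee_fin hdens_ge0.
rewrite (ge0_plane_swap mgd (fun _ => d0 _ _)) (ge0_plane_swap mgT (fun _ => d0 _ _)).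
by apply: eq_integral=> y _; rewrite (@ge0_integral_shift R b)//; exact: (measurable_sectr y mgd).
Qed.

(** An isometry that is a measure-preserving map S in log-polar coordinates, compatible with the
    density, needs no further computation. *)
Lemma preserves_hyp_polar (S T : R * R -> R * R) :
 mfunT S -> mfunT T ->
 (forall q, T (hyp_polar q) = hyp_polar (S q)) ->
 (forall q, hpolar_jac (S q) = hpolar_jac q) ->
 (forall g : R * R -> \bar R, mfunT g -> (forall p, 0 <= g p) ->
  \int[mu \x mu]_p g p = \int[mu \x mu]_p g (S p)) -> preserves_hyp T.
Proof.
move=> mS mT eT ej HS; split=> // g mg g0.
rewrite (ge0_integral_hyp_polar mg g0).
rewrite (ge0_integral_hyp_polar (g := g \o T)); [|exact: measurableT_comp|by move=> p; exact: g0].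
rewrite HS.
- by apply: eq_integral=> q _; rewrite /= eT ej.
- by have mp := @measurable_hyp_polar R; have mj := @measurable_hpolar_jac R; meas.
- by move=> p; rewrite mule_ge0// lee_fin hpolar_jac_ge0.
Qed.

Lemma preserves_hyp_scale (c : R) : (0 < c)%R ->
 preserves_hyp (fun p => (c * p.1, c * p.2)%R).
Proof.
move=> c0.
have mS : mfunT (fun p : R * R => (p.1 + ln c, p.2)%R) by meas.
apply: (preserves_hyp_polar (S := fun p => (p.1 + ln c, p.2)%R)) => //.
- by meas.
- move=> q; rewrite /hyp_polar /= expRD lnK//.
 by congr pair; ring.
- move=> g mg g0; have mgS := measurableT_comp mg mS.
 rewrite (ge0_plane_swap mg g0) (ge0_plane_swap mgS (fun p => g0 _)).
 apply: eq_integral=> y _; rewrite (@ge0_integral_shift R (ln c))//.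
 exact: measurable_sectr.
Qed.

(** In log-polar coordinates z -> -1/z is (t, v) -> (-t, -v). *)
Lemma preserves_hyp_inv :
 preserves_hyp (fun p => (- p.1 / (p.1 ^+ 2 + p.2 ^+ 2), p.2 / (p.1 ^+ 2 + p.2 ^+ 2))%R).
Proof.
have mS : mfunT (fun p : R * R => (- p.1, - p.2)%R) by meas.
apply: (preserves_hyp_polar (S := fun p => (- p.1, - p.2)%R)) => //.
- by meas.
- move=> [t th]; rewrite /hyp_polar /=.
 have -> : ((expR t * sin th) ^+ 2 + (expR t * cos th) ^+ 2 = expR t ^+ 2)%R.
  by rewrite !exprMn -mulrDr [X in (_ * X)%R]addrC cos2Dsin2 mulr1.
 have e0 : expR t != 0%R by rewrite gt_eqF// expR_gt0.
 by rewrite expRN sinN cosN; congr pair; field.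
- by move=> [t th]; rewrite /hpolar_jac /in_pihalf /= cosN ltrN2 ltrNl andbC.
- exact: ge0_integral_opp2.
Qed.

Definition moebius_plane (A : SL2 R) (p : R * R) : R * R :=
 (moebius_re A p.1 p.2, moebius_im A p.1 p.2).

Lemma measurable_moebius_plane A : mfunT (moebius_plane A).
Proof. by rewrite /moebius_plane /moebius_re /moebius_im /mdenom; meas. Qed.

Local Close Scope ereal_scope.

Lemma preserves_hyp_moebius A : preserves_hyp (moebius_plane A).
Proof.
have dA := SL2_detE A; have mA := measurable_moebius_plane A.
have [c0|c0] := eqVneq (A 1 0) 0%R.
 have ad : (A 0 0 * A 1 1 = 1)%R by rewrite -dA c0 mulr0 subr0.
 have a0 : A 0 0 != 0%R.
  by apply/eqP=> a0; move: ad; rewrite a0 mul0r => /eqP; rewrite eq_sym oner_eq0.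
 have d0 : A 1 1 != 0%R.
  by apply/eqP=> a0'; move: ad; rewrite a0' mulr0 => /eqP; rewrite eq_sym oner_eq0.
 have e : (A 1 1 = (A 0 0)^-1)%R by apply: (mulfI a0); rewrite ad divff.
 apply: (preserves_hyp_eq (T := (fun p => (p.1 + A 0 0 * A 0 1, p.2)%R) \o (fun p => (A 0 0 ^+ 2 * p.1, A 0 0 ^+ 2 * p.2)%R))) => //.
  move=> -[x y] /= y0; rewrite /moebius_plane /moebius_re /moebius_im /mdenom /= c0 e.
  by congr pair; field.
 apply: preserves_hyp_comp; first exact: preserves_hyp_transl.
 by apply: preserves_hyp_scale; rewrite exprn_even_gt0.
have c2 : (0 < A 1 0 ^+ 2)%R by rewrite exprn_even_gt0.
(* Bruhat decomposition: the map is z -> a/c - 1/(c^2 (z + d/c)). *)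
apply: (preserves_hyp_eq (T := (fun p => (p.1 + A 0 0 / A 1 0, p.2)%R) \o
 ((fun p => (- p.1 / (p.1 ^+ 2 + p.2 ^+ 2), p.2 / (p.1 ^+ 2 + p.2 ^+ 2))%R) \o
 ((fun p => (A 1 0 ^+ 2 * p.1, A 1 0 ^+ 2 * p.2)%R) \o
  (fun p => (p.1 + A 1 1 / A 1 0, p.2)%R))))) => //; last first.
 apply: preserves_hyp_comp; first exact: preserves_hyp_transl.
 apply: preserves_hyp_comp; first exact: preserves_hyp_inv.
 apply: preserves_hyp_comp; first exact: preserves_hyp_scale.
 exact: preserves_hyp_transl.
move=> -[x y] /= y0; rewrite /moebius_plane /=.
have m0 := mdenom_gt0 A x y0.
have bE : (A 0 1 = (A 0 0 * A 1 1 - 1) / A 1 0)%R.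
 by rewrite -[X in (_ - X)%R]dA; field.
have dn : (mdenom A x y != 0)%R by rewrite gt_eqF.
have e : ((A 1 0 ^+ 2 * (x + A 1 1 / A 1 0)) ^+ 2 + (A 1 0 ^+ 2 * y) ^+ 2 =
  A 1 0 ^+ 2 * mdenom A x y)%R.
 by rewrite /mdenom; field.
rewrite e; congr pair; last by rewrite /moebius_im; field; rewrite dn.
rewrite /moebius_re bE; move: dn; rewrite /mdenom => dn; field.
by rewrite dn.
Qed.

End moebius_invariance.

(** * The defining equations of f and g *)

Section linear_ode.
Variable R : realType.
Implicit Types (t r : R).

Lemma is_derive_within_continuous (f df : R -> R) (a b : R) :
 (forall x : R, x \in `[a, b] -> is_derive x 1 f (df x)) -> {within `[a, b], continuous f}.
Proof.
move=> h; apply: continuous_in_subspaceT => x; rewrite inE /= => /h[dx _].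
exact/differentiable_continuous/derivable1_diffP.
Qed.

Lemma MVT_is_derive (f df : R -> R) (a b : R) : a <= b ->
 (forall x : R, a <= x <= b -> is_derive x 1 f (df x)) ->
 exists2 c, a <= c <= b & f b - f a = df c * (b - a).
Proof.
rewrite le_eqVlt => /predU1P[-> _|ab h].
 by exists b; rewrite ?lexx// !subrr mulr0.
have [c] := @MVT R f df a b ab (fun x hx => h x (ltac:(by move: hx; rewrite in_itv/= => /andP[x1 x2]; rewrite !ltW)))
 (@is_derive_within_continuous f df a b (fun x hx => h x (ltac:(by move: hx; rewrite in_itv/=)))).
by rewrite in_itv/= => /andP[c1 c2] e; exists c; rewrite // !ltW.
Qed.

Lemma abs_derive_bound (f df : R -> R) (a b K : R) : a <= b ->
 (forall x : R, a <= x <= b -> is_derive x 1 f (df x)) ->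
 (forall x, a <= x <= b -> `|df x| <= K) ->
 `|f b - f a| <= K * (b - a).
Proof.
move=> ab h hK; have [c hc ->] := MVT_is_derive ab h.
by rewrite normrM (ger0_norm (_ : 0 <= b - a)) ?subr_ge0// ler_wpM2r ?subr_ge0// hK.
Qed.

(** H times e^(-Lt) decreases to the right of t0, and H times e^(Lt) increases towards t0 from the
    left; as H is nonnegative and vanishes at t0, it vanishes at t1. *)
Lemma gronwall_zero (H dH : R -> R) (I : set R) (t0 t1 L : R) :
 (forall t, Num.min t0 t1 <= t <= Num.max t0 t1 -> I t) ->
 (forall t, I t -> is_derive t 1 H (dH t)) ->
 (forall t, I t -> 0 <= H t) ->
 (forall t, Num.min t0 t1 <= t <= Num.max t0 t1 -> `|dH t| <= L * H t) ->
 H t0 = 0 -> H t1 = 0.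
Proof.
move=> hI dHt H0 hL Ht0.
have key (e : R) : e = 1 \/ e = -1 ->
  forall x, I x -> is_derive x 1 (fun t => H t * expR (e * L * t))
   (expR (e * L * x) * (dH x + e * L * H x)).
 move=> _ x Ix; have dHx := dHt _ Ix.
 have de : is_derive x 1 (fun t => expR (e * L * t)) (e * L * expR (e * L * x)).
  have d1 : is_derive x 1 (fun t => e * L * t) (e * L).
   by apply: is_derive_eq; rewrite /GRing.scale/= mulr1.
  have := @is_derive1_comp R expR (fun t => e * L * t) x _ _ (is_derive_expR _) d1.
  by rewrite [_ * (e * L)]mulrC.
 by apply: is_derive_eq; rewrite /GRing.scale/=; ring.
have [le01|lt10] := leP t0 t1.
 move: hI hL; rewrite (min_idPl le01) (max_idPr le01) => hI hL.
 have [c hc] := MVT_is_derive le01 (fun x hx => key (-1) (or_intror erefl) x (hI x hx)).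
 rewrite Ht0 mul0r subr0 => e.
 have : H t1 * expR (-1 * L * t1) <= 0.
  rewrite e mulr_le0_ge0 ?subr_ge0// pmulr_rle0 ?expR_gt0//.
  have := hL _ hc; rewrite ler_norml => /andP[_]; lra.
 rewrite pmulr_lle0 ?expR_gt0// => h; apply/eqP; rewrite eq_le h H0//.
 by apply: hI; rewrite le01 lexx.
move: hI hL; rewrite (min_idPr (ltW lt10)) (max_idPl (ltW lt10)) => hI hL.
have [c hc] := MVT_is_derive (ltW lt10) (fun x hx => key 1 (or_introl erefl) x (hI x hx)).
rewrite Ht0 mul0r sub0r => e.
have : H t1 * expR (1 * L * t1) <= 0.
 rewrite -oppr_ge0 e mulr_ge0 ?subr_ge0 ?(ltW lt10)// pmulr_rge0 ?expR_gt0//.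
 have := hL _ hc; rewrite ler_norml => /andP[+ _]; lra.
rewrite pmulr_lle0 ?expR_gt0// => h; apply/eqP; rewrite eq_le h H0//.
by apply: hI; rewrite (ltW lt10) lexx.
Qed.

(** Real form of D'' = c D - q D' with D = D1 + i D2 and c = c1 + i c2. The energy |D|^2 + |D'|^2
    satisfies |H'| <= (2 + 6K) H, because |xy| <= (x^2 + y^2)/2. *)
Lemma linear_ode_unique (D1 D2 E1 E2 q c1 c2 : R -> R) (I : set R) (t0 t1 K : R) :
 (forall t, Num.min t0 t1 <= t <= Num.max t0 t1 -> I t) ->
 (forall t, I t -> is_derive t 1 D1 (E1 t)) ->
 (forall t, I t -> is_derive t 1 D2 (E2 t)) ->
 (forall t, I t -> is_derive t 1 E1 (c1 t * D1 t - c2 t * D2 t - q t * E1 t)) ->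
 (forall t, I t -> is_derive t 1 E2 (c2 t * D1 t + c1 t * D2 t - q t * E2 t)) ->
 (forall t, Num.min t0 t1 <= t <= Num.max t0 t1 ->
  [/\ `|q t| <= K, `|c1 t| <= K & `|c2 t| <= K]) ->
 [/\ D1 t0 = 0, D2 t0 = 0, E1 t0 = 0 & E2 t0 = 0] ->
 D1 t1 = 0 /\ D2 t1 = 0.
Proof.
move=> hI d1 d2 e1 e2 hK [D10 D20 E10 E20].
pose H t := D1 t ^+ 2 + D2 t ^+ 2 + E1 t ^+ 2 + E2 t ^+ 2.
pose dH t := 2 * (D1 t * E1 t + D2 t * E2 t + E1 t * (c1 t * D1 t - c2 t * D2 t - q t * E1 t) +
  E2 t * (c2 t * D1 t + c1 t * D2 t - q t * E2 t)).
have dHt t : I t -> is_derive t 1 H (dH t).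
 move=> It; have := d1 _ It; have := d2 _ It; have := e1 _ It; have := e2 _ It => ? ? ? ?.
 by rewrite /H; apply: is_derive_eq; rewrite /dH /GRing.scale/= ?expr1; ring.
have H0 t : I t -> 0 <= H t by move=> _; rewrite !addr_ge0 ?sqr_ge0.
have : H t1 = 0.
 apply: (@gronwall_zero H dH I t0 t1 (2 + 6 * K)) => //; last first.
  by rewrite /H D10 D20 E10 E20 expr0n !addr0.
 move=> t /hK[hq h1 h2].
 have am (x y : R) : `|x * y| <= (x ^+ 2 + y ^+ 2) / 2.
  rewrite ler_norml; apply/andP; split; have := sqr_ge0 (x + y); have := sqr_ge0 (x - y); nra.
 have K0 : 0 <= K by exact: le_trans hq.
 have amK (c x y : R) : `|c| <= K -> `|c * (x * y)| <= K * ((x ^+ 2 + y ^+ 2) / 2).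
  by move=> hc; rewrite normrM ler_pM.
 rewrite /dH normrM (ger0_norm (ler0n _ 2)).
 have -> : D1 t * E1 t + D2 t * E2 t + E1 t * (c1 t * D1 t - c2 t * D2 t - q t * E1 t) +
   E2 t * (c2 t * D1 t + c1 t * D2 t - q t * E2 t) =
   D1 t * E1 t + D2 t * E2 t + c1 t * (E1 t * D1 t) - c2 t * (E1 t * D2 t) - q t * (E1 t * E1 t)
   + c2 t * (E2 t * D1 t) + c1 t * (E2 t * D2 t) - q t * (E2 t * E2 t) by ring.
 have k1 := mulr_ge0 K0 (sqr_ge0 (D1 t)); have k2 := mulr_ge0 K0 (sqr_ge0 (D2 t)).
 move: (am (D1 t) (E1 t)) (am (D2 t) (E2 t)) (amK _ (E1 t) (D1 t) h1)
  (amK _ (E1 t) (D2 t) h2) (amK _ (E1 t) (E1 t) hq) (amK _ (E2 t) (D1 t) h2)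
  (amK _ (E2 t) (D2 t) h1) (amK _ (E2 t) (E2 t) hq) k1 k2.
 have := mulr_ge0 K0 (sqr_ge0 (E1 t)); have := mulr_ge0 K0 (sqr_ge0 (E2 t)).
 rewrite /H; move: (sqr_ge0 (D1 t)) (sqr_ge0 (D2 t)) (sqr_ge0 (E1 t)) (sqr_ge0 (E2 t)).
 move: (D1 t * E1 t) (D2 t * E2 t) (c1 t * _) (c2 t * (E1 t * D2 t)) (q t * (E1 t * E1 t))
  (c2 t * _) (c1 t * (E2 t * D2 t)) (q t * _) => x1 x2 x3 x4 x5 x6 x7 x8.
 move: (D1 t ^+ 2) (D2 t ^+ 2) (E1 t ^+ 2) (E2 t ^+ 2) => X Y Z W.
 rewrite !ler_norml => X0 Y0 Z0 W0 k3 k4.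
 move=> /andP[a1 b1] /andP[a2 b2] /andP[a3 b3] /andP[a4 b4] /andP[a5 b5] /andP[a6 b6] /andP[a7 b7] /andP[a8 b8] k1 k2.
 rewrite -ler_pdivlMl// ler_norml.
 by clear -X0 Y0 Z0 W0 k1 k2 k3 k4 a1 b1 a2 b2 a3 b3 a4 b4 a5 b5 a6 b6 a7 b7 a8 b8; apply/andP; split; lra.
move=> /eqP; rewrite /H !paddr_eq0 ?addr_ge0 ?sqr_ge0// !sqrf_eq0.
by move=> /andP[/andP[/andP[/eqP-> /eqP->]]].
Qed.

Lemma sinh_homo (r r' : R) : r <= r' -> sinh r <= sinh r'.
Proof.
move=> rr'; have [c hc] := MVT_is_derive rr' (fun x _ => is_derive_sinh x).
by move=> h; rewrite -subr_ge0 h mulr_ge0 ?subr_ge0// ltW// cosh_gt0.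
Qed.

(* [p] stays away from 0 near 0 only if [D] has a logarithmic singularity there. *)
Lemma no_log_singularity (D p dp : R -> R) (r0 K B : R) : 0 < r0 -> r0 <= 1 ->
 (forall r, 0 < r <= r0 -> is_derive r 1 D (p r / sinh r)) ->
 (forall r, 0 < r <= r0 -> is_derive r 1 p (dp r)) ->
 (forall r, 0 < r <= r0 -> `|dp r| <= K) ->
 (forall r, 0 < r <= r0 -> `|D r| <= B) ->
 p r0 <= K * r0.
Proof.
move=> r00 r01 dD dpp hK hB; rewrite leNgt; apply/negP=> hp.
pose eta := p r0 - K * r0.
have eta0 : 0 < eta by rewrite subr_gt0.
have K0 : 0 <= K by apply: le_trans (hK r0 _); rewrite ?r00 ?lexx.
have pe s : 0 < s <= r0 -> eta <= p s.
 move=> /andP[s0 sr]; have sub x : s <= x <= r0 -> 0 < x <= r0.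
  by move=> /andP[sx ->]; rewrite (lt_le_trans s0 sx).
 have := abs_derive_bound sr (fun x hx => dpp x (sub x hx)) (fun x hx => hK x (sub x hx)).
 rewrite ler_norml => /andP[_]; rewrite /eta; nra.
(* The constant 4 bounds [cosh] on [0, 1], where e <= 4 is obtained from e^(1/2) <= 2. *)
have shb s : 0 < s <= r0 -> sinh s <= 4 * s.
 move=> /andP[s0 sr].
 have [c /andP[c0 cs]] := MVT_is_derive (ltW s0) (fun x _ => is_derive_sinh x).
 have -> : sinh 0 = 0 :> R by rewrite /sinh oppr0 subrr mul0r.
 rewrite !subr0 => ->; rewrite ler_pM2r//.
 rewrite /cosh ler_pdivrMr//.
 have c1 : c <= 1 by apply: le_trans cs (le_trans sr r01).
 have e1 : expR c <= expR 1 by rewrite ler_expR.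
 have e2 : expR (- c) <= 1 by rewrite -expR0 ler_expR oppr_le0.
 have e3 : expR 1 <= 4 :> R.
  have h : expR (2^-1) <= 2 :> R.
   have := expR_ge1Dx (- 2^-1 : R); rewrite expRN => h.
   have e0 := expR_gt0 (2^-1 : R).
   have : expR (2^-1) * (expR (2^-1))^-1 = 1 :> R by rewrite divff ?gt_eqF.
   move: h e0; move: (expR _) => y; move: (y^-1) => z; nra.
  have -> : expR 1 = expR (2^-1) * expR (2^-1) :> R by rewrite -expRD; congr expR; lra.
  have := expR_gt0 (2^-1 : R); nra.
 lra.
(* D grows at least like (eta/4) ln r; this choice makes the growth from [s] to [r0] at least 2B +
   1, more than the variation 2B that |D| <= B allows. *)
pose s := r0 * expR (- (4 * (2 * B + 1) / eta)).
have B0 : 0 <= B by apply: le_trans (hB r0 _); rewrite ?r00 ?lexx.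
have s0 : 0 < s by rewrite mulr_gt0// expR_gt0.
have sr : s <= r0.
 rewrite /s -[leRHS]mulr1 ler_pM2l// -[leRHS]expR0 ler_expR oppr_le0.
 by rewrite divr_ge0 ?(ltW eta0)// mulr_ge0// addr_ge0// mulr_ge0.
have sub x : s <= x <= r0 -> 0 < x <= r0.
 by move=> /andP[sx ->]; rewrite (lt_le_trans s0 sx).
pose h r := D r - eta / 4 * ln r.
have dh x : s <= x <= r0 -> is_derive x 1 h (p x / sinh x - eta / 4 * x^-1).
 move=> /sub hx; have ? := dD _ hx.
 have ? : is_derive x 1 (@ln R) x^-1 by apply: is_derive1_ln; case/andP: hx.
 by rewrite /h; apply: is_derive_eq.
have [c hc e] := MVT_is_derive sr dh.
have : 0 <= h r0 - h s.
 rewrite e mulr_ge0 ?subr_ge0//; have hc' := sub _ hc; case/andP: (hc') => c0 _.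
 rewrite [leLHS](_ : _ = (eta / (4 * c))); last by field; rewrite gt_eqF.
 by apply: ler_pM; rewrite ?invr_ge0 ?(ltW eta0) ?mulr_ge0 ?(ltW c0) ?pe ?lef_pV2 ?posrE ?sinh_gt0 ?mulr_gt0 ?shb.
rewrite /h /s lnM ?posrE ?expR_gt0// expRK.
have := hB r0; rewrite r00 lexx => /(_ isT); rewrite ler_norml => /andP[_ b1].
have := hB s; rewrite s0 sr => /(_ isT); rewrite ler_norml => /andP[b2 _].
have -> : D r0 - eta / 4 * ln r0 - (D (r0 * expR (- (4 * (2 * B + 1) / eta))) -
  eta / 4 * (ln r0 - 4 * (2 * B + 1) / eta)) = D r0 - D s - (2 * B + 1).
 by rewrite /s; field; rewrite gt_eqF.
lra.
Qed.

(** The derivative of sinh r D' is sinh r times the zero-order term, of size at most L B. Without a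
    logarithmic singularity sinh r D' starts from 0, so |D'| <= L B r. Integrating from the limit 0
    of D at the origin gives |D| <= L B rho^2 <= B/2. *)
Lemma singular_ode_halving (D1 D2 E1 E2 : R -> R) (l1 l2 rho B : R) :
 0 < rho -> rho <= 1 -> (`|l1| + `|l2|) * rho ^+ 2 <= 2^-1 ->
 (forall r, 0 < r -> is_derive r 1 D1 (E1 r)) ->
 (forall r, 0 < r -> is_derive r 1 D2 (E2 r)) ->
 (forall r, 0 < r -> is_derive r 1 E1 (l1 * D1 r - l2 * D2 r - cosh r / sinh r * E1 r)) ->
 (forall r, 0 < r -> is_derive r 1 E2 (l2 * D1 r + l1 * D2 r - cosh r / sinh r * E2 r)) ->
 D1 r @[r --> 0^'+] --> (0 : R) -> D2 r @[r --> 0^'+] --> (0 : R) ->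
 (forall r, 0 < r <= rho -> `|D1 r| <= B /\ `|D2 r| <= B) ->
 (forall r, 0 < r <= rho -> `|D1 r| <= B / 2 /\ `|D2 r| <= B / 2).
Proof.
move=> rho0 rho1 hl d1 d2 e1 e2 lim1 lim2 hB.
have B0 : 0 <= B.
 by have [] := hB rho; rewrite ?rho0 ?lexx// => + _; apply: le_trans.
set L := `|l1| + `|l2| in hl.
have L0 : 0 <= L by rewrite addr_ge0.
have half (D E X : R -> R) :
  (forall r, 0 < r -> is_derive r 1 D (E r)) ->
  (forall r, 0 < r -> is_derive r 1 E (X r - cosh r / sinh r * E r)) ->
  D r @[r --> 0^'+] --> (0 : R) ->
  (forall r, 0 < r <= rho -> `|X r| <= L * B) ->
  (forall r, 0 < r <= rho -> `|D r| <= B) ->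
  forall r, 0 < r <= rho -> `|D r| <= B / 2.
 move=> dD dE limD hX hD.
 have dp r : 0 < r -> is_derive r 1 (fun r => sinh r * E r) (sinh r * X r).
  move=> r0; have ? := is_derive_sinh r; have ? := dE _ r0.
  apply: is_derive_eq; rewrite /GRing.scale/=; field.
  by rewrite gt_eqF// sinh_gt0.
 have dD' r : 0 < r -> is_derive r 1 D ((sinh r * E r) / sinh r).
  by move=> r0; rewrite mulrAC divff ?mul1r; [exact: dD|rewrite gt_eqF// sinh_gt0].
 have hE r : 0 < r <= rho -> `|E r| <= L * B * r.
  move=> /andP[r0 rr].
  have s0 := sinh_gt0 r0.
  have sub x : 0 < x <= r -> 0 < x <= rho.
   by move=> /andP[-> xr] /=; exact: le_trans rr.
  have hb x : 0 < x <= r -> `|sinh x * X x| <= sinh r * (L * B).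
   move=> hx; have := hX _ (sub _ hx); case/andP: hx => x0 xr hx.
   rewrite normrM ler_pM// ger0_norm ?sinh_homo//; exact/ltW/sinh_gt0.
  have up : sinh r * E r <= sinh r * (L * B) * r.
   apply: (@no_log_singularity D (fun r => sinh r * E r) (fun r => sinh r * X r) r _ B).
   + exact: r0.
   + exact: le_trans rr rho1.
   + by move=> x /andP[x0 _]; exact: dD'.
   + by move=> x /andP[x0 _]; exact: dp.
   + exact: hb.
   + by move=> x /sub; exact: hD.
  have lo : - (sinh r * E r) <= sinh r * (L * B) * r.
   apply: (@no_log_singularity (fun r => - D r) (fun r => - (sinh r * E r)) (fun r => - (sinh r * X r)) r _ B).
   + exact: r0.
   + exact: le_trans rr rho1.
   + by move=> x /andP[x0 _]; have ? := dD' _ x0; rewrite mulNr; apply: is_derive_eq.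
   + by move=> x /andP[x0 _]; have ? := dp _ x0; apply: is_derive_eq.
   + by move=> x hx; rewrite normrN; exact: hb.
   + by move=> x /sub hx; rewrite normrN; exact: hD.
  rewrite -(ler_pM2l s0) -{1}(gtr0_norm s0) -normrM ler_norml mulrA; apply/andP; split; lra.
 move=> r hr; case/andP: (hr) => r0 rr.
 have step s : 0 < s <= r -> `|D r - D s| <= B / 2.
  move=> /andP[s0 sr].
  have sub x : s <= x <= r -> 0 < x by move=> /andP[sx _]; exact: lt_le_trans sx.
  apply: le_trans (@abs_derive_bound D E s r (L * B * rho) sr (fun x hx => dD x (sub x hx)) _) _.
   move=> x hx; have x0 := sub _ hx; case/andP: hx => sx xr.
   apply: le_trans (hE x _) _; first by rewrite x0 (le_trans xr rr).
   by rewrite ler_wpM2l ?mulr_ge0// (le_trans xr rr).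
  apply: le_trans (_ : L * B * rho * rho <= _).
   by rewrite ler_wpM2l ?mulr_ge0 ?(ltW rho0)//; lra.
  have -> : L * B * rho * rho = B * (L * rho ^+ 2) by ring.
  by rewrite ler_wpM2l.
 apply/ler_addgt0Pr => e e0.
 have [s [s0 sr se]] : exists s, [/\ 0 < s, s <= r & `|0 - D s| <= e].
  near (0 : R)^'+ => s; exists s; split; near: s.
  - exact: nbhs_right_gt.
  - by apply: nbhs_right_le.
  - by move/cvgrPdist_le : limD; apply.
 have -> : D r = (D r - D s) - (0 - D s) by ring.
 apply: le_trans (ler_normB _ _) _; apply: lerD => //.
 by apply: step; rewrite s0.
have hX1 r : 0 < r <= rho -> `|l1 * D1 r - l2 * D2 r| <= L * B.
 move=> /hB[b1 b2]; apply: le_trans (ler_normB _ _) _.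
 by rewrite /L mulrDl !normrM; apply: lerD; rewrite ler_wpM2l.
have hX2 r : 0 < r <= rho -> `|l2 * D1 r + l1 * D2 r| <= L * B.
 move=> /hB[b1 b2]; apply: le_trans (ler_normD _ _) _.
 by rewrite /L addrC mulrDl !normrM; apply: lerD; rewrite ler_wpM2l.
move=> r hr; split.
 by apply: (half D1 E1 _ d1 e1 lim1 hX1) => // x /hB[].
by apply: (half D2 E2 _ d2 e2 lim2 hX2) => // x /hB[].
Unshelve. all: by end_near.
Qed.

(** Repeated halving makes D vanish near 0; from [t0] on the equation is regular and the ordinary
    uniqueness theorem takes over. *)
Lemma singular_ode_unique (D1 D2 E1 E2 : R -> R) (l1 l2 : R) :
 (forall r : R, 0 < r -> is_derive r 1 D1 (E1 r)) ->
 (forall r : R, 0 < r -> is_derive r 1 D2 (E2 r)) ->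
 (forall r : R, 0 < r -> is_derive r 1 E1 (l1 * D1 r - l2 * D2 r - cosh r / sinh r * E1 r)) ->
 (forall r : R, 0 < r -> is_derive r 1 E2 (l2 * D1 r + l1 * D2 r - cosh r / sinh r * E2 r)) ->
 D1 r @[r --> 0^'+] --> (0 : R) -> D2 r @[r --> 0^'+] --> (0 : R) ->
 forall r : R, 0 < r -> D1 r = 0 /\ D2 r = 0.
Proof.
move=> d1 d2 e1 e2 lim1 lim2.
pose L := `|l1| + `|l2|.
have L0 : 0 <= L by rewrite addr_ge0.
have [rho [rho0 rho1 hrho hB]] : exists rho, [/\ 0 < rho, rho <= 1, L * rho ^+ 2 <= 2^-1 &
  forall r, 0 < r <= rho -> `|D1 r| <= 1 /\ `|D2 r| <= 1].
 have : \forall r \near (0 : R)^'+, `|0 - D1 r| <= 1 /\ `|0 - D2 r| <= 1.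
  near=> r; split; near: r.
   by move/cvgrPdist_le : lim1; apply.
  by move/cvgrPdist_le : lim2; apply.
 move=> [eps /= eps0 heps].
 (* The first term keeps |D| <= 1, the second keeps the interval in ]0, 1], and the last gives L
    rho^2 <= 1/2. *)
 exists (Num.min (eps / 2) (Num.min 1 (2 * (L + 1))^-1)); split.
 - by rewrite !lt_min divr_gt0// ltr01 invr_gt0 mulr_gt0// ltr_wpDl.
 - by rewrite !ge_min lexx orbT.
 - set rho := Num.min _ _.
  have r0 : 0 < rho by rewrite !lt_min divr_gt0// ltr01 invr_gt0 mulr_gt0// ltr_wpDl.
  have r1 : rho <= 1 by rewrite !ge_min lexx orbT.
  have r2 : rho <= (2 * (L + 1))^-1 by rewrite !ge_min lexx !orbT.
  apply: le_trans (_ : (L + 1) * (2 * (L + 1))^-1 <= _).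
   apply: ler_pM => //; [exact: sqr_ge0|lra|].
   by apply: le_trans r2; rewrite expr2 ler_piMr// ltW.
  by rewrite invfM mulrCA divff ?mulr1// gt_eqF// ltr_wpDl.
 - move=> r /andP[r0]; rewrite le_min => /andP[r1 _].
  have := heps r; rewrite /= sub0r normrN gtr0_norm// !sub0r !normrN.
  by apply => //; lra.
have hn n : forall r, 0 < r <= rho -> `|D1 r| <= 2^-1 ^+ n /\ `|D2 r| <= 2^-1 ^+ n.
 elim: n => [|n IH]; first by rewrite expr0.
 rewrite exprSr; exact: (singular_ode_halving rho0 rho1 hrho d1 d2 e1 e2 lim1 lim2 IH).
have zero x : (forall n, `|x| <= 2^-1 ^+ n) -> x = 0 :> R.
 move=> h; apply/eqP; rewrite -normr_le0; apply/ler_addgt0Pr => e e0; rewrite add0r.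
 have c : (2^-1 : R) ^+ n @[n --> \oo] --> (0 : R).
  by apply: cvg_expr; rewrite ger0_norm ?invr_ge0// invf_lt1// ltr1n.
 move/cvgrPdist_le : c => /(_ _ e0)[N _ /(_ N (leqnn _))].
 rewrite sub0r normrN ger0_norm ?exprn_ge0 ?invr_ge0// => hN.
 exact: le_trans hN.
have z1 r : 0 < r <= rho -> D1 r = 0 by move=> hr; apply: zero => n; have [] := hn n r hr.
have z2 r : 0 < r <= rho -> D2 r = 0 by move=> hr; apply: zero => n; have [] := hn n r hr.
pose t0 := rho / 2.
have t00 : 0 < t0 by rewrite divr_gt0.
have dz (D E : R -> R) : (forall r : R, 0 < r -> is_derive r 1 D (E r)) ->
  (forall r, 0 < r <= rho -> D r = 0) -> E t0 = 0.
 move=> dD zD; have [_ <-] := dD _ t00.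
 have -> : 'D_1 D t0 = 'D_1 (cst 0 : R -> R) t0.
  apply: near_eq_derive.
  near=> x; rewrite zD//.
  have : x \in `]0, rho[.
   near: x; apply: near_in_itvoo.
   by rewrite in_itv /= t00 /t0 ltr_pdivrMr// ltr_pMr// ltr1n.
  by rewrite in_itv /= => /andP[-> /ltW].
 by rewrite derive_cst.
move=> r r0.
have lo t : Num.min t0 r <= t <= Num.max t0 r -> 0 < t.
 by move=> /andP[+ _]; apply: lt_le_trans; rewrite lt_min t00.
pose m := Num.min t0 r.
have m0 : 0 < m by rewrite lt_min t00.
have cont : forall t, Num.min t0 r <= t <= Num.max t0 r -> `|cosh t / sinh t| <= 1 + (sinh m)^-1.
 move=> t ht; have t0' := lo _ ht; have st := sinh_gt0 t0'.
 have sm := sinh_gt0 m0.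
 rewrite ger0_norm; last by apply: divr_ge0; apply: ltW => //; exact: cosh_gt0.
 have hc : cosh t <= sinh t + 1.
  have := cosh2_sinh2 t; have := cosh_gt0 t; nra.
 apply: le_trans (_ : (sinh t + 1) / sinh t <= _); first by rewrite ler_pM2r ?invr_gt0.
 rewrite mulrDl divff ?gt_eqF// mul1r lerD2l lef_pV2 ?posrE// sinh_homo//.
 by case/andP: ht.
apply: (@linear_ode_unique D1 D2 E1 E2 (fun t => cosh t / sinh t) (fun=> l1) (fun=> l2)
 [set t | 0 < t] t0 r (1 + (sinh m)^-1 + L)) => //.
- move=> t ht; have := cont t ht; have sm : 0 < (sinh m)^-1 by rewrite invr_gt0 sinh_gt0.
 have := normr_ge0 l1; have := normr_ge0 l2.
 by rewrite /L; split; lra.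
- split; [| |exact: dz d1 z1|exact: dz d2 z2].
  by apply: z1; rewrite t00 /t0; lra.
 by apply: z2; rewrite t00 /t0; lra.
Unshelve. all: by end_near.
Qed.

End linear_ode.

(** * Compactness and the truncated fundamental domain *)

Section boundedness.
Variables (R : realType) (n : nat).

Lemma rV_coord_le (v : 'rV[R]_n) k : `|v 0 k| <= `|v|.
Proof.
rewrite [leRHS]/Num.norm /= mx_normrE.
exact: (le_bigmax _ (fun i : 'I_1 * 'I_n => `|v i.1 i.2|) (0, k)).
Qed.

Lemma fst_coord_continuous k : continuous (fun p : 'rV[R]_n * 'rV[R]_n => p.1 0 k).
Proof. by move=> p; apply: (continuous_comp (f := fst) (g := fun v : 'rV[R]_n => v 0 k)); [exact: cvg_fst|exact: coord_continuous]. Qed.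

Lemma snd_coord_continuous k : continuous (fun p : 'rV[R]_n * 'rV[R]_n => p.2 0 k).
Proof. by move=> p; apply: (continuous_comp (f := snd) (g := fun v : 'rV[R]_n => v 0 k)); [exact: cvg_snd|exact: coord_continuous]. Qed.

Lemma compact_in_boxes (K : set 'rV[R[i]]_n) : K `<=` @Hn R n ->
 compact [set p | on_xy K p] -> exists2 M, 1 <= M & forall z, K z -> in_boxes M z.
Proof.
move=> KH cK; set K' := [set p | _] in cK.
have Kz z : K z -> K' (re z, im z).
 rewrite /K' /= /on_xy (_ : mkz _ _ = z)//; apply/rowP=> k; rewrite !mxE.
 by case: (z 0 k).
suff [M M1 h] : exists2 M, 1 <= M & forall k z, K z ->
  in_box M (Re (z 0 k)) (Im (z 0 k)).
 by exists M => // z Kz0 k; exact: h.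
apply: (common_bound (Pr := fun k M => forall z, K z ->
  in_box M (Re (z 0 k)) (Im (z 0 k)))) => [k M M' M1 MM' H z /H|k].
 exact: in_box_le.
have [[z Kz0]|] := pselect (exists z, K z); last first.
 by move=> nK; exists 1 => // z Kz0; exfalso; apply: nK; exists z.
have cb (f : 'rV[R]_n * 'rV[R]_n -> R) : continuous f -> exists M, forall p, K' p -> f p <= M.
 move=> cf; have [p _ hp] := compact_EVT_max (ex_intro _ _ (Kz _ Kz0)) cK (continuous_subspaceT cf).
 by exists (f p) => q Kq; apply: hp; rewrite inE.
have [M1 h1] := cb _ (@fst_coord_continuous k).
have [M2 h2] := cb (fun p => - p.1 0 k) (fun p => continuousN (@fst_coord_continuous k p)).
have [M3 h3] := cb _ (@snd_coord_continuous k).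
have [p0 Kp0 h4] := compact_EVT_min (ex_intro _ _ (Kz _ Kz0)) cK (continuous_subspaceT (@snd_coord_continuous k)).
have e0 : 0 < p0.2 0 k by move: Kp0; rewrite inE => /KH/(_ k); rewrite /mkz mxE.
have i0 : 0 < (p0.2 0 k)^-1 by rewrite invr_gt0.
have n1 := normr_ge0 M1; have n2 := normr_ge0 M2; have n3 := normr_ge0 M3.
have l1 := ler_norm M1; have l2 := ler_norm M2; have l3 := ler_norm M3.
exists (1 + `|M1| + `|M2| + `|M3| + (p0.2 0 k)^-1); first lra.
move=> w Kw; have := h1 _ (Kz _ Kw); have := h2 _ (Kz _ Kw); have := h3 _ (Kz _ Kw).
have := h4 _ (mem_set (Kz _ Kw)); rewrite /= !mxE => k1 k2 k3 k4; split.
- by rewrite ler_norml; apply/andP; split; lra.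
- apply: le_trans k1; rewrite -[leRHS]invrK lef_pV2 ?posrE//; lra.
- lra.
Qed.

Lemma compact_support_bound (psi : 'rV[R]_n -> R[i]) : compact_support psi ->
 exists2 M, 0 <= M & forall v, psi v != 0 -> forall k, `|v 0 k| <= M.
Proof.
move=> /compact_bounded [M0 [_ hM]]; have := hM (`|M0| + 1) _.
rewrite (le_lt_trans (ler_norm M0)) ?ltrDl// => /(_ isT) h.
exists (`|M0| + 1); first by rewrite addr_ge0.
move=> v pv k; apply: le_trans (rV_coord_le v k) _; apply: h.
exact: subset_closure.
Qed.

Lemma parallelotope_bounded m (B : 'M[R]_(m, n)) : exists2 M, 0 <= M &
 forall v, parallelotope B v -> forall k, `|v 0 k| <= M.
Proof.
exists (\sum_i \sum_k `|B i k|); first by do 2 (apply: sumr_ge0 => ? _).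
move=> v [c hc ->] k; rewrite mxE; apply: le_trans (ler_norm_sum _ _ _) _.
apply: ler_sum => i _; rewrite (bigD1 k)//= normrM.
have /andP[c0 c1] := hc i; rewrite (ger0_norm c0).
apply: le_trans (_ : `|B i k| <= _).
 by rewrite ler_piMl// ltW.
by rewrite lerDl sumr_ge0.
Qed.

Lemma act_boxes (g : PSL2n R n) M : 1 <= M -> exists2 M', 1 <= M' &
 forall z, in_boxes M z -> in_boxes M' (act g z).
Proof.
move=> M1; suff [M' M'1 h] : exists2 M', 1 <= M' & forall k z, in_boxes M z ->
  in_box M' (Re (act g z 0 k)) (Im (act g z 0 k)).
 by exists M' => // z hz k; exact: h.
apply: (common_bound (Pr := fun k M' => forall z, in_boxes M z ->
  in_box M' (Re (act g z 0 k)) (Im (act g z 0 k)))) => [k L L' L1 LL' H z /H|k].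
 exact: in_box_le.
have [L L1 hL] := moebius_box (repr (g k)) M1; exists L => // z hz.
by rewrite [act _ _ _ _]mxE moebiusE; [exact/hL/hz|exact: (in_boxes_Hn M1 hz)].
Qed.

End boundedness.

Section cusp_domain.
Variables (R : realType) (n : nat) (Gam : set (PSL2n R n)).
Hypotheses (n0 : (0 < n)%N)
 (Gam_group : is_subgroup Gam)
 (Gam_discrete : is_discrete Gam).
Variables (S : set {ffun 'I_n -> option R}) (sigma : {ffun 'I_n -> option R} -> PSL2n R n)
 (P : {ffun 'I_n -> option R} -> 'M[R]_n).
Variables (Q : {ffun 'I_n -> option R} -> 'M[R]_(n.-1, n)) (C : R).
Hypotheses (S_finite : finite_set S)
 (S_complete : complete_cusps Gam S)
 (sigma_infty : forall kappa, S kappa ->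
 act_bd (sigma kappa) (@infty R n) = kappa)
 (P_basis : forall kappa, S kappa ->
 lattice_basis (P kappa) (transl_set Gam (sigma kappa)))
 (Q_basis : forall kappa, S kappa ->
 lattice_basis (Q kappa) (log_mult_set Gam (sigma kappa)))
 (C0 : 0 < C)
 (C_separates : separated_pieces Gam S sigma P Q C).
Variable F0 : set 'rV[R[i]]_n.
Hypothesis F0_compact : compact [set p | on_xy F0 p].
Local Notation F := (fdomain S sigma P Q C F0).
Local Notation F_upto := (fdomain_upto S sigma P Q C F0).
Hypothesis F_Hn : F `<=` @Hn R n.

(** The norm of the imaginary part lies between C and A, the second parallelotope bounds the ratios
    of the y_k to its n-th root, and the first one bounds the real parts. *)
Lemma cusp_piece_boxes (rho : PSL2n R n) (p : 'M[R]_n) (q : 'M[R]_(n.-1, n)) A :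
 exists2 M, 1 <= M & forall z, cusp_piece rho p q C z ->
  vnorm (im (act rho^-1%g z)) <= A -> in_boxes M z.
Proof.
have [Mp Mp0 hp] := parallelotope_bounded p.
have [Mq Mq0 hq] := parallelotope_bounded q.
pose c := C `^ n%:R^-1; pose a := (1 + `|A|) `^ n%:R^-1.
have A1 : 0 < 1 + `|A| by rewrite ltr_pwDl.
have c0 : 0 < c by rewrite powR_gt0.
have a0 : 0 < a by rewrite powR_gt0.
pose L := 1 + Mp + a * expR Mq + (c * expR (- Mq))^-1.
have e1 := expR_gt0 Mq; have e2 := expR_gt0 (- Mq).
have p1 : 0 < a * expR Mq by rewrite mulr_gt0.
have p2 : 0 < (c * expR (- Mq))^-1 by rewrite invr_gt0 mulr_gt0.
have L1 : 1 <= L by rewrite /L; lra.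
have [M M1 hM] := act_boxes rho L1; exists M => // _ [w [w0 Cw pw qw] <-].
rewrite actK// => wA; apply: hM => k; split.
- by have := hp _ pw k; rewrite mxE /L; lra.
- set N := vnorm (im w) in Cw wA qw *.
 have := hq _ qw k; rewrite !mxE -/N ler_norml => /andP[l1 l2].
 have N0 : 0 < N by apply: lt_trans Cw.
 have t0 : 0 < N `^ n%:R^-1 by rewrite powR_gt0.
 have y0 := w0 k.
 apply: le_trans (_ : c * expR (- Mq) <= _).
  by rewrite -[leRHS]invrK lef_pV2 ?posrE ?invr_gt0 ?mulr_gt0 // /L; lra.
 rewrite -[leRHS](divfK (lt0r_neq0 t0)) mulrC; apply: ler_pM; rewrite ?(ltW c0) ?(ltW e2)//.
  by rewrite -[leRHS]lnK ?posrE ?divr_gt0// ler_expR.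
 by rewrite /c ge0_ler_powR ?nnegrE ?invr_ge0 ?(ltW C0) ?(ltW N0)// ltW.
- set N := vnorm (im w) in Cw wA qw *.
 have := hq _ qw k; rewrite !mxE -/N ler_norml => /andP[l1 l2].
 have N0 : 0 < N by apply: lt_trans Cw.
 have t0 : 0 < N `^ n%:R^-1 by rewrite powR_gt0.
 have y0 := w0 k.
 apply: le_trans (_ : a * expR Mq <= _); last by rewrite /L; lra.
 rewrite -[leLHS](divfK (lt0r_neq0 t0)) mulrC; apply: ler_pM; rewrite ?(ltW t0) ?divr_ge0 ?(ltW y0) ?(ltW t0)//.
  have lA := ler_norm A.
  by rewrite /a ge0_ler_powR ?nnegrE ?invr_ge0 ?(ltW A1) ?(ltW N0)//; lra.
 by rewrite -[leLHS]lnK ?posrE ?divr_gt0// ler_expR.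
Qed.

Lemma F_upto_boxes A : exists2 M, 1 <= M & forall z, F_upto A z -> in_boxes M z.
Proof.
have [M0 M01 h0] : exists2 M, 1 <= M & forall z, F0 z -> in_boxes M z.
 by apply: compact_in_boxes => // z Fz; apply: F_Hn; left.
have /choice[Mk hk] : forall kappa, exists M, 1 <= M /\ forall z, cusp_piece (sigma kappa) (P kappa) (Q kappa) C z ->
  vnorm (im (act (sigma kappa)^-1%g z)) <= A -> in_boxes M z.
 by move=> kappa; have [M M1 h] := cusp_piece_boxes (sigma kappa) (P kappa) (Q kappa) A; exists M.
have /finite_seqP[r Sr] := S_finite.
pose L := M0 + \sum_(kappa <- r) Mk kappa.
have s0 : 0 <= \sum_(kappa <- r) Mk kappa.
 by apply: sumr_ge0 => k _; have [M1 _] := hk k; apply: le_trans M1.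
exists L; first by rewrite /L; lra.
move=> z [/h0 hz|[kappa Sk [pz hz]]] k.
 by apply: in_box_le (hz k); rewrite ?/L//; lra.
have [M1 h] := hk kappa; apply: in_box_le (h _ pz hz k) => //.
have kS : kappa \in r by move: Sk; rewrite Sr.
rewrite /L (big_rem kappa)//= addrCA lerDl addr_ge0//; first by apply: le_trans M01.
by apply: sumr_ge0 => k' _; have [M1' _] := hk k'; apply: le_trans M1'.
Qed.

Lemma F_uptoS A A' : A <= A' -> F_upto A `<=` F_upto A'.
Proof.
move=> AA' z [Fz|[kappa Sk [pz hz]]]; first by left.
by right; exists kappa => //; split=> //; exact: le_trans AA'.
Qed.

Lemma F_uptoF A : F_upto A `<=` F.
Proof. by move=> z [Fz|[kappa Sk [pz hz]]]; [left|right; exists kappa]. Qed.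

(** Each imaginary part shrinks at most by the factor M + 2, so above the height C (M + 2)^n the
    image is still above C, and [horoball_stabilizer] applies. *)
Lemma mixed_far (g : PSL2n R n) z M : 0 <= M -> mixed Gam g -> F z ->
 (forall k, csq (z 0 k) (act g z 0 k) <= M) -> F_upto (C * (M + 2) ^+ n) z.
Proof.
move=> M0 [Gg _ _ nofix] Fz hz; have zH := F_Hn Fz.
case: Fz => [|[kappa Sk pz]]; first by left.
right; exists kappa => //; split=> //=; rewrite leNgt; apply/negP=> far.
have [cS _ _] := S_complete.
apply: (nofix _ (cS _ Sk)).
move: pz => [w [w0 Cw _ _] wz]; move: far; rewrite -wz actK// => far.
apply: (horoball_stabilizer n0 Gam_group Gam_discrete sigma_infty P_basis Q_basis C0 C_separates Sk w0 Gg Cw).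
set h := (_ * g * _)%g.
have hw : @Hn R n (act h w) by exact: act_Hn.
have le k : im w 0 k <= (M + 2) * im (act h w) 0 k.
 rewrite [im _ _ _]mxE [im (act h w) _ _]mxE; apply: (sqdist_im_ge (w0 k) (hw k)).
 have := hz k; rewrite -wz.
 have -> : act g (act (sigma kappa) w) = act (sigma kappa) (act h w).
  by rewrite -!act_mul// /h !mulgA mulgV mul1g.
 by rewrite csq_act// => /le_trans; apply.
have : vnorm (im w) <= (M + 2) ^+ n * vnorm (im (act h w)).
 rewrite -[n in _ ^+ n]card_ord -prodr_const -big_split /=.
 by apply: ler_prod => k _; rewrite le andbT mxE ltW// w0.
move=> /(lt_le_trans far); rewrite mulrC ltr_pM2l//.
by rewrite exprn_gt0//; lra.
Qed.

Variables (psi : 'rV[R]_n -> R[i]) (u : 'rV[R[i]]_n -> R[i]).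
Hypothesis psi_compact : compact_support psi.

Lemma point_pair_csq z w : point_pair psi z w = psi (\row_k csq (z 0 k) (w 0 k)).
Proof. by rewrite /point_pair; congr psi; apply/rowP=> k; rewrite !mxE sqdistE. Qed.

Lemma class_fun_near : exists2 M, 0 <= M & forall g z, class_fun psi u g z != 0 ->
 forall k, csq (z 0 k) (act g z 0 k) <= M.
Proof.
have [M M0 hM] := compact_support_bound psi_compact; exists M => // g z.
rewrite /class_fun mulf_eq0 negb_or => /andP[pz _] k.
move: pz; rewrite point_pair_csq => /hM/(_ k); rewrite mxE.
by apply: le_trans; exact: ler_norm.
Qed.

Lemma mixed_support : exists A0, forall g z, mixed Gam g -> F z ->
 class_fun psi u g z != 0 -> F_upto A0 z.
Proof.
have [M M0 hM] := class_fun_near.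
by exists (C * (M + 2) ^+ n) => g z mg Fz /hM; exact: mixed_far.
Qed.

Lemma mixed_finite : finite_set [set g | mixed Gam g /\ exists2 z, F z & class_fun psi u g z != 0].
Proof.
have [M M0 hM] := class_fun_near; have [A0 hA] := mixed_support.
have [L L1 hL] := F_upto_boxes A0.
apply: sub_finite_set (finite_close Gam_group Gam_discrete L1 M0).
move=> g [mg [z Fz nz]]; split; first by case: mg.
by exists z; [exact/hL/(hA g)|exact: hM nz].
Qed.

End cusp_domain.

(** * Countable sums, unfolding and transport of complex integrals *)

Section countable_sums.
Local Open Scope ereal_scope.
Context d (X : measurableType d) (R : realType) (I : choiceType).
Implicit Types (J : set I).

(** The value [None] allows one enumeration without repetition for finite, empty and infinite sets
    alike, so that sums over J become series. *)
Lemma countable_enum J : countable J -> exists e : nat -> option I,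
 (forall i, J i -> exists k, e k = Some i) /\
 (forall k i, e k = Some i -> J i) /\
 (forall k l i, e k = Some i -> e l = Some i -> k = l).
Proof.
move=> /countable_injP [f fi].
pose e k := if pselect (exists i, J i /\ f i = k) is left h then Some (projT1 (cid h)) else None.
have eP k i : e k = Some i -> J i /\ f i = k.
 by rewrite /e; case: pselect => // h [<-]; case: (cid h).
exists e; split=> [i Ji|].
 exists (f i); rewrite /e; case: pselect => [h|[]]; last by exists i.
 by case: (cid h) => j [Jj fj] /=; rewrite (fi j i) ?inE.
split=> [k i /eP[]//|k l i /eP[_ <-] /eP[_ <-]//].
Qed.

Definition opt_val (e : nat -> option I) (a : I -> \bar R) (k : nat) : \bar R :=
 if e k is Some i then a i else 0.

Lemma esum_enum J e (a : I -> \bar R) :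
 (forall i, J i -> exists k, e k = Some i) -> (forall k i, e k = Some i -> J i) ->
 (forall k l i, e k = Some i -> e l = Some i -> k = l) -> (forall i, 0 <= a i) ->
 \esum_(i in J) a i = \sum_(k <oo) opt_val e a k.
Proof.
move=> surj eJ einj a0.
have [i0|J0] := pselect (exists i, J i); last first.
 rewrite (_ : J = set0); last by apply/seteqP; split=> // i Ji; case: J0; exists i.
 rewrite esum_set0 eseries0// => k _ _; rewrite /opt_val; case ek : (e k) => [i|//].
 by case: J0; exists i; exact: eJ ek.
case: i0 => i0 Ji0.
pose e' k := odflt i0 (e k); pose P k := e k != None.
have -> : J = [set e' k | k in [set k | P k]].
 apply/seteqP; split=> [i /surj[k ek]|_ [k /= Pk <-]].
  by exists k; rewrite /P /e' /= ek.
 by move: Pk; rewrite /P /e'; case ek : (e k) => [i|//] _; exact: eJ ek.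
rewrite esum_pred_image//; last first.
 move=> k l; rewrite !inE /= /P /e'; case ek: (e k) => [i|//]; case el: (e l) => [j|//] _ _ /= ij.
 by apply: (einj _ _ i) => //; rewrite el ij.
rewrite eseries_mkcond; apply: eq_eseriesr => k _.
by rewrite /P /e' /opt_val; case: (e k).
Qed.

Lemma ge0_integral_esum (mu : {measure set X -> \bar R}) J (f : I -> X -> \bar R) :
 countable J -> (forall i, J i -> mfunT (f i)) ->
 (forall i x, 0 <= f i x) ->
 mfunT (fun x => \esum_(i in J) f i x) /\
 \int[mu]_x (\esum_(i in J) f i x) = \esum_(i in J) \int[mu]_x f i x.
Proof.
move=> /countable_enum[e [surj [eJ einj]]] mf f0.
pose F k x := opt_val e (fun i => f i x) k.
have F0 k x : 0 <= F k x by rewrite /F /opt_val; case: (e k).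
have mF k : mfunT (F k).
 by rewrite /F /opt_val; case ek: (e k) => [i|]; [exact: mf (eJ _ _ ek)|exact: measurable_cst].
have E : (fun x => \esum_(i in J) f i x) = (fun x => \sum_(k <oo) F k x).
 by apply/funext=> x; apply: esum_enum.
rewrite E; split.
 by apply: ge0_emeasurable_sum => // k x _ _.
rewrite integral_nneseries// (esum_enum surj eJ einj); last by move=> i; exact: integral_ge0.
apply: eq_eseriesr => k _; rewrite /F /opt_val; case: (e k) => // .
by rewrite integral0.
Qed.

(* Cutting along the translates of F: every point of the support of G lies in exactly
  one tau i F. *)
Lemma ge0_unfold (mu : {measure set X -> \bar R}) J (tau tau' : I -> X -> X)
  (F : set X) (G : X -> R) :
 countable J -> measurable F -> mfunT G -> (forall x, (0 <= G x)%R) ->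
 (forall i, mfunT (tau i)) -> (forall i, mfunT (tau' i)) ->
 (forall i (g : X -> \bar R), mfunT g -> (forall x, 0 <= g x) ->
   \int[mu]_x g x = \int[mu]_x g (tau i x)) ->
 (forall i x, J i -> G (tau i x) != 0%R -> tau' i (tau i x) = x) ->
 {ae mu, forall x, G x != 0%R -> \esum_(i in J) (\1_F (tau' i x) : R)%:E = 1} ->
 \int[mu]_x (G x)%:E = \esum_(i in J) \int[mu]_x (G (tau i x) * \1_F x)%:E.
Proof.
move=> cJ mF mG G0 mt mt' inv can ae1.
pose f i x := (G x)%:E * (\1_F (tau' i x))%:E.
have f0 i x : 0 <= f i x by rewrite mule_ge0 ?lee_fin.
have mf i : mfunT (f i).
 apply: emeasurable_funM; apply/measurable_EFinP=> //.
 apply: (measurableT_comp _ (mt' i)); exact: measurable_indic.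
have [mS eS] := ge0_integral_esum mu cJ (fun i _ => mf i) f0.
transitivity (\int[mu]_x (\esum_(i in J) f i x)).
 apply: ge0_ae_eq_integral=> //; first exact/measurable_EFinP.
   by move=> x _; rewrite lee_fin.
  by move=> x _; apply: esum_ge0 => i _; exact: f0.
 move: ae1; apply: filterS => x hx _; rewrite /f.
 have [->|Gx] := eqVneq (G x) 0%R.
  by rewrite esum1// => i _; rewrite mul0e.
 rewrite -[LHS]mule1 -(hx Gx).
 have [e [surj [eJ einj]]] := countable_enum cJ.
 rewrite (esum_enum surj eJ einj); last by move=> i; rewrite lee_fin.
 rewrite (esum_enum surj eJ einj); last by move=> i; rewrite mule_ge0 ?lee_fin.
 rewrite -nneseriesZl//; last by move=> k _; rewrite /opt_val; case: (e k) => //= i; rewrite lee_fin.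
 by apply: eq_eseriesr => k _; rewrite /opt_val; case: (e k); rewrite ?mule0.
rewrite eS; apply: eq_esum => i Ji; rewrite (inv i)//.
apply: eq_integral=> x _; rewrite /f EFinM.
by have [->|Gx] := eqVneq (G (tau i x)) 0%R; rewrite ?mul0e// can.
Qed.

End countable_sums.

Section transports.
Context d d' (X : measurableType d) (Y : measurableType d') (R : realType).
Variables (mu : {measure set X -> \bar R}) (nu : {measure set Y -> \bar R}).

(** The measure mu is the image under [phi] of the measure with density [j]. The formula is required
    for nonnegative functions; signed and complex ones follow through positive and negative
    parts. *)
Definition transports (phi : Y -> X) (j : Y -> R) : Prop :=
 [/\ mfunT phi, mfunT j, forall y, 0 <= j y &
  forall g : X -> \bar R, mfunT g -> (forall x, (0 <= g x)%E) ->
  (\int[mu]_x g x = \int[nu]_y (g (phi y) * (j y)%:E))%E].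

Lemma transports_integral phi j (h : X -> R) : transports phi j -> mfunT h ->
 (\int[mu]_x (h x)%:E = \int[nu]_y (j y * h (phi y))%:E)%E.
Proof.
move=> [mphi mj j0 H] mh; rewrite integralE [RHS]integralE; congr (_ - _)%E.
 rewrite H//; last by apply: measurable_funepos; exact/measurable_EFinP.
 apply: eq_integral=> y _; rewrite !funeposE -!EFin_max -EFinM; congr (_%:E).
 by rewrite mulrC maxr_pMr// mulr0.
rewrite H//; last by apply: measurable_funeneg; exact/measurable_EFinP.
apply: eq_integral=> y _; rewrite !funenegE -!EFinN -!EFin_max -EFinM; congr (_%:E).
by rewrite -mulrN mulrC maxr_pMr// mulr0.
Qed.

Lemma transports_integrable phi j (h : X -> R) : transports phi j -> mfunT h ->
 mu.-integrable setT (fun x => (h x)%:E) <->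
 nu.-integrable setT (fun y => (j y * h (phi y))%:E).
Proof.
move=> [mphi mj j0 H] mh.
have mh' : mfunT (fun y => j y * h (phi y)).
 by apply: measurable_funM => //; exact: measurableT_comp.
have e : (\int[mu]_x `|(h x)%:E| = \int[nu]_y `|(j y * h (phi y))%:E|)%E.
 rewrite H//; last by apply: measurableT_comp => //; exact/measurable_EFinP.
 apply: eq_integral=> y _; rewrite !abse_EFin -EFinM; congr (_%:E).
 by rewrite normrM (ger0_norm (j0 y)) mulrC.
split=> /integrableP [_ hi]; apply/integrableP; split.
- exact/measurable_EFinP.
- by move: hi; rewrite e.
- exact/measurable_EFinP.
- by move: hi; rewrite -e.
Qed.

Definition cmeas (f : X -> R[i]) : Prop :=
 mfunT (fun x => Re (f x)) /\
 mfunT (fun x => Im (f x)).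

Lemma transports_cintegral phi j (f : X -> R[i]) : transports phi j -> cmeas f ->
 cintegral mu setT f = cintegral nu setT (fun y => (j y)%:C * f (phi y)).
Proof.
move=> T [mr mi]; rewrite /cintegral /Rintegral.
rewrite (transports_integral T mr) (transports_integral T mi).
congr (fine _ +i* fine _); apply: eq_integral=> y _; congr (_%:E);
 by case: (f (phi y)) => a b /=; rewrite ?mul0r ?subr0 ?addr0.
Qed.

Lemma transports_cintegrable phi j (f : X -> R[i]) : transports phi j -> cmeas f ->
 cintegrable mu setT f <-> cintegrable nu setT (fun y => (j y)%:C * f (phi y)).
Proof.
move=> T [mr mi]; rewrite /cintegrable (transports_integrable T mr) (transports_integrable T mi).
have er : (fun y => (j y * Re (f (phi y)))%:E) = (fun y => (Re ((j y)%:C * f (phi y)))%:E).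
 by apply/funext=> y; congr (_%:E); case: (f (phi y)) => a b /=; rewrite mul0r subr0.
have ei : (fun y => (j y * Im (f (phi y)))%:E) = (fun y => (Im ((j y)%:C * f (phi y)))%:E).
 by apply/funext=> y; congr (_%:E); case: (f (phi y)) => a b /=; rewrite mul0r addr0.
by rewrite er ei.
Qed.

End transports.

Section complex_integrals.
Context d (X : measurableType d) (R : realType) (mu : {measure set X -> \bar R}).
Implicit Types (f : X -> R[i]) (D : set X).

Lemma cintegral_mkcond D f :
 cintegral mu D f = cintegral mu setT (fun x => (\1_D x)%:C * f x).
Proof.
rewrite /cintegral /Rintegral; congr (fine _ +i* fine _);
 rewrite integral_mkcond; apply: eq_integral=> x _; rewrite patchE indicE;
 case: ifP=> // _; rewrite ?mul1r ?mul0r//.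
Qed.

Lemma cintegrable_mkcond D f : measurable D ->
 cintegrable mu D f <-> cintegrable mu setT (fun x => (\1_D x)%:C * f x).
Proof.
move=> mD; rewrite /cintegrable.
rewrite (integrable_mkcond _ mD) (integrable_mkcond (fun x => (Im (f x))%:E) mD).
have er : patch (fun=> 0%E) D (fun x => (Re (f x))%:E) = (fun x => (Re ((\1_D x)%:C * f x))%:E).
 by apply/funext=> x; rewrite patchE indicE; case: ifP=> _; rewrite ?mul1r ?mul0r.
have ei : patch (fun=> 0%E) D (fun x => (Im (f x))%:E) = (fun x => (Im ((\1_D x)%:C * f x))%:E).
 by apply/funext=> x; rewrite patchE indicE; case: ifP=> _; rewrite ?mul1r ?mul0r.
by rewrite er ei.
Qed.

Lemma cmeas_cst (c : R[i]) : cmeas (fun _ : X => c).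
Proof. by split; exact: measurable_cst. Qed.

Lemma cmeasM f h : cmeas f -> cmeas h -> cmeas (fun x => f x * h x).
Proof.
move=> [f1 f2] [h1 h2]; split.
 rewrite (_ : (fun x => _) = (fun x => Re (f x) * Re (h x) - Im (f x) * Im (h x))).
  by apply: measurable_funB; apply: measurable_funM.
 by apply/funext=> x; case: (f x); case: (h x).
rewrite (_ : (fun x => _) = (fun x => Re (f x) * Im (h x) + Im (f x) * Re (h x))).
 by apply: measurable_funD; apply: measurable_funM.
by apply/funext=> x; case: (f x); case: (h x).
Qed.

Lemma cmeas_real (r : X -> R) : mfunT r -> cmeas (fun x => (r x)%:C).
Proof. by move=> mr; split=> //=; exact: measurable_cst. Qed.

Lemma cmeas_prod (I : Type) (s : seq I) (F : I -> X -> R[i]) :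
 (forall i, cmeas (F i)) -> cmeas (fun x => \prod_(i <- s) F i x).
Proof.
move=> mF; elim: s => [|i s IH].
 by rewrite (_ : (fun x => _) = cst 1); [exact: cmeas_cst|apply/funext=> x; rewrite big_nil].
rewrite (_ : (fun x => _) = fun x => F i x * \prod_(j <- s) F j x); first exact: cmeasM.
by apply/funext=> x; rewrite big_cons.
Qed.

Lemma cmeas_comp d' (Y : measurableType d') (phi : Y -> X) f :
 cmeas f -> mfunT phi -> cmeas (fun y => f (phi y)).
Proof.
by move=> [f1 f2] mphi; split; [exact: (measurableT_comp f1 mphi)|exact: (measurableT_comp f2 mphi)].
Qed.

Lemma cintegrableZ (c : R[i]) f : cintegrable mu setT f -> cintegrable mu setT (fun x => c * f x).
Proof.
move=> [fr fi]; split.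
 rewrite (_ : (fun x => _) = ((fun x => (Re c)%:E * (Re (f x))%:E - (Im c)%:E * (Im (f x))%:E)%E)).
  by apply: integrableB => //; apply: integrableZl.
 by apply/funext=> x; rewrite -!EFinM -EFinB; congr (_%:E); case: c {fr fi}; case: (f x).
rewrite (_ : (fun x => _) = ((fun x => (Re c)%:E * (Im (f x))%:E + (Im c)%:E * (Re (f x))%:E)%E)).
 by apply: integrableD => //; apply: integrableZl.
by apply/funext=> x; rewrite -!EFinM -EFinD; congr (_%:E); case: c {fr fi}; case: (f x).
Qed.

Lemma cintegrableD f h : cintegrable mu setT f -> cintegrable mu setT h ->
 cintegrable mu setT (fun x => f x + h x).
Proof.
move=> [fr fi] [hr hi]; split.
 rewrite (_ : (fun x => _) = (fun x => (Re (f x))%:E + (Re (h x))%:E)%E).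
  exact: integrableD.
 by apply/funext=> x; rewrite -EFinD; case: (f x); case: (h x).
rewrite (_ : (fun x => _) = (fun x => (Im (f x))%:E + (Im (h x))%:E)%E).
 exact: integrableD.
by apply/funext=> x; rewrite -EFinD; case: (f x); case: (h x).
Qed.

Lemma cintegralZ (c : R[i]) f : cintegrable mu setT f ->
 cintegral mu setT (fun x => c * f x) = c * cintegral mu setT f.
Proof.
move=> [fr fi]; rewrite /cintegral.
have er : (fun x => Re (c * f x)) = (fun x => Re c * Re (f x) - Im c * Im (f x)).
 by apply/funext=> x; case: c; case: (f x).
have ei : (fun x => Im (c * f x)) = (fun x => Re c * Im (f x) + Im c * Re (f x)).
 by apply/funext=> x; case: c {er}; case: (f x).
have zi (a : R) r : mu.-integrable setT (fun x => (r x)%:E) -> mu.-integrable setT (fun x => (a * r x)%:E).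
 move=> ri; rewrite (_ : (fun x => _) = (fun x => a%:E * (r x)%:E)%E); first exact: integrableZl.
 by apply/funext=> x; rewrite EFinM.
rewrite er ei RintegralB//; try exact: zi.
rewrite RintegralD//; try exact: zi.
by rewrite !RintegralZl//; case: c {er ei}.
Qed.

Lemma cintegralD f h : cintegrable mu setT f -> cintegrable mu setT h ->
 cintegral mu setT (fun x => f x + h x) = cintegral mu setT f + cintegral mu setT h.
Proof.
move=> [fr fi] [hr hi]; rewrite /cintegral.
have er : (fun x => Re (f x + h x)) = (fun x => Re (f x) + Re (h x)).
 by apply/funext=> x; case: (f x); case: (h x).
have ei : (fun x => Im (f x + h x)) = (fun x => Im (f x) + Im (h x)).
 by apply/funext=> x; case: (f x); case: (h x).
by rewrite er ei !RintegralD.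
Qed.

Lemma eq_cintegral f h : (forall x, f x = h x) -> cintegral mu setT f = cintegral mu setT h.
Proof. by move=> e; congr (cintegral _ _ _); apply/funext. Qed.

Lemma normc_Re (z : R[i]) : `|Re z| <= normc z.
Proof. by case: z => a b /=; rewrite -sqrtr_sqr ler_wsqrtr// lerDl sqr_ge0. Qed.

Lemma normc_Im (z : R[i]) : `|Im z| <= normc z.
Proof. by case: z => a b /=; rewrite -sqrtr_sqr ler_wsqrtr// lerDr sqr_ge0. Qed.

Lemma cintegrable_bounded (D : set X) (K : R) f : measurable D -> (mu D < +oo)%E ->
 cmeas f -> (forall x, normc (f x) <= K * \1_D x) -> cintegrable mu setT f.
Proof.
move=> mD Dfin [mr mi] bf.
have iD : mu.-integrable setT (fun x => (K * \1_D x)%:E).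
 rewrite (_ : (fun x => _) = (fun x => K%:E * (\1_D x)%:E)%E); last by apply/funext=> x; rewrite EFinM.
 apply: integrableZl => //; apply/integrableP; split.
   by apply/measurable_EFinP; exact: measurable_indic.
  rewrite (eq_integral (fun x => (\1_D x)%:E)); first by rewrite integral_indic// setIT.
  by move=> x _; rewrite abse_EFin ger0_norm.
split.
 apply: (le_integrable _ _ _ iD) => //; first exact/measurable_EFinP.
 move=> x _; rewrite !abse_EFin lee_fin; apply: le_trans (normc_Re _) _.
 by apply: le_trans (bf x) (ler_norm _).
apply: (le_integrable _ _ _ iD) => //; first exact/measurable_EFinP.
move=> x _; rewrite !abse_EFin lee_fin; apply: le_trans (normc_Im _) _.
by apply: le_trans (bf x) (ler_norm _).
Qed.

End complex_integrals.

(** * Measurability on the product of half planes and its invariant measure *)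

Section tuple_points.
Variables (R : realType) (n : nat).
Local Notation RT := (measurableTypeR R).
Local Notation T2 := (n.-tuple RT * n.-tuple RT)%type.
Implicit Types (p : T2).

Definition zpoint p : 'rV[R[i]]_n := mkz (tnth p.1) (tnth p.2).

Definition to_row (t : n.-tuple RT) : 'rV[R]_n := \row_k tnth t k.

Definition to_xy p : 'rV[R]_n * 'rV[R]_n := (to_row p.1, to_row p.2).

Lemma on_xy_to (T : Type) (f : 'rV[R[i]]_n -> T) p : on_xy f (to_xy p) = f (zpoint p).
Proof. by rewrite /on_xy /zpoint; congr f; apply/rowP=> k; rewrite !mxE. Qed.

Lemma zpointE p k : zpoint p 0 k = tnth p.1 k +i* tnth p.2 k.
Proof. by rewrite mxE. Qed.

Lemma measurable_row_ball (q : 'rV[R]_n) e : measurable (to_row @^-1` ball q e).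
Proof.
have [e0|e0] := leP e 0.
 rewrite (_ : _ @^-1` _ = set0)//; apply/seteqP; split=> // t /=.
 by rewrite -ball_normE /= => /(le_lt_trans (normr_ge0 _)) /(le_lt_trans e0); rewrite ltxx.
rewrite (_ : _ @^-1` _ = \bigcap_(k in [set: 'I_n]) ((fun t : n.-tuple RT => tnth t k) @^-1` ball (q 0 k) e)).
 apply: fin_bigcap_measurable => // k _; rewrite -[X in measurable X]setTI.
 apply: measurable_tnth => //; exact: measurable_ball.
apply/seteqP; split=> t /=.
 by move=> [_ h] k _; have := h 0 k; rewrite mxE.
by move=> h; split=> // i k; rewrite (ord1 i) mxE; exact: h.
Qed.

(** Links the topology of row vectors to the product sigma-algebra of tuples: an open set is a
    countable union of balls with rational centres and radii 1/(N + 1). *)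
Lemma measurable_open_xy (O : set ('rV[R]_n * 'rV[R]_n)) : open O ->
 measurable (to_xy @^-1` O).
Proof.
move=> oO.
pose qr (q : 'rV[rat]_n) : 'rV[R]_n := map_mx ratr q.
pose B (i : 'rV[rat]_n * 'rV[rat]_n * nat) : set ('rV[R]_n * 'rV[R]_n) :=
 ball (qr i.1.1) i.2.+1%:R^-1 `*` ball (qr i.1.2) i.2.+1%:R^-1.
have dense (x : 'rV[R]_n) (e : R) : 0 < e -> exists q : 'rV[rat]_n, ball x e (qr q).
 move=> e0; have /choice[q hq] : forall k, exists q : rat, `|x 0 k - ratr q| < e.
  move=> k; have := @rat_in_itvoo R (x 0 k - e) (x 0 k + e) _.
  rewrite ltrBlDr -addrA ltrDl addr_gt0// => /(_ isT)[q]; rewrite in_itv /= => /andP[q1 q2].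
  by exists q; rewrite ltr_norml; apply/andP; split; lra.
 exists (\row_k q k); split=> // i k; rewrite (ord1 i) !mxE.
 by rewrite -ball_normE /=; exact: hq.
rewrite (_ : _ @^-1` _ = \bigcup_(i in [set i | B i `<=` O]) (to_xy @^-1` B i)).
 rewrite bigcup_mkcond; apply: countable_bigcupT_measurable => //.
 move=> i; case: ifP=> // _; rewrite (_ : to_xy @^-1` B i = (to_row @^-1` ball (qr i.1.1) i.2.+1%:R^-1) `*` (to_row @^-1` ball (qr i.1.2) i.2.+1%:R^-1))//.
 by apply: measurableX; exact: measurable_row_ball.
apply/seteqP; split=> [p Op|p [i /= iO Bi]]; last exact: iO.
have := open_nbhs_nbhs (conj oO Op) => /nbhs_ballP[e /= e0 he].
pose N := Num.truncn (2 / e).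
have N0 : 2 / e < N.+1%:R by exact: truncnS_gt.
have N0' : 0 < N.+1%:R^-1 :> R by rewrite invr_gt0.
have Ne : N.+1%:R^-1 < e / 2 by rewrite -[ltRHS]invrK invf_div ltf_pV2 ?posrE ?divr_gt0.
have [q1 h1] := dense (to_xy p).1 _ N0'; have [q2 h2] := dense (to_xy p).2 _ N0'.
exists ((q1, q2), N); last by split=> /=; apply: ball_sym.
have N2 : N.+1%:R^-1 + N.+1%:R^-1 <= e.
 by move: Ne; move: (N.+1%:R^-1) => t; lra.
move=> [r1 r2] [/= b1 b2]; apply: he; split=> /=.
 exact: (le_ball N2 (ball_triangle h1 b1)).
exact: (le_ball N2 (ball_triangle h2 b2)).
Qed.

Definition upper : set T2 := coords (@Hn R n).

Lemma upperE p : upper p <-> forall k, 0 < tnth p.2 k.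
Proof. by split=> h k; have := h k; rewrite mxE. Qed.

Lemma measurable_upper : measurable upper.
Proof.
rewrite (_ : upper = \bigcap_(k in [set: 'I_n]) ((fun p => tnth p.2 k) @^-1` [set t | 0 < t])).
 apply: fin_bigcap_measurable => // k _; rewrite -[X in measurable X]setTI.
 apply: (measurableT_comp (measurable_tnth k) measurable_snd) => //.
 rewrite (_ : [set t | 0 < t] = `]0, +oo[%classic); first exact: measurable_itv.
 by apply/seteqP; split=> t /=; rewrite in_itv /= andbT.
by apply/seteqP; split=> p; [move/upperE => h k _; exact: h|move=> h; apply/upperE => k; exact: h].
Qed.

Lemma upper_xyE p : upper p = upper_xy (to_xy p).
Proof. by rewrite /upper_xy /= on_xy_to. Qed.

Lemma measurable_continuous_xy (phi : 'rV[R]_n * 'rV[R]_n -> R) :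
 (forall q, @upper_xy R n q -> {for q, continuous phi}) ->
 measurable_fun upper (fun p => phi (to_xy p)).
Proof.
move=> cphi; apply: (measurability _ (RGenOInfty.measurableE R)) => _ [_ [r ->] <-].
rewrite (_ : _ `&` _ = upper `&` to_xy @^-1` ([set q | r < phi q]^°)).
 by apply: measurableI; [exact: measurable_upper|apply: measurable_open_xy; exact: open_interior].
apply/seteqP; split=> p [up] /=; rewrite ?in_itv /= ?andbT => rp; split=> //.
 have := up; rewrite upper_xyE => /cphi c; exact: c (lt_nbhsr rp).
by move: rp => /interior_subset.
Qed.

(** The indicator discards the values outside the half planes, about which nothing is known. *)
Lemma measurable_indic_upper (phi : 'rV[R]_n * 'rV[R]_n -> R) :
 (forall q, @upper_xy R n q -> {for q, continuous phi}) ->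
 mfunT (fun p => \1_upper p * phi (to_xy p)).
Proof.
move=> cphi.
rewrite (_ : (fun p => _) = ((fun p => phi (to_xy p)) \_ upper)); last first.
 by apply/funext=> p; rewrite patchE indicE; case: ifP; rewrite ?mul1r ?mul0r.
by apply/(measurable_restrictT _ measurable_upper); exact: measurable_continuous_xy.
Qed.

Lemma cmeas_upper (u : 'rV[R[i]]_n -> R[i]) :
 csmooth_on (@upper_xy R n) (on_xy u) ->
 cmeas (fun p => (\1_upper p)%:C * u (zpoint p)).
Proof.
move=> [sr si]; split.
 rewrite (_ : (fun p => _) = fun p => \1_upper p * Re (on_xy u (to_xy p))).
  by apply: (@measurable_indic_upper (fun q => Re (on_xy u q))) => q /(sr [::])[].
 by apply/funext=> p; rewrite on_xy_to; case: (u _) => a b /=; rewrite mul0r subr0.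
rewrite (_ : (fun p => _) = fun p => \1_upper p * Im (on_xy u (to_xy p))).
 by apply: (@measurable_indic_upper (fun q => Im (on_xy u q))) => q /(si [::])[].
by apply/funext=> p; rewrite on_xy_to; case: (u _) => a b /=; rewrite mul0r addr0.
Qed.

Lemma cmeas_row (psi : 'rV[R]_n -> R[i]) : csmooth_on setT psi ->
 cmeas (fun t : n.-tuple RT => psi (to_row t)).
Proof.
(* A fixed point of the half planes as second component reduces functions on R^n to the preceding
   lemma. *)
pose one : n.-tuple RT := [tuple 1 | _ < n].
have m1 : mfunT (fun t : n.-tuple RT => (t, one)).
 by apply: measurable_fun_pair.
have up t : upper (t, one) by apply/upperE => k; rewrite tnth_mktuple ltr01.
have key (phi : 'rV[R]_n -> R) : continuous phi -> mfunT (fun t : n.-tuple RT => phi (to_row t)).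
 move=> cphi; have := @measurable_indic_upper (fun q => phi q.1) _.
 have c q : @upper_xy R n q -> {for q, continuous (fun q => phi q.1)}.
  by move=> _; apply: (continuous_comp (f := fst) (g := phi)); [exact: cvg_fst|exact: cphi].
 move=> /(_ c) m; have := measurableT_comp m m1; congr (measurable_fun _ _).
 by apply/funext=> t; rewrite /= indicE mem_set ?mul1r.
by move=> [sr si]; split; [apply: (key (fun v => Re (psi v)))|apply: (key (fun v => Im (psi v)))] => v;
 [have [] := sr [::] v I|have [] := si [::] v I].
Qed.

End tuple_points.

Arguments upper {R n}.

Section hyperbolic_measure.
Variables (R : realType) (n : nat).
Local Notation RT := (measurableTypeR R).
Local Notation T2 := (n.-tuple RT * n.-tuple RT)%type.
Implicit Types (p : T2).

Definition hyp_dens p : R := \prod_i hdens (tnth p.1 i, tnth p.2 i).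

Lemma measurable_hyp_dens : mfunT hyp_dens.
Proof. by apply: (measurable_prod_tnth2 (d := fun _ => @hdens R)) => i; exact: measurable_hdens. Qed.

Lemma hyp_dens_ge0 p : 0 <= hyp_dens p.
Proof. by apply: prodr_ge0 => i _; exact: hdens_ge0. Qed.

Lemma hyp_densE p : hyp_dens p = \1_upper p * dens p.2.
Proof.
rewrite indicE /hyp_dens /dens; have [/set_mem/upperE up|/negP up] := boolP (p \in upper).
 rewrite mul1r -prodfV; apply: eq_bigr=> i _.
 by rewrite /hdens /= up.
rewrite mul0r; apply/eqP; rewrite prodf_seq_eq0 /=; apply: contra_notT up => /hasPn h.
rewrite inE; apply/upperE => k; have := h k (mem_index_enum k).
by rewrite /hdens /=; case: ifP=> //; rewrite eqxx.
Qed.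

(** The invariant measure on all of R^n x R^n, with density 0 outside the half planes, so that
    integrals need no domain. *)
Definition hypm : {measure set T2 -> \bar R} :=
 density (@dxdy R n) measurable_hyp_dens hyp_dens_ge0.

Lemma transports_hypm : transports hypm (@dxdy R n) id hyp_dens.
Proof.
split=> //; first exact: measurable_hyp_dens; first exact: hyp_dens_ge0.
by move=> g mg g0; rewrite /hypm ge0_integral_density.
Qed.

Lemma hintegral_hypm D (f : 'rV[R[i]]_n -> R[i]) : D `<=` @Hn R n ->
 cmeas (fun p => (\1_(coords D) p)%:C * f (zpoint p)) ->
 hintegral D f = cintegral hypm setT (fun p => (\1_(coords D) p)%:C * f (zpoint p)).
Proof.
move=> DH mf; rewrite (transports_cintegral transports_hypm mf) /hintegral cintegral_mkcond.
apply: eq_cintegral => p; rewrite hyp_densE rmorphM /= !indicE.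
have [/set_mem Dp|_] := boolP (p \in coords D); last by rewrite !mul0r mulr0.
by rewrite mem_set ?mul1r//; exact: DH.
Qed.

Lemma hintegrable_hypm D (f : 'rV[R[i]]_n -> R[i]) : D `<=` @Hn R n -> measurable (coords D) ->
 cmeas (fun p => (\1_(coords D) p)%:C * f (zpoint p)) ->
 hintegrable D f <-> cintegrable hypm setT (fun p => (\1_(coords D) p)%:C * f (zpoint p)).
Proof.
move=> DH mD mf; rewrite (transports_cintegrable transports_hypm mf) /hintegrable cintegrable_mkcond//.
rewrite (_ : (fun p => _) = (fun y : n.-tuple R * n.-tuple R => (hyp_dens (id y))%:C * ((\1_(coords D) (id y))%:C * f (zpoint (id y)))))//.
apply/funext=> p; rewrite hyp_densE rmorphM /= !indicE.
have [/set_mem Dp|_] := boolP (p \in coords D); last by rewrite !mul0r mulr0.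
by rewrite mem_set ?mul1r//; exact: DH.
Qed.

Lemma hvolE D : D `<=` @Hn R n -> measurable (coords D) -> hvol D = hypm (coords D).
Proof.
move=> DH mD; rewrite /hvol integral_mkcond /hypm /= /density [in RHS]integral_mkcond.
apply: eq_integral=> p _; rewrite !patchE; case: ifP=> // /set_mem Dp.
by rewrite hyp_densE indicE mem_set ?mul1r//; exact: DH.
Qed.

(** A total measurable version of the action; the group laws are available over [upper]. *)
Definition actT (g : PSL2n R n) p : T2 :=
 map_fun2 (fun k => moebius_plane (repr (g k))) p.

Lemma measurable_actT g : mfunT (actT g).
Proof. by apply: measurable_map_fun2 => i; exact: measurable_moebius_plane. Qed.

Lemma zpoint_actT g p : upper p -> zpoint (actT g p) = act g (zpoint p).
Proof.
move=> /upperE up; apply/rowP=> k; rewrite [in RHS]mxE !zpointE moebiusE; last exact: up.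
by rewrite /actT /map_fun2 /= !tnth_mktuple.
Qed.

Lemma upper_actT g p : upper (actT g p) <-> upper p.
Proof.
split=> /upperE h; apply/upperE => k; last first.
 by rewrite /actT /= tnth_mktuple /moebius_plane /= moebius_im_gt0.
have := h k; rewrite /actT /= tnth_mktuple /moebius_plane /= /moebius_im => hk.
have [//|y0] := ltP 0 (tnth p.2 k).
move: hk; rewrite ltNge; apply: contraNP=> _.
by rewrite mulr_le0_ge0// invr_ge0 addr_ge0// sqr_ge0.
Qed.

Lemma actT_invariant g (G : T2 -> \bar R) : mfunT G -> (forall p, 0 <= G p)%E ->
 (\int[hypm]_p G p = \int[hypm]_p G (actT g p))%E.
Proof.
move=> mG G0; rewrite /hypm !ge0_integral_density//; last first.
 by apply: measurableT_comp => //; exact: measurable_actT.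
apply: (ge0_leb2_coordinate_change (d := fun _ => @hdens R) (j := fun _ => @hdens R)
  (Z := fun k => moebius_plane (repr (g k)))) => //.
- by move=> i; exact: measurable_hdens.
- by move=> i x; exact: hdens_ge0.
- by move=> i; exact: measurable_hdens.
- by move=> i x; exact: hdens_ge0.
- by move=> i; exact: measurable_moebius_plane.
- by move=> i h mh h0; have [_] := preserves_hyp_moebius (repr (g i)); apply.
Qed.

Lemma actTM g h p : upper p -> actT (g * h)%g p = actT g (actT h p).
Proof.
move=> up; have e : zpoint (actT (g * h)%g p) = zpoint (actT g (actT h p)).
 rewrite !zpoint_actT//; last exact/upper_actT.
 by rewrite act_mul.
case: (actT (g * h)%g p) (actT g (actT h p)) e => a b [c d] /rowP e.
by congr pair; apply: eq_from_tnth=> k; have := e k; rewrite !zpointE => -[].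
Qed.

Lemma actT1 p : upper p -> actT 1%g p = p.
Proof.
move=> up; have e : zpoint (actT 1%g p) = zpoint p by rewrite zpoint_actT// act1.
case: (actT 1%g p) e => a b; case: p {up} => c d /rowP e.
by congr pair; apply: eq_from_tnth=> k; have := e k; rewrite !zpointE => -[].
Qed.

Lemma actTK g p : upper p -> actT g^-1%g (actT g p) = p.
Proof. by move=> up; rewrite -actTM// mulVg actT1. Qed.

Lemma cmeas_class_fun (psi : 'rV[R]_n -> R[i]) (u : 'rV[R[i]]_n -> R[i]) g :
 csmooth_on setT psi -> csmooth_on (@upper_xy R n) (on_xy u) ->
 cmeas (fun p => (\1_upper p)%:C * class_fun psi u g (zpoint p)).
Proof.
move=> spsi su.
pose sq p : n.-tuple RT := [tuple (let q := moebius_plane (repr (g k)) (tnth p.1 k, tnth p.2 k) in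
  sqdist (tnth p.1 k) (tnth p.2 k) q.1 q.2) | k < n].
have msq : mfunT sq.
 apply/measurable_fun_tnthP=> k.
 rewrite (_ : _ \o _ = fun p => let q := moebius_plane (repr (g k)) (tnth p.1 k, tnth p.2 k) in
  sqdist (tnth p.1 k) (tnth p.2 k) q.1 q.2); last by apply/funext=> p; rewrite /= tnth_mktuple.
 have mq := @measurable_moebius_plane R (repr (g k)).
 by rewrite /sqdist; meas.
rewrite (_ : (fun p => _) = (fun p => psi (to_row (sq p)) * ((\1_upper p)%:C * u (zpoint p)))).
 apply: cmeasM; last exact: cmeas_upper.
 exact: (cmeas_comp (cmeas_row spsi)).
apply/funext=> p; rewrite indicE; have [/set_mem up|_] := boolP (p \in upper); last by rewrite !mul0r mulr0.
rewrite !mul1r /class_fun point_pair_csq; congr (psi _ * _); apply/rowP=> k.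
rewrite [LHS]mxE [RHS]mxE tnth_mktuple /csq -zpoint_actT// !zpointE /=.
by rewrite /actT /= !tnth_mktuple.
Qed.

End hyperbolic_measure.

Arguments hypm {R}.

(** * The boundary action and conjugation invariance *)

Section boundary_action.
Variable R : realType.
Implicit Types (g h : PSL2 R) (A : 'M[R]_2).

(** The point [p : q] of the projective line. In homogeneous coordinates the boundary action is
    linear, and the case distinctions at infinity disappear. *)
Definition ratio (p q : R) : option R := if q == 0 then None else Some (p / q).

Lemma ratioZ c p q : c != 0 -> ratio (c * p) (c * q) = ratio p q.
Proof.
move=> c0; rewrite /ratio mulf_eq0 (negbTE c0) /=; case: eqP=> // q0.
by rewrite -mulf_div divff// mul1r.
Qed.

Lemma moebius_bd_ratio (A : SL2 R) p q : p != 0 \/ q != 0 ->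
 moebius_bd (\pi_(PSL2 R) A)%qT (ratio p q) =
 ratio (A 0 0 * p + A 0 1 * q) (A 1 0 * p + A 1 1 * q).
Proof.
move=> pq.
have key (B : SL2 R) (c : R) : c != 0 -> (forall i j, B i j = c * A i j) ->
  (let B := SL2_mx B in match ratio p q with
   | None => if B 1 0 == 0 then None else Some (B 0 0 / B 1 0)
   | Some t => if B 1 0 * t + B 1 1 == 0 then None
         else Some ((B 0 0 * t + B 0 1) / (B 1 0 * t + B 1 1)) end)
  = ratio (A 0 0 * p + A 0 1 * q) (A 1 0 * p + A 1 1 * q).
 move=> c0 BA; rewrite /= /ratio; have [q0|q0] := eqVneq q 0.
  have p0 : p != 0 by case: pq => //; rewrite q0 eqxx.
  rewrite q0 !mulr0 !addr0 -/(ratio _ _) -/(ratio (A 0 0 * p) _) -(ratioZ (A 0 0 * p) (A 1 0 * p) (mulf_neq0 c0 (invr_neq0 p0))) !BA.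
  by congr ratio; field.
 rewrite -/(ratio _ _) -/(ratio (A 0 0 * p + _) _) -(ratioZ (A 0 0 * p + A 0 1 * q) _ (mulf_neq0 c0 (invr_neq0 q0))) !BA.
 by congr ratio; field.
rewrite /moebius_bd; case/orP: (repr_sim A) => /eqP e.
 by apply: (key _ 1) => [|i j]; rewrite ?oner_eq0// e mul1r.
by apply: (key _ (-1)) => [|i j]; rewrite ?oppr_eq0 ?oner_eq0// e mxE mulN1r.
Qed.

Lemma ratio_surj (x : option R) : exists p q, (p != 0 \/ q != 0) /\ x = ratio p q.
Proof.
case: x => [t|]; last by exists 1, 0; rewrite /ratio eqxx oner_eq0; split=> //; left.
by exists t, 1; rewrite /ratio oner_eq0 divr1; split=> //; right.
Qed.

Lemma moebius_bd_mul g h x : moebius_bd (g * h)%g x = moebius_bd g (moebius_bd h x).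
Proof.
have [p [q [pq ->]]] := ratio_surj x; rewrite -[g]reprK -[h]reprK PSL2_mulE pi_mulE.
set A := repr g; set B := repr h; rewrite !moebius_bd_ratio//=; last first.
 have dB := SL2_detE B.
 have [e1|] := eqVneq (B 0 0 * p + B 0 1 * q) 0; last by left.
 have [e2|] := eqVneq (B 1 0 * p + B 1 1 * q) 0; last by right.
 exfalso; have p0 : p = 0.
  have : (B 0 0 * B 1 1 - B 0 1 * B 1 0) * p = B 1 1 * (B 0 0 * p + B 0 1 * q) - B 0 1 * (B 1 0 * p + B 1 1 * q) by ring.
  by rewrite e1 e2 dB mul1r !mulr0 subr0.
 have q0 : q = 0.
  have : (B 0 0 * B 1 1 - B 0 1 * B 1 0) * q = B 0 0 * (B 1 0 * p + B 1 1 * q) - B 1 0 * (B 0 0 * p + B 0 1 * q) by ring.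
  by rewrite e1 e2 dB mul1r !mulr0 subr0.
 by case: pq; rewrite ?p0 ?q0 eqxx.
by rewrite !mulmx22; congr ratio; ring.
Qed.

Lemma abs_trace_pi (A : SL2 R) : `|\tr (SL2_mx (repr (\pi_(PSL2 R) A)%qT))| = `|\tr (SL2_mx A)|.
Proof. by case/orP: (repr_sim A) => /eqP ->//; rewrite raddfN normrN. Qed.

Lemma abs_trace_conj g h : `|\tr (SL2_mx (repr (h^-1 * g * h)%g))| = `|\tr (SL2_mx (repr g))|.
Proof.
rewrite -[h]reprK; have [A ->] := PSL2_lift g; rewrite !PSL2_mulE PSL2_invE pi_invE !pi_mulE !abs_trace_pi /=.
by rewrite -mulmxA mxtrace_mulC -mulmxA mulmxV ?mulmx1//; exact: SL2_unit.
Qed.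

End boundary_action.

Section conjugates.
Variables (R : realType) (n : nat) (Gam : set (PSL2n R n)).
Hypothesis Gam_group : is_subgroup Gam.

Lemma act_bd_mul (g h : PSL2n R n) x : act_bd (g * h)%g x = act_bd g (act_bd h x).
Proof. by apply/ffunP=> k; rewrite !ffunE moebius_bd_mul. Qed.

(** With h rho in place of rho the conjugated group rho^-1 Gam rho is the same, hence also its
    translations and multipliers. *)
Lemma cusp_act kappa h : Gam h -> is_cusp Gam kappa -> is_cusp Gam (act_bd h kappa).
Proof.
have [_ Gm Gi] := Gam_group.
move=> Gh [rho [<- Lt Lm]]; exists (h * rho)%g; split; first exact: act_bd_mul.
 suff -> : transl_set Gam (h * rho)%g = transl_set Gam rho by [].
 apply/seteqP; split=> b [g Gg gb].
  exists (h^-1 * g * h)%g; first by apply: (Gm) => //; apply: (Gm) => //; exact: (Gi).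
  by rewrite -gb invgM !mulgA.
 exists (h * g * h^-1)%g; first by apply: (Gm); [exact: (Gm)|exact: (Gi)].
 by rewrite -gb invgM !mulgA !mulgVK.
suff e : mult_set Gam (h * rho)%g = mult_set Gam rho by move: Lm; rewrite /mult_set_iso e.
apply/seteqP; split=> b [b0 [g Gg gb]]; split=> //.
 exists (h^-1 * g * h)%g; first by apply: (Gm) => //; apply: (Gm) => //; exact: (Gi).
 by move: gb; rewrite invgM !mulgA.
exists (h * g * h^-1)%g; first by apply: (Gm); [exact: (Gm)|exact: (Gi)].
have -> : ((h * rho)^-1 * (h * g * h^-1) * (h * rho) = rho^-1 * g * rho)%g.
 by rewrite invgM !mulgA !mulgVK.
by [].
Qed.

Lemma conj_mixed g h : Gam h -> mixed Gam g -> mixed Gam (h^-1 * g * h)%g.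
Proof.
have [_ Gm Gi] := Gam_group.
move=> Gh [Gg [k hk] np nc].
have E j : (h^-1 * g * h)%g j = ((h j)^-1 * g j * h j)%g.
 by rewrite !mul_ffun_groupE inv_ffun_groupE.
split; first by apply: (Gm) => //; apply: (Gm) => //; exact: (Gi).
- by exists k; rewrite /hyperbolic E abs_trace_conj.
- move=> j [gj tj]; apply: (np j); split; last by move: tj; rewrite E abs_trace_conj.
 by move=> g1; apply: gj; rewrite E g1 mulg1 mulVg.
move=> kappa ck e; apply: (nc _ (cusp_act Gh ck)).
by rewrite -[X in _ = act_bd h X]e -!act_bd_mul !mulgA mulgV mul1g.
Qed.

Lemma conj_class_eq g h : Gam h -> conj_class Gam (h^-1 * g * h)%g = conj_class Gam g.
Proof.
have [_ Gm Gi] := Gam_group.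
move=> Gh; apply/seteqP; split=> _ [l Gl <-].
 by exists (h * l)%g; [exact: (Gm)|rewrite invgM !mulgA].
exists (h^-1 * l)%g; first by apply: (Gm) => //; exact: (Gi).
by rewrite invgM invgK !mulgA !mulgK.
Qed.

Lemma mixed_class_mixed X g : mixed_classes Gam X -> X g -> mixed Gam g /\ X = conj_class Gam g.
Proof.
by move=> [g0 mg0 <-] [h Gh <-]; split; [exact: conj_mixed|rewrite conj_class_eq].
Qed.

End conjugates.

Section measurable_domains.
Variables (R : realType) (n : nat).
Local Notation RT := (measurableTypeR R).
Local Notation T2 := (n.-tuple RT * n.-tuple RT)%type.

Lemma measurable_row_mul d (X : measurableType d) m l (v : X -> 'rV[R]_m) (B : 'M[R]_(m, l)) :
 (forall k, mfunT (fun x => v x 0 k)) ->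
 forall k, mfunT (fun x => (v x *m B) 0 k).
Proof.
move=> mv k; rewrite (_ : (fun x => _) = (fun x => \sum_j v x 0 j * B j k)).
 apply: measurable_sum => j; apply: measurable_funM => //.
by apply/funext=> x; rewrite mxE.
Qed.

(** Explicit linear coordinates replace the existential quantifier, so measurability reduces to
    finitely many equations and inequalities. *)
Lemma parallelotopeP m l (B : 'M[R]_(m, l)) v : row_free B -> parallelotope B v <->
 v *m pinvmx B *m B = v /\ forall i, 0 <= (v *m pinvmx B) 0 i < 1.
Proof.
move=> fB; split=> [[c hc ->]|[h1 h2]]; first by rewrite !mulmxKp.
by exists (v *m pinvmx B).
Qed.

Lemma measurable_parallelotope d (X : measurableType d) m l (v : X -> 'rV[R]_l) (B : 'M[R]_(m, l)) :
 row_free B -> (forall k, mfunT (fun x => v x 0 k)) ->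
 measurable [set x | parallelotope B (v x)].
Proof.
move=> fB mv.
have mc := measurable_row_mul (pinvmx B) mv; have mcB := measurable_row_mul B mc.
rewrite (_ : [set x | _] = (\bigcap_(k in [set: 'I_l]) [set x | (v x *m pinvmx B *m B) 0 k == v x 0 k]) `&`
  \bigcap_(i in [set: 'I_m]) [set x | (0 <= (v x *m pinvmx B) 0 i) && ((v x *m pinvmx B) 0 i < 1)]).
 apply: measurableI; apply: fin_bigcap_measurable => // k _; rewrite -[X in measurable X]setTI.
  by apply: (measurable_fun_eqr (mcB k) (mv k)) => //; exact: measurableT.
 by apply: (measurable_and (f := fun x => 0 <= (v x *m pinvmx B) 0 k) (g := fun x => (v x *m pinvmx B) 0 k < 1)) => //;
   [apply: measurable_fun_ler|apply: measurable_fun_ltr].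
apply/seteqP; split=> x /=.
 by move=> /(parallelotopeP _ fB)[/rowP h1 h2]; split=> k _ /=; [rewrite h1|exact: h2].
move=> [h1 h2]; apply/(parallelotopeP _ fB); split=> [|i]; last exact: h2.
by apply/rowP=> k; apply/eqP; exact: h1.
Qed.

Lemma measurable_compact_coords (K : set 'rV[R[i]]_n) : compact [set p | on_xy K p] ->
 measurable (coords K).
Proof.
move=> /compact_closed cK.
have -> : coords K = ~` (@to_xy R n @^-1` ~` [set p | on_xy K p]).
 by apply/seteqP; split=> p; rewrite /= on_xy_to; [move=> h; apply|move/contrapT].
apply: measurableC; apply: measurable_open_xy; apply: closed_openC; apply: cK.
exact: norm_hausdorff.
Qed.

Lemma coords_act (g : PSL2n R n) (D : set 'rV[R[i]]_n) : D `<=` @Hn R n ->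
 coords (act g @` D) = upper `&` (actT g^-1%g @^-1` coords D).
Proof.
move=> DH; apply/seteqP; split=> [p [z Dz zp]|p [up Dp]].
 have up : upper p by rewrite /upper /coords /= -zp; apply: act_Hn; exact: DH.
 split=> //; change (D (zpoint (actT g^-1%g p))); rewrite zpoint_actT// -[zpoint p]zp actK//; exact: DH.
exists (zpoint (actT g^-1%g p)) => //; rewrite -zpoint_actT; last exact/upper_actT.
by rewrite -{1}[g]invgK actTK.
Qed.

Lemma measurable_coords_act (g : PSL2n R n) (D : set 'rV[R[i]]_n) : D `<=` @Hn R n ->
 measurable (coords D) -> measurable (coords (act g @` D)).
Proof.
move=> DH mD; rewrite coords_act//; apply: measurableI; first exact: measurable_upper.
by rewrite -[X in measurable X]setTI; exact: measurable_actT.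
Qed.

Lemma measurable_tnth_im (k : 'I_n) : mfunT (fun p : T2 => tnth p.2 k).
Proof. exact: (measurableT_comp (measurable_tnth k) measurable_snd). Qed.

Lemma measurable_tnth_re (k : 'I_n) : mfunT (fun p : T2 => tnth p.1 k).
Proof. exact: (measurableT_comp (measurable_tnth k) measurable_fst). Qed.

Lemma measurable_vnorm_im : mfunT (fun p : T2 => vnorm (im (zpoint p))).
Proof.
rewrite (_ : (fun p => _) = (fun p : T2 => \prod_k tnth p.2 k)).
 by apply: measurable_prod => k _; exact: measurable_tnth_im.
by apply/funext=> p; apply: eq_bigr=> k _; rewrite mxE zpointE.
Qed.

Lemma measurable_cusp_piece (rho : PSL2n R n) (p : 'M[R]_n) (q : 'M[R]_(n.-1, n)) C :
 row_free p -> row_free q -> measurable (coords (cusp_piece rho p q C)).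
Proof.
move=> fp fq; apply: measurable_coords_act => [z []//|].
rewrite (_ : coords _ = upper `&` [set p | C < vnorm (im (zpoint p))] `&`
 [set t | parallelotope p (re (zpoint t))] `&`
 [set t | parallelotope q (\row_k ln (im (zpoint t) 0 k / (vnorm (im (zpoint t))) `^ (n%:R^-1)))]); last first.
 by apply/seteqP; split=> t; [case=> *; do !split=> //|move=> [[[]]]].
apply: measurableI; [apply: measurableI; [apply: measurableI; first exact: measurable_upper|]|].
- rewrite -[X in measurable X]setTI; apply: (measurable_fun_ltr (measurable_cst C) measurable_vnorm_im) => //.
- apply: measurable_parallelotope => // k.
 rewrite (_ : (fun x => _) = (fun p : T2 => tnth p.1 k)); first exact: measurable_tnth_re.
 by apply/funext=> t; rewrite mxE zpointE.
- apply: measurable_parallelotope => // k.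
 rewrite (_ : (fun x => _) = (fun p : T2 => ln (tnth p.2 k / (vnorm (im (zpoint p))) `^ (n%:R^-1)))); last first.
  by apply/funext=> t; rewrite mxE [im _ _ _]mxE zpointE.
 apply: (measurableT_comp (@measurable_ln R)) => //.
 apply: measurable_funM; first exact: measurable_tnth_im.
 apply: (measurableT_comp (@measurable_invr R)); apply: (measurableT_comp (measurable_powR _)) => //.
 exact: measurable_vnorm_im.
Qed.

End measurable_domains.

Section finite_support_sums.
Variables (R : realType) (I : choiceType).
Implicit Types (D A : set I).

Lemma esum_finite_lty D A (a : I -> \bar R) : finite_set A ->
 (forall i, D i -> 0 <= a i)%E -> (forall i, D i -> a i < +oo)%E ->
 (forall i, D i -> a i != 0 -> A i)%E -> (\esum_(i in D) a i < +oo)%E.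
Proof.
move=> fA a0 afin asupp.
have fDA : finite_set (D `&` A) by exact: finite_setIr.
rewrite (esumID A)// [X in (_ + X)%E]esum1; last first.
 by move=> i [Di nAi]; apply/eqP; apply: contra_notT nAi => /(asupp _ Di).
rewrite adde0 esum_fset//; last by move=> i; rewrite inE => -[Di _]; exact: a0.
rewrite fsbig_finite//= big_seq_cond; apply/lte_sum_pinfty => i.
by rewrite andbT in_fset_set// inE => -[Di _]; exact: afin.
Qed.

Lemma csummable_finite D A (f : I -> R[i]) : finite_set A ->
 (forall i, D i -> f i != 0 -> A i) -> csummable D f.
Proof.
move=> fA fs; apply: (esum_finite_lty (A := A)) => // [i Di|i Di].
 by rewrite abse_EFin ltry.
rewrite abse_EFin eqe normr_eq0 => h; apply: fs => //; apply: contraNneq h => ->.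
by rewrite ComplexField.Normc.normc0.
Qed.

(** Independence of the decomposition: if a and b are the sums of the positive and negative parts
    and P, Q those of p and q, then a + Q = b + P, with all terms finite. *)
Lemma rsum_diff D (f p q : I -> R) :
 (forall i, D i -> f i = p i - q i) -> (forall i, D i -> 0 <= p i) -> (forall i, D i -> 0 <= q i) ->
 (\esum_(i in D) (p i)%:E < +oo)%E -> (\esum_(i in D) (q i)%:E < +oo)%E ->
 rsum D f = fine (\esum_(i in D) (p i)%:E)%E - fine (\esum_(i in D) (q i)%:E)%E.
Proof.
move=> fE p0 q0 pfin qfin; rewrite /rsum.
set a := (\esum_(i in D) (Num.max (f i) 0)%:E)%E; set b := (\esum_(i in D) (Num.max (- f i) 0)%:E)%E.
set P := (\esum_(i in D) (p i)%:E)%E in pfin *; set Q := (\esum_(i in D) (q i)%:E)%E in qfin *.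
have m0 (x : R) : (0 <= (Num.max x 0)%:E)%E by rewrite lee_fin le_max lexx orbT.
have aP : (a <= P)%E.
 by apply: le_esum => i Di; rewrite lee_fin ge_max p0// fE// lerBlDr lerDl q0.
have bQ : (b <= Q)%E.
 by apply: le_esum => i Di; rewrite lee_fin ge_max q0// fE// opprB lerBlDr lerDl p0.
have afin : a \is a fin_num by rewrite ge0_fin_numE ?(le_lt_trans aP)//; apply: esum_ge0.
have bfin : b \is a fin_num by rewrite ge0_fin_numE ?(le_lt_trans bQ)//; apply: esum_ge0.
have Pf : P \is a fin_num by rewrite ge0_fin_numE//; apply: esum_ge0 => i /p0; rewrite lee_fin.
have Qf : Q \is a fin_num by rewrite ge0_fin_numE//; apply: esum_ge0 => i /q0; rewrite lee_fin.
have e : (a + Q = b + P)%E.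
 rewrite -(esumD (b := fun i => (q i)%:E))//.
 rewrite -(esumD (b := fun i => (p i)%:E))//.
 apply: eq_esum => i Di; rewrite -!EFinD fE//; congr (_%:E).
 case: (leP (p i) (q i)) => h.
  by rewrite max_r ?subr_le0// max_l ?oppr_ge0 ?subr_le0// opprB add0r subrK.
 by rewrite max_l ?subr_ge0 1?(ltW h)// max_r ?oppr_le0 ?subr_ge0 1?(ltW h)// subrK add0r.
have := congr1 fine e; rewrite !fineD ?fin_numN// fineN.
by move: (fine a) (fine b) (fine P) (fine Q) => *; lra.
Qed.

Lemma rsum_neq0 D (f : I -> R) : rsum D f != 0 -> exists2 i, D i & f i != 0.
Proof.
apply: contraNP=> H; have f0 i : D i -> f i = 0.
 by move=> Di; apply: contrapT => /eqP h; apply: H; exists i.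
by rewrite /rsum !esum1 ?sube0//= => i Di; rewrite f0 ?oppr0 ?maxxx.
Qed.

Lemma csum_neq0 D (f : I -> R[i]) : csum D f != 0 -> exists2 i, D i & f i != 0.
Proof.
move=> h; have [h1|h1] := eqVneq (rsum D (fun i => Re (f i))) 0; last first.
 have [i Di fi] := rsum_neq0 h1; exists i => //.
 by apply: contraNneq fi => ->.
have [h2|h2] := eqVneq (rsum D (fun i => Im (f i))) 0.
 by move: h; rewrite /csum h1 h2 eqxx.
have [i Di fi] := rsum_neq0 h2; exists i => //.
by apply: contraNneq fi => ->.
Qed.

Lemma eq_csum D (f h : I -> R[i]) : (forall i, D i -> f i = h i) -> csum D f = csum D h.
Proof.
move=> e; rewrite /csum /rsum; congr (fine _ +i* fine _);
 by congr (_ - _)%E; apply: eq_esum => i Di; rewrite e.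
Qed.

Lemma esum_unique D (B : set I) i0 : D i0 -> B i0 -> (forall i, D i -> B i -> i = i0) ->
 (\esum_(i in D) (\1_B i : R)%:E = 1)%E.
Proof.
move=> D0 B0 u; rewrite (esumID B)//.
rewrite [X in (_ + X)%E]esum1 ?adde0; last by move=> i [_ nB]; rewrite indicE memNset.
rewrite (_ : D `&` B = [set i0]); last first.
 by apply/seteqP; split=> i; [move=> [Di Bi]; exact: u|move=> ->].
by rewrite esum_set1 ?indicE ?mem_set// lee_fin.
Qed.

End finite_support_sums.

(** * Sums over conjugacy classes *)

Section class_integrals.
Variables (R : realType) (n : nat) (Gam : set (PSL2n R n)).
Hypotheses (n0 : (0 < n)%N)
 (Gam_group : is_subgroup Gam)
 (Gam_discrete : is_discrete Gam).
Variables (S : set {ffun 'I_n -> option R}) (sigma : {ffun 'I_n -> option R} -> PSL2n R n)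
 (P : {ffun 'I_n -> option R} -> 'M[R]_n).
Variables (Q : {ffun 'I_n -> option R} -> 'M[R]_(n.-1, n)) (C : R).
Hypotheses (S_finite : finite_set S)
 (S_complete : complete_cusps Gam S)
 (sigma_infty : forall kappa, S kappa ->
 act_bd (sigma kappa) (@infty R n) = kappa)
 (P_basis : forall kappa, S kappa ->
 lattice_basis (P kappa) (transl_set Gam (sigma kappa)))
 (Q_basis : forall kappa, S kappa ->
 lattice_basis (Q kappa) (log_mult_set Gam (sigma kappa)))
 (C0 : 0 < C)
 (C_separates : separated_pieces Gam S sigma P Q C).
Variable F0 : set 'rV[R[i]]_n.
Hypothesis F0_compact : compact [set p | on_xy F0 p].
Local Notation F := (fdomain S sigma P Q C F0).
Local Notation F_upto := (fdomain_upto S sigma P Q C F0).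
Hypotheses (F_fundamental : is_fundamental_domain Gam F)
 (F_volume : (hvol F < +oo)%E).
Variables (psi : 'rV[R]_n -> R[i]) (u : 'rV[R[i]]_n -> R[i]).
Hypotheses (psi_smooth : csmooth_on [set: 'rV[R]_n] psi)
 (psi_compact : compact_support psi)
 (u_smooth : csmooth_on (@upper_xy R n) (on_xy u))
 (u_invariant : forall g z, Gam g -> @Hn R n z -> u (act g z) = u z).
Local Notation RT := (measurableTypeR R).
Local Notation T2 := (n.-tuple RT * n.-tuple RT)%type.
Local Notation phi g := (class_fun psi u g).

Let F_Hn : F `<=` @Hn R n. Proof. by case: F_fundamental. Qed.
Let mF : measurable (coords F). Proof. by case: F_fundamental. Qed.

Lemma measurable_F_upto A : measurable (coords (F_upto A)).
Proof.
rewrite (_ : coords _ = coords F0 `|` \bigcup_(kappa in S) (coords (piece sigma P Q C kappa) `&`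
  [set p | vnorm (im (act (sigma kappa)^-1%g (zpoint p))) <= A])).
 apply: measurableU; first exact: measurable_compact_coords.
 apply: fin_bigcup_measurable => // kappa Sk.
 have [fP _] := P_basis Sk; have [fQ _] := Q_basis Sk.
 have mp := measurable_cusp_piece (sigma kappa) C fP fQ.
 rewrite (_ : _ `&` _ = coords (piece sigma P Q C kappa) `&`
  (upper `&` [set p | vnorm (im (zpoint (actT (sigma kappa)^-1%g p))) <= A])).
  apply: measurableI => //; apply: measurableI; first exact: measurable_upper.
  rewrite -[X in measurable X]setTI; apply: (measurable_fun_ler _ (measurable_cst A)) => //.
  by apply: (measurableT_comp (@measurable_vnorm_im R n)); exact: measurable_actT.
 apply/seteqP; split=> p [/= pp h]; have up : upper p.
 - by apply: F_Hn; right; exists kappa.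
 - by split=> //; split=> //; rewrite /= zpoint_actT.
 - by apply: F_Hn; right; exists kappa.
 - by case: h => _ h; split=> //; move: h; rewrite /= zpoint_actT.
by apply/seteqP; split=> p [Fp|[kappa Sk h]]; [left|right; exists kappa|left|right; exists kappa].
Qed.

Lemma upper_indic (D : set 'rV[R[i]]_n) (f : 'rV[R[i]]_n -> R[i]) p : D `<=` @Hn R n ->
 (\1_(coords D) p)%:C * f (zpoint p) = (\1_(coords D) p)%:C * ((\1_upper p)%:C * f (zpoint p)).
Proof.
move=> DH; rewrite !indicE; have [/set_mem Dp|_] := boolP (p \in coords D); last by rewrite !mul0r.
by rewrite mem_set ?mul1r//; exact: DH.
Qed.

Lemma cmeas_class (D : set 'rV[R[i]]_n) g : D `<=` @Hn R n -> measurable (coords D) ->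
 cmeas (fun p => (\1_(coords D) p)%:C * phi g (zpoint p)).
Proof.
move=> DH mD; rewrite (_ : (fun p => _) = (fun p => (\1_(coords D) p)%:C * ((\1_upper p)%:C * phi g (zpoint p)))).
 apply: cmeasM; first exact/cmeas_real/measurable_indic.
 exact: cmeas_class_fun.
by apply/funext=> p; exact: upper_indic.
Qed.

Lemma normc_nneg (z : R[i]) : 0 <= normc z.
Proof. by case: z => a b; exact: sqrtr_ge0. Qed.

Lemma normc_le_abs (z : R[i]) : normc z <= `|Re z| + `|Im z|.
Proof.
case: z => a b /=; have h : 0 <= `|a| + `|b| by exact: addr_ge0.
rewrite -[leRHS]ger0_norm// -sqrtr_sqr ler_wsqrtr// sqrrD !real_normK ?num_real//.
by rewrite -addrA lerD2l addrC lerDl mulrn_wge0// mulr_ge0.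
Qed.

Lemma bounded_on_boxes (f : 'rV[R]_n * 'rV[R]_n -> R) M : 1 <= M ->
 (forall q, @upper_xy R n q -> {for q, continuous f}) ->
 exists2 K : R, 0 <= K & forall z, in_boxes M z -> `|f (re z, im z)| <= K.
Proof.
move=> M1 cf.
pose B := [set q : 'rV[R]_n * 'rV[R]_n | (forall k, `|q.1 0 k| <= M) /\ (forall k, M^-1 <= q.2 0 k <= M)].
have cB : compact B.
 pose B1 := [set v : 'rV[R]_n | forall i, v ord0 i \in `[- M, M]].
 pose B2 := [set v : 'rV[R]_n | forall i, v ord0 i \in `[M^-1, M]].
 have c1 : compact B1.
  by apply: (@rV_compact _ _ (fun=> `[- M, M]%classic)) => _; exact: segment_compact.
 have c2 : compact B2.
  by apply: (@rV_compact _ _ (fun=> `[M^-1, M]%classic)) => _; exact: segment_compact.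
 rewrite (_ : B = B1 `*` B2); first exact: compact_setX.
 apply/seteqP; split=> q [h1 h2]; split=> k.
 - by rewrite in_itv /= -ler_norml; exact: h1.
 - by rewrite in_itv /=; exact: h2.
 - by have := h1 k; rewrite in_itv /= -ler_norml.
 - by have := h2 k; rewrite in_itv /=.
have Bup q : B q -> @upper_xy R n q.
 move=> [_ h2] k; rewrite /mkz mxE /=; have /andP[h _] := h2 k.
 by apply: lt_le_trans h; rewrite invr_gt0; lra.
have cfB : {within B, continuous f}.
 apply: continuous_in_subspaceT => q; rewrite inE => /Bup; exact: cf.
have [K0 [_ hK]] := compact_bounded (continuous_compact cfB cB).
exists (`|K0| + 1); first by rewrite addr_ge0.
move=> z hz; apply: hK; first by rewrite (le_lt_trans (ler_norm K0)) ?ltrDl.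
exists (re z, im z) => //; split=> k /=; rewrite mxE; have [h1 h2 h3] := hz k => //.
by rewrite h2.
Qed.

Lemma re_imK (z : 'rV[R[i]]_n) : mkz (fun k => re z 0 k) (fun k => im z 0 k) = z.
Proof. by apply/rowP=> k; rewrite !mxE; case: (z 0 k). Qed.

Lemma u_bounded M : 1 <= M -> exists2 K : R, 0 <= K & forall z, in_boxes M z -> normc (u z) <= K.
Proof.
move=> M1; have [sr si] := u_smooth.
have [K1 K10 h1] := @bounded_on_boxes (fun q => Re (on_xy u q)) M M1 (fun q uq => (sr [::] q uq).1).
have [K2 K20 h2] := @bounded_on_boxes (fun q => Im (on_xy u q)) M M1 (fun q uq => (si [::] q uq).1).
exists (K1 + K2); first exact: addr_ge0.
move=> z hz; apply: le_trans (normc_le_abs _) _.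
by have := h2 z hz; have := h1 z hz; rewrite /on_xy /= re_imK; exact: lerD.
Qed.

Lemma psi_bounded : exists2 K : R, 0 <= K & forall v, normc (psi v) <= K.
Proof.
have [sr si] := psi_smooth.
pose f (v : 'rV[R]_n) : R := `|Re (psi v)| + `|Im (psi v)|.
have cf : continuous f.
 have cr : continuous (fun v => Re (psi v)) by move=> v; have [] := sr [::] v I.
 have ci : continuous (fun v => Im (psi v)) by move=> v; have [] := si [::] v I.
 by move=> v; exact: (cvgD (cvg_norm (cr v)) (cvg_norm (ci v))).
have cfB : {within closure [set x | psi x != 0], continuous f} by exact: continuous_subspaceT.
have [K0 [_ hK]] := compact_bounded (continuous_compact cfB psi_compact).
exists (`|K0| + 1); first by rewrite addr_ge0.
move=> v; apply: le_trans (normc_le_abs _) _; rewrite -/(f v).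
have [p0|p0] := eqVneq (psi v) 0; first by rewrite /f p0 /= normr0 addr0 addr_ge0.
rewrite -[leLHS]ger0_norm ?addr_ge0//.
apply: hK; first by rewrite (le_lt_trans (ler_norm K0)) ?ltrDl.
by exists v => //; exact: subset_closure.
Qed.

(** [u] may grow in the cusps, but by [mixed_support] the product vanishes on F outside a bounded
    part, where continuity bounds [u]. *)
Lemma class_fun_bounded g : mixed Gam g -> exists2 K : R, 0 <= K & forall z, F z -> normc (phi g z) <= K.
Proof.
move=> mg.
have [A0 hA0] := mixed_support n0 Gam_group Gam_discrete S_complete sigma_infty P_basis Q_basis C0 C_separates F_Hn u psi_compact.
have [M M1 hM] := F_upto_boxes S_finite C0 F0_compact F_Hn A0.
have [K1 K10 h1] := psi_bounded; have [K2 K20 h2] := u_bounded M1.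
exists (K1 * K2); first exact: mulr_ge0.
move=> z Fz; have [->|nz] := eqVneq (phi g z) 0.
 by rewrite ComplexField.Normc.normc0 mulr_ge0.
rewrite /class_fun ComplexField.Normc.normcM ler_pM ?normc_nneg//.
 exact: h1.
by apply: h2; apply: hM; exact: hA0 nz.
Qed.

Lemma class_fun_cintegrable D g : mixed Gam g -> D `<=` F -> measurable (coords D) ->
 cintegrable (hypm n) setT (fun p => (\1_(coords D) p)%:C * phi g (zpoint p)).
Proof.
move=> mg DF mD; have DH := subset_trans DF F_Hn.
have [K K0 hK] := class_fun_bounded mg.
apply: (@cintegrable_bounded _ T2 R (hypm n) (coords F) K) => //.
- by rewrite -hvolE.
- exact: cmeas_class.
move=> p; rewrite !indicE; have [/set_mem Dp|_] := boolP (p \in coords D).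
 rewrite mem_set ?mul1r ?mulr1; first by apply: hK; exact: DF.
 exact: DF.
by rewrite mul0r ComplexField.Normc.normc0 mulr_ge0.
Qed.

Lemma class_fun_hintegrable D g : mixed Gam g -> D `<=` F -> measurable (coords D) ->
 hintegrable D (phi g).
Proof.
move=> mg DF mD; have DH := subset_trans DF F_Hn.
by apply/hintegrable_hypm => //; [exact: cmeas_class|exact: class_fun_cintegrable].
Qed.

(** All convergence and finiteness claims below reduce to this one finite set of group elements. *)
Let active := [set g | mixed Gam g /\ exists2 z, F z & phi g z != 0].
Let active_finite : finite_set active.
Proof.
exact: (mixed_finite n0 Gam_group Gam_discrete S_finite S_complete sigma_infty P_basis Q_basis C0 C_separates F0_compact F_Hn).
Qed.

Lemma hintegral_active D g : mixed Gam g -> D `<=` F -> hintegral D (phi g) != 0 -> active g.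
Proof.
move=> mg DF h; split=> //; apply: contrapT => H; move/negP: h; apply; apply/eqP.
have e : forall p, (coords D) p -> (dens p.2)%:C * phi g (mkz (tnth p.1) (tnth p.2)) = 0.
 move=> p Dp; suff -> : phi g (mkz (tnth p.1) (tnth p.2)) = 0 by rewrite mulr0.
 by apply/eqP; apply: contrapT => /negP nz; apply: H; exists (mkz (tnth p.1) (tnth p.2)) => //; exact: DF.
rewrite /hintegral /cintegral /Rintegral !integral0_eq//= => p Dp; by rewrite e.
Qed.

Lemma class_sum_cvg D X : mixed_classes Gam X -> D `<=` F -> measurable (coords D) ->
 class_sum_converges psi u D X.
Proof.
move=> mX DF mD; split=> [g Xg|].
 by have [mg _] := mixed_class_mixed Gam_group mX Xg; exact: class_fun_hintegrable.
apply: (csummable_finite active_finite) => g Xg h.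
by have [mg _] := mixed_class_mixed Gam_group mX Xg; exact: hintegral_active h.
Qed.

Lemma class_sum_active D X : mixed_classes Gam X -> D `<=` F -> class_sum psi u D X != 0 ->
 [set conj_class Gam g | g in active] X.
Proof.
move=> mX DF /csum_neq0[g Xg hg]; have [mg XE] := mixed_class_mixed Gam_group mX Xg.
by exists g => //; exact: hintegral_active hg.
Qed.

Lemma class_sums_summable D : D `<=` F -> csummable (mixed_classes Gam) (class_sum psi u D).
Proof.
move=> DF; apply: (csummable_finite (finite_image (conj_class Gam) active_finite)) => X mX.
exact: class_sum_active.
Qed.

Lemma active_classes_finite D : D `<=` F ->
 finite_set [set X | mixed_classes Gam X /\ class_sum psi u D X <> 0].
Proof.
move=> DF; apply: sub_finite_set (finite_image (conj_class Gam) active_finite) => X [mX /eqP h].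
exact: class_sum_active h.
Qed.

(** Beyond [A0] the truncation removes only points where every class function vanishes; [A0] serves
    all classes at once. *)
Lemma class_sum_eventually : exists A0, forall A, A0 <= A -> forall X, mixed_classes Gam X ->
 class_sum psi u (F_upto A) X = class_sum psi u F X.
Proof.
have [A0 hA0] := mixed_support n0 Gam_group Gam_discrete S_complete sigma_infty P_basis Q_basis C0 C_separates F_Hn u psi_compact.
exists A0 => A A0A X mX; apply: eq_csum => g Xg.
have [mg _] := mixed_class_mixed Gam_group mX Xg.
have FF : F_upto A `<=` F by exact: F_uptoF.
have mA := measurable_F_upto A.
rewrite !hintegral_hypm//; try exact: cmeas_class; last first.
 by apply: cmeas_class => //; exact: subset_trans F_Hn.
 exact: subset_trans F_Hn.
apply: eq_cintegral => p; rewrite !indicE.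
have [->|nz] := eqVneq (phi g (zpoint p)) 0; first by rewrite !mulr0.
congr (_%:C * _); congr ((_ : bool)%:R); apply/idP/idP; rewrite !inE; first exact: FF.
by move=> Fp; apply: (F_uptoS A0A); apply: hA0 nz.
Qed.

End class_integrals.

(** * Unfolding the sum over a conjugacy class *)

Section unfolding.
Variables (R : realType) (n : nat) (Gam : set (PSL2n R n)).
Hypotheses (Gam_group : is_subgroup Gam)
 (Gam_discrete : is_discrete Gam).
Variable F : set 'rV[R[i]]_n.
Hypothesis F_fundamental : is_fundamental_domain Gam F.
Local Notation RT := (measurableTypeR R).
Local Notation T2 := (n.-tuple RT * n.-tuple RT)%type.
Variable gam : PSL2n R n.
Hypothesis Ggam : Gam gam.
Variable D : set T2.
Hypotheses (mD : measurable D)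
 (D_cover : forall p, upper p -> exists2 c, centralizer Gam gam c & D (actT c p))
 (D_inj : forall p c c', upper p -> centralizer Gam gam c -> centralizer Gam gam c' ->
 D (actT c p) -> D (actT c' p) -> c = c').

Let F_Hn : F `<=` @Hn R n. Proof. by case: F_fundamental. Qed.
Let mF : measurable (coords F : set T2). Proof. by case: F_fundamental. Qed.

(** Translation by g^-1 turns the overlap of gF and g'F into that of F and (g^-1 g')F, which is null
    by the definition of a fundamental domain. *)
Lemma overlap_null g g' : Gam g -> Gam g' -> g <> g' ->
 (hypm n).-negligible (coords (act g @` F) `&` coords (act g' @` F) : set T2).
Proof.
have [_ Gm Gi] := Gam_group; have [_ _ _ Fdisj] := F_fundamental.
move=> Gg Gg' gg'; set N := _ `&` _.
have mN : measurable N.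
 by apply: measurableI; exact: measurable_coords_act.
exists N; split=> //.
have k1 : (g^-1 * g')%g <> 1%g by move=> /mulg1_eq; rewrite invgK.
have Gk : Gam (g^-1 * g')%g by apply: (Gm) => //; exact: (Gi).
have mK : measurable (coords (F `&` act (g^-1 * g')%g @` F) : set T2).
 by apply: measurableI => //; apply: measurable_coords_act.
have := Fdisj _ Gk k1; rewrite hvolE; last 2 first.
- by move=> z [/F_Hn].
- exact: mK.
move=> h0; rewrite -[RHS]h0.
have -> : hypm n N = (\int[hypm n]_p (\1_N p)%:E)%E by rewrite integral_indic// setIT.
rewrite (actT_invariant g); last 2 first.
- by apply/measurable_EFinP; exact: measurable_indic.
- by move=> p; rewrite lee_fin.
transitivity (\int[hypm n]_p ((\1_(coords (F `&` act (g^-1 * g')%g @` F)) p : R)%:E))%E; last first.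
 by rewrite integral_indic// setIT.
apply: eq_integral=> p _; congr (_%:E); rewrite !indicE; congr ((_ : bool)%:R).
apply/idP/idP; rewrite !inE.
 rewrite /N !coords_act// => -[[/upper_actT up]] /=.
 rewrite actTK// => Fp [_ h]; split=> //.
 change ((coords (act (g^-1 * g')%g @` F)) p); rewrite coords_act//; split=> //=.
 by rewrite invgM invgK actTM.
move=> h; have Fp : (coords F) p by case: h.
have : (coords (act (g^-1 * g')%g @` F)) p by case: h.
rewrite coords_act// => -[up /=]; rewrite invgM invgK actTM// => h'.
have ugp : upper (actT g p) by exact/upper_actT.
by rewrite /N !coords_act//; do 2 split=> //=; rewrite ?actTK.
Qed.

(** The group is countable, so off one null set a point lies in no two translates of F, and it lies
    in one because they cover. *)
Lemma tiling_ae : {ae hypm n, forall p : T2, upper p ->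
 (\esum_(g in Gam) (\1_(coords F) (actT g^-1%g p) : R)%:E = 1)%E}.
Proof.
have [e [surj [eJ einj]]] := countable_enum (countable_group Gam_group Gam_discrete).
pose N k l : set T2 := if (e k, e l) is (Some g, Some g') then
  (if g == g' then set0 else coords (act g @` F) `&` coords (act g' @` F)) else set0.
have : (hypm n).-negligible (\bigcup_k \bigcup_l N k l).
 apply: negligible_bigcup => k; apply: negligible_bigcup => l; rewrite /N.
 case ek: (e k) => [g|]; last exact: negligible_set0.
 case el: (e l) => [g'|]; last exact: negligible_set0.
 case: eqP=> [_|gg']; first exact: negligible_set0.
 by apply: overlap_null => //; [exact: eJ ek|exact: eJ el].
apply: negligibleS => p /= /not_implyP[up np].
apply: contrapT => H; apply: np.
have [_ _ Gi] := Gam_group; have [_ _ Fcov _] := F_fundamental.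
have [g Gg Fg] : exists2 g, Gam g & F (act g (zpoint p)) by apply: Fcov.
apply: (@esum_unique _ _ _ [set g : PSL2n R n | coords F (actT g^-1%g p)] g^-1%g).
- exact: Gi.
- by rewrite /= invgK; change (F (zpoint (actT g p))); rewrite zpoint_actT.
move=> h Gh /= Fh; apply: contrapT => hg; apply: H.
have [k ek] := surj _ Gh; have [l el] := surj _ (Gi _ Gg).
exists k => //; exists l => //; rewrite /N ek el; case: eqP=> // _; rewrite !coords_act//; split=> //; split=> //.
by rewrite /= invgK; change (F (zpoint (actT g p))); rewrite zpoint_actT.
Qed.

(** D is cut along the translates of F, and the elements g are grouped by the conjugate s = g^-1 gam
    g. Each fibre is a coset of the centralizer, and exactly one of its elements moves a given point
    into D, so the indicators of D sum to 1. *)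
Lemma ge0_unfold_class (W : PSL2n R n -> T2 -> R) :
 (forall s, mfunT (W s)) -> (forall s p, 0 <= W s p) ->
 (forall s p, ~ upper p -> W s p = 0) ->
 (forall g p, Gam g -> upper p -> W (g^-1 * gam * g)%g p = W gam (actT g p)) ->
 (\int[hypm n]_p (\1_D p * W gam p)%:E =
  \esum_(s in conj_class Gam gam) \int[hypm n]_p (W s p * \1_(coords F) p)%:E)%E.
Proof.
move=> mW W0 Wsupp Wconj; have [G1 Gm Gi] := Gam_group.
pose fib (s : PSL2n R n) : set (PSL2n R n) := [set g | Gam g /\ (g^-1 * gam * g)%g = s].
have GamE : Gam = \bigcup_(s in conj_class Gam gam) fib s.
 apply/seteqP; split=> [g Gg|g [s _ [Gg _]]//].
 by exists (g^-1 * gam * g)%g; [exists g|].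
have cG := countable_group Gam_group Gam_discrete.
have mG : mfunT (fun p => \1_D p * W gam p).
 by apply: measurable_funM => //; exact: measurable_indic.
rewrite (@ge0_unfold _ _ _ _ (hypm n) Gam (fun g => actT g) (fun g => actT g^-1%g) (coords F)) //.
- transitivity (\esum_(g in \bigcup_(s in conj_class Gam gam) fib s) (\int[hypm n]_x
            (\1_D (actT g x) * W gam (actT g x) * \1_(coords F) x)%:E)%E)%E.
  by rewrite -GamE.
 rewrite -GamE (@reindex_esum R _ _ (conj_class Gam gam `*`` fib) Gam snd); last first.
  split=> [[s g] [/= _ []]//|[s g] [t h] |g Gg].
   by rewrite !inE /= => -[/= _ [_ <-]] [/= _ [_ <-]] /= ->.
  by exists (g^-1 * gam * g, g)%g => //; split=> //=; exists g.
 rewrite -(@esum_esum R _ _ (conj_class Gam gam) fib (fun s g => \int[hypm n]_x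
   (\1_D (actT g x) * W gam (actT g x) * \1_(coords F) x)%:E))%E; last first.
  by move=> s g _ _; apply: integral_ge0 => p _; rewrite lee_fin !mulr_ge0.
 apply: eq_esum => s [g0 Gg0 g0s].
 have cf : countable (fib s) by apply: sub_countable cG; apply: subset_card_le => g [].
 transitivity (\esum_(g in fib s) \int[hypm n]_p (\1_D (actT g p) * (W s p * \1_(coords F) p))%:E)%E.
  apply: eq_esum => g [Gg gs]; apply: eq_integral=> p _; congr (_%:E); rewrite -mulrA; congr (_ * _).
  rewrite !indicE; case: (boolP (p \in coords F)); last by rewrite !mulr0.
  by rewrite inE => /F_Hn up; rewrite !mulr1 -gs Wconj.
 have mf g : mfunT (fun p => (\1_D (actT g p) * (W s p * \1_(coords F) p))%:E).
  apply/measurable_EFinP; apply: measurable_funM.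
   by apply: (measurableT_comp (measurable_indic mD)); exact: measurable_actT.
  by apply: measurable_funM => //; exact: measurable_indic.
 have f0 g p : (0 <= (\1_D (actT g p) * (W s p * \1_(coords F) p))%:E)%E.
  by rewrite lee_fin !mulr_ge0.
 have [_ <-] := ge0_integral_esum (hypm n) cf (fun g _ => mf g) f0.
 apply: eq_integral=> p _.
 have [wp|wp] := eqVneq (W s p * \1_(coords F) p) 0.
  by rewrite wp esum1// => g _; rewrite mulr0.
 have up : upper p.
  by apply: contrapT => np; move: wp; rewrite Wsupp// mul0r eqxx.
 have [c Cc Dc] := D_cover (p := actT g0 p) ((upper_actT g0 p).2 up).
 have e1 : (\esum_(g in fib s) (\1_D (actT g p) : R)%:E = 1)%E.
  have [Gc cgam] := Cc.
  apply: (@esum_unique _ _ _ [set g | D (actT g p)] (c * g0)%g).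
  - split; first exact: (Gm).
   rewrite -g0s invgM !mulgA; congr (_ * _)%g.
   by rewrite -!mulgA; congr (_ * _)%g; rewrite -cgam mulKg.
  - by rewrite /= actTM.
  move=> g [Gg gs] /= Dg.
  have Cg : centralizer Gam gam (g * g0^-1)%g.
   split; first by apply: (Gm) => //; exact: (Gi).
   move: gs; rewrite -g0s => /(congr1 (fun x => g * x * g0^-1)%g).
   by rewrite !mulgA mulgV mul1g !mulgK => ->.
  have := D_inj ((upper_actT g0 p).2 up) Cc Cg Dc _.
  rewrite -actTM// mulgVK => /(_ Dg) ->.
  by rewrite mulgVK.
 transitivity (\esum_(g in fib s) ((W s p * \1_(coords F) p)%:E * (\1_D (actT g p) : R)%:E))%E; last first.
  have [e [surj [eJ einj]]] := countable_enum cf.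
  move: e1; rewrite !(esum_enum surj eJ einj)//; try by move=> i; rewrite ?mule_ge0// lee_fin ?mulr_ge0.
  move=> e1; rewrite -[RHS]mule1 -e1 -nneseriesZl//; last first.
   by move=> k _; rewrite /opt_val; case: (e k) => //= i; rewrite lee_fin.
  by apply: eq_eseriesr => k _; rewrite /opt_val; case: (e k); rewrite ?mule0.
 by apply: eq_esum => g _; rewrite -EFinM mulrC.
- by move=> p; rewrite mulr_ge0.
- by move=> g; exact: measurable_actT.
- by move=> g; exact: measurable_actT.
- by move=> g h mh h0; exact: actT_invariant.
- move=> g p Gg h; apply: actTK; apply/(upper_actT g).
 by apply: contrapT => np; move: h; rewrite Wsupp// mulr0 eqxx.
have := tiling_ae; apply: filterS => p h wp; apply: h.
by apply: contrapT => np; move: wp; rewrite Wsupp// mulr0 eqxx.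
Qed.

(** The nonnegative case is applied to |r| and |r| + r, whose difference is r. The finite set A of
    contributing elements makes both sums finite, and this gives integrability over D. *)
Lemma unfold_class (r : PSL2n R n -> T2 -> R) (A : set (PSL2n R n)) :
 (forall s, mfunT (r s)) ->
 (forall s p, ~ upper p -> r s p = 0) ->
 (forall g p, Gam g -> upper p -> r (g^-1 * gam * g)%g p = r gam (actT g p)) ->
 finite_set A ->
 (forall s p, conj_class Gam gam s -> coords F p -> r s p != 0 -> A s) ->
 (forall s, conj_class Gam gam s -> (hypm n).-integrable setT (fun p => (\1_(coords F) p * r s p)%:E)) ->
 (hypm n).-integrable setT (fun p => (\1_D p * r gam p)%:E) /\
 rsum (conj_class Gam gam) (fun s => \int[hypm n]_p (\1_(coords F) p * r s p)) =
 \int[hypm n]_p (\1_D p * r gam p).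
Proof.
move=> mr rsupp rconj fA rA ri.
have mF1 : mfunT (\1_(coords F) : T2 -> R) by exact: measurable_indic.
have mD1 : mfunT (\1_D : T2 -> R) by exact: measurable_indic.
have key (w : PSL2n R n -> T2 -> R) : (forall s, mfunT (w s)) ->
  (forall s p, 0 <= w s p) -> (forall s p, r s p = 0 -> w s p = 0) ->
  (forall g p, Gam g -> upper p -> w (g^-1 * gam * g)%g p = w gam (actT g p)) ->
  (forall s, conj_class Gam gam s -> (hypm n).-integrable setT (fun p => (w s p * \1_(coords F) p)%:E)) ->
  [/\ (hypm n).-integrable setT (fun p => (\1_D p * w gam p)%:E),
   (\esum_(s in conj_class Gam gam) (\int[hypm n]_p (w s p * \1_(coords F) p))%:E =
    \int[hypm n]_p (\1_D p * w gam p)%:E)%E &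
   (\esum_(s in conj_class Gam gam) (\int[hypm n]_p (w s p * \1_(coords F) p))%:E < +oo)%E].
 move=> mw w0 wr wc wi.
 have E : (\esum_(s in conj_class Gam gam) (\int[hypm n]_p (w s p * \1_(coords F) p))%:E =
   \int[hypm n]_p (\1_D p * w gam p)%:E)%E.
  rewrite ge0_unfold_class//; last by move=> s p np; apply/wr/rsupp.
  by apply: eq_esum => s Xs; rewrite fineK// integrable_fin_num//; exact: wi.
 have L : (\esum_(s in conj_class Gam gam) (\int[hypm n]_p (w s p * \1_(coords F) p))%:E < +oo)%E.
  apply: (esum_finite_lty fA) => [s _|s _|s Xs]; first by rewrite lee_fin; apply: Rintegral_ge0 => p _; rewrite mulr_ge0.
   exact: ltry.
  apply: contraNP=> nA; apply/eqP; congr (_%:E); rewrite /Rintegral integral0_eq// => p _.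
  rewrite indicE; case: (boolP (p \in coords F)); last by rewrite mulr0.
  rewrite inE => Fp; rewrite wr ?mul0r//; apply/eqP; apply: contrapT => /negP h.
  by apply: nA; exact: rA h.
 split=> //; apply/integrableP; split; first by apply/measurable_EFinP; exact: measurable_funM.
 by under eq_integral do rewrite abse_EFin ger0_norm ?mulr_ge0//; rewrite -E.
have n0 (x : R) : 0 <= `|x| + x by rewrite addrC -lerBlDl sub0r -normrN ler_norm.
have iN s : conj_class Gam gam s -> (hypm n).-integrable setT (fun p => (`|r s p| * \1_(coords F) p)%:E).
 move=> /ri /integrable_abse; apply: eq_integrable => // p _.
 by rewrite /= normrM [X in X * _]ger0_norm// mulrC.
have iD s : conj_class Gam gam s -> (hypm n).-integrable setT (fun p => ((`|r s p| + r s p) * \1_(coords F) p)%:E).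
 move=> Xs; have := integrableD measurableT (iN s Xs) (ri s Xs); apply: eq_integrable => // p _.
 by rewrite /= -EFinD; congr (_%:E); ring.
have [|//||g p Gg up||I1 E1 L1] := key (fun s p => `|r s p|).
- by move=> s; exact: measurableT_comp.
- by move=> s p ->; rewrite normr0.
- by rewrite rconj.
- exact: iN.
have [|//||g p Gg up||I2 E2 L2] := key (fun s p => `|r s p| + r s p).
- by move=> s; apply: measurable_funD => //; exact: measurableT_comp.
- by move=> s p ->; rewrite normr0 addr0.
- by rewrite !rconj.
- exact: iD.
have dE p : (\1_D p * r gam p)%:E = ((\1_D p * (`|r gam p| + r gam p))%:E - (\1_D p * `|r gam p|)%:E)%E.
 by rewrite -EFinB; congr (_%:E); ring.
have I : (hypm n).-integrable setT (fun p => (\1_D p * r gam p)%:E).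
 by have := integrableB measurableT I2 I1; apply: eq_integrable => // p _; rewrite dE.
split=> //; rewrite (rsum_diff (p := fun s => \int[hypm n]_p ((`|r s p| + r s p) * \1_(coords F) p))
 (q := fun s => \int[hypm n]_p (`|r s p| * \1_(coords F) p)))//.
- rewrite E1 E2 -fineB ?integrable_fin_num// /Rintegral -integralB_EFin//.
 by congr fine; apply: eq_integral=> p _; rewrite dE.
- move=> s Xs; rewrite -RintegralB//; [|exact: iD|exact: iN].
 by congr fine; apply: eq_integral=> p _; congr (_%:E); ring.
- by move=> s _; apply: Rintegral_ge0 => p _; rewrite mulr_ge0.
- by move=> s _; apply: Rintegral_ge0 => p _; rewrite mulr_ge0.
Qed.

End unfolding.

(** * Polar coordinates adapted to dilations and rotations *)

Section polar_coordinates.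
Variable R : realType.
Implicit Types (q : R * R) (g h : PSL2 R) (b : bool).

Definition cpx q : R[i] := q.1 +i* q.2.

(** The boolean marks a hyperbolic coordinate (log-polar at the geodesic) as opposed to an elliptic
    one (geodesic polar at i). *)
Definition polar b q : R * R := if b then hyp_polar q else ell_polar q.

Definition polar_dom b (v : R) : Prop := b -> - (pi / 2) < v < pi / 2.

Definition polar_jac b q : R := if b then hpolar_jac q else ell_polar_jac q.

Lemma polar_im_gt0 b q : polar_dom b q.2 -> 0 < (polar b q).2.
Proof.
rewrite /polar /polar_dom; case: b => /= [/(_ isT) h|_].
 by rewrite mulr_gt0 ?expR_gt0// cos_gt0_pihalf.
by rewrite invr_gt0 ell_den_gt0.
Qed.

Lemma measurable_polar b : mfunT (polar b).
Proof. by case: b; [exact: measurable_hyp_polar|exact: measurable_ell_polar]. Qed.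

Lemma ge0_integral_polar_coord b (g : R * R -> \bar R) : mfunT g ->
 (forall p, 0 <= g p)%E ->
 (\int[(@lebesgue_measure R \x @lebesgue_measure R)]_p (g p * (hdens p)%:E) =
  \int[(@lebesgue_measure R \x @lebesgue_measure R)]_q (g (polar b q) * (polar_jac b q)%:E))%E.
Proof. by case: b => mg g0; [exact: ge0_integral_hyp_polar|exact: ge0_integral_ell_polar]. Qed.

(** Dilations and rotations about i are both translations of the first polar coordinate. This common
    form allows the hyperbolic and elliptic coordinates of the centralizer to be handled
    together. *)
Definition shifts b g t := forall q, polar_dom b q.2 ->
 moebius g (cpx (polar b q)) = cpx (polar b (q.1 + t, q.2)).

Lemma shifts1 b : shifts b 1%g 0.
Proof. by move=> [a v] h; rewrite moebius1 addr0. Qed.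

Lemma shiftsM b g h s t : shifts b g s -> shifts b h t -> shifts b (g * h)%g (s + t).
Proof.
move=> hg hh q hq; rewrite moebius_mul; last exact: polar_im_gt0.
by rewrite hh// hg// -addrA [t + s]addrC.
Qed.

Lemma shiftsV b g s : shifts b g s -> shifts b g^-1%g (- s).
Proof.
move=> hg q hq; have := hg (q.1 - s, q.2) hq; rewrite /= subrK => e.
have -> : polar b q = polar b (q.1, q.2) by rewrite -surjective_pairing.
by rewrite -e moebiusK//; apply: polar_im_gt0.
Qed.

Lemma shifts_dil e : 0 < e -> shifts true (psl2 (dil_mx e)) (ln e).
Proof.
move=> e0 q hq; rewrite moebius_dil// /cpx /polar /hyp_polar /= expRD lnK ?posrE//.
by apply: complex_eqP=> /=; ring.
Qed.

Lemma det_rot (t : R) : \det (rot_mx t) == 1.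
Proof. by rewrite det_mx2 mulrN opprK -!expr2 cos2Dsin2. Qed.

(** The hyperbolic circle of radius r about i is the Euclidean circle X^2 + (Y - cosh r)^2 = sinh^2
    r. *)
Lemma ell_circle (C S x y : R) : C ^+ 2 - S ^+ 2 = 1 -> x ^+ 2 + y ^+ 2 = 1 -> C - S * x != 0 ->
 (S * y / (C - S * x)) ^+ 2 = 2 * C * (C - S * x)^-1 - 1 - (C - S * x)^-1 ^+ 2.
Proof.
move=> cs c2 dn0.
have e : (S * y) ^+ 2 = (2 * C - (C - S * x)) * (C - S * x) - 1.
 apply/eqP; rewrite -subr_eq0; apply/eqP.
 transitivity (S ^+ 2 * (x ^+ 2 + y ^+ 2 - 1) - (C ^+ 2 - S ^+ 2 - 1)); first by ring.
 by rewrite cs c2; ring.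
by rewrite expr_div_n e; field.
Qed.

Lemma shifts_rot t : shifts false (psl2 (rot_mx t)) (- (2 * t)).
Proof.
move=> [th r] _; rewrite (psl2_pi (det_rot t)) /cpx /=.
rewrite moebius_xy; last by rewrite invr_gt0 ell_den_gt0.
rewrite /moebius_re /moebius_im /mdenom /= !mxE /=.
have hd := ell_den_gt0 r th; have hd' := ell_den_gt0 r (th - 2 * t).
have cs := cosh2_sinh2 r; have c1 := cos2Dsin2 t; have c2 := cos2Dsin2 th.
have ec : cos (th - 2 * t) = cos th * (cos t ^+ 2 - sin t ^+ 2) + 2 * sin th * sin t * cos t.
 by rewrite cosB mulr_natl mulr2n cosD sinD; ring.
have es : sin (th - 2 * t) = sin th * (cos t ^+ 2 - sin t ^+ 2) - 2 * cos th * sin t * cos t.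
 by rewrite sinB mulr_natl mulr2n cosD sinD; ring.
move: hd hd'; rewrite ec es.
move: (cosh r) (sinh r) (cos t) (sin t) (cos th) (sin th) cs c1 c2 => C S c s x y cs c1 c2 hd hd'.
set d := C - S * x in hd *; set d' := C - S * _ in hd' *.
have dn0 : d != 0 by rewrite gt_eqF.
have d'n0 : d' != 0 by rewrite gt_eqF.
have hX : (S * y / d) ^+ 2 = 2 * C * d^-1 - 1 - d^-1 ^+ 2.
 exact: ell_circle cs c2 dn0.
have hS : S * x = C - d by rewrite /d; ring.
(* This is |c - s z|^2 = d'/d for the denominators before and after the rotation. The difference is
   written as an explicit combination of the three relations between squares. *)
have key : (c * d - s * (S * y)) ^+ 2 + s ^+ 2 = d * d'.
 apply/eqP; rewrite -subr_eq0; apply/eqP.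
 transitivity (d * C * (c ^+ 2 + s ^+ 2 - 1) + s ^+ 2 * (S ^+ 2 * (x ^+ 2 + y ^+ 2 - 1) - (C ^+ 2 - S ^+ 2 - 1))).
  by rewrite /d /d'; ring.
 by rewrite cs c1 c2; ring.
clearbody d d'.
have dn : (- s * (S * y / d) + c) ^+ 2 + (- s * d^-1) ^+ 2 = d' / d.
 have -> : d' / d = (d * d') / d ^+ 2 by field.
 by rewrite -key; field.
rewrite dn; apply: complex_eqP=> /=; last by field; rewrite dn0 d'n0.
have -> : (c * (S * y / d) + s) * (- s * (S * y / d) + c) + c * - s * d^-1 ^+ 2 =
  (c ^+ 2 - s ^+ 2) * (S * y / d) + c * s * (1 - (S * y / d) ^+ 2 - d^-1 ^+ 2) by ring.
rewrite hX.
have -> : S * (y * (c ^+ 2 - s ^+ 2) - 2 * x * s * c) = S * y * (c ^+ 2 - s ^+ 2) - 2 * (S * x) * s * c by ring.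
by rewrite hS; field; rewrite dn0 d'n0.
Qed.

Lemma csq_dil N q : 0 < N -> polar_dom true q.2 ->
 csq (cpx (polar true q)) (moebius (psl2 (dil_mx N)) (cpx (polar true q))) = hyp_dist q.2 N.
Proof.
move=> N0 hq; rewrite moebius_dil// /csq /cpx /polar /hyp_polar /hyp_dist /sqdist /=.
have c0 : 0 < cos q.2 by apply: cos_gt0_pihalf; exact: hq.
have c1 := cos2Dsin2 q.2; have e0 := expR_gt0 q.1.
move: (expR q.1) (cos q.2) (sin q.2) c0 c1 e0 => e c s c0 c1 e0.
have -> : (e * s - (N * (e * s) - 0 * (e * c))) ^+ 2 + (e * c - (N * (e * c) + 0 * (e * s))) ^+ 2 =
  (N - 1) ^+ 2 * e ^+ 2 * (c ^+ 2 + s ^+ 2) by ring.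
by rewrite c1; field; rewrite !gt_eqF.
Qed.

Lemma csq_rot t q :
 csq (cpx (polar false q)) (moebius (psl2 (rot_mx t)) (cpx (polar false q))) = ell_dist q.2 t.
Proof.
case: q => th r; have hd := ell_den_gt0 r th.
rewrite (psl2_pi (det_rot t)) /cpx /polar /csq moebius_xy /= ?invr_gt0// sqdist_moebius_self ?invr_gt0//.
rewrite /= !mxE /= /ell_dist /=.
have cs := cosh2_sinh2 r; have c2 := cos2Dsin2 th.
move: hd cs c2; move: (cosh r) (sinh r) (cos t) (sin t) (cos th) (sin th) => C S c s x y hd cs c2.
have dn0 : C - S * x != 0 by rewrite gt_eqF.
have hX := ell_circle cs c2 dn0.
have Y0 : (C - S * x)^-1 != 0 by rewrite invr_neq0.
set Y := (C - S * x)^-1 in Y0 hX *; set X := S * y * Y in hX *; clearbody X Y.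
have -> : (- s * (X ^+ 2 - Y ^+ 2) + (c - c) * X - s) ^+ 2 + (2 * - s * X * Y + (c - c) * Y) ^+ 2 =
  s ^+ 2 * ((X ^+ 2 - Y ^+ 2 + 1) ^+ 2 + 4 * X ^+ 2 * Y ^+ 2) by ring.
rewrite hX (_ : (2 * S * s) ^+ 2 = 4 * (C ^+ 2 - 1) * s ^+ 2); last first.
 by rewrite (_ : C ^+ 2 - 1 = S ^+ 2); [ring|lra].
by field.
Qed.

End polar_coordinates.

Section log_radius.
Variable R : realType.

Definition log_radius (z : R[i]) : R := ln (Num.sqrt (Re z ^+ 2 + Im z ^+ 2)).

Lemma log_radius_scale e (z : R[i]) : 0 < e -> 0 < Im z ->
 log_radius (e%:C * z) = log_radius z + ln e.
Proof.
case: z => x y /= e0 y0; rewrite /log_radius /= !mul0r subr0 addr0.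
have s0 : 0 < x ^+ 2 + y ^+ 2 by rewrite ltr_wpDl ?sqr_ge0// exprn_gt0.
rewrite !exprMn -mulrDr sqrtrM ?sqr_ge0// sqrtr_sqr gtr0_norm//.
by rewrite lnM ?posrE ?sqrtr_gt0// addrC.
Qed.

Lemma log_radius_polar (q : R * R) : log_radius (cpx (polar true q)) = q.1.
Proof.
rewrite /log_radius /cpx /polar /hyp_polar /= !exprMn -mulrDr sin2cos2 subrK mulr1.
by rewrite sqrtr_sqr gtr0_norm ?expR_gt0// expRK.
Qed.

(** Both elements move the imaginary axis in the same way, and two of its points determine an
    element. *)
Lemma shifts_true_dil (g : PSL2 R) t : shifts true g t -> g = psl2 (dil_mx (expR t)).
Proof.
move=> hg; have e0 := expR_gt0 t.
have hd : shifts true (psl2 (dil_mx (expR t))) t by rewrite -[X in shifts _ _ X](expRK t); exact: shifts_dil.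
have d0 : polar_dom true (0 : R) by move=> _; rewrite oppr_lt0 divr_gt0 ?pi_gt0.
suff : ((psl2 (dil_mx (expR t)))^-1 * g)%g = 1%g by move=> /mulg1_eq; rewrite invgK.
have fx (a : R) : moebius ((psl2 (dil_mx (expR t)))^-1 * g)%g (cpx (polar true (a, 0))) = cpx (polar true (a, 0)).
 have i0 := @polar_im_gt0 R true (a, 0) d0.
 by rewrite moebius_mul// (hg (a, 0) d0) -(hd (a, 0) d0) moebiusK.
apply: (moebius_fix2 _ _ _ (fx 0) (fx 1)); try exact: polar_im_gt0.
move=> /(congr1 log_radius); rewrite !log_radius_polar /= => /eqP.
by rewrite eq_sym oner_eq0.
Qed.

Lemma measurable_log_radius d (X : measurableType d) (x y : X -> R) :
 mfunT x -> mfunT y ->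
 mfunT (fun t => log_radius (x t +i* y t)).
Proof.
move=> mx my; apply: (measurableT_comp (@measurable_ln R)).
by meas.
Qed.

End log_radius.

(** * The lattice of the centralizer *)

Section centralizer_lattice.
Variables (R : realType) (n m : nat) (Gam : set (PSL2n R n)).
Hypotheses (Gam_group : is_subgroup Gam)
 (Gam_discrete : is_discrete Gam).
Variables (gam rho : PSL2n R n) (h : 'I_m -> 'I_n).
Hypothesis h_inj : injective h.
Variables (gens : 'I_m -> PSL2n R n) (Ng : 'I_m -> 'I_m -> R).
Hypotheses (gens_basis : free_abelian_basis (centralizer Gam gam) gens)
 (gens_hyp : forall i j, 0 < Ng i j /\
 (rho^-1 * gens i * rho)%g (h j) = psl2 (dil_mx (Ng i j)))
 (gens_ell : forall i k, k \notin codom h ->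
 exists phi, (rho^-1 * gens i * rho)%g k = psl2 (rot_mx phi)).
Local Notation RT := (measurableTypeR R).
Local Notation T2 := (n.-tuple RT * n.-tuple RT)%type.
Local Notation hk := (fun k => k \in codom h).
Local Notation B := (\matrix_(i, j) ln (Ng i j)).

(** After conjugation by rho each generator is a vector of shifts: ln [Ng] in the hyperbolic
    coordinates and -2 phi in the elliptic ones. *)
Lemma period_vectors : exists tau : 'I_m -> 'I_n -> R,
 (forall i k, shifts (k \in codom h) ((rho^-1 * gens i * rho)%g k) (tau i k)) /\
 forall i j, tau i (h j) = ln (Ng i j).
Proof.
suff /choice[tau ht] : forall i, exists tau : 'I_n -> R, (forall k, shifts (k \in codom h) ((rho^-1 * gens i * rho)%g k) (tau k)) /\
 forall j, tau (h j) = ln (Ng i j).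
 by exists tau; split=> [i k|i j]; case: (ht i).
move=> i; suff /choice[tau ht] : forall k, exists t, shifts (k \in codom h) ((rho^-1 * gens i * rho)%g k) t /\
  forall j, h j = k -> t = ln (Ng i j).
 by exists tau; split=> [k|j]; [case: (ht k)|case: (ht (h j)) => _ /(_ j erefl)].
move=> k; have [hkk|hkk] := boolP (k \in codom h); last first.
 have [phi ->] := gens_ell i hkk; exists (- (2 * phi)); split; first exact: shifts_rot.
 by move=> j hj; move: hkk; rewrite -hj codom_f.
have /codomP[j kj] := hkk; exists (ln (Ng i j)); split.
 by rewrite kj; have [N0 ->] := gens_hyp i j; exact: shifts_dil.
by move=> j'; rewrite kj => /h_inj ->.
Qed.

Lemma conj_mul (g g' : PSL2n R n) : (rho^-1 * (g * g') * rho = (rho^-1 * g * rho) * (rho^-1 * g' * rho))%g.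
Proof. by rewrite !mulgA mulgK. Qed.

Lemma conj_inv (g : PSL2n R n) : (rho^-1 * g^-1 * rho = (rho^-1 * g * rho)^-1)%g.
Proof. by rewrite !invgM invgK mulgA. Qed.

Lemma conj_one : (rho^-1 * 1 * rho = 1 :> PSL2n R n)%g.
Proof. by rewrite mulg1 mulVg. Qed.

Lemma shifts_zpow b (k : 'I_n) (g : PSL2n R n) t (a : int) : shifts b ((rho^-1 * g * rho)%g k) t ->
 shifts b ((rho^-1 * zpow g a * rho)%g k) (a%:~R * t).
Proof.
have pw (l : nat) : shifts b ((rho^-1 * g * rho)%g k) t -> shifts b ((rho^-1 * g ^+ l * rho)%g k) (l%:R * t).
 move=> hg; elim: l => [|l IH].
  by rewrite expg0 conj_one one_ffun_groupE mul0r; exact: shifts1.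
 by rewrite expgS conj_mul mul_ffun_groupE -nat1r mulrDl mul1r; exact: shiftsM.
case: a => [l|l] hg /=; first exact: pw.
rewrite conj_inv inv_ffun_groupE NegzE rmorphN mulNr; apply: shiftsV; exact: pw.
Qed.

Definition word (a : 'rV[int]_m) : PSL2n R n := (\prod_(i < m) zpow (gens i) (a ord0 i))%g.

Lemma shifts_word tau (a : 'rV[int]_m) k :
 (forall i k, shifts (k \in codom h) ((rho^-1 * gens i * rho)%g k) (tau i k)) ->
 shifts (k \in codom h) ((rho^-1 * word a * rho)%g k) (\sum_i (a 0 i)%:~R * tau i k).
Proof.
move=> ht; rewrite /word; elim: (index_enum 'I_m) => [|i s IH].
 by rewrite !big_nil conj_one one_ffun_groupE; exact: shifts1.
by rewrite !big_cons conj_mul mul_ffun_groupE; apply: shiftsM => //; exact: shifts_zpow.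
Qed.

Lemma centralizer_word a : centralizer Gam gam (word a).
Proof.
have [G1 Gm Gi] := Gam_group; have [gC _ _] := gens_basis.
have C1 : centralizer Gam gam 1%g by split; rewrite ?mulg1 ?mul1g.
have CM g g' : centralizer Gam gam g -> centralizer Gam gam g' -> centralizer Gam gam (g * g')%g.
 by move=> [Gg cg] [Gg' cg']; split; [exact: (Gm)|rewrite -mulgA cg' mulgA cg mulgA].
have CV g : centralizer Gam gam g -> centralizer Gam gam g^-1%g.
 move=> [Gg cg]; split; first exact: (Gi).
 by apply: (mulgI g); rewrite !mulgA mulgV mul1g cg mulgK.
have CX g l : centralizer Gam gam g -> centralizer Gam gam (g ^+ l)%g.
 by move=> Cg; elim: l => [//|l IH]; rewrite expgS; exact: CM.
rewrite /word; elim: (index_enum 'I_m) => [|i s IH]; first by rewrite big_nil.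
rewrite big_cons; apply: (CM) => //; case: (a ord0 i) => l /=; first exact: CX.
by apply: (CV); exact: CX.
Qed.

Lemma word_inj : injective word.
Proof.
move=> a a' e; have [_ _ u] := gens_basis; have [b [_ ub]] := u _ (centralizer_word a).
by rewrite -(ub a erefl) -(ub a' e).
Qed.

Lemma word_surj g : centralizer Gam gam g -> exists a, g = word a.
Proof. by move=> Cg; have [_ _ u] := gens_basis; have [a [ga _]] := u _ Cg; exists a. Qed.

Lemma word_log (a : 'rV[int]_m) j : \sum_i (a 0 i)%:~R * ln (Ng i j) = (map_mx intr a *m B) 0 j :> R.
Proof. by rewrite mxE; apply: eq_bigr=> i _; rewrite !mxE. Qed.

Lemma hyp_polar_base (t : R) : cpx (polar true (t, 0)) = 0 +i* expR t.
Proof. by rewrite /cpx /polar /hyp_polar /= sin0 cos0 mulr0 mulr1. Qed.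

Lemma ell_polar_base (t : R) : cpx (polar false (t, 0)) = 0 +i* 1.
Proof. by rewrite /cpx /polar /ell_polar /= /sinh /cosh oppr0 expR0 subrr !mul0r subr0 divff ?invr1// pnatr_eq0. Qed.

(* A relation between the period vectors with real coefficients gives, by rounding its
  multiples, infinitely many elements moving a point by a bounded distance. *)
Lemma period_matrix_free : row_free B.
Proof.
rewrite -kermx_eq0; apply/negPn/negP=> /rowV0Pn[c /sub_kermxP cB c0].
have [i0 ci0] : exists i, c 0 i != 0.
 apply: contrapT => H; move/negP: c0; apply; apply/eqP/rowP=> i; rewrite [RHS]mxE.
 by apply/eqP; apply: contrapT => /negP ci; apply: H; exists i.
have [tau [ht htau]] := period_vectors.
(* The rounded multiples of the relation [c]. Since c B = 0, only the rounding errors contribute to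
   their image under B, which stays bounded by K. *)
pose p (q : nat) : 'rV[int]_m := \row_i Num.floor (q%:R * c 0 i).
pose K := \sum_i \sum_j `|(B : 'M[R]_m) i j|.
have K0 : 0 <= K by do 2 (apply: sumr_ge0 => ? _).
have bnd q j : `|\sum_i (p q 0 i)%:~R * ln (Ng i j)| <= K.
 have -> : \sum_i (p q 0 i)%:~R * ln (Ng i j) = \sum_i ((p q 0 i)%:~R - q%:R * c 0 i) * B i j.
  rewrite [RHS](eq_bigr (fun i => (p q 0 i)%:~R * ln (Ng i j) - q%:R * (c 0 i * B i j))); last first.
   by move=> i _; rewrite !mxE; ring.
  rewrite sumrB -mulr_sumr (_ : \sum_i c 0 i * B i j = 0) ?mulr0 ?subr0//.
  by move/rowP: cB => /(_ j); rewrite !mxE.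
 apply: le_trans (ler_norm_sum _ _ _) _; apply: ler_sum => i _.
 rewrite (bigD1 j)//= normrM; apply: le_trans (_ : `|(B : 'M[R]_m) i j| <= _); last first.
  by rewrite lerDl sumr_ge0.
 rewrite ler_piMl// [p q 0 i]mxE; have /andP[f1 f2] := floor_itv (q%:R * c 0 i).
 by rewrite ler_norml; move: f2; rewrite rmorphD /= => f2; apply/andP; split; lra.
pose w0 : 'rV[R[i]]_n := \row_k (0 +i* 1).
have w0b : in_boxes 1 w0.
 by move=> k; rewrite mxE /=; split; rewrite ?normr0 ?invr1.
have w0H : @Hn R n w0 by move=> k; rewrite mxE /= ltr01.
have [M M1 hM] := act_boxes rho (lexx 1).
have d0 b : polar_dom b (0 : R) by move=> _; rewrite oppr_lt0 divr_gt0 ?pi_gt0.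
(* A dilation by e^t with |t| <= K displaces i by e^t + e^-t - 2, which is at most 2 e^K; the
   rotations fix i. *)
have NN : 0 <= 2 * expR K by rewrite mulr_ge0// expR_ge0.
have fr : finite_set (range (fun q => word (p q))).
 apply: sub_finite_set (finite_close Gam_group Gam_discrete M1 NN) => _ [q _ <-].
 have [Gw _] := centralizer_word (p q); split=> //.
 exists (act rho w0) => [|k]; first exact: hM.
 have -> : act (word (p q)) (act rho w0) = act rho (act (rho^-1 * word (p q) * rho)%g w0).
  by rewrite -!act_mul// !mulgA mulgV mul1g.
 rewrite csq_act//; last exact: act_Hn.
 have := @shifts_word tau (p q) k ht; rewrite [w0 0 k]mxE [act _ _ 0 k]mxE [w0 0 k]mxE.
 have [hkk|hkk] := boolP (k \in codom h) => sh.
  have /codomP[j kj] := hkk.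
  have := sh (0, 0) (d0 true); rewrite !hyp_polar_base expR0 => -> /=.
  rewrite add0r (eq_bigr (fun i => (p q 0 i)%:~R * ln (Ng i j))); last by move=> i _; rewrite kj htau.
  have := bnd q j; move: (\sum_i _) => t; rewrite ler_norml => /andP[t1 t2].
  rewrite /csq /sqdist /= subrr expr0n add0r mul1r ler_pdivrMr ?expR_gt0//.
  have e1 : expR t <= expR K by rewrite ler_expR.
  have e2 : 1 <= expR K * expR t by rewrite -expRD -expR0 ler_expR; lra.
  have e3 := expR_gt0 t; have e4 := expR_gt0 K.
  by rewrite sqrrB expr1n mul1r; nra.
 have := sh (0, 0) (d0 false); rewrite !ell_polar_base => -> /=.
 by rewrite /csq /sqdist /= !subrr expr0n addr0 mul0r.
have fp : finite_set (range p).
 have : finite_set (word @` range p) by rewrite -image_comp in fr.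
 by rewrite (eq_finite_set (inj_card_eq (in2W word_inj))).
have /finite_seqP[s rs] := fp.
pose L : R := \sum_(a <- s) `|(a 0 i0)%:~R|.
have hL q : `|(p q 0 i0)%:~R| <= L.
 have : p q \in s by have : (range p) (p q) by []; rewrite rs.
 move=> ps; rewrite /L (big_rem _ ps) /= lerDl sumr_ge0// .
have L0 : 0 <= L by apply: le_trans (hL 0%N).
have cpos : 0 < `|c 0 i0| by rewrite normr_gt0.
(* For this multiple the entry [i0] of the rounded vector exceeds the common bound L of the finitely
   many vectors. *)
pose q := (Num.truncn ((L + 1) / `|c 0 i0|)).+1.
have : L + 1 < q%:R * `|c 0 i0| by rewrite -ltr_pdivrMr// truncnS_gt.
have := hL q; rewrite [p q 0 i0]mxE; have /andP[f1 f2] := floor_itv (q%:R * c 0 i0).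
move: f2; rewrite rmorphD /= => f2 h1 h2.
have : `|q%:R * c 0 i0| <= `|(Num.floor (q%:R * c 0 i0))%:~R| + 1.
 rewrite -[q%:R * c 0 i0 in leLHS](subrK ((Num.floor (q%:R * c 0 i0))%:~R)) addrC.
 apply: le_trans (ler_normD _ _) _; rewrite lerD2l ger0_norm; lra.
by rewrite normrM normr_nat; lra.
Qed.

(** A fundamental domain of the centralizer: after moving back by rho, only the log radii of the
    hyperbolic coordinates are restricted. *)
Definition period_tile : set T2 := [set p | upper p /\
 parallelotope B (\row_j log_radius (zpoint (actT rho^-1%g p) 0 (h j)))].

Lemma measurable_period_tile : measurable period_tile.
Proof.
apply: measurableI; first exact: measurable_upper.
apply: measurable_parallelotope => [|j]; first exact: period_matrix_free.
rewrite (_ : (fun x => _) = (fun p => log_radius (tnth (actT rho^-1%g p).1 (h j) +i* tnth (actT rho^-1%g p).2 (h j)))); last first.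
 by apply/funext=> p; rewrite mxE zpointE.
apply: measurable_log_radius.
 by apply: (measurableT_comp (measurable_tnth_re (h j))); exact: measurable_actT.
by apply: (measurableT_comp (measurable_tnth_im (h j))); exact: measurable_actT.
Qed.

Lemma log_radius_word a (p : T2) : upper p ->
 \row_j log_radius (zpoint (actT rho^-1%g (actT (word a) p)) 0 (h j)) =
 \row_j log_radius (zpoint (actT rho^-1%g p) 0 (h j)) + map_mx intr a *m B.
Proof.
move=> up; have [tau [ht htau]] := period_vectors.
have e : actT rho^-1%g (actT (word a) p) = actT (rho^-1 * word a * rho)%g (actT rho^-1%g p).
 by rewrite -!(actTM _ _ up) mulgK.
have ur : upper (actT rho^-1%g p) by exact/upper_actT.
apply/rowP=> j; rewrite e zpoint_actT// [LHS]mxE [act _ _ _ _]mxE [RHS]mxE [X in _ = X + _]mxE.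
have := @shifts_word tau a (h j) ht; rewrite codom_f => /shifts_true_dil ->.
have i0 : 0 < Im (zpoint (actT rho^-1%g p) 0 (h j)) by exact: ur.
rewrite moebius_dil ?expR_gt0// (log_radius_scale (expR_gt0 _) i0).
by rewrite expRK -word_log; congr (_ + _); apply: eq_bigr=> i _; rewrite htau.
Qed.

Lemma period_tile_cover p : upper p -> exists2 c, centralizer Gam gam c & period_tile (actT c p).
Proof.
move=> up; set l := \row_j log_radius (zpoint (actT rho^-1%g p) 0 (h j)).
have uB : (B : 'M[R]_m) \in unitmx by rewrite -row_free_unit; exact: period_matrix_free.
have [a ha] := floor_shift (l *m invmx B).
exists (word a); first exact: centralizer_word.
split; first exact/upper_actT.
rewrite log_radius_word// -/l; exists (l *m invmx B + map_mx intr a); first exact: ha.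
by rewrite mulmxDl mulmxKV.
Qed.

Lemma period_tile_inj p c c' : upper p -> centralizer Gam gam c -> centralizer Gam gam c' ->
 period_tile (actT c p) -> period_tile (actT c' p) -> c = c'.
Proof.
move=> up /word_surj[a ->] /word_surj[a' ->] [_]; rewrite log_radius_word//.
set l := \row_j log_radius _; move=> [x hx xe] [_]; rewrite log_radius_word// -/l => -[x' hx' xe'].
congr word.
have e : (map_mx intr a - map_mx intr a' : 'rV[R]_m) = x - x'.
 apply: (row_free_inj period_matrix_free); rewrite !mulmxBl -xe -xe'.
 by rewrite opprD addrACA subrr add0r.
apply/rowP=> i; have := hx i; have := hx' i; move/rowP: e => /(_ i); rewrite !mxE => e h1 h2.
apply/eqP; rewrite -subr_eq0 -absz_eq0 -leqn0 -ltnS -ltz_nat abszE.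
rewrite -(ltr_int R) intr_norm rmorphB /= e ltr_norml; apply/andP; split; lra.
Qed.

End centralizer_lattice.

(** * Complex derivatives and the chain rule *)

Section complex_derivatives.
Variable R : realType.
Implicit Types (f g : R -> R[i]) (t : R) (d e : R[i]).

Definition cis_derive f t d : Prop :=
 is_derive t (1 : R) (fun s => Re (f s)) (Re d) /\
 is_derive t (1 : R) (fun s => Im (f s)) (Im d).

Lemma eq_cis_derive f t d e : d = e -> cis_derive f t d -> cis_derive f t e.
Proof. by move=> ->. Qed.

Lemma cis_derive_cst (c : R[i]) t : cis_derive (fun _ => c) t 0.
Proof. by split; apply: is_derive_cst. Qed.

Lemma cis_deriveD f g t d e : cis_derive f t d -> cis_derive g t e ->
 cis_derive (fun s => f s + g s) t (d + e).
Proof.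
move=> [f1 f2] [g1 g2]; split.
 rewrite (_ : (fun s => _) = (fun s => Re (f s)) + (fun s => Re (g s))); last first.
  by apply/funext=> s; rewrite !fctE; case: (f s); case: (g s).
 by apply: (is_derive_eq (is_deriveD f1 g1)); case: d {f1 f2}; case: e {g1 g2}.
rewrite (_ : (fun s => _) = (fun s => Im (f s)) + (fun s => Im (g s))); last first.
 by apply/funext=> s; rewrite !fctE; case: (f s); case: (g s).
by apply: (is_derive_eq (is_deriveD f2 g2)); case: d {f1 f2}; case: e {g1 g2}.
Qed.

Lemma cis_deriveM f g t d e : cis_derive f t d -> cis_derive g t e ->
 cis_derive (fun s => f s * g s) t (d * g t + f t * e).
Proof.
move=> [f1 f2] [g1 g2]; split.
 rewrite (_ : (fun s => _) = (fun s => Re (f s)) * (fun s => Re (g s)) - (fun s => Im (f s)) * (fun s => Im (g s))); last first.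
  by apply/funext=> s; rewrite !fctE; case: (f s); case: (g s).
 apply: (is_derive_eq (is_deriveB (is_deriveM f1 g1) (is_deriveM f2 g2))); rewrite /GRing.scale /=.
 by case: d {f1 f2} => d1 d2; case: e {g1 g2} => e1 e2; case: (f t) => a b; case: (g t) => p q /=; ring.
rewrite (_ : (fun s => _) = (fun s => Re (f s)) * (fun s => Im (g s)) + (fun s => Im (f s)) * (fun s => Re (g s))); last first.
 by apply/funext=> s; rewrite !fctE; case: (f s); case: (g s).
apply: (is_derive_eq (is_deriveD (is_deriveM f1 g2) (is_deriveM f2 g1))); rewrite /GRing.scale /=.
by case: d {f1 f2} => d1 d2; case: e {g1 g2} => e1 e2; case: (f t) => a b; case: (g t) => p q /=; ring.
Qed.

Lemma complex_neq0 (z : R[i]) : z != 0 -> Re z ^+ 2 + Im z ^+ 2 != 0.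
Proof.
case: z => x y; apply: contraNN => /=; rewrite paddr_eq0 ?sqr_ge0// !sqrf_eq0.
by move=> /andP[/eqP -> /eqP ->].
Qed.

Lemma complex_invE (z : R[i]) : z^-1 =
 (Re z / (Re z ^+ 2 + Im z ^+ 2)) +i*
 (- Im z / (Re z ^+ 2 + Im z ^+ 2)).
Proof.
have [->|z0] := eqVneq z 0; first by rewrite invr0 /= mul0r oppr0 mul0r.
apply: (mulIf z0); rewrite mulVf//; have := complex_neq0 z0; case: z {z0} => x y /= n0.
by apply: complex_eqP=> /=; field.
Qed.

Lemma cis_deriveV f t d : f t != 0 -> cis_derive f t d ->
 cis_derive (fun s => (f s)^-1) t (- d * (f t)^-1 ^+ 2).
Proof.
move=> ft0 [f1 f2]; have := complex_neq0 ft0.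
pose q := (fun s => Re (f s)) * (fun s => Re (f s)) +
     (fun s => Im (f s)) * (fun s => Im (f s)).
have qE s : q s = Re (f s) ^+ 2 + Im (f s) ^+ 2 by rewrite /q !fctE -!expr2.
have dq := is_deriveD (is_deriveM f1 f1) (is_deriveM f2 f2).
rewrite -qE => n0; have dqi := is_deriveV n0 dq.
have e1 := is_deriveM f1 dqi; have e2 := is_deriveM (is_deriveN f2) dqi.
split.
 rewrite (_ : (fun s => _) = (fun s => Re (f s)) * (fun s => (q s)^-1)); last first.
  by apply/funext=> s; rewrite !fctE complex_invE qE.
 apply: (is_derive_eq e1); rewrite complex_invE -qE.
 move: n0; rewrite qE [X in - d * X]expr2 /GRing.scale /=; case: d {f1 f2 dq dqi e1 e2} => d1 d2.
 by case: (f t) ft0 => a b _ /= n0; field.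
rewrite (_ : (fun s => _) = (- (fun s => Im (f s))) * (fun s => (q s)^-1)); last first.
 by apply/funext=> s; rewrite !fctE complex_invE qE.
apply: (is_derive_eq e2); rewrite complex_invE -qE.
move: n0; rewrite qE [X in - d * X]expr2 /GRing.scale /=; case: d {f1 f2 dq dqi e1 e2} => d1 d2.
by rewrite !fctE; case: (f t) ft0 => a b _ /= n0; field.
Qed.

Lemma cis_derive_moebius (A : SL2 R) f t d : 0 < Im (f t) -> cis_derive f t d ->
 cis_derive (fun s => ((A 0 0)%:C * f s + (A 0 1)%:C) / ((A 1 0)%:C * f s + (A 1 1)%:C)) t
  (d / ((A 1 0)%:C * f t + (A 1 1)%:C) ^+ 2).
Proof.
move=> f0 hf; have dA := SL2_detE A.
have n0 : (A 1 0)%:C * f t + (A 1 1)%:C != 0.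
 apply/eqP; case: (f t) f0 => x y /= y0 [e1 e2].
 have := mdenom_gt0 A x y0; rewrite /mdenom.
 move: e1 e2; rewrite !mul0r subr0 !addr0 => -> ->; by rewrite expr0n addr0 ltxx.
have hl (a b : R) : cis_derive (fun s => a%:C * f s + b%:C) t (a%:C * d).
 apply: eq_cis_derive (cis_deriveD (cis_deriveM (cis_derive_cst a%:C t) hf) (cis_derive_cst b%:C t)).
 by rewrite mul0r add0r addr0.
apply: eq_cis_derive (cis_deriveM (hl _ _) (cis_deriveV n0 (hl _ _))).
have dC : (A 0 0)%:C * (A 1 1)%:C - (A 0 1)%:C * (A 1 0)%:C = 1 :> R[i].
 by rewrite -!rmorphM -rmorphB dA.
rewrite -[d in RHS]mulr1 -dC.
by field.
Qed.

End complex_derivatives.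

Section chain_rule.
Variable R : realType.
Implicit Types (f : R -> R) (t : R).

Lemma is_derive_slope f t d : is_derive t (1 : R) f d -> exists q : R -> R,
 [/\ q t = d, {for t, continuous q} & forall s, f s - f t = q s * (s - t)].
Proof.
move=> [df dE]; pose q s := if s == t then d else (f s - f t) / (s - t).
exists q; split; rewrite /q ?eqxx//; last first.
 move=> s; case: eqP=> [->|/eqP st]; first by rewrite !subrr mulr0.
 by rewrite divfK// subr_eq0.
have : h^-1 *: ((f \o shift t) (h *: (1 : R)) - f t) @[h --> (0 : R)^'] --> d.
 by rewrite -dE; exact: df.
move=> /cvgrPdist_lt lim; apply/cvgrPdist_lt => e e0; rewrite eqxx.
have [r /= r0 hr] := lim e e0; exists r => // s /= st.
case: eqP=> [_|/eqP snt]; first by rewrite subrr normr0.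
have := hr (s - t); rewrite /= sub0r normrN distrC => /(_ st).
rewrite subr_eq0 snt => /(_ isT); rewrite /shift /= /GRing.scale /= mulr1 subrK.
by rewrite mulrC.
Qed.

Lemma slope_is_derive f t (q : R -> R) : {for t, continuous q} ->
 (forall s, f s - f t = q s * (s - t)) -> is_derive t (1 : R) f (q t).
Proof.
move=> cq fE; have lim : h^-1 *: ((f \o shift t) (h *: (1 : R)) - f t) @[h --> (0 : R)^'] --> q t.
 apply/cvgrPdist_lt => e e0; move/cvgrPdist_lt : cq => /(_ e e0)[r /= r0 hr].
 exists r => // h /= hr' h0; rewrite /shift /= fE /GRing.scale /= mulr1 addrK.
 rewrite mulrCA mulVf// mulr1; apply: hr => /=.
 by move: hr'; rewrite sub0r normrN opprD addrCA subrr addr0 normrN.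
split; first exact: cvgP lim.
exact: cvg_lim lim.
Qed.

Lemma is_derive_continuous f t d : is_derive t (1 : R) f d -> {for t, continuous f}.
Proof. by move=> [df _]; apply/differentiable_continuous/derivable1_diffP. Qed.

(** By the mean value theorem in x, the slope at (X, Y) is a value of G1 at a point no farther from
    (x0, y0); hence it is continuous jointly in both variables. *)
Lemma partial_slope (G G1 : R -> R -> R) (x0 y0 : R) :
 (\forall p \near (x0, y0), is_derive p.1 (1 : R) (G ^~ p.2) (G1 p.1 p.2)) ->
 {for (x0, y0), continuous (fun p => G1 p.1 p.2)} ->
 exists A : R * R -> R, [/\ A (x0, y0) = G1 x0 y0, {for (x0, y0), continuous A} &
  forall X Y, G X Y - G x0 Y = A (X, Y) * (X - x0)].
Proof.
move=> hG cG1; pose A (p : R * R) := if p.1 == x0 then G1 x0 p.2 else (G p.1 p.2 - G x0 p.2) / (p.1 - x0).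
exists A; split; rewrite /A /= ?eqxx//; last first.
 move=> X Y; case: eqP=> [->|/eqP Xx]; first by rewrite !subrr mulr0.
 by rewrite divfK// subr_eq0.
apply/cvgrPdist_lt => e e0; rewrite /= eqxx.
move/cvgrPdist_lt : cG1 => /(_ e e0) near1.
have : \forall p \near (x0, y0), is_derive p.1 (1 : R) (G ^~ p.2) (G1 p.1 p.2) /\ `|G1 x0 y0 - G1 p.1 p.2| < e.
 by apply: filterI.
move=> [[B1 B2] [/= /nbhs_ballP[r /= r0 hr1] n2] hB].
exists (ball x0 r, B2) => [/=|[X Y] [/= bX bY]].
 by split=> //; apply/nbhs_ballP; exists r.
have hr c : `|x0 - c| <= `|x0 - X| -> is_derive c (1 : R) (G ^~ Y) (G1 c Y) /\ `|G1 x0 y0 - G1 c Y| < e.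
 by move=> h; apply: (hB (c, Y)); split=> //=; apply: hr1; exact: le_lt_trans bX.
case: eqP=> [_|/eqP Xx]; first by have [] := hr x0; rewrite ?subrr ?normr0.
have xn : X - x0 != 0 by rewrite subr_eq0.
case: (ltrgtP X x0) => [lt|gt|eq]; last by rewrite eq eqxx in Xx.
- have [c /andP[c1 c2] ce] := @MVT_is_derive R (G^~ Y) (G1^~ Y) X x0 (ltW lt) (fun c hc => (hr c (ltac:(case/andP: hc => ? ?; rewrite !ger0_norm; lra))).1).
 have -> : (G X Y - G x0 Y) / (X - x0) = G1 c Y.
  by rewrite -[G X Y - _]opprB ce -mulrN opprB mulfK.
 by have [] := hr c; rewrite // !ger0_norm; lra.
- have [c /andP[c1 c2] ce] := @MVT_is_derive R (G^~ Y) (G1^~ Y) x0 X (ltW gt) (fun c hc => (hr c (ltac:(case/andP: hc => ? ?; rewrite !ler0_norm; lra))).1).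
 have -> : (G X Y - G x0 Y) / (X - x0) = G1 c Y by rewrite ce mulfK.
 by have [] := hr c; rewrite // !ler0_norm; lra.
Qed.

(** The increment is split into an x-difference at height y(s) and a y-difference at x(t). Each is a
    continuous slope times an increment, and the slopes of x and y finish the product. *)
Lemma chain2 (G G1 G2 : R -> R -> R) (x y : R -> R) t x' y' :
 (\forall p \near (x t, y t), is_derive p.1 (1 : R) (G ^~ p.2) (G1 p.1 p.2)) ->
 {for (x t, y t), continuous (fun p => G1 p.1 p.2)} ->
 is_derive (y t) (1 : R) (G (x t)) (G2 (x t) (y t)) ->
 is_derive t (1 : R) x x' -> is_derive t (1 : R) y y' ->
 is_derive t (1 : R) (fun s => G (x s) (y s)) (G1 (x t) (y t) * x' + G2 (x t) (y t) * y').
Proof.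
move=> hG cG1 hG2 dx dy.
have [A [At cA AE]] := partial_slope hG cG1.
have [qx [qxt cqx qxE]] := is_derive_slope dx; have [qy [qyt cqy qyE]] := is_derive_slope dy.
have [qG [qGt cqG qGE]] := is_derive_slope hG2.
have cx := is_derive_continuous dx; have cy := is_derive_continuous dy.
pose q s := A (x s, y s) * qx s + qG (y s) * qy s.
rewrite -At -qGt -qxt -qyt -/(q t); apply: slope_is_derive => [|s].
 apply: cvgD; apply: cvgM => //.
  have cxy : (x s, y s) @[s --> t] --> (x t, y t) by exact: (cvg_pair cx cy).
  exact: (cvg_comp _ _ cxy cA).
 exact: (cvg_comp _ _ cy cqG).
rewrite /q mulrDl -!mulrA -qxE -qyE -AE -qGE.
by rewrite addrA subrK.
Qed.

End chain_rule.

Section smooth_functions.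
Variables (R : realType) (n : nat).
Local Notation V := ('rV[R]_n * 'rV[R]_n)%type.
Implicit Types (phi : V -> R) (p : V) (k : 'I_n).

Lemma smooth_on_derive (U : set V) phi v : smooth_on U phi -> smooth_on U ('D_v phi).
Proof.
have E vs f : iter_derive (rcons vs v) f = iter_derive vs ('D_v f) :> (V -> R).
 by elim: vs => [|w vs IH] //=; rewrite IH.
by move=> h vs x Ux; rewrite -E; exact: h.
Qed.

(** Used with a base point whose k-th imaginary part is 0, so that [y] is the k-th imaginary part of
    the result. *)
Definition coord_point p k (x y : R) : V := p + x *: dir_x R k + y *: dir_y R k.

Lemma coord_point_im p k x y j : (coord_point p k x y).2 0 j = p.2 0 j + y * (j == k)%:R.
Proof. by rewrite /coord_point /dir_x /dir_y /= !mxE eqxx /= mulr0 addr0. Qed.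

Lemma upper_coord_point p k x y : p.2 0 k = 0 ->
 @upper_xy R n (coord_point p k x y) <-> (forall j, j != k -> 0 < p.2 0 j) /\ 0 < y.
Proof.
have E : @upper_xy R n (coord_point p k x y) <-> forall j, 0 < (coord_point p k x y).2 0 j.
 by split=> [h j|h j]; [have := h j; rewrite mxE|rewrite /mkz mxE; exact: h].
move=> pk; rewrite E; split=> [h|[h y0] j].
 split=> [j jk|]; first by have := h j; rewrite coord_point_im (negbTE jk) mulr0 addr0.
 by have := h k; rewrite coord_point_im eqxx mulr1 pk add0r.
rewrite coord_point_im; have [->|jk] := eqVneq j k; first by rewrite mulr1 pk add0r.
by rewrite mulr0 addr0; exact: h.
Qed.

Lemma is_derive_line phi p v : derivable phi p v -> forall s : R,
 is_derive s (1 : R) (fun x => phi (p + (x - s) *: v)) ('D_v phi p).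
Proof.
move=> /derivableP[dphi _] s.
have lim : h^-1 *: (((fun x : R => phi (p + (x - s) *: v)) \o shift s) (h *: (1 : R)) - phi (p + (s - s) *: v)) @[h --> (0 : R)^'] --> 'D_v phi p.
 have E (h : R) : h^-1 *: (((fun x : R => phi (p + (x - s) *: v)) \o shift s) (h *: (1 : R)) - phi (p + (s - s) *: v)) =
   h^-1 *: ((phi \o shift p) (h *: v) - phi p).
  rewrite /shift /= subrr scale0r addr0 [h *: 1]/GRing.scale /= mulr1 addrK.
  by rewrite [p + _]addrC.
 rewrite (eq_cvg _ _ E); exact: dphi.
split; first exact: cvgP lim.
exact: cvg_lim lim.
Qed.

Lemma chain_coord phi p k (x y : R -> R) t x' y' : smooth_on (@upper_xy R n) phi -> p.2 0 k = 0 ->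
 @upper_xy R n (coord_point p k (x t) (y t)) ->
 is_derive t (1 : R) x x' -> is_derive t (1 : R) y y' ->
 is_derive t (1 : R) (fun s => phi (coord_point p k (x s) (y s)))
  ('D_(dir_x R k) phi (coord_point p k (x t) (y t)) * x' +
   'D_(dir_y R k) phi (coord_point p k (x t) (y t)) * y').
Proof.
move=> sphi pk up dx dy.
pose G X Y := phi (coord_point p k X Y).
pose G1 X Y := 'D_(dir_x R k) phi (coord_point p k X Y).
pose G2 X Y := 'D_(dir_y R k) phi (coord_point p k X Y).
have dG1 X Y : @upper_xy R n (coord_point p k X Y) -> is_derive X (1 : R) (G^~ Y) (G1 X Y).
 move=> u; have [_ dv] := sphi [::] _ u; have := is_derive_line (dv (dir_x R k)) X.
 rewrite (_ : (fun x => _) = G^~ Y)//; apply/funext=> X'.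
 rewrite /G /coord_point; congr phi; rewrite scalerBl -!addrA; congr (_ + _).
 by rewrite addrC -!addrA addNr addr0 addrC.
have dG2 X Y : @upper_xy R n (coord_point p k X Y) -> is_derive Y (1 : R) (G X) (G2 X Y).
 move=> u; have [_ dv] := sphi [::] _ u; have := is_derive_line (dv (dir_y R k)) Y.
 rewrite (_ : (fun x => _) = G X)//; apply/funext=> Y'.
 by rewrite /G /coord_point; congr phi; rewrite scalerBl addrA addrAC addrK.
have [h1 y0] := (upper_coord_point (x t) (y t) pk).1 up.
have near1 : \forall q \near (x t, y t), is_derive q.1 (1 : R) (G ^~ q.2) (G1 q.1 q.2).
 have : \forall q \near (x t, y t), 0 < q.2 :> R.
  exists (setT, [set z : R | 0 < z]) => [/=|[X Y] [] //].
  by split; [exact: filterT|exact: lt_nbhsr].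
 by apply: filterS => -[X Y] /= Y0; apply: dG1; apply/upper_coord_point.
have cont1 : {for (x t, y t), continuous (fun q : R * R => G1 q.1 q.2)}.
 have [c1 _] := sphi [:: dir_x R k] _ up.
 have c2 : coord_point p k q.1 q.2 @[q --> (x t, y t)] --> coord_point p k (x t) (y t).
  apply: cvgD; first apply: cvgD; first exact: cvg_cst.
   by apply: cvgZr_tmp; exact: cvg_fst.
  by apply: cvgZr_tmp; exact: cvg_snd.
 exact: (cvg_comp _ _ c2 c1).
exact: (@chain2 R G G1 G2 x y t x' y' near1 cont1 (dG2 _ _ up) dx dy).
Qed.

End smooth_functions.

(** * Conformal coordinates and the Laplacian *)

Section conformal_coordinates.
Variable R : realType.

(* Z is conformal from the plane with metric da^2 + s(v)^2 dv^2 (up to a factor), harmonic,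
  and pulls the hyperbolic metric dz^2/y^2 back to w(v) (dv^2 + da^2/s^2). *)
Definition conformal (dom : R -> Prop) (Z Za Zv Zaa Zvv : R -> R -> R[i]) (s ds w : R -> R) : Prop :=
 forall a v, dom v ->
 [/\ cis_derive (Z ^~ v) a (Za a v), cis_derive (Z a) v (Zv a v),
   cis_derive (Za ^~ v) a (Zaa a v) & cis_derive (Zv a) v (Zvv a v)] /\
 [/\ 0 < Im (Z a v), Za a v ^+ 2 + (s v)%:C ^+ 2 * Zv a v ^+ 2 = 0,
   Zaa a v + (s v)%:C ^+ 2 * Zvv a v + (s v)%:C * (ds v)%:C * Zv a v = 0,
   normc (Zv a v) ^+ 2 = w v * Im (Z a v) ^+ 2 &
   normc (Za a v) ^+ 2 = s v ^+ 2 * normc (Zv a v) ^+ 2].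

(** Uniform bounds on compact ranges, the domination needed to differentiate under the integral
    sign. *)
Definition bounded_coords (dom : R -> Prop) (Z Za Zv Zaa Zvv : R -> R -> R[i]) : Prop :=
 forall L v1 v2, (forall v, v1 <= v <= v2 -> dom v) -> exists2 K : R, 1 <= K &
 forall a v, `|a| <= L -> v1 <= v <= v2 ->
 in_box K (Re (Z a v)) (Im (Z a v)) /\
 [/\ normc (Za a v) <= K, normc (Zv a v) <= K, normc (Zaa a v) <= K & normc (Zvv a v) <= K].

Definition mob (A : SL2 R) (z : R[i]) := ((A 0 0)%:C * z + (A 0 1)%:C) / ((A 1 0)%:C * z + (A 1 1)%:C).
Definition mden (A : SL2 R) (z : R[i]) := (A 1 0)%:C * z + (A 1 1)%:C.

Lemma mden_normc A z : normc (mden A z) ^+ 2 = mdenom A (Re z) (Im z).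
Proof. by rewrite normc_sqr /mden /mdenom; case: z => x y /=; rewrite !mul0r !subr0 !addr0. Qed.

Lemma mden_neq0 A z : 0 < Im z -> mden A z != 0.
Proof.
move=> z0; apply: contraTneq (mdenom_gt0 A (Re z) z0) => e.
by rewrite -mden_normc e ComplexField.Normc.normc0 expr0n ltxx.
Qed.

Lemma mob_moebius A z : mob A z = moebius (\pi_(PSL2 R) A)%qT z.
Proof. by rewrite moebius_pi. Qed.

Lemma mob_im A z : 0 < Im z -> Im (mob A z) = Im z / normc (mden A z) ^+ 2.
Proof. by move=> z0; rewrite mob_moebius mden_normc; case: z z0 => x y z0; rewrite moebius_xy. Qed.

Lemma normcV (z : R[i]) : normc z^-1 = (normc z)^-1.
Proof.
have [->|z0] := eqVneq z 0; first by rewrite invr0 ComplexField.Normc.normc0 invr0.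
apply: (@mulIf _ (normc z)).
 by apply: contraNneq z0 => /ComplexField.Normc.eq0_normc ->.
rewrite -ComplexField.Normc.normcM mulVf// mulVf ?ComplexField.Normc.normc1//.
by apply: contraNneq z0 => /ComplexField.Normc.eq0_normc ->.
Qed.

Lemma normcX (z : R[i]) m : normc (z ^+ m) = normc z ^+ m.
Proof.
by elim: m => [|m IH]; rewrite ?expr0 ?ComplexField.Normc.normc1// !exprS ComplexField.Normc.normcM IH.
Qed.

Variables (dom : R -> Prop) (Z Za Zv Zaa Zvv : R -> R -> R[i]) (s ds w : R -> R).

(** The chain rule for a Moebius map with first derivative 1/(cz + d)^2 and second derivative
    -2c/(cz + d)^3. *)
Definition mob_a A a v := Za a v / mden A (Z a v) ^+ 2.
Definition mob_v A a v := Zv a v / mden A (Z a v) ^+ 2.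
Definition mob_aa A a v := Zaa a v / mden A (Z a v) ^+ 2 -
 2%:R * (A 1 0)%:C * Za a v ^+ 2 / mden A (Z a v) ^+ 3.
Definition mob_vv A a v := Zvv a v / mden A (Z a v) ^+ 2 -
 2%:R * (A 1 0)%:C * Zv a v ^+ 2 / mden A (Z a v) ^+ 3.

Lemma cis_derive_quot A (f f' : R -> R[i]) t f'' : mden A (f t) != 0 ->
 cis_derive f t (f' t) -> cis_derive f' t f'' ->
 cis_derive (fun s => f' s / mden A (f s) ^+ 2) t
  (f'' / mden A (f t) ^+ 2 - 2%:R * (A 1 0)%:C * f' t ^+ 2 / mden A (f t) ^+ 3).
Proof.
move=> n0 df df'.
have dq : cis_derive (fun s => mden A (f s)) t ((A 1 0)%:C * f' t).
 apply: eq_cis_derive (cis_deriveD (cis_deriveM (cis_derive_cst _ t) df) (cis_derive_cst _ t)).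
 by rewrite mul0r add0r addr0.
have dqi := cis_deriveV n0 dq.
have e := cis_deriveM df' (cis_deriveM dqi dqi).
rewrite (_ : (fun s => _) = (fun s => f' s * ((mden A (f s))^-1 * (mden A (f s))^-1))); last first.
 by apply/funext=> x; rewrite expr2 invfM.
by apply: eq_cis_derive e; field.
Qed.

(** Composition with a holomorphic map multiplies Za^2 + s^2 Zv^2 by the square of its derivative.
    In the harmonicity equation the second derivative multiplies the same expression, which is 0.
    The metric factors are kept because the map is an isometry. *)
Lemma conformal_mob A : conformal dom Z Za Zv Zaa Zvv s ds w ->
 conformal dom (fun a v => mob A (Z a v)) (mob_a A) (mob_v A) (mob_aa A) (mob_vv A) s ds w.
Proof.
move=> hZ a v hv; have [[d1 d2 d3 d4] [z0 e1 e2 e3 e4]] := hZ a v hv.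
have n0 := mden_neq0 A z0; split; split.
- exact: (cis_derive_moebius A (f := Z^~ v) z0 d1).
- exact: (cis_derive_moebius A (f := Z a) z0 d2).
- exact: (cis_derive_quot (f := Z^~ v) (f' := Za^~ v) n0 d1 d3).
- exact: (cis_derive_quot (f := Z a) (f' := Zv a) n0 d2 d4).
- by rewrite mob_moebius Im_moebius_gt0.
- rewrite /mob_a /mob_v; transitivity ((Za a v ^+ 2 + (s v)%:C ^+ 2 * Zv a v ^+ 2) / mden A (Z a v) ^+ 4).
  by field.
 by rewrite e1 mul0r.
- rewrite /mob_aa /mob_vv /mob_v.
 transitivity ((Zaa a v + (s v)%:C ^+ 2 * Zvv a v + (s v)%:C * (ds v)%:C * Zv a v) / mden A (Z a v) ^+ 2
   - 2%:R * (A 1 0)%:C * (Za a v ^+ 2 + (s v)%:C ^+ 2 * Zv a v ^+ 2) / mden A (Z a v) ^+ 3).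
  by field.
 by rewrite e1 e2 mul0r mulr0 mul0r subr0.
- rewrite mob_im// /mob_v ComplexField.Normc.normcM normcV normcX exprMn e3.
 by rewrite exprMn -mulrA exprVn.
- rewrite /mob_a /mob_v; move: (mden A (Z a v) ^+ 2)^-1 => D.
 by rewrite (ComplexField.Normc.normcM (Za a v)) (ComplexField.Normc.normcM (Zv a v)) exprMn e4 exprMn -mulrA.
Qed.

Lemma bounded_mob A : conformal dom Z Za Zv Zaa Zvv s ds w -> bounded_coords dom Z Za Zv Zaa Zvv ->
 bounded_coords dom (fun a v => mob A (Z a v)) (mob_a A) (mob_v A) (mob_aa A) (mob_vv A).
Proof.
move=> hZ bZ L v1 v2 hv; have [K K1 hK] := bZ L v1 v2 hv.
have [K' K'1 hK'] := moebius_box A K1.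
pose q := K' * K; have q1 : 1 <= q by rewrite /q; nra.
pose c := `|A 1 0|; have c0 : 0 <= c := normr_ge0 _.
have qK : 0 <= K * q by rewrite mulr_ge0//; lra.
have qK2 : 0 <= 2 * c * K ^+ 2 * q ^+ 2 by rewrite !mulr_ge0 ?exprn_ge0//; lra.
exists (K' + K * q + 2 * c * K ^+ 2 * q ^+ 2); first lra.
move=> a v aL vv; have [bx [h1 h2 h3 h4]] := hK a v aL vv.
have [_ [z0 _ _ _ _]] := hZ a v (hv v vv).
have bx' := hK' _ _ bx.
have e : mob A (Z a v) = moebius_re A (Re (Z a v)) (Im (Z a v)) +i* moebius_im A (Re (Z a v)) (Im (Z a v)).
 by rewrite mob_moebius; case: (Z a v) z0 => x y z0; rewrite moebius_xy.
set D := mden A (Z a v).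
(* Here |cz + d|^-2 is the quotient of the imaginary parts of the image and of z, bounded by K' and
   1/K. *)
have D2 : (normc D)^-1 ^+ 2 <= q.
 have d0 := mdenom_gt0 A (Re (Z a v)) z0.
 rewrite exprVn mden_normc; case: bx' => _ _; rewrite /moebius_im => hi.
 case: bx => _ lo _.
 rewrite -[leLHS]mul1r; apply: le_trans (_ : (Im (Z a v) * K) / mdenom A (Re (Z a v)) (Im (Z a v)) <= _).
  by rewrite ler_pM2r ?invr_gt0// -ler_pdivrMr ?mul1r//; lra.
 by rewrite mulrAC /q ler_pM2r//; lra.
have D0 : 0 <= (normc D)^-1 by rewrite invr_ge0 normc_nneg.
have D3 : (normc D)^-1 ^+ 3 <= q ^+ 2.
 have h : ((normc D)^-1 ^+ 3) ^+ 2 <= (q ^+ 2) ^+ 2.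
  rewrite -!exprM mulnC exprM; apply: le_trans (_ : q ^+ 3 <= _).
   by apply: lerXn2r => //; rewrite ?nnegrE ?exprn_ge0//; lra.
  by apply: ler_weXn2l.
 by rewrite -ler_sqr ?nnegrE ?exprn_ge0//; lra.
have b1 (z : R[i]) : normc z <= K -> normc (z / D ^+ 2) <= K * q.
 by move=> hz; rewrite ComplexField.Normc.normcM normcV normcX -exprVn ler_pM ?normc_nneg ?exprn_ge0.
have b2 (z : R[i]) : normc z <= K -> normc (2%:R * (A 1 0)%:C * z ^+ 2 / D ^+ 3) <= 2 * c * K ^+ 2 * q ^+ 2.
 move=> hz; rewrite ComplexField.Normc.normcM normcV normcX -exprVn ler_pM ?normc_nneg ?exprn_ge0//.
 rewrite !ComplexField.Normc.normcM.
 have -> : normc (2%:R : R[i]) = 2 by rewrite -[2%:R]/((1 +i* 0) + (1 +i* 0)) /= !addr0 expr0n addr0 sqrtr_sqr ger0_norm.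
 have -> : normc ((A 1 0)%:C) = c by rewrite /= expr0n addr0 sqrtr_sqr.
 by rewrite -[normc z * normc z]expr2 ler_wpM2l ?mulr_ge0// lerXn2r ?nnegrE ?normc_nneg//; lra.
have tri (z z' : R[i]) : normc (z - z') <= normc z + normc z'.
 by apply: le_trans (le_normcD _ _) _; case: z' => p q'; rewrite /= !sqrrN.
split.
 by rewrite e; apply: in_box_le bx' => //; lra.
split.
- by apply: le_trans (b1 _ h1) _; lra.
- by apply: le_trans (b1 _ h2) _; lra.
- apply: le_trans (tri _ _) _; have := b1 _ h3; have := b2 _ h1; rewrite /D; lra.
- apply: le_trans (tri _ _) _; have := b1 _ h4; have := b2 _ h2; rewrite /D; lra.
Qed.

End conformal_coordinates.

Section polar_conformal.
Variable R : realType.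

Lemma is_derive_div (f g : R -> R) t df dg : g t != 0 ->
 is_derive t (1 : R) f df -> is_derive t (1 : R) g dg ->
 is_derive t (1 : R) (fun s => f s / g s) ((df * g t - f t * dg) / g t ^+ 2).
Proof.
move=> g0 hf hg; have h := is_deriveM hf (is_deriveV g0 hg).
by apply: (is_derive_eq h); rewrite /GRing.scale /=; field.
Qed.

Definition hyp_Z_v (a v : R) : R[i] := (expR a * cos v) +i* (- (expR a * sin v)).

Lemma is_derive_expM (c a : R) : is_derive a (1 : R) (fun x => expR x * c) (expR a * c).
Proof.
have h := is_deriveM (is_derive_expR a) (is_derive_cst c a (1 : R)).
by apply: (is_derive_eq h); rewrite /GRing.scale /=; ring.
Qed.

Lemma is_derive_expsin (a v : R) : is_derive v (1 : R) (fun x => expR a * sin x) (expR a * cos v).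
Proof.
have h := is_deriveM (is_derive_cst (expR a) v (1 : R)) (is_derive_sin v).
by apply: (is_derive_eq h); rewrite /GRing.scale /=; ring.
Qed.

Lemma is_derive_expcos (a v : R) : is_derive v (1 : R) (fun x => expR a * cos x) (- (expR a * sin v)).
Proof.
have h := is_deriveM (is_derive_cst (expR a) v (1 : R)) (is_derive_cos v).
by apply: (is_derive_eq h); rewrite /GRing.scale /=; ring.
Qed.

Lemma is_derive_expNsin (a v : R) : is_derive v (1 : R) (fun x => - (expR a * sin x)) (- (expR a * cos v)).
Proof. exact: is_deriveN (is_derive_expsin a v). Qed.

Lemma conformal_hyp_polar : conformal (polar_dom true) (fun a v => cpx (@polar R true (a, v)))
 (fun a v => cpx (polar true (a, v))) hyp_Z_v (fun a v => cpx (polar true (a, v)))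
 (fun a v => - cpx (polar true (a, v))) (fun=> 1) (fun=> 0) (fun v => (cos v ^+ 2)^-1).
Proof.
move=> a v hv; have c0 : 0 < cos v by rewrite cos_gt0_pihalf//; exact: hv.
have da : cis_derive (fun a => cpx (@polar R true (a, v))) a (cpx (polar true (a, v))).
 by split; [exact: (is_derive_expM (sin v) a)|exact: (is_derive_expM (cos v) a)].
split; split.
- exact: da.
- by split; [exact: is_derive_expsin|exact: is_derive_expcos].
- exact: da.
- by split; [exact: is_derive_expcos|exact: is_derive_expNsin].
- exact: (@polar_im_gt0 _ true (a, v)).
- by rewrite mulrC /hyp_Z_v /cpx /polar /hyp_polar /= !expr2; apply: complex_eqP=> /=; ring.
- by rewrite /hyp_Z_v /cpx /polar /hyp_polar /=; apply: complex_eqP=> /=; ring.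
- rewrite normc_sqr /hyp_Z_v /= sqrrN !exprMn -mulrDr cos2Dsin2 mulr1 mulrCA mulVf ?mulr1//.
 by rewrite expf_neq0// gt_eqF.
- by rewrite !normc_sqr /hyp_Z_v /= sqrrN expr1n mul1r addrC.
Qed.

(** The point is (sinh v sin a + i)/d. With d' the v-derivative of d one has d'' = d and sin^2 a +
    d'^2 = d^2; these relations give all the conformal identities for geodesic polar coordinates. *)
Definition ell_d (a v : R) := cosh v - sinh v * cos a.
Definition ell_dv (a v : R) := sinh v - cosh v * cos a.
Definition ell_Z_a (a v : R) : R[i] :=
 (- (sinh v * ell_dv a v) / ell_d a v ^+ 2) +i* (- (sinh v * sin a) / ell_d a v ^+ 2).
Definition ell_Z_v (a v : R) : R[i] := (sin a / ell_d a v ^+ 2) +i* (- ell_dv a v / ell_d a v ^+ 2).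
Definition ell_Z_aa (a v : R) : R[i] :=
 (- (sinh v * cosh v * sin a) / ell_d a v ^+ 2 + 2 * sinh v ^+ 2 * sin a * ell_dv a v / ell_d a v ^+ 3) +i*
 (- (sinh v * cos a) / ell_d a v ^+ 2 + 2 * sinh v ^+ 2 * sin a ^+ 2 / ell_d a v ^+ 3).
Definition ell_Z_vv (a v : R) : R[i] :=
 (- 2 * sin a * ell_dv a v / ell_d a v ^+ 3) +i* (- (ell_d a v)^-1 + 2 * ell_dv a v ^+ 2 / ell_d a v ^+ 3).

Lemma ell_d_neq0 a v : ell_d a v != 0.
Proof. by rewrite gt_eqF// ell_den_gt0. Qed.

Lemma ell_d_identity a v : sin a ^+ 2 + ell_dv a v ^+ 2 = ell_d a v ^+ 2.
Proof.
have h1 := cosh2_sinh2 v; have h2 := cos2Dsin2 a.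
rewrite /ell_dv /ell_d; have -> : sin a ^+ 2 = 1 - cos a ^+ 2 by rewrite -h2; ring.
apply/eqP; rewrite -subr_eq0 (_ : _ - _ = (1 - cos a ^+ 2) * (1 - (cosh v ^+ 2 - sinh v ^+ 2))); last by ring.
by rewrite h1 subrr mulr0.
Qed.

Lemma is_derive_ell_d_v a v : is_derive v (1 : R) (ell_d a) (ell_dv a v).
Proof.
have h := is_deriveB (is_derive_cosh v) (is_deriveM (is_derive_sinh v) (is_derive_cst (cos a) v (1 : R))).
by apply: (is_derive_eq h); rewrite /GRing.scale /= /ell_dv; ring.
Qed.

Lemma is_derive_ell_dv_v a v : is_derive v (1 : R) (ell_dv a) (ell_d a v).
Proof.
have h := is_deriveB (is_derive_sinh v) (is_deriveM (is_derive_cosh v) (is_derive_cst (cos a) v (1 : R))).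
by apply: (is_derive_eq h); rewrite /GRing.scale /= /ell_d; ring.
Qed.

Lemma is_derive_ell_d_a a v : is_derive a (1 : R) (ell_d ^~ v) (sinh v * sin a).
Proof.
have h := is_deriveB (is_derive_cst (cosh v) a (1 : R)) (is_deriveM (is_derive_cst (sinh v) a (1 : R)) (is_derive_cos a)).
by apply: (is_derive_eq h); rewrite /GRing.scale /=; ring.
Qed.

Lemma is_derive_ell_dv_a a v : is_derive a (1 : R) (ell_dv ^~ v) (cosh v * sin a).
Proof.
have h := is_deriveB (is_derive_cst (sinh v) a (1 : R)) (is_deriveM (is_derive_cst (cosh v) a (1 : R)) (is_derive_cos a)).
by apply: (is_derive_eq h); rewrite /GRing.scale /=; ring.
Qed.

Lemma is_derive_divX2 (f g : R -> R) t df dg : g t != 0 ->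
 is_derive t (1 : R) f df -> is_derive t (1 : R) g dg ->
 is_derive t (1 : R) (fun s => f s / g s ^+ 2) (df / g t ^+ 2 - 2 * f t * dg / g t ^+ 3).
Proof.
move=> g0 hf hg; have hgg := is_deriveM hg hg.
have n0 : (g * g) t != 0 by rewrite mulf_neq0.
have h := is_derive_div n0 hf hgg.
rewrite (_ : (fun s => f s / g s ^+ 2) = (fun s => f s / (g * g) s)); last by apply/funext=> s; rewrite expr2.
by apply: (is_derive_eq h); rewrite /GRing.scale /= !fctE; field.
Qed.

Lemma is_derive_cmul (c : R) (f : R -> R) t df : is_derive t (1 : R) f df ->
 is_derive t (1 : R) (fun s => c * f s) (c * df).
Proof.
move=> hf; have h := is_deriveM (is_derive_cst c t (1 : R)) hf.
by apply: (is_derive_eq h); rewrite /GRing.scale /=; ring.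
Qed.

Lemma conformal_ell_polar : conformal (polar_dom false) (fun a v => cpx (@polar R false (a, v)))
 ell_Z_a ell_Z_v ell_Z_aa ell_Z_vv (@Defs.sinh R) (@Defs.cosh R) (fun=> 1).
Proof.
move=> a v hv; have n0 := ell_d_neq0 a v; have id2 := ell_d_identity a v.
have ch := cosh2_sinh2 v; have cs := cos2Dsin2 a.
have dd := is_derive_ell_d_v a v; have da := is_derive_ell_d_a a v.
have ddv := is_derive_ell_dv_v a v; have dva := is_derive_ell_dv_a a v.
split; split.
- split.
  have h := @is_derive_div _ (ell_d^~ v) a _ _ n0 (is_derive_cmul (sinh v) (is_derive_sin a)) da.
  apply: (is_derive_eq h); rewrite /=; congr (_ / _); rewrite /ell_d /ell_dv.
  transitivity (sinh v * (cosh v * cos a) - sinh v ^+ 2 * (cos a ^+ 2 + sin a ^+ 2)); first by ring.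
  by rewrite cs; ring.
 have h := @is_derive_div _ (ell_d^~ v) a _ _ n0 (is_derive_cst (1 : R) a (1 : R)) da.
 rewrite (_ : (fun s => _) = (fun s => 1 / ell_d s v)); last by apply/funext=> s /=; rewrite div1r.
 by apply: (is_derive_eq h) => /=; congr (_ / _); ring.
- split.
  have h := @is_derive_div _ (ell_d a) v _ _ n0 (is_deriveM (is_derive_sinh v) (is_derive_cst (sin a) v (1 : R))) dd.
  apply: (is_derive_eq h); rewrite /GRing.scale /=; congr (_ / _); rewrite /ell_d /ell_dv !fctE.
  transitivity (sin a * (cosh v ^+ 2 - sinh v ^+ 2)); first by ring.
  by rewrite ch mulr1.
 have h := @is_derive_div _ (ell_d a) v _ _ n0 (is_derive_cst (1 : R) v (1 : R)) dd.
 rewrite (_ : (fun s => _) = (fun s => 1 / ell_d a s)); last by apply/funext=> s /=; rewrite div1r.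
 by apply: (is_derive_eq h) => /=; congr (_ / _); ring.
- split.
  have h := @is_derive_divX2 _ (ell_d^~ v) a _ _ n0 (is_deriveN (is_derive_cmul (sinh v) dva)) da.
  by apply: (is_derive_eq h); rewrite /= !fctE; field.
 have h := @is_derive_divX2 _ (ell_d^~ v) a _ _ n0 (is_deriveN (is_derive_cmul (sinh v) (is_derive_sin a))) da.
 by apply: (is_derive_eq h); rewrite /= !fctE; field.
- split.
  have h := @is_derive_divX2 _ (ell_d a) v _ _ n0 (is_derive_cst (sin a) v (1 : R)) dd.
  by apply: (is_derive_eq h); rewrite /=; field.
 have h := @is_derive_divX2 _ (ell_d a) v _ _ n0 (is_deriveN ddv) dd.
 by apply: (is_derive_eq h); rewrite /= !fctE; field.
- exact: (@polar_im_gt0 _ false (a, v)).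
- rewrite /ell_Z_a /ell_Z_v; apply: complex_eqP=> /=; rewrite !(mul0r, mulr0, subr0, addr0); field; exact: n0.
- rewrite /ell_Z_aa /ell_Z_vv /ell_Z_v; apply: complex_eqP=> /=; rewrite !(mul0r, mulr0, subr0, addr0).
  by field.
 transitivity ((- (sinh v * cos a) - sinh v * cosh v * ell_dv a v - sinh v ^+ 2 * ell_d a v) / ell_d a v ^+ 2
  + 2 * sinh v ^+ 2 * (sin a ^+ 2 + ell_dv a v ^+ 2) / ell_d a v ^+ 3); first by field.
 rewrite id2.
 transitivity (sinh v * (- cos a - cosh v * ell_dv a v + sinh v * ell_d a v) / ell_d a v ^+ 2); first by field.
 rewrite /ell_dv {1}/ell_d (_ : _ + _ = cos a * ((cosh v ^+ 2 - sinh v ^+ 2) - 1)); last by ring.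
 by rewrite ch subrr mulr0 mulr0 mul0r.
- rewrite normc_sqr /= -/(ell_d a v) mul1r.
 transitivity ((sin a ^+ 2 + ell_dv a v ^+ 2) / ell_d a v ^+ 4); first by field.
 by rewrite id2; field.
- rewrite !normc_sqr /=; by field.
Qed.

Section bounded_region.
Variables (L v1 v2 : R).

(** Bounded on the rectangle of the section. The closure properties serve as hints, so that
    boundedness of the explicit derivatives is found by [auto]. *)
Definition bdd (f : R -> R -> R) : Prop :=
 exists K, forall a v, `|a| <= L -> v1 <= v <= v2 -> `|f a v| <= K.

Lemma bddD f g : bdd f -> bdd g -> bdd (fun a v => f a v + g a v).
Proof.
move=> [K hK] [K' hK']; exists (K + K') => a v ha hv; apply: le_trans (ler_normD _ _) _.
by apply: lerD; [exact: hK|exact: hK'].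
Qed.

Lemma bddM f g : bdd f -> bdd g -> bdd (fun a v => f a v * g a v).
Proof.
move=> [K hK] [K' hK']; exists (K * K') => a v ha hv.
by rewrite normrM ler_pM//; [exact: hK|exact: hK'].
Qed.

Lemma bddN f : bdd f -> bdd (fun a v => - f a v).
Proof. by move=> [K hK]; exists K => a v ha hv; rewrite normrN; exact: hK. Qed.

Lemma bddC c : bdd (fun _ _ => c).
Proof. by exists `|c|. Qed.

Lemma bddX f m : bdd f -> bdd (fun a v => f a v ^+ m).
Proof.
by move=> [K hK]; exists (K ^+ m) => a v ha hv; rewrite normrX lerXn2r ?nnegrE//; last exact: hK; exact: le_trans (hK a v ha hv).
Qed.

Lemma bdd_eq f g : (forall a v, f a v = g a v) -> bdd f -> bdd g.
Proof. by move=> e [K hK]; exists K => a v ha hv; rewrite -e; exact: hK. Qed.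

Definition cbdd (f : R -> R -> R[i]) :=
 bdd (fun a v => Re (f a v)) /\ bdd (fun a v => Im (f a v)).

Lemma cbdd_normc f : cbdd f ->
 exists K : R, forall a v, `|a| <= L -> v1 <= v <= v2 -> normc (f a v) <= K.
Proof.
move=> [[K hK] [K' hK']]; exists (K + K') => a v ha hv; apply: le_trans (normc_le_abs _) _.
by apply: lerD; [exact: hK|exact: hK'].
Qed.

Lemma bounded_coords_region Z Za Zv Zaa Zvv : cbdd Z ->
 (forall a v, v1 <= v <= v2 -> 0 < Im (Z a v)) ->
 bdd (fun a v => (Im (Z a v))^-1) ->
 cbdd Za -> cbdd Zv -> cbdd Zaa -> cbdd Zvv ->
 exists2 K : R, 1 <= K &
 forall a v, `|a| <= L -> v1 <= v <= v2 ->
 in_box K (Re (Z a v)) (Im (Z a v)) /\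
 [/\ normc (Za a v) <= K, normc (Zv a v) <= K, normc (Zaa a v) <= K & normc (Zvv a v) <= K].
Proof.
move=> [[K1 h1] [K2 h2]] pos [K3 h3] /cbdd_normc[K4 h4] /cbdd_normc[K5 h5].
move=> /cbdd_normc[K6 h6] /cbdd_normc[K7 h7].
pose K := 1 + `|K1| + `|K2| + `|K3| + `|K4| + `|K5| + `|K6| + `|K7|.
have n1 := ler_norm K1; have n2 := ler_norm K2; have n3 := ler_norm K3; have n4 := ler_norm K4.
have n5 := ler_norm K5; have n6 := ler_norm K6; have n7 := ler_norm K7.
have m1 := normr_ge0 K1; have m2 := normr_ge0 K2; have m3 := normr_ge0 K3; have m4 := normr_ge0 K4.
have m5 := normr_ge0 K5; have m6 := normr_ge0 K6; have m7 := normr_ge0 K7.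
exists K; first by rewrite /K; lra.
move=> a v ha hv; have y0 := pos a v hv; split; first split.
- by apply: le_trans (h1 a v ha hv) _; rewrite /K; lra.
- have := h3 a v ha hv; rewrite gtr0_norm ?invr_gt0// => h.
 have K0 : 0 < K by rewrite /K; lra.
 rewrite -[leRHS]invrK lef_pV2 ?posrE ?invr_gt0//.
 by apply: le_trans h _; rewrite /K; lra.
- by apply: le_trans (le_trans (ler_norm _) (h2 a v ha hv)) _; rewrite /K; lra.
split.
- by apply: le_trans (h4 a v ha hv) _; rewrite /K; lra.
- by apply: le_trans (h5 a v ha hv) _; rewrite /K; lra.
- by apply: le_trans (h6 a v ha hv) _; rewrite /K; lra.
- by apply: le_trans (h7 a v ha hv) _; rewrite /K; lra.
Qed.

Lemma bdd_a f : (forall a, `|a| <= L -> `|f a| <= expR L) -> bdd (fun a _ => f a).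
Proof. by move=> h; exists (expR L) => a v ha _; exact: h. Qed.

Lemma bdd_sin_a : bdd (fun a _ => sin a).
Proof. by exists 1 => a v _ _; rewrite ler_norml sin_geN1 sin_le1. Qed.

Lemma bdd_cos_a : bdd (fun a _ => cos a).
Proof. by exists 1 => a v _ _; rewrite ler_norml cos_geN1 cos_le1. Qed.

Lemma bdd_sin_v : bdd (fun _ v => sin v).
Proof. by exists 1 => a v _ _; rewrite ler_norml sin_geN1 sin_le1. Qed.

Lemma bdd_cos_v : bdd (fun _ v => cos v).
Proof. by exists 1 => a v _ _; rewrite ler_norml cos_geN1 cos_le1. Qed.

Lemma bdd_exp : bdd (fun a _ => expR a).
Proof.
by exists (expR L) => a v ha _; rewrite gtr0_norm ?expR_gt0// ler_expR; exact: le_trans (ler_norm a) ha.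
Qed.

Lemma bdd_expN : bdd (fun a _ => (expR a)^-1).
Proof.
exists (expR L) => a v ha _; rewrite -expRN gtr0_norm ?expR_gt0// ler_expR.
by apply: le_trans ha; rewrite -normrN ler_norm.
Qed.

Lemma bdd_exp_v : bdd (fun _ v => expR v).
Proof.
by exists (expR v2) => a v ha /andP[_ h]; rewrite gtr0_norm ?expR_gt0// ler_expR.
Qed.

Lemma bdd_expN_v : bdd (fun _ v => expR (- v)).
Proof.
by exists (expR (- v1)) => a v ha /andP[h _]; rewrite gtr0_norm ?expR_gt0// ler_expR lerN2.
Qed.

Lemma bdd_sinh : bdd (fun _ v => sinh v).
Proof.
apply: bddM (bddC _).
exact: bddD bdd_exp_v (bddN bdd_expN_v).
Qed.

Lemma bdd_cosh : bdd (fun _ v => cosh v).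
Proof.
apply: bddM (bddC _).
exact: bddD bdd_exp_v bdd_expN_v.
Qed.

Lemma bdd_ell_d : bdd ell_d.
Proof.
exact: bddD bdd_cosh (bddN (bddM bdd_sinh bdd_cos_a)).
Qed.

Lemma bdd_ell_dv : bdd ell_dv.
Proof.
exact: bddD bdd_sinh (bddN (bddM bdd_cosh bdd_cos_a)).
Qed.

(** The denominator is a convex combination of e^v and e^-v, hence its inverse is at most their
    sum. *)
Lemma bdd_ell_dV : bdd (fun a v => (ell_d a v)^-1).
Proof.
have [K1 h1] := bdd_exp_v; have [K2 h2] := bdd_expN_v.
exists (K1 + K2) => a v ha hv; have d0 := ell_den_gt0 v a.
have := h1 a v ha hv; have := h2 a v ha hv; rewrite !gtr0_norm ?expR_gt0 ?invr_gt0// => e2 e1.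
have p1 := expR_gt0 v; have p2 := expR_gt0 (- v).
have e12 : expR v * expR (- v) = 1 by rewrite -expRD subrr expR0.
apply: le_trans (lerD e1 e2); rewrite -[leLHS]mul1r ler_pdivrMr// /ell_d /sinh /cosh.
have := cos_geN1 a; have := cos_le1 a; nra.
Qed.

Lemma bdd_cosV : (forall v, v1 <= v <= v2 -> polar_dom true v) ->
 bdd (fun _ v => (cos v)^-1).
Proof.
move=> hv; have [v12|v21] := leP v1 v2; last first.
 by exists 1 => a v _ /andP[h1 h2]; have := le_lt_trans (le_trans h1 h2) v21; rewrite ltxx.
have [c hc cm] := @EVT_min R cos v1 v2 v12 (continuous_subspaceT (@continuous_cos R)).
have pos v : v1 <= v <= v2 -> 0 < cos v by move=> h; apply: cos_gt0_pihalf; exact: (hv v h).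
exists (cos c)^-1 => a v _ h; have c0 : 0 < cos c by apply: pos; move: hc; rewrite in_itv.
by rewrite gtr0_norm ?invr_gt0 ?pos// lef_pV2 ?posrE ?pos//; apply: cm; rewrite in_itv.
Qed.

End bounded_region.

Hint Resolve bddD bddM bddN bddC bddX
 bdd_sin_a bdd_cos_a bdd_sin_v bdd_cos_v
 bdd_exp bdd_expN bdd_sinh bdd_cosh
 bdd_ell_d bdd_ell_dv bdd_ell_dV : bounded_db.

Lemma bounded_hyp_polar : bounded_coords (polar_dom true) (fun a v => cpx (@polar R true (a, v)))
 (fun a v => cpx (polar true (a, v))) hyp_Z_v (fun a v => cpx (polar true (a, v)))
 (fun a v => - cpx (polar true (a, v))).
Proof.
move=> L v1 v2 hv; apply: bounded_coords_region.
- by split; rewrite /cpx /polar /hyp_polar /=; auto with bounded_db.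
- by move=> a v h; apply: (@polar_im_gt0 _ true (a, v)); exact: hv.
- apply: (bdd_eq (f := fun a v => (expR a)^-1 * (cos v)^-1)); last first.
  by apply: bddM => //; [exact: bdd_expN|exact: bdd_cosV].
 by move=> a v; rewrite /= invfM.
- by split; rewrite /cpx /polar /hyp_polar /=; auto with bounded_db.
- by split; rewrite /hyp_Z_v /=; auto with bounded_db.
- by split; rewrite /cpx /polar /hyp_polar /=; auto with bounded_db.
- by split; rewrite /cpx /polar /hyp_polar /=; auto with bounded_db.
Qed.

Lemma bounded_ell_polar : bounded_coords (polar_dom false) (fun a v => cpx (@polar R false (a, v)))
 ell_Z_a ell_Z_v ell_Z_aa ell_Z_vv.
Proof.
move=> L v1 v2 hv.
have dX m : bdd L v1 v2 (fun a v => (ell_d a v ^+ m)^-1).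
 apply: (bdd_eq (f := fun a v => (ell_d a v)^-1 ^+ m)); last by auto with bounded_db.
 by move=> a v; rewrite exprVn.
apply: bounded_coords_region.
- by split; rewrite /cpx /polar /ell_polar /= -/(ell_d _ _); auto 8 with bounded_db.
- by move=> a v h; apply: (@polar_im_gt0 _ false (a, v)); exact: hv.
- apply: (bdd_eq (f := ell_d)); last by auto with bounded_db.
 by move=> a v; rewrite /= invrK.
- by split; rewrite /ell_Z_a /=; auto 8 with bounded_db.
- by split; rewrite /ell_Z_v /=; auto 8 with bounded_db.
- by split; rewrite /ell_Z_aa /=; auto 10 with bounded_db.
- by split; rewrite /ell_Z_vv /=; auto 10 with bounded_db.
Qed.

End polar_conformal.

Section conformal_algebra.
Variable R : realType.

Lemma sum_products_rearrange (a b c d p q r t : R) :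
 p * a + b * q + (r * c + d * t) = (q * b + t * d) + (p * a + r * c).
Proof. by ring. Qed.

(* The conformal identity makes the mixed second derivatives cancel. *)
Lemma conformal_laplacian_algebra (px py pxx pxy pyx pyy y : R) (za zv zaa zvv : R[i]) (s ds w : R) :
 za ^+ 2 + s%:C ^+ 2 * zv ^+ 2 = 0 -> zaa + s%:C ^+ 2 * zvv + s%:C * ds%:C * zv = 0 ->
 normc zv ^+ 2 = w * y ^+ 2 -> normc za ^+ 2 = s ^+ 2 * normc zv ^+ 2 ->
 let D1 z := px * Re z + py * Im z in
 let D2 z z' := (pxx * Re z + pyx * Im z) * Re z +
  (pxy * Re z + pyy * Im z) * Im z + D1 z' in
 D2 za zaa + s ^+ 2 * D2 zv zvv + s * ds * D1 zv = s ^+ 2 * w * (y ^+ 2 * (pxx + pyy)).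
Proof.
rewrite !normc_sqr => e1 e2 e3 e4 /=.
have := congr1 (@Re R) e1; have := congr1 (@Im R) e1.
have := congr1 (@Re R) e2; have := congr1 (@Im R) e2.
move: e3 e4 => {e1 e2}.
case: za => xa ya; case: zv => xv yv; case: zaa => xaa yaa; case: zvv => xvv yvv /=.
rewrite !(mul0r, mulr0, subr0, addr0, add0r).
move=> e3 e4 e2i e2r e1i e1r.
have h1 : xa ^+ 2 + s ^+ 2 * xv ^+ 2 = s ^+ 2 * w * y ^+ 2.
 by rewrite -[RHS]mulrA -e3; lra.
have h2 : ya ^+ 2 + s ^+ 2 * yv ^+ 2 = s ^+ 2 * w * y ^+ 2.
 by rewrite -[RHS]mulrA -e3; lra.
have h3 : xa * ya + s ^+ 2 * xv * yv = 0 by lra.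
have h4 : xaa + s ^+ 2 * xvv + s * ds * xv = 0 by rewrite expr2; lra.
have h5 : yaa + s ^+ 2 * yvv + s * ds * yv = 0 by rewrite expr2; lra.
transitivity (pxx * (xa ^+ 2 + s ^+ 2 * xv ^+ 2) + pyy * (ya ^+ 2 + s ^+ 2 * yv ^+ 2) +
 (pxy + pyx) * (xa * ya + s ^+ 2 * xv * yv) + px * (xaa + s ^+ 2 * xvv + s * ds * xv) +
 py * (yaa + s ^+ 2 * yvv + s * ds * yv)); first by ring.
by rewrite h1 h2 h3 h4 h5; ring.
Qed.

End conformal_algebra.

Section pullback.
Variables (R : realType) (n : nat) (k : 'I_n) (p : 'rV[R]_n * 'rV[R]_n).
Implicit Types (phi : 'rV[R]_n * 'rV[R]_n -> R) (z : R[i]).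

(** [phi] restricted to the k-th plane through p; [pull1] and [pull2] are its first and second
    derivatives along a curve with position z, velocity z1 and acceleration z2. *)
Definition pull phi z := phi (coord_point p k (Re z) (Im z)).

Definition pull1 phi z (z1 : R[i]) :=
 pull ('D_(dir_x R k) phi) z * Re z1 + pull ('D_(dir_y R k) phi) z * Im z1.

Definition pull2 phi z (z1 z2 : R[i]) :=
 (pull1 ('D_(dir_x R k) phi) z z1 * Re z1 + pull1 ('D_(dir_y R k) phi) z z1 * Im z1)
 + pull1 phi z z2.

Hypotheses (pk : p.2 0 k = 0)
 (p_pos : forall j, j != k -> 0 < p.2 0 j).

Lemma pull_derive phi (f : R -> R[i]) t z1 : smooth_on (@upper_xy R n) phi -> 0 < Im (f t) ->
 cis_derive f t z1 -> is_derive t (1 : R) (fun s => pull phi (f s)) (pull1 phi (f t) z1).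
Proof.
move=> sphi f0 [d1 d2].
by apply: (chain_coord sphi pk _ d1 d2); apply/upper_coord_point.
Qed.

Lemma pull1_derive phi (f f1 : R -> R[i]) t z2 : smooth_on (@upper_xy R n) phi -> 0 < Im (f t) ->
 cis_derive f t (f1 t) -> cis_derive f1 t z2 ->
 is_derive t (1 : R) (fun s => pull1 phi (f s) (f1 s)) (pull2 phi (f t) (f1 t) z2).
Proof.
move=> sphi f0 df [d1 d2].
have hx := pull_derive (smooth_on_derive (dir_x R k) sphi) f0 df.
have hy := pull_derive (smooth_on_derive (dir_y R k) sphi) f0 df.
have h := is_deriveD (is_deriveM hx d1) (is_deriveM hy d2).
apply: (is_derive_eq h); exact: sum_products_rearrange.
Qed.

Lemma pull_laplacian phi (z za zv zaa zvv : R[i]) (s ds w : R) :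
 za ^+ 2 + s%:C ^+ 2 * zv ^+ 2 = 0 -> zaa + s%:C ^+ 2 * zvv + s%:C * ds%:C * zv = 0 ->
 normc zv ^+ 2 = w * Im z ^+ 2 -> normc za ^+ 2 = s ^+ 2 * normc zv ^+ 2 ->
 pull2 phi z za zaa + s ^+ 2 * pull2 phi z zv zvv + s * ds * pull1 phi z zv =
 s ^+ 2 * w * (Im z ^+ 2 * (pull ('D_(dir_x R k) ('D_(dir_x R k) phi)) z +
                   pull ('D_(dir_y R k) ('D_(dir_y R k) phi)) z)).
Proof. by move=> e1 e2 e3 e4; exact: conformal_laplacian_algebra. Qed.

End pullback.

(** * Differentiation under the integral sign *)

Section derivative_under_integral.
Context d (Y : measurableType d) (R : realType).
Variables (mu : {measure set Y -> \bar R}) (B : set Y).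
Hypotheses (mB : measurable B) (B_fin : (mu B < +oo)%E).

Lemma integrable_bounded (f : Y -> R) K : measurable_fun B f -> (forall y, B y -> `|f y| <= K) ->
 mu.-integrable B (EFin \o f).
Proof.
move=> mf hK; apply: measurable_bounded_integrable => //.
exists K; split; first exact: num_real.
by move=> x Kx y By; apply: le_trans (hK y By) (ltW Kx).
Qed.

(** Pointwise limit of difference quotients with steps r/(2(m + 1)), which remain within the radius
    r. *)
Lemma derive_measurable (F F1 : R -> Y -> R) (x r : R) : 0 < r ->
 (forall x', `|x' - x| < r -> measurable_fun B (F x')) ->
 (forall y, B y -> is_derive x (1 : R) (F ^~ y) (F1 x y)) -> measurable_fun B (F1 x).
Proof.
move=> r0 mF dF.
pose h (m : nat) : R := r / 2 * m.+1%:R^-1.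
have h0 m : 0 < h m by rewrite mulr_gt0 ?invr_gt0 ?ltr0n//; lra.
have hr m : h m < r.
 apply: le_lt_trans (_ : r / 2 < _); last lra.
 by rewrite /h ger_pMr ?invf_le1 ?ler1n ?ltr0n//; lra.
have ch : h @ \oo --> (0 : R).
 rewrite -[X in _ --> X](mulr0 (r / 2)); apply: cvgM; first exact: cvg_cst.
 exact: cvg_harmonic.
apply: (@measurable_fun_cvg _ _ _ _ (fun m y => (h m)^-1 * (F (x + h m) y - F x y))).
 move=> m; apply: measurable_funM; first exact: measurable_cst.
 by apply: measurable_funB; apply: mF; rewrite ?subrr ?normr0// [x + _]addrC addrK gtr0_norm.
move=> y By; have [q [qx cq qE]] := is_derive_slope (dF y By).
rewrite -qx (_ : (fun m => _) = q \o (fun m => x + h m)); last first.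
 by apply/funext=> m /=; rewrite qE addrAC subrr add0r mulrC mulfK// gt_eqF.
have cxh : x + h m @[m --> \oo] --> x.
 by rewrite -[X in _ --> X]addr0; apply: cvgD => //; exact: cvg_cst.
exact: (cvg_comp _ _ cxh cq).
Qed.

Lemma derive_under_integral (F F1 : R -> Y -> R) (t0 r K : R) : 0 < r ->
 (forall x, `|x - t0| < r -> measurable_fun B (F x)) ->
 (forall x y, `|x - t0| < r -> B y -> is_derive x (1 : R) (F ^~ y) (F1 x y)) ->
 (forall x y, `|x - t0| < r -> B y -> `|F x y| <= K) ->
 (forall x y, `|x - t0| < r -> B y -> `|F1 x y| <= K) ->
 forall x, `|x - t0| < r ->
  measurable_fun B (F1 x) /\ is_derive x (1 : R) (fun x' => \int[mu]_(y in B) F x' y) (\int[mu]_(y in B) F1 x y).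
Proof.
move=> r0 mF dF bF bF1 x hx.
have I1 x' : (`]t0 - r, t0 + r[%classic x') <-> (`|x' - t0| < r).
 rewrite /= in_itv /= ltr_norml; split=> /andP[h1 h2]; apply/andP; split; lra.
split.
 pose r' := r - `|x - t0|.
 apply: (@derive_measurable F F1 x r'); first by rewrite subr_gt0.
  move=> x' hx'; apply: mF; apply: le_lt_trans (ler_distD x _ _) _.
  by move: hx'; rewrite /r'; lra.
 by move=> y By; exact: dF.
have Ix : `]t0 - r, t0 + r[%classic x by exact/I1.
have intF x' : `]t0 - r, t0 + r[%classic x' -> mu.-integrable B (EFin \o F x').
 by move=> /I1 h; apply: (@integrable_bounded _ K) => [|y By]; [exact: mF|exact: bF].
have dvF x' y : `]t0 - r, t0 + r[%classic x' -> B y -> derivable (F ^~ y) x' 1.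
 by move=> /I1 h By; have [] := dF x' y h By.
have dvE x' y : `]t0 - r, t0 + r[%classic x' -> B y -> partial1of2 F x' y = F1 x' y.
 by move=> /I1 h By; have [_ <-] := dF x' y h By; rewrite /partial1of2 derive1E.
have intK : mu.-integrable B (EFin \o cst `|K|).
 by apply: (@integrable_bounded _ `|K|) => [|y By]; [exact: measurable_cst|rewrite /= normr_id].
have G_ub x' y : `]t0 - r, t0 + r[%classic x' -> B y -> `|partial1of2 F x' y| <= cst `|K| y.
 move=> h By; rewrite dvE//; apply: le_trans (ler_norm K); apply: bF1 => //; exact/I1.
have D := derivable_under_integral mB Ix intF dvF (fun y => normr_ge0 K) intK G_ub.
have C := cvg_differentiation_under_integral mB Ix intF dvF (fun y => normr_ge0 K) intK G_ub.
have E : \int[mu]_(y in B) partial1of2 F x y = \int[mu]_(y in B) F1 x y.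
 by apply: eq_Rintegral => y /set_mem By; exact: dvE.
split=> //; rewrite -E; apply/cvg_lim => //.
rewrite (_ : (fun h => _) = (fun h : R => h^-1 *: ((fun x' : R => \int[mu]_(y in B) F x' y) (h + x) - (fun x' : R => \int[mu]_(y in B) F x' y) x))) //.
by apply/funext=> h; rewrite /shift /= /GRing.scale /= mulr1.
Qed.

End derivative_under_integral.

Section updt.
Variables (R : realType) (n : nat).
Implicit Types (t v : n.-tuple (measurableTypeR R)) (k j : 'I_n).

Definition updt t k (x : R) : n.-tuple (measurableTypeR R) :=
 [tuple (if j == k then x else tnth t j : measurableTypeR R) | j < n].

Lemma tnth_updt t k x j : tnth (updt t k x) j = if j == k then x else tnth t j.
Proof. by rewrite tnth_mktuple. Qed.

Lemma updt_id t k : updt t k (tnth t k) = t.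
Proof. by apply: eq_from_tnth=> j; rewrite tnth_updt; case: eqP=> [->|]. Qed.

Lemma updt_set t k x y : updt (updt t k x) k y = updt t k y.
Proof. by apply: eq_from_tnth=> j; rewrite !tnth_updt; case: eqP. Qed.

End updt.

(** * Averages of eigenfunctions over period cells *)

Section averages.
Variables (R : realType) (n : nat).
Local Notation RT := (measurableTypeR R).
Local Notation T1 := (n.-tuple RT).
Local Notation V := ('rV[R]_n * 'rV[R]_n)%type.
Variables (dom : 'I_n -> R -> Prop) (Zc Za Zv Zaa Zvv : 'I_n -> R -> R -> R[i]) (s ds w : 'I_n -> R -> R).
Hypotheses (conf : forall k, conformal (dom k) (Zc k) (Za k) (Zv k) (Zaa k) (Zvv k) (s k) (ds k) (w k))
 (bnd : forall k, bounded_coords (dom k) (Zc k) (Za k) (Zv k) (Zaa k) (Zvv k))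
 (dom_open : forall k v, dom k v -> exists2 r : R, 0 < r & forall x, v - r <= x <= v + r -> dom k x).

Implicit Types (a v : T1) (k j : 'I_n) (phi : V -> R).

(** The variables [a] (log radii and angles) are averaged over a period cell, while [v] (angles from
    the axis and distances from i) stay free. *)
Definition zt a v : 'rV[R[i]]_n := \row_k Zc k (tnth a k) (tnth v k).
Definition pt a v : V := (re (zt a v), im (zt a v)).
Definition base k a v : V :=
 (\row_j (if j == k then 0 else Re (zt a v 0 j)), \row_j (if j == k then 0 else Im (zt a v 0 j))).
Definition doms v : Prop := forall k, dom k (tnth v k).

Lemma zt_gt0 a v j : dom j (tnth v j) -> 0 < Im (zt a v 0 j).
Proof. by move=> h; rewrite mxE; have [_ []] := conf (tnth a j) h. Qed.

Lemma base_k k a v : (base k a v).2 0 k = 0.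
Proof. by rewrite mxE eqxx. Qed.

Lemma base_gt0 k a v : doms v -> forall j, j != k -> 0 < (base k a v).2 0 j.
Proof. by move=> hv j jk; rewrite mxE (negbTE jk) zt_gt0. Qed.

Lemma base_set_v k a v x : base k a (updt v k x) = base k a v.
Proof. by congr pair; apply/rowP=> j; rewrite !mxE tnth_updt; case: eqP. Qed.

Lemma base_set_a k a v x : base k (updt a k x) v = base k a v.
Proof. by congr pair; apply/rowP=> j; rewrite !mxE tnth_updt; case: eqP. Qed.

Lemma pt_coord k a v : pt a v = coord_point (base k a v) k (Re (zt a v 0 k)) (Im (zt a v 0 k)).
Proof.
rewrite /coord_point /dir_x /dir_y /pt; apply/pair_equal_spec; split; apply/rowP=> j; rewrite /= !mxE eqxx /=;
 by case: eqP=> [->|_]; rewrite ?mulr0 ?mulr1 ?addr0 ?add0r.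
Qed.

Lemma phi_pt phi k a v : phi (pt a v) = pull k (base k a v) phi (Zc k (tnth a k) (tnth v k)).
Proof. by rewrite (pt_coord k) /pull !mxE. Qed.

Lemma upper_pt a v : doms v -> @upper_xy R n (pt a v).
Proof. by move=> hv j; rewrite !mxE /=; have := @zt_gt0 a v j (hv j); rewrite mxE. Qed.

Lemma doms_set v k x : doms v -> dom k x -> doms (updt v k x).
Proof. by move=> hv hx j; rewrite tnth_updt; case: eqP=> [->|]. Qed.

Lemma cis_derive_measurable (f f1 : R -> R[i]) : (forall t, cis_derive f t (f1 t)) ->
 mfunT (fun t => Re (f t)) /\ mfunT (fun t => Im (f t)).
Proof.
move=> df; split; apply: continuous_measurable_fun => t.
 exact: is_derive_continuous (df t).1.
exact: is_derive_continuous (df t).2.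
Qed.

Lemma measurable_phi_pt phi v : (forall q, @upper_xy R n q -> {for q, continuous phi}) -> doms v ->
 mfunT (fun a => phi (pt a v)).
Proof.
move=> cphi hv.
have mZ k : mfunT (fun t => Re (Zc k t (tnth v k))) /\
      mfunT (fun t => Im (Zc k t (tnth v k))).
 by apply: (@cis_derive_measurable _ (fun t => Za k t (tnth v k))) => t; have [[]] := conf t (hv k).
pose q a := (map_fun (fun k t => Re (Zc k t (tnth v k))) a,
       map_fun (fun k t => Im (Zc k t (tnth v k))) a).
have mq : mfunT q.
 by apply: measurable_fun_pair; apply: measurable_map_fun => k; [exact: (mZ k).1|exact: (mZ k).2].
have qE a : to_xy (q a) = pt a v.
 by congr pair; apply/rowP=> j; rewrite !mxE tnth_mktuple.
rewrite (_ : (fun a => _) = (fun p => \1_(@upper R n) p * phi (to_xy p)) \o q); last first.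
 apply/funext=> a /=; rewrite indicE mem_set ?mul1r ?qE// upper_xyE qE; exact: upper_pt.
exact: measurableT_comp (measurable_indic_upper cphi) mq.
Qed.

Variables (A : set T1) (L : R).
Hypotheses (mA : measurable A) (A_fin : (leb R n A < +oo)%E).
Hypothesis A_bnd : forall a, A a -> forall j, `|tnth a j| <= L.

Lemma box_bound k v L' : doms v -> exists2 r : R, 0 < r & exists2 K : R, 1 <= K &
 forall a x, (forall j, `|tnth a j| <= L') -> `|x - tnth v k| < r ->
 [/\ dom k x, in_boxes K (zt a (updt v k x)) &
  [/\ normc (Za k (tnth a k) x) <= K, normc (Zv k (tnth a k) x) <= K,
    normc (Zaa k (tnth a k) x) <= K & normc (Zvv k (tnth a k) x) <= K]].
Proof.
move=> hv; have [r r0 hr] := dom_open (hv k).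
have [K0 K01 hK0] := bnd L' hr.
have /choice[Kj hKj] : forall j, exists K : R, 1 <= K /\ forall b : R, `|b| <= L' ->
  in_box K (Re (Zc j b (tnth v j))) (Im (Zc j b (tnth v j))).
 move=> j; have h x : tnth v j <= x <= tnth v j -> dom j x.
  by rewrite -eq_le => /eqP <-; exact: hv.
 have [K K1 hK] := bnd L' h; exists K; split=> // b hb.
 by have [] := hK b (tnth v j) hb _; rewrite ?lexx.
exists r => //; exists (K0 + \sum_j Kj j).
 have : 0 <= \sum_j Kj j by apply: sumr_ge0 => j _; apply: le_trans (hKj j).1.
 lra.
have S0 : 0 <= \sum_j Kj j by apply: sumr_ge0 => j _; apply: le_trans (hKj j).1.
move=> a x ha hx.
have hx' : tnth v k - r <= x <= tnth v k + r.
 by move: hx; rewrite ltr_norml => /andP[h1 h2]; apply/andP; split; lra.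
have [b0 [h1 h2 h3 h4]] := hK0 (tnth a k) x (ha k) hx'.
have le0 : K0 <= K0 + \sum_j Kj j by rewrite lerDl.
split; first exact: hr.
 move=> j; rewrite mxE tnth_updt; have [->|jk] := eqVneq j k.
  exact: in_box_le b0.
 have [Kj1 bj] := hKj j; apply: in_box_le (bj _ (ha j)) => //.
 rewrite (bigD1 j)//= addrCA lerDl addr_ge0//; first lra.
 by apply: sumr_ge0 => i _; apply: le_trans (hKj i).1.
by split; apply: le_trans le0.
Qed.

Lemma pull_bound phi K k : smooth_on (@upper_xy R n) phi -> 1 <= K -> exists2 C : R, 0 <= C &
 forall a v (z1 z2 : R[i]), in_boxes K (zt a v) -> normc z1 <= K -> normc z2 <= K ->
 [/\ `|pull k (base k a v) phi (Zc k (tnth a k) (tnth v k))| <= C,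
  `|pull1 k (base k a v) phi (Zc k (tnth a k) (tnth v k)) z1| <= C &
  `|pull2 k (base k a v) phi (Zc k (tnth a k) (tnth v k)) z1 z2| <= C].
Proof.
move=> sphi K1.
have cont vs : forall q, @upper_xy R n q -> {for q, continuous (iter_derive vs phi)}.
 by move=> q uq; have [] := sphi vs q uq.
have [C0 C00 h0] := bounded_on_boxes K1 (cont [::]).
have [Cx Cx0 hx] := bounded_on_boxes K1 (cont [:: dir_x R k]).
have [Cy Cy0 hy] := bounded_on_boxes K1 (cont [:: dir_y R k]).
have [Cxx Cxx0 hxx] := bounded_on_boxes K1 (cont [:: dir_x R k; dir_x R k]).
have [Cyx Cyx0 hyx] := bounded_on_boxes K1 (cont [:: dir_y R k; dir_x R k]).
have [Cxy Cxy0 hxy] := bounded_on_boxes K1 (cont [:: dir_x R k; dir_y R k]).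
have [Cyy Cyy0 hyy] := bounded_on_boxes K1 (cont [:: dir_y R k; dir_y R k]).
have K0 : 0 <= K by lra.
pose C1 := (Cx + Cy) * K; pose C2 := ((Cxx + Cyx) * K + (Cxy + Cyy) * K) * K + C1.
have C10 : 0 <= C1 by rewrite mulr_ge0 ?addr_ge0.
have C20 : 0 <= C2 by rewrite addr_ge0// mulr_ge0 ?addr_ge0// mulr_ge0 ?addr_ge0.
have q0 : C0 <= C0 + C1 + C2 by lra.
have q1 : C1 <= C0 + C1 + C2 by lra.
have q2 : C2 <= C0 + C1 + C2 by lra.
exists (C0 + C1 + C2); first exact: le_trans q0.
have comb (x y c c' : R) (z : R[i]) : `|x| <= c -> `|y| <= c' -> normc z <= K ->
  `|x * Re z + y * Im z| <= (c + c') * K.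
 move=> hx' hy' hz; apply: le_trans (ler_normD _ _) _; rewrite !normrM mulrDl.
 by apply: lerD; apply: ler_pM => //; apply: le_trans hz; [exact: normc_Re|exact: normc_Im].
move=> a v z1 z2 hb n1 n2.
have P psi C : (forall z, in_boxes K z -> `|psi (re z, im z)| <= C) ->
  `|pull k (base k a v) psi (Zc k (tnth a k) (tnth v k))| <= C.
 by move=> h; rewrite -phi_pt; exact: h.
have p0 := P _ _ h0; have px := P _ _ hx; have py := P _ _ hy.
have pxx := P _ _ hxx; have pyx := P _ _ hyx; have pxy := P _ _ hxy; have pyy := P _ _ hyy.
have p1 z : normc z <= K -> `|pull1 k (base k a v) phi (Zc k (tnth a k) (tnth v k)) z| <= C1.
 by move=> hz; exact: comb.
split.
- exact: le_trans p0 q0.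
- exact: le_trans (p1 _ n1) q1.
- apply: le_trans q2.
 apply: le_trans (ler_normD _ _) _; apply: lerD; last exact: p1.
 exact: (comb _ _ _ _ _ (comb _ _ _ _ _ pxx pyx n1) (comb _ _ _ _ _ pxy pyy n1) n1).
Qed.

Definition avg (f : T1 -> R) : R := \int[leb R n]_(a in A) f a.
Definition avg0 phi v := avg (fun a => phi (pt a v)).
Definition avg1 k phi v := avg (fun a => pull1 k (base k a v) phi (Zc k (tnth a k) (tnth v k)) (Zv k (tnth a k) (tnth v k))).
Definition avg2 k phi v := avg (fun a => pull2 k (base k a v) phi (Zc k (tnth a k) (tnth v k)) (Zv k (tnth a k) (tnth v k)) (Zvv k (tnth a k) (tnth v k))).
Definition avg_laplacian k phi v := avg (fun a => Im (Zc k (tnth a k) (tnth v k)) ^+ 2 *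
 ('D_(dir_x R k) ('D_(dir_x R k) phi) (pt a v) + 'D_(dir_y R k) ('D_(dir_y R k) phi) (pt a v))).

Lemma avg_v_derivatives phi k v : smooth_on (@upper_xy R n) phi -> doms v ->
 [/\ measurable_fun A (fun a => pull1 k (base k a v) phi (Zc k (tnth a k) (tnth v k)) (Zv k (tnth a k) (tnth v k))),
   measurable_fun A (fun a => pull2 k (base k a v) phi (Zc k (tnth a k) (tnth v k)) (Zv k (tnth a k) (tnth v k)) (Zvv k (tnth a k) (tnth v k))),
   is_derive (tnth v k) (1 : R) (fun x => avg0 phi (updt v k x)) (avg1 k phi v) &
   is_derive (tnth v k) (1 : R) (fun x => avg1 k phi (updt v k x)) (avg2 k phi v)].
Proof.
move=> sphi hv; have [r r0 [K K1 hK]] := box_bound k L hv.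
have [C C0 hC] := pull_bound k sphi K1.
pose F (x : R) a := pull k (base k a v) phi (Zc k (tnth a k) x).
pose F1 (x : R) a := pull1 k (base k a v) phi (Zc k (tnth a k) x) (Zv k (tnth a k) x).
pose F2 (x : R) a := pull2 k (base k a v) phi (Zc k (tnth a k) x) (Zv k (tnth a k) x) (Zvv k (tnth a k) x).
have FE x a : F x a = phi (pt a (updt v k x)).
 by rewrite (phi_pt phi k) base_set_v tnth_updt eqxx.
(* A point of A is wanted, since [box_bound] gives the domain condition together with a bounded
   tuple; over an empty set every average is 0. *)
have A0 : A !=set0 \/ A = set0 by have [->|/set0P] := eqVneq A set0; [right|left].
case: A0 => [[a0 Aa0]|A0]; last first.
 have z f : avg f = 0 by rewrite /avg A0 Rintegral_set0.
 have mz (f : T1 -> R) : measurable_fun A f by rewrite A0; exact: measurable_fun_set0.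
 split=> //.
  rewrite /avg1 z (_ : (fun x => _) = fun=> 0); first exact: is_derive_cst.
  by apply/funext=> x; rewrite /avg0 z.
 rewrite /avg2 z (_ : (fun x => _) = fun=> 0); first exact: is_derive_cst.
 by apply/funext=> x; rewrite /avg1 z.
have domx x : `|x - tnth v k| < r -> dom k x by move=> hx; have [] := hK a0 x (A_bnd Aa0) hx.
have bounds x a : `|x - tnth v k| < r -> A a -> [/\ `|F x a| <= C, `|F1 x a| <= C & `|F2 x a| <= C].
 move=> hx Aa; have [dx hb [n1 n2 n3 n4]] := hK a x (A_bnd Aa) hx.
 have := hC a (updt v k x) (Zv k (tnth a k) x) (Zvv k (tnth a k) x) hb n2 n4.
 by rewrite base_set_v tnth_updt eqxx.
have mF x : `|x - tnth v k| < r -> measurable_fun A (F x).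
 move=> hx; rewrite (_ : F x = fun a => phi (pt a (updt v k x))); last exact/funext/FE.
 apply: (@measurable_funS _ _ _ _ setT) => //; apply: measurable_phi_pt; last first.
  by apply: doms_set => //; exact: domx.
 by move=> q uq; have [] := sphi [::] q uq.
have dF x a : `|x - tnth v k| < r -> A a -> is_derive x (1 : R) (F ^~ a) (F1 x a).
 move=> hx Aa; have [[_ d2 _ _] [z0 _ _ _ _]] := conf (tnth a k) (domx x hx).
 exact: (@pull_derive R n k _ (base_k k a v) (base_gt0 a hv) phi (Zc k (tnth a k)) x _ sphi z0 d2).
have dF1 x a : `|x - tnth v k| < r -> A a -> is_derive x (1 : R) (F1 ^~ a) (F2 x a).
 move=> hx Aa; have [[_ d2 _ d4] [z0 _ _ _ _]] := conf (tnth a k) (domx x hx).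
 exact: (@pull1_derive R n k _ (base_k k a v) (base_gt0 a hv) phi (Zc k (tnth a k)) (Zv k (tnth a k)) x _ sphi z0 d2 d4).
have H0 := derive_under_integral mA A_fin r0 mF dF
 (fun x a hx Aa => let: And3 h _ _ := bounds x a hx Aa in h) (fun x a hx Aa => let: And3 _ h _ := bounds x a hx Aa in h).
have H1 := derive_under_integral mA A_fin r0 (fun x hx => (H0 x hx).1) dF1
 (fun x a hx Aa => let: And3 _ h _ := bounds x a hx Aa in h) (fun x a hx Aa => let: And3 _ _ h := bounds x a hx Aa in h).
have r1 : `|tnth v k - tnth v k| < r by rewrite subrr normr0.
split.
- exact: (H0 _ r1).1.
- exact: (H1 _ r1).1.
- rewrite (_ : (fun x => _) = (fun x' => \int[leb R n]_(y in A) F x' y)); first exact: (H0 _ r1).2.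
 by apply/funext=> x; rewrite /avg0 /avg; congr (Rintegral _ _ _); apply/funext=> a; rewrite FE.
- rewrite (_ : (fun x => _) = (fun x' => \int[leb R n]_(y in A) F1 x' y)); first exact: (H1 _ r1).2.
 apply/funext=> x; rewrite /avg1 /avg; congr (Rintegral _ _ _); apply/funext=> a.
 by rewrite base_set_v tnth_updt eqxx.
Qed.

Lemma cis_derive_shift (f : R -> R[i]) (c x : R) (d : R[i]) :
 cis_derive f (c + x) d -> cis_derive (fun y => f (c + y)) x d.
Proof.
have sh : is_derive x (1 : R) (fun y : R => c + y) 1.
 by apply: (is_derive_eq (is_deriveD (is_derive_cst c x (1 : R)) (is_derive_id x (1 : R)))); rewrite add0r.
by move=> [d1 d2]; split; [have := is_derive1_comp d1 sh|have := is_derive1_comp d2 sh]; rewrite mulr1.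
Qed.

Lemma box_bound_a k v : doms v -> exists2 K : R, 1 <= K &
 forall a x, A a -> `|x| < 1 ->
 [/\ in_boxes K (zt (updt a k (tnth a k + x)) v),
    normc (Za k (tnth a k + x) (tnth v k)) <= K & normc (Zaa k (tnth a k + x) (tnth v k)) <= K].
Proof.
move=> hv; have [r r0 [K K1 hK]] := box_bound k (L + 1) hv; exists K => // a x Aa hx.
have hb j : `|tnth (updt a k (tnth a k + x)) j| <= L + 1.
 rewrite tnth_updt; case: eqP=> _; last by have := A_bnd Aa j; lra.
 by apply: le_trans (ler_normD _ _) _; have := A_bnd Aa k; lra.
have r1 : `|tnth v k - tnth v k| < r by rewrite subrr normr0.
by have [_] := hK _ _ hb r1; rewrite updt_id tnth_updt eqxx => h [].
Qed.

(** By the invariance hypothesis the average of the translated function is constant in x;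
    differentiating it twice under the integral gives 0. *)
Lemma avg_a_derivatives phi k v : smooth_on (@upper_xy R n) phi -> doms v ->
 (forall x, avg (fun a => phi (pt (updt a k (tnth a k + x)) v)) = avg0 phi v) ->
 let f := fun a => pull2 k (base k a v) phi (Zc k (tnth a k) (tnth v k)) (Za k (tnth a k) (tnth v k)) (Zaa k (tnth a k) (tnth v k)) in
 measurable_fun A f /\ avg f = 0.
Proof.
move=> sphi hv per f; have [K K1 hK] := box_bound_a k hv.
have [C C0 hC] := pull_bound k sphi K1.
pose F (x : R) a := pull k (base k a v) phi (Zc k (tnth a k + x) (tnth v k)).
pose F1 (x : R) a := pull1 k (base k a v) phi (Zc k (tnth a k + x) (tnth v k)) (Za k (tnth a k + x) (tnth v k)).
pose F2 (x : R) a := pull2 k (base k a v) phi (Zc k (tnth a k + x) (tnth v k)) (Za k (tnth a k + x) (tnth v k)) (Zaa k (tnth a k + x) (tnth v k)).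
have FE x a : F x a = phi (pt (updt a k (tnth a k + x)) v).
 by rewrite (phi_pt phi k) base_set_a tnth_updt eqxx.
have bounds x a : `|x - 0| < 1 -> A a -> [/\ `|F x a| <= C, `|F1 x a| <= C & `|F2 x a| <= C].
 rewrite subr0 => hx Aa; have [hb n1 n3] := hK a x Aa hx.
 have := hC (updt a k (tnth a k + x)) v _ _ hb n1 n3.
 by rewrite base_set_a tnth_updt eqxx.
have mF x : `|x - 0| < 1 -> measurable_fun A (F x).
 move=> _; rewrite (_ : F x = (fun a => phi (pt a v)) \o (map_fun (fun j t => if j == k then t + x else t))).
  apply: (@measurable_funS _ _ _ _ setT) => //.
  apply: (measurableT_comp (measurable_phi_pt _ hv)); first by move=> q uq; have [] := sphi [::] q uq.
  apply: measurable_map_fun => j; case: eqP=> _; last exact: measurable_id.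
  by apply: measurable_funD => //; exact: measurable_cst.
 apply/funext=> a; rewrite FE /=; congr (phi (pt _ v)); apply: eq_from_tnth=> j.
 by rewrite tnth_updt tnth_mktuple; case: eqP=> [->|].
have dF x a : `|x - 0| < 1 -> A a -> is_derive x (1 : R) (F ^~ a) (F1 x a).
 move=> hx Aa; have [[d1 _ _ _] [z0 _ _ _ _]] := conf (tnth a k + x) (hv k).
 exact: (@pull_derive R n k _ (base_k k a v) (base_gt0 a hv) phi (fun y => Zc k (tnth a k + y) (tnth v k)) x _ sphi z0 (cis_derive_shift d1)).
have dF1 x a : `|x - 0| < 1 -> A a -> is_derive x (1 : R) (F1 ^~ a) (F2 x a).
 move=> hx Aa; have [[d1 _ d3 _] [z0 _ _ _ _]] := conf (tnth a k + x) (hv k).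
 exact: (@pull1_derive R n k _ (base_k k a v) (base_gt0 a hv) phi (fun y => Zc k (tnth a k + y) (tnth v k)) (fun y => Za k (tnth a k + y) (tnth v k)) x _ sphi z0 (cis_derive_shift d1) (cis_derive_shift d3)).
have H0 := derive_under_integral mA A_fin ltr01 mF dF
 (fun x a hx Aa => let: And3 h _ _ := bounds x a hx Aa in h) (fun x a hx Aa => let: And3 _ h _ := bounds x a hx Aa in h).
have H1 := derive_under_integral mA A_fin ltr01 (fun x hx => (H0 x hx).1) dF1
 (fun x a hx Aa => let: And3 _ h _ := bounds x a hx Aa in h) (fun x a hx Aa => let: And3 _ _ h := bounds x a hx Aa in h).
have E0 : (fun x' => \int[leb R n]_(y in A) F x' y) = fun=> avg0 phi v.
 by apply/funext=> x; rewrite -(per x); congr (Rintegral _ _ _); apply/funext=> a; rewrite FE.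
have F10 x : `|x - 0| < 1 -> \int[leb R n]_(y in A) F1 x y = 0.
 move=> hx; have [_] := H0 x hx; rewrite E0 => -[_ <-]; exact: derive_cst.
have r1 : `|(0 : R) - 0| < 1 by rewrite subrr normr0.
have [m2 d2] := H1 0 r1.
have fE : f = F2 0 by apply/funext=> a; rewrite /F2 addr0.
rewrite fE; split=> //; rewrite /avg.
have d0 : is_derive (0 : R) (1 : R) (fun x' => \int[leb R n]_(y in A) F1 x' y) 0.
 have nq : \forall x \near (0 : R), (fun=> 0 : R) x = \int[leb R n]_(y in A) F1 x y.
  near=> x; rewrite F10// subr0; near: x; exact: nbhs0_lt.
 exact: (near_eq_is_derive nq (is_derive_cst (0 : R) (0 : R) (1 : R))).
by have [_ e2] := d2; have [_ e0] := d0; exact: (etrans (esym e2) e0).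
Unshelve. all: by end_near.
Qed.

(** The conformal form of the Laplacian is averaged, and its second a-derivative drops out. *)
Lemma avg_ode phi k v : smooth_on (@upper_xy R n) phi -> doms v ->
 (forall x, avg (fun a => phi (pt (updt a k (tnth a k + x)) v)) = avg0 phi v) ->
 s k (tnth v k) ^+ 2 * avg2 k phi v + s k (tnth v k) * ds k (tnth v k) * avg1 k phi v =
 s k (tnth v k) ^+ 2 * w k (tnth v k) * avg_laplacian k phi v.
Proof.
move=> sphi hv per.
have [r r0 [K K1 hK]] := box_bound k L hv; have [C C0 hC] := pull_bound k sphi K1.
have r1 : `|tnth v k - tnth v k| < r by rewrite subrr normr0.
have [m1 m2 _ _] := avg_v_derivatives k sphi hv.
have [maa aa0] := avg_a_derivatives sphi hv per.
set f1 := (fun a : T1 => pull1 _ _ _ _ _) in m1; set f2 := (fun a : T1 => pull2 _ _ _ _ _ _) in m2.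
set fa := (fun a : T1 => pull2 _ _ _ _ _ _) in maa aa0.
have box a : A a -> [/\ in_boxes K (zt a v), normc (Za k (tnth a k) (tnth v k)) <= K, normc (Zv k (tnth a k) (tnth v k)) <= K, normc (Zaa k (tnth a k) (tnth v k)) <= K & normc (Zvv k (tnth a k) (tnth v k)) <= K].
 by move=> Aa; have [_] := hK a (tnth v k) (A_bnd Aa) r1; rewrite updt_id => h [].
have b1 a : A a -> `|f1 a| <= C.
 by move=> /box[hb n1 n2 n3 n4]; have [] := hC a v _ _ hb n2 n4.
have b2 a : A a -> `|f2 a| <= C.
 by move=> /box[hb n1 n2 n3 n4]; have [] := hC a v _ _ hb n2 n4.
have ba a : A a -> `|fa a| <= C.
 by move=> /box[hb n1 n2 n3 n4]; have [] := hC a v _ _ hb n1 n3.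
have i1 := integrable_bounded mA A_fin m1 b1.
have i2 := integrable_bounded mA A_fin m2 b2.
have ia := integrable_bounded mA A_fin maa ba.
set S := s k (tnth v k); set D := ds k (tnth v k); set W := w k (tnth v k).
pose fL a := Im (Zc k (tnth a k) (tnth v k)) ^+ 2 *
 ('D_(dir_x R k) ('D_(dir_x R k) phi) (pt a v) + 'D_(dir_y R k) ('D_(dir_y R k) phi) (pt a v)).
have E a : S ^+ 2 * W * fL a = fa a + S ^+ 2 * f2 a + S * D * f1 a.
 have [_ [_ e1 e2 e3 e4]] := conf (tnth a k) (hv k).
 rewrite /fL (phi_pt ('D_(dir_x R k) ('D_(dir_x R k) phi)) k) (phi_pt ('D_(dir_y R k) ('D_(dir_y R k) phi)) k) /fa /f2 /f1; symmetry; exact: pull_laplacian.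
have iS2 : (leb R n).-integrable A (EFin \o (fun a => S ^+ 2 * f2 a)).
 by rewrite (_ : _ \o _ = fun a => ((S ^+ 2)%:E * (EFin \o f2) a)%E)//; exact: integrableZl.
have iSD : (leb R n).-integrable A (EFin \o (fun a => S * D * f1 a)).
 by rewrite (_ : _ \o _ = fun a => ((S * D)%:E * (EFin \o f1) a)%E)//; exact: integrableZl.
have iaS : (leb R n).-integrable A (EFin \o (fun a => fa a + S ^+ 2 * f2 a)).
 by rewrite (_ : _ \o _ = fun a => ((EFin \o fa) a + (EFin \o (fun a => (S ^+ 2 * f2 a)%R)) a)%E)//; exact: integrableD.
have T1 : avg (fun a => fa a + S ^+ 2 * f2 a + S * D * f1 a) = S ^+ 2 * avg2 k phi v + S * D * avg1 k phi v.
 rewrite /avg RintegralD// RintegralD// !RintegralZl//.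
 by rewrite -[X in X + _ + _]/(avg fa) aa0 add0r.
rewrite -T1.
(* Integrability of [fL] comes from dividing the integrable right side by S^2 W; if this factor is
   0, both sides vanish. *)
have [Z|Z] := eqVneq (S ^+ 2 * W) 0.
 rewrite Z mul0r; transitivity (avg (fun=> 0)); last by rewrite /avg Rintegral_cst// mul0r.
 by congr avg; apply/funext=> a; rewrite -E Z mul0r.
rewrite -[avg_laplacian k phi v]/(avg fL) /avg -RintegralZl//.
 by congr (Rintegral _ _ _); apply/funext=> a; rewrite E.
have iT : (leb R n).-integrable A (EFin \o (fun a => fa a + S ^+ 2 * f2 a + S * D * f1 a)).
 by rewrite (_ : _ \o _ = fun a => ((EFin \o (fun a => (fa a + S ^+ 2 * f2 a)%R)) a + (EFin \o (fun a => (S * D * f1 a)%R)) a)%E)//; exact: integrableD.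
rewrite (_ : _ \o _ = fun a => ((S ^+ 2 * W)^-1%:E * (EFin \o (fun a => fa a + S ^+ 2 * f2 a + S * D * f1 a)%R) a)%E).
 exact: integrableZl.
by apply/funext=> a; rewrite /= -E -EFinM mulKf.
Qed.

End averages.

(** * Periodic functions and period cells *)

Section translations.
Variables (R : realType) (n : nat).
Local Notation RT := (measurableTypeR R).
Local Notation T1 := (n.-tuple RT).
Implicit Types (a : T1) (b : 'I_n -> R).

Definition translate b a : T1 := map_fun (fun k t => t + b k) a.

Lemma tnth_translate b a k : tnth (translate b a) k = tnth a k + b k.
Proof. by rewrite tnth_mktuple. Qed.

Lemma measurable_translate b : mfunT (translate b).
Proof.
by apply: measurable_map_fun => k; apply: measurable_funD => //; exact: measurable_cst.
Qed.

Lemma ge0_integral_translate b (g : T1 -> \bar R) : mfunT g -> (forall a, 0 <= g a)%E ->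
 (\int[leb R n]_a g a = \int[leb R n]_a g (translate b a))%E.
Proof.
move=> mg g0.
have mZ k : mfunT (fun t : R => t + b k) by meas.
have HK (k : 'I_n) (g1 : R -> \bar R) : mfunT g1 -> (forall x, (0 <= g1 x)%E) ->
  (\int[lebesgue_measure]_x g1 x = \int[lebesgue_measure]_x (g1 (x + b k)%R * 1))%E.
 by move=> mg1 g10; under [RHS]eq_integral do rewrite mule1; exact: ge0_integral_shift.
rewrite (ge0_leb_coordinate_change (fun _ => measurable_cst _) (fun _ _ => ler01) mZ HK mg g0).
by apply: eq_integral=> v _; rewrite big1_eq mule1.
Qed.

(** A translate of a fundamental domain is again one. The translated set is cut along the lattice
    translates of A by [ge0_unfold] and reassembled into A by invariance of f. *)
Lemma ge0_integral_periodic (lam : 'rV[int]_n -> 'I_n -> R) (A : set T1) (f : T1 -> R) b :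
 (forall x k, lam (- x) k = - lam x k) ->
 measurable A -> (forall a, exists! x, A (translate (lam x) a)) ->
 mfunT f -> (forall a, 0 <= f a) -> (forall x a, f (translate (lam x) a) = f a) ->
 (\int[leb R n]_(a in A) (f (translate b a))%:E = \int[leb R n]_(a in A) (f a)%:E)%E.
Proof.
move=> lamN mA uA mf f0 per.
have trK c c' a : (forall k, c' k = - c k) -> translate c' (translate c a) = a.
 by move=> e; apply: eq_from_tnth=> k; rewrite !tnth_translate e addrK.
have sumA a : (\esum_(i in [set: 'rV[int]_n]) (\1_A (translate (lam i) a) : R)%:E = 1)%E.
 have [x [Ax ux]] := uA a.
 have := @esum_unique R _ setT [set i | A (translate (lam i) a)] x I Ax (fun i _ Ai => esym (ux i Ai)).
 by [].
have sumA' a : (\esum_(i in [set: 'rV[int]_n]) (\1_A (translate (fun k => - lam i k) a) : R)%:E = 1)%E.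
 have E i : translate (fun k => - lam i k) a = translate (lam (- i)) a.
  by apply: eq_from_tnth=> k; rewrite !tnth_translate lamN.
 have [x [Ax ux]] := uA a.
 have Ax' : A (translate (fun k => - lam (- x) k) a) by rewrite E opprK.
 have := @esum_unique R _ setT [set i | A (translate (fun k => - lam i k) a)] (- x) I Ax' _.
 apply => i _; rewrite /mkset E => /ux ->; by rewrite opprK.
have countI : countable [set: 'rV[int]_n] by exact: countableP.
pose b' k := - b k.
have mtr c : mfunT (fun a => f (translate c a)) by exact: measurableT_comp mf (measurable_translate c).
have mA1 c : mfunT (fun a => \1_A (translate c a) : R).
 by apply: measurableT_comp (measurable_translate c); exact: measurable_indic.
have G0 a : 0 <= f a * \1_A (translate b' a) by rewrite mulr_ge0.
have mG : mfunT (fun a => f a * \1_A (translate b' a)) by exact: measurable_funM.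
transitivity (\int[leb R n]_a (f a * \1_A (translate b' a))%:E)%E.
 rewrite integral_mkcond [RHS](ge0_integral_translate b).
 - apply: eq_integral=> a _; rewrite patchE trK// indicE.
  by case: ifP; rewrite ?mulr1 ?mulr0.
 - exact/measurable_EFinP.
 - by move=> a; rewrite lee_fin.
rewrite (@ge0_unfold _ T1 R _ (leb R n) setT (fun i => translate (lam i)) (fun i => translate (fun k => - lam i k)) A) //.
- have E i a : (f (translate (lam i) a) * \1_A (translate b' (translate (lam i) a)) * \1_A a)%:E =
  ((f a * \1_A a)%:E * (\1_A (translate (lam i) (translate b' a)) : R)%:E)%E.
  rewrite per -EFinM mulrAC; congr (_ * _ * (\1_A _))%:E.
  by apply: eq_from_tnth=> k; rewrite !tnth_translate addrAC.
 transitivity (\esum_(i in [set: 'rV[int]_n]) \int[leb R n]_a ((f a * \1_A a)%:E * (\1_A (translate (lam i) (translate b' a)) : R)%:E))%E.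
  by apply: eq_esum => i _; apply: eq_integral=> a _; exact: E.
 have mB i : mfunT (fun a => ((f a * \1_A a)%:E * (\1_A (translate (lam i) (translate b' a)) : R)%:E)%E).
  apply: emeasurable_funM; apply/measurable_EFinP.
   by apply: measurable_funM => //; exact: measurable_indic.
  exact: measurableT_comp (mA1 (lam i)) (measurable_translate b').
 have B0 i a : (0 <= (f a * \1_A a)%:E * (\1_A (translate (lam i) (translate b' a)) : R)%:E)%E.
  by rewrite mule_ge0 ?lee_fin ?mulr_ge0.
 have [_ <-] := ge0_integral_esum (leb R n) countI (fun i _ => mB i) B0.
 rewrite [RHS]integral_mkcond; apply: eq_integral=> a _.
 transitivity ((f a * \1_A a)%:E * 1)%E; last first.
  by rewrite mule1 patchE indicE; case: ifP; rewrite ?mulr1 ?mulr0.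
 rewrite -(sumA (translate b' a)).
 have [->|n0] := eqVneq (f a * \1_A a) 0.
  by rewrite mul0e esum1// => i _; rewrite mul0e.
 have [e [surj [eJ einj]]] := countable_enum countI.
 rewrite (esum_enum surj eJ einj); last by move=> i; rewrite mule_ge0 ?lee_fin ?mulr_ge0.
 rewrite (esum_enum surj eJ einj); last by move=> i; rewrite lee_fin.
 rewrite -nneseriesZl//; last by move=> k _; rewrite /opt_val; case: (e k) => //= i; rewrite lee_fin.
 by apply: eq_eseriesr => k _; rewrite /opt_val; case: (e k); rewrite ?mule0.
- by move=> i; exact: measurable_translate.
- by move=> i; exact: measurable_translate.
- by move=> i g mg g0; exact: ge0_integral_translate.
- by move=> i a _ _; exact: trK.
- by apply: aeW => a _; exact: sumA'.
Qed.

Lemma Rintegral_periodic (lam : 'rV[int]_n -> 'I_n -> R) (A : set T1) (f : T1 -> R) b :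
 (forall x k, lam (- x) k = - lam x k) ->
 measurable A -> (forall a, exists! x, A (translate (lam x) a)) ->
 mfunT f -> (forall x a, f (translate (lam x) a) = f a) ->
 \int[leb R n]_(a in A) f (translate b a) = \int[leb R n]_(a in A) f a.
Proof.
move=> lamN mA uA mf per.
pose fp a := Num.max (f a) 0; pose fn a := Num.max (- f a) 0.
have mp : mfunT fp by apply: measurable_maxr => //; exact: measurable_cst.
have mn : mfunT fn.
 by apply: measurable_maxr; [apply: measurableT_comp => //; apply: continuous_measurable_fun; exact: opp_continuous|exact: measurable_cst].
have p0 a : 0 <= fp a by rewrite le_max lexx orbT.
have n0 a : 0 <= fn a by rewrite le_max lexx orbT.
have ep := @ge0_integral_periodic lam A fp b lamN mA uA mp p0 (fun x a => ltac:(by rewrite /fp per)).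
have en := @ge0_integral_periodic lam A fn b lamN mA uA mn n0 (fun x a => ltac:(by rewrite /fn per)).
rewrite /Rintegral; congr fine; rewrite integralE [RHS]integralE.
have funp (g : T1 -> R) : ((fun a => (g a)%:E)^\+ = fun a => (Num.max (g a) 0)%:E)%E.
 by apply/funext=> a; rewrite funeposE EFin_max.
have funn (g : T1 -> R) : ((fun a => (g a)%:E)^\- = fun a => (Num.max (- g a) 0)%:E)%E.
 by apply/funext=> a; rewrite funenegE EFin_max EFinN.
by rewrite !funp !funn; congr (_ - _)%E.
Qed.

End translations.

Section period_cell.
Variables (R : realType) (n m : nat) (h : 'I_m -> 'I_n).
Hypothesis h_inj : injective h.
Variables (B : 'M[R]_m) (tau : 'I_m -> 'I_n -> R).
Hypotheses (B_free : row_free B)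
 (tauB : forall i j, tau i (h j) = B i j).
Local Notation T1 := (n.-tuple (measurableTypeR R)).
Implicit Types (a : T1).

(** Reduction by the generators fixes the hyperbolic coordinates but also turns the angles, which
    are then reduced by full turns. *)
Definition period_cell : set T1 :=
 [set a | parallelotope B (\row_j tnth a (h j)) /\
      forall k, k \notin codom h -> - (pi / 2) <= tnth a k < 3 * (pi / 2)].

(* The coordinates of x listed by h count the vectors tau i, the other ones the
  full turns of the corresponding angle. *)
Definition period_shift (x : 'rV[int]_n) (k : 'I_n) : R :=
 \sum_i (x 0 (h i))%:~R * tau i k + (if k \in codom h then 0 else 2 * pi * (x 0 k)%:~R).

Lemma period_shiftN x k : period_shift (- x) k = - period_shift x k.
Proof.
rewrite /period_shift opprD -sumrN; congr (_ + _).
 by apply: eq_bigr=> i _; rewrite mxE rmorphN mulNr.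
by case: ifP; rewrite ?oppr0// mxE rmorphN mulrN.
Qed.

Lemma measurable_period_cell : measurable period_cell.
Proof.
apply: measurableI.
 apply: (@measurable_parallelotope _ _ _ _ _ (fun a : T1 => \row_j tnth a (h j))) => // k.
 rewrite (_ : (fun a => _) = fun a : T1 => tnth a (h k)); first exact: measurable_tnth.
 by apply/funext=> a; rewrite mxE.
rewrite (_ : (fun a => _) = \bigcap_(k in [set k | k \notin codom h]) ((fun a : T1 => tnth a k) @^-1` `[(- (pi / 2)), (3 * (pi / 2))[%classic)).
 apply: fin_bigcap_measurable => [|k _].
  exact: finite_finset.
 rewrite -[X in measurable X]setTI; apply: measurable_tnth => //; exact: measurable_itv.
by apply/seteqP; split=> a /= H k hk; have := H k hk; rewrite /= in_itv.
Qed.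

Lemma period_cell_bounded : exists2 L : R, 0 <= L & forall a, period_cell a -> forall j, `|tnth a j| <= L.
Proof.
have [M M0 hM] := parallelotope_bounded B; exists (M + 3 * (pi / 2)).
 by rewrite addr_ge0// mulr_ge0// divr_ge0// pi_ge0.
have p0 := pi_gt0 R.
move=> a [Pa ea] j; have [/codomP[i ->]|hj] := boolP (j \in codom h).
 by have := hM _ Pa i; rewrite mxE; lra.
by rewrite ler_norml; have /andP[e1 e2] := ea j hj; apply/andP; split; lra.
Qed.

Lemma period_cell_fin : (leb R n period_cell < +oo)%E.
Proof.
have [L L0 hL] := period_cell_bounded.
pose D (i : 'I_n) : set (measurableTypeR R) := `[- L, L]%classic.
have mD i : measurable (D i) by exact: measurable_itv.
have mB : measurable [set a : T1 | forall i, D i (tnth a i)].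
 rewrite (_ : [set a | _] = \bigcap_(i in [set: 'I_n]) ((fun a : T1 => tnth a i) @^-1` D i)).
  apply: fin_bigcap_measurable => // i _; rewrite -[X in measurable X]setTI; exact: measurable_tnth.
 by apply/seteqP; split=> a /= H i; [move=> _; exact: H|exact: (H i I)].
apply: le_lt_trans (_ : leb R n [set a : T1 | forall i, D i (tnth a i)] < _)%E.
 apply: le_measure; rewrite ?inE//; first exact: measurable_period_cell.
 by move=> a Ca i; rewrite /D /= in_itv /= -ler_norml; exact: hL.
rewrite leb_box//.
suff : (0 <= \prod_(i < n) @lebesgue_measure R (D i) < +oo)%E by case/andP.
elim/big_ind: _ => [|x y /andP[x0 hx] /andP[y0 hy]|i _].
- by rewrite lee_fin ler01 ltry.
- by rewrite mule_ge0//= lte_mul_pinfty// ge0_fin_numE.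
- by rewrite measure_ge0 /= lebesgue_measure_itv /= lte_fin; case: ifP; rewrite ?ltry// -EFinB ltry.
Qed.

Lemma row_period_shift x a : (\row_j tnth (translate (period_shift x) a) (h j)) =
 (\row_j tnth a (h j)) + (map_mx intr (\row_j x 0 (h j)) : 'rV[R]_m) *m B.
Proof.
apply/rowP=> j; rewrite !mxE tnth_translate /period_shift codom_f addr0; congr (_ + _).
by apply: eq_bigr=> i _; rewrite !mxE tauB.
Qed.

Lemma int_close (x y : int) : `|x%:~R - y%:~R : R| < 1 -> x = y.
Proof.
rewrite -rmorphB /= -intr_norm -[1]/(1%:~R) ltr_int => e; apply/eqP; rewrite -subr_eq0.
by rewrite -absz_eq0 -leqn0 -ltnS -ltz_nat abszE.
Qed.

Lemma period_cell_unique a : exists! x, period_cell (translate (period_shift x) a).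
Proof.
have uB : B \in unitmx by rewrite -row_free_unit.
have p0 := pi_gt0 R.
set l : 'rV[R]_m := \row_j tnth a (h j).
have [c hc] := floor_shift (l *m invmx B).
pose S k : R := \sum_i (c 0 i)%:~R * tau i k.
(* The hyperbolic entries are determined first. The floor then counts the turns of the angle already
   shifted by [S k], measured from -pi/2. *)
pose x : 'rV[int]_n := \row_k (if [pick j | h j == k] is Some j then c 0 j
 else - Num.floor ((tnth a k + S k + pi / 2) / (2 * pi))).
have xh j : x 0 (h j) = c 0 j.
 rewrite mxE; case: pickP=> [j' /eqP /h_inj ->//|/(_ j)]; by rewrite eqxx.
have xc : (\row_j x 0 (h j)) = c by apply/rowP=> j; rewrite mxE xh.
exists x; split.
 split.
  rewrite row_period_shift xc; exists (l *m invmx B + map_mx intr c); first exact: hc.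
  by rewrite mulmxDl mulmxKV.
 move=> k hk; rewrite tnth_translate /period_shift (negbTE hk).
 have -> : \sum_i (x 0 (h i))%:~R * tau i k = S k by apply: eq_bigr=> i _; rewrite xh.
 have -> : x 0 k = - Num.floor ((tnth a k + S k + pi / 2) / (2 * pi)).
  rewrite mxE; case: pickP=> // j /eqP jk; by rewrite -jk codom_f in hk.
 set q := (_ + pi / 2) / _; have /andP[f1 f2] := floor_itv q.
 have qE : tnth a k + S k = q * (2 * pi) - pi / 2.
  by rewrite /q divfK ?addrK// mulf_neq0// gt_eqF.
 move: f2; rewrite rmorphD rmorphN /= addrA qE => f2.
 by apply/andP; split; nra.
move=> y [[c1 hc1 c1E] ey].
have yc : (\row_j y 0 (h j)) = c.
 move: c1E; rewrite row_period_shift -/l => /(congr1 (mulmx^~ (invmx B))).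
 rewrite mulmxDl !mulmxK// => c1E.
 apply/rowP=> j; apply: int_close; have := hc1 j; have := hc j; rewrite -c1E !mxE => /andP[u1 u2] /andP[v1 v2].
 by rewrite ltr_norml; apply/andP; split; lra.
apply/rowP=> k; have [/codomP[j ->]|hk] := boolP (k \in codom h).
 by rewrite xh -yc mxE.
have := ey k hk; rewrite tnth_translate /period_shift (negbTE hk).
have -> : \sum_i (y 0 (h i))%:~R * tau i k = S k.
 by apply: eq_bigr=> i _; rewrite -yc mxE.
have -> : x 0 k = - Num.floor ((tnth a k + S k + pi / 2) / (2 * pi)).
 rewrite mxE; case: pickP=> // j /eqP jk; by rewrite -jk codom_f in hk.
set q := (_ + pi / 2) / _; have /andP[f1 f2] := floor_itv q.
have qE : tnth a k + S k = q * (2 * pi) - pi / 2.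
 by rewrite /q divfK ?addrK// mulf_neq0// gt_eqF.
move: f2; rewrite rmorphD /= addrA qE => f2 /andP[y1 y2].
have z1 : 0 <= q + (y 0 k)%:~R by nra.
have z2 : q + (y 0 k)%:~R < 1 by nra.
apply: int_close; rewrite rmorphN /= ltr_norml; apply/andP; split; lra.
Qed.

End period_cell.

(** * The averages in terms of f and g *)

Section special_functions.
Variable R : realType.
Implicit Types (f g W E : R -> R[i]) (l : R[i]).

Lemma cderive1_cis f (t : R) : @cderivable R R^o f t 1 -> cis_derive f t (cderive1 f t).
Proof. by move=> [d1 d2]; split; [exact: (derivableP d1)|exact: (derivableP d2)]. Qed.

Lemma cis_deriveN f t d : cis_derive f t d -> cis_derive (fun s => - f s) t (- d).
Proof.
move=> h; rewrite (_ : (fun s => _) = fun s => (-1) * f s); last by apply/funext=> s; rewrite mulN1r.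
by apply: eq_cis_derive (cis_deriveM (cis_derive_cst (-1) t) h); rewrite mul0r add0r mulN1r.
Qed.

Lemma cis_deriveZ (c : R[i]) f t d : cis_derive f t d -> cis_derive (fun s => f s * c) t (d * c).
Proof.
by move=> h; apply: eq_cis_derive (cis_deriveM h (cis_derive_cst c t)); rewrite mulr0 addr0.
Qed.

Lemma cis_derive_opp f t d : cis_derive f (- t) d -> cis_derive (fun s => f (- s)) t (- d).
Proof.
have sh : is_derive t (1 : R) (fun y : R => - y) (-1) by exact: (is_deriveN (is_derive_id t (1 : R))).
move=> [d1 d2]; have e1 := is_derive1_comp d1 sh; have e2 := is_derive1_comp d2 sh.
split; [apply: (is_derive_eq e1)|apply: (is_derive_eq e2)]; case: d {d1 d2 e1 e2} => x y /=; by rewrite mulrN1.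
Qed.

Lemma complex_linear_ode f E l (c : R -> R) (b t : R) :
 (forall s, - b < s < b -> cis_derive f s (E s)) ->
 (forall s, - b < s < b -> cis_derive E s (l * (c s)%:C * f s)) ->
 (forall s, `|s| <= `|t| -> `|c s| <= c t) ->
 f 0 = 0 -> E 0 = 0 -> - b < t < b -> f t = 0.
Proof.
move=> df dE hc f0 E0 ht.
pose K := `|Re l| * c t + `|Im l| * c t.
have ct0 : 0 <= c t by apply: le_trans (hc t (lexx _)).
have btw s : Num.min 0 t <= s <= Num.max 0 t -> `|s| <= `|t|.
 rewrite ge_min le_max; case: (leP 0 t) => t0.
  by move=> /andP[/orP[s0|s0] /orP[s1|s1]]; rewrite !ger0_norm; lra.
 by move=> /andP[/orP[s0|s0] /orP[s1|s1]]; rewrite !ler0_norm; lra.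
have [] := @linear_ode_unique R (fun s => Re (f s)) (fun s => Im (f s))
 (fun s => Re (E s)) (fun s => Im (E s)) (fun=> 0)
 (fun s => Re l * c s) (fun s => Im l * c s) [set s | - b < s < b] 0 t K.
- move=> s /btw hs /=; move: hs ht; rewrite ler_norml => /andP[s1 s2] /andP[t1 t2].
 by move: s1 s2; case: (leP 0 t) => t0; [rewrite ger0_norm//|rewrite ltr0_norm//] => s1 s2; apply/andP; split; lra.
- by move=> s hs; exact: (df s hs).1.
- by move=> s hs; exact: (df s hs).2.
- move=> s hs; apply: (is_derive_eq (dE s hs).1); case: (f s) => x y; case: (E s) => p q; case: (l) => l1 l2 /=; ring.
- move=> s hs; apply: (is_derive_eq (dE s hs).2); case: (f s) => x y; case: (E s) => p q; case: (l) => l1 l2 /=; ring.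
- move=> s /btw /hc hs; rewrite normr0 !normrM /K; split.
 + by rewrite addr_ge0 ?mulr_ge0.
 + by apply: le_trans (_ : `|Re l| * c t <= _); rewrite ?ler_wpM2l// lerDl mulr_ge0.
 + by apply: le_trans (_ : `|Im l| * c t <= _); rewrite ?ler_wpM2l// lerDr mulr_ge0.
- by rewrite f0 E0.
- by move=> h1 h2; apply: complex_eqP.
Qed.

(* Both sides solve the equation with the same initial data, the left one having
  derivative 0 at 0 by symmetry. *)
Lemma f_solution_average l f W E : f_solution l f ->
 (forall t, - (pi / 2) < t < pi / 2 -> cis_derive W t (E t)) ->
 (forall t, - (pi / 2) < t < pi / 2 -> cis_derive E t (l * ((cos t ^+ 2)^-1)%:C * W t)) ->
 forall t, - (pi / 2) < t < pi / 2 -> W t + W (- t) = 2%:R * f t * W 0.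
Proof.
move=> [f0 f10 hf] dW dE t ht.
have sym (s : R) : - (pi / 2) < s < pi / 2 -> - (pi / 2) < - s < pi / 2.
 by move=> /andP[s1 s2]; apply/andP; split; lra.
pose D s := W s + W (- s) - f s * (2%:R * W 0).
pose ED s := E s - E (- s) - cderive1 f s * (2%:R * W 0).
suff : D t = 0 by rewrite /D => /eqP; rewrite subr_eq0 => /eqP ->; rewrite mulrCA mulrA.
apply: (@complex_linear_ode D ED l (fun s => (cos s ^+ 2)^-1) (pi / 2) t) => //.
- move=> s hs; have [d1 _ _] := hf s hs.
 have h := cis_deriveD (cis_deriveD (dW s hs) (cis_derive_opp (dW _ (sym s hs)))) (cis_deriveN (cis_deriveZ (2%:R * W 0) (cderive1_cis d1))).
 exact: h.
- move=> s hs; have [_ d2 e2] := hf s hs.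
 have h := cis_deriveD (cis_deriveD (dE s hs) (cis_deriveN (cis_derive_opp (dE _ (sym s hs))))) (cis_deriveN (cis_deriveZ (2%:R * W 0) (cderive1_cis d2))).
 apply: (eq_cis_derive _ h); rewrite e2 opprK cosN /D fmorphV.
 by ring.
- move=> s hs; have c0 x : `|x| <= `|t| -> cos t <= cos x /\ 0 < cos x.
  move=> hx; have ct : 0 < cos t by exact: cos_gt0_pihalf.
  have : cos t <= cos x; last by move=> h; split=> //; exact: lt_le_trans h.
  have ca y : cos `|y| = cos y :> R by have [y0|y0] := ltP y 0; [rewrite ltr0_norm// cosN|rewrite ger0_norm].
  have tp : `|t| <= pi.
   by have := pi_ge0 R; move: ht => /andP[t1 t2]; rewrite ler_norml => p0; apply/andP; split; lra.
  rewrite -(ca t) -(ca x); move: hx; rewrite le_eqVlt => /orP[/eqP -> //|hx].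
  by rewrite ltW// ltr_cos// in_itv /= normr_ge0 //= (le_trans (ltW hx) tp).
 have [c1 c2] := c0 s hs; have [_ c3] := c0 t (lexx _).
 rewrite ger0_norm ?invr_ge0 ?sqr_ge0// lef_pV2 ?posrE ?exprn_gt0//.
 by rewrite lerXn2r ?nnegrE// ltW.
- by rewrite /D oppr0 f0; ring.
- by rewrite /ED oppr0 f10 mul0r subr0 subrr.
Qed.

(** The difference W - g W(0) solves the singular equation and tends to 0 at the origin, so it
    vanishes by [singular_ode_unique]. *)
Lemma g_solution_average l g W E : g_solution l g ->
 (forall t, 0 < t -> cis_derive W t (E t)) ->
 (forall t, 0 < t -> cis_derive E t (l * W t - (cosh t / sinh t)%:C * E t)) ->
 Re (W t) @[t --> (0 : R)^'+] --> Re (W 0) ->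
 Im (W t) @[t --> (0 : R)^'+] --> Im (W 0) ->
 forall t, 0 < t -> W t = g t * W 0.
Proof.
move=> [g0 cgr cgi hg] dW dE cr ci t t0.
pose D s := W s - g s * W 0; pose ED s := E s - cderive1 g s * W 0.
have dD s : 0 < s -> cis_derive D s (ED s).
 move=> s0; have [d1 _ _] := hg s s0.
 exact: (cis_deriveD (dW s s0) (cis_deriveN (cis_deriveZ _ (cderive1_cis d1)))).
have dED s : 0 < s -> cis_derive ED s (l * D s - (cosh s / sinh s)%:C * ED s).
 move=> s0; have [_ d2 e2] := hg s s0.
 have h := cis_deriveD (dE s s0) (cis_deriveN (cis_deriveZ (W 0) (cderive1_cis d2))).
 apply: (eq_cis_derive _ h).
 have -> : cderive1 (cderive1 g) s = l * g s - (cosh s / sinh s)%:C * cderive1 g s by rewrite -e2 addrK.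
 by rewrite /D /ED; ring.
have gr : Re (g s) @[s --> (0 : R)^'+] --> (1 : R).
 move/continuous_within_itvcyP : cgr => [_]; by rewrite g0.
have gi : Im (g s) @[s --> (0 : R)^'+] --> (0 : R).
 move/continuous_within_itvcyP : cgi => [_]; by rewrite g0.
suff [e1 e2] : Re (D t) = 0 /\ Im (D t) = 0.
 have : D t = 0 by apply: complex_eqP.
 by rewrite /D => /eqP; rewrite subr_eq0 => /eqP.
apply: (@singular_ode_unique R (fun s => Re (D s)) (fun s => Im (D s))
 (fun s => Re (ED s)) (fun s => Im (ED s)) (Re l) (Im l)) => //.
- by move=> s s0; exact: (dD s s0).1.
- by move=> s s0; exact: (dD s s0).2.
- move=> s s0; apply: (is_derive_eq (dED s s0).1); case: (D s) => x y; case: (ED s) => p q; case: (l) => l1 l2 /=; ring.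
- move=> s s0; apply: (is_derive_eq (dED s s0).2); case: (D s) => x y; case: (ED s) => p q; case: (l) => l1 l2 /=; ring.
- rewrite (_ : (fun s => _) = (fun s => Re (W s) - (Re (g s) * Re (W 0) - Im (g s) * Im (W 0)))); last first.
  by apply/funext=> s; rewrite /D; case: (W s); case: (g s); case: (W 0).
 rewrite [X in _ --> X](_ : 0 = Re (W 0) - (1 * Re (W 0) - 0 * Im (W 0))); last by ring.
 by apply: cvgB => //; apply: cvgB; apply: cvgM => //; exact: cvg_cst.
- rewrite (_ : (fun s => _) = (fun s => Im (W s) - (Re (g s) * Im (W 0) + Im (g s) * Re (W 0)))); last first.
  by apply/funext=> s; rewrite /D; case: (W s); case: (g s); case: (W 0).
 rewrite [X in _ --> X](_ : 0 = Im (W 0) - (1 * Im (W 0) + 0 * Re (W 0))); last by ring.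
 by apply: cvgB => //; apply: cvgD; apply: cvgM => //; exact: cvg_cst.
Qed.

End special_functions.

Section polar_family.
Variable R : realType.
Implicit Types (b : bool).

Definition polar_Z b (a v : R) : R[i] := cpx (polar b (a, v)).
Definition polar_Z_a b := if b then polar_Z true else @ell_Z_a R.
Definition polar_Z_v b := if b then @hyp_Z_v R else @ell_Z_v R.
Definition polar_Z_aa b := if b then polar_Z true else @ell_Z_aa R.
Definition polar_Z_vv b := if b then (fun a v => - polar_Z true a v) else @ell_Z_vv R.
Definition polar_s b : R -> R := if b then fun=> 1 else @Defs.sinh R.
Definition polar_ds b : R -> R := if b then fun=> 0 else @Defs.cosh R.
Definition polar_w b : R -> R := if b then fun v => (cos v ^+ 2)^-1 else fun=> 1.

Lemma conformal_polar b : conformal (polar_dom b) (polar_Z b) (polar_Z_a b) (polar_Z_v b)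
 (polar_Z_aa b) (polar_Z_vv b) (polar_s b) (polar_ds b) (polar_w b).
Proof. by case: b; [exact: conformal_hyp_polar|exact: conformal_ell_polar]. Qed.

Lemma bounded_polar b : bounded_coords (polar_dom b) (polar_Z b) (polar_Z_a b) (polar_Z_v b)
 (polar_Z_aa b) (polar_Z_vv b).
Proof. by case: b; [exact: bounded_hyp_polar|exact: bounded_ell_polar]. Qed.

Lemma polar_dom_open b (v : R) : polar_dom b v ->
 exists2 r : R, 0 < r & forall x, v - r <= x <= v + r -> polar_dom b x.
Proof.
case: b => [/(_ isT) /andP[v1 v2]|_]; last by exists 1.
pose r := Num.min (v + pi / 2) (pi / 2 - v) / 2.
have m0 : 0 < Num.min (v + pi / 2) (pi / 2 - v) by rewrite lt_min; apply/andP; split; lra.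
have m1 : Num.min (v + pi / 2) (pi / 2 - v) <= v + pi / 2 by rewrite ge_min lexx.
have m2 : Num.min (v + pi / 2) (pi / 2 - v) <= pi / 2 - v by rewrite ge_min lexx orbT.
exists r; first by rewrite /r; lra.
by move=> x /andP[x1 x2] _; rewrite /r in x1 x2; apply/andP; split; lra.
Qed.

Lemma ell_polar_turns (t v : R) (j : int) : polar false (t + 2 * pi * j%:~R, v) = polar false (t, v).
Proof.
have E (i : nat) (x : R) : polar false (x + 2 * pi * i%:R, v) = polar false (x, v).
 elim: i x => [|i IH] x; first by rewrite mulr0 addr0.
 rewrite (_ : x + 2 * pi * i.+1%:R = (x + 2 * pi * i%:R) + pi *+ 2); last by rewrite -natr1 mulr2n; ring.
 by rewrite -(IH x) /polar /ell_polar /= sinD2pi cosD2pi.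
case: j => i; first exact: E.
have -> : (Negz i)%:~R = - i.+1%:R :> R by rewrite NegzE rmorphN.
transitivity (polar false (t + 2 * pi * - i.+1%:R + 2 * pi * i.+1%:R, v)); first by rewrite E.
by congr (polar _ (_, _)); ring.
Qed.

End polar_family.

Lemma is_derive_reset (R : realType) n (F : n.-tuple (measurableTypeR R) -> R) k v (x d : R) :
 is_derive (tnth (updt v k x) k : R) (1 : R) (fun x' => F (updt (updt v k x) k x')) d ->
 is_derive x (1 : R) (fun x' => F (updt v k x')) d.
Proof.
rewrite tnth_updt eqxx (_ : (fun x' => F (updt (updt v k x) k x')) = (fun x' => F (updt v k x'))) //.
by apply/funext=> x'; rewrite updt_set.
Qed.

Lemma eigen_algebra (R : realType) (y xr xi yr yi : R) (l U : R[i]) :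
 (y ^+ 2)%:C * (xr +i* xi + yr +i* yi) + l * U = 0 ->
 y ^+ 2 * (xr + yr) = - Re l * Re U + Im l * Im U /\
 y ^+ 2 * (xi + yi) = - Im l * Re U + (- Re l) * Im U.
Proof.
case: U => p q; case: l => l1 l2 /= [e1 e2].
by split; [move: e1|move: e2]; rewrite ?mul0r ?subr0 ?addr0 => e; lra.
Qed.

Lemma wave_hyp_algebra (R : realType) (w : R) (x1 x2 l W : R[i]) :
 (1 ^+ 2)%:C * x2 + (1 * 0)%:C * x1 = (1 ^+ 2 * w)%:C * (l * W) -> x2 = l * w%:C * W.
Proof. by rewrite expr1n mulr0 !mul1r mul0r addr0 => ->; ring. Qed.

Lemma wave_ell_algebra (R : realType) (s c : R) (x1 x2 l W : R[i]) : s != 0 ->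
 (s ^+ 2)%:C * x2 + (s * c)%:C * x1 = (s ^+ 2 * 1)%:C * (l * W) -> x2 = l * W - (c / s)%:C * x1.
Proof.
move=> s0; have sC : s%:C != 0 :> R[i] by rewrite (inj_eq (@complexI R)).
rewrite mulr1 expr2 !rmorphM fmorphV /= => e; apply: (mulfI (mulf_neq0 sC sC)).
by rewrite mulrBr -e; field.
Qed.

Section period_average.
Variables (R : realType) (n m : nat) (Gam : set (PSL2n R n)).
Hypothesis Gam_group : is_subgroup Gam.
Variables (gam rho : PSL2n R n) (h : 'I_m -> 'I_n).
Hypothesis h_inj : injective h.
Variables (gens : 'I_m -> PSL2n R n) (B : 'M[R]_m) (tau : 'I_m -> 'I_n -> R).
Hypotheses (gens_basis : free_abelian_basis (centralizer Gam gam) gens)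
 (B_free : row_free B)
 (tau_shifts : forall i k, shifts (k \in codom h) ((rho^-1 * gens i * rho)%g k) (tau i k))
 (tauB : forall i j, tau i (h j) = B i j).
Variables (lam : 'I_n -> R[i]) (u : 'rV[R[i]]_n -> R[i]).
Hypotheses (u_smooth : csmooth_on (@upper_xy R n) (on_xy u))
 (u_invariant : forall g z, Gam g -> @Hn R n z -> u (act g z) = u z)
 (u_eigen : forall k p, @upper_xy R n p -> laplacian k u p + lam k * on_xy u p = 0).
Local Notation T1 := (n.-tuple (measurableTypeR R)).
Local Notation b k := (k \in codom h).
Implicit Types (a v : T1) (k : 'I_n).

Definition coordZ k (a v : R) : R[i] := mob (repr (rho k)) (polar_Z (b k) a v).
Definition coord_dom k : R -> Prop := polar_dom (b k).

Lemma conformal_coordZ k : conformal (coord_dom k) (coordZ k)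
 (mob_a (polar_Z (b k)) (polar_Z_a (b k)) (repr (rho k))) (mob_v (polar_Z (b k)) (polar_Z_v (b k)) (repr (rho k)))
 (mob_aa (polar_Z (b k)) (polar_Z_a (b k)) (polar_Z_aa (b k)) (repr (rho k)))
 (mob_vv (polar_Z (b k)) (polar_Z_v (b k)) (polar_Z_vv (b k)) (repr (rho k)))
 (polar_s (b k)) (polar_ds (b k)) (polar_w (b k)).
Proof. exact: (conformal_mob (repr (rho k)) (@conformal_polar R (b k))). Qed.

Lemma bounded_coordZ k : bounded_coords (coord_dom k) (coordZ k)
 (mob_a (polar_Z (b k)) (polar_Z_a (b k)) (repr (rho k))) (mob_v (polar_Z (b k)) (polar_Z_v (b k)) (repr (rho k)))
 (mob_aa (polar_Z (b k)) (polar_Z_a (b k)) (polar_Z_aa (b k)) (repr (rho k)))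
 (mob_vv (polar_Z (b k)) (polar_Z_v (b k)) (polar_Z_vv (b k)) (repr (rho k))).
Proof. exact: (bounded_mob (repr (rho k)) (@conformal_polar R (b k)) (@bounded_polar R (b k))). Qed.

Lemma coord_dom_open k (v : R) : coord_dom k v ->
 exists2 r : R, 0 < r & forall x, v - r <= x <= v + r -> coord_dom k x.
Proof. exact: polar_dom_open. Qed.

Local Notation zt := (zt coordZ).
Local Notation pt := (pt coordZ).
Local Notation doms := (doms coord_dom).
Local Notation cell := (period_cell h B).

Definition polar_row a v : 'rV[R[i]]_n := \row_k polar_Z (b k) (tnth a k) (tnth v k).

Lemma polar_row_Hn a v : doms v -> @Hn R n (polar_row a v).
Proof. by move=> hv k; rewrite mxE; apply: polar_im_gt0; exact: hv. Qed.

Lemma zt_act a v : zt a v = act rho (polar_row a v).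
Proof. by apply/rowP=> k; rewrite !mxE. Qed.

(** Up to full turns, which do not move the point, the shift is the action of the centralizer
    element with exponents x at the places listed by h. *)
Lemma u_periodic x a v : doms v -> u (zt (translate (period_shift h tau x) a) v) = u (zt a v).
Proof.
move=> hv; pose c : 'rV[int]_m := \row_j x 0 (h j).
have Hz := polar_row_Hn a hv.
have e : polar_row (translate (period_shift h tau x) a) v = act (rho^-1 * word gens c * rho)%g (polar_row a v).
 apply/rowP=> k; rewrite !mxE tnth_translate.
 have sh := @shifts_word R n m rho h gens tau c k tau_shifts.
 have := sh (tnth a k, tnth v k) (hv k); rewrite -/(polar_Z (b k) (tnth a k) (tnth v k)) => ->.
 rewrite /polar_Z /period_shift /=.
 have -> : \sum_i (c 0 i)%:~R * tau i k = \sum_i (x 0 (h i))%:~R * tau i k.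
  by apply: eq_bigr=> i _; rewrite mxE.
 by case: (b k); rewrite ?addr0// addrA ell_polar_turns.
rewrite !zt_act e -act_mul// !mulgA mulgV mul1g act_mul// u_invariant//.
 by have [] := @centralizer_word R n m Gam Gam_group gam gens gens_basis c.
exact: act_Hn.
Qed.

Local Notation phi_re := (fun q => Re (on_xy u q)).
Local Notation phi_im := (fun q => Im (on_xy u q)).

Lemma on_xy_pt a v : on_xy u (pt a v) = u (zt a v).
Proof. by rewrite /on_xy re_imK. Qed.

Lemma translation_average (phi : R[i] -> R) k v (t : R) : doms v ->
 (forall q, @upper_xy R n q -> {for q, continuous (fun q => phi (on_xy u q))}) ->
 avg cell (fun a => phi (on_xy u (pt (updt a k (tnth a k + t)) v))) = avg0 coordZ cell (fun q => phi (on_xy u q)) v.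
Proof.
move=> hv cphi; rewrite /avg0 /avg.
have E a : updt a k (tnth a k + t) = translate (fun j => if j == k then t else 0) a.
 apply: eq_from_tnth=> j; rewrite tnth_updt tnth_translate; case: eqP=> [->//|_]; by rewrite addr0.
rewrite -(@Rintegral_periodic R n (period_shift h tau) cell (fun a => phi (on_xy u (pt a v))) (fun j => if j == k then t else 0)).
- by apply: eq_Rintegral => a _; rewrite E.
- exact: period_shiftN.
- exact: measurable_period_cell.
- exact: period_cell_unique.
- exact: (measurable_phi_pt conformal_coordZ cphi hv).
- by move=> x a; rewrite !on_xy_pt u_periodic.
Qed.

Definition cell_avg v : R[i] := cintegral (leb R n) cell (fun a => u (zt a v)).

Lemma cell_avgE v : cell_avg v = avg0 coordZ cell phi_re v +i* avg0 coordZ cell phi_im v.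
Proof.
rewrite /cell_avg /cintegral /avg0 /avg.
by congr (_ +i* _); apply: eq_Rintegral => a _; rewrite on_xy_pt.
Qed.

Local Notation Zv k := (mob_v (polar_Z (b k)) (polar_Z_v (b k)) (repr (rho k))).
Local Notation Zvv k := (mob_vv (polar_Z (b k)) (polar_Z_v (b k)) (polar_Z_vv (b k)) (repr (rho k))).

Definition cell_avg1 k v : R[i] :=
 avg1 coordZ (fun k => Zv k) cell k phi_re v +i* avg1 coordZ (fun k => Zv k) cell k phi_im v.

Lemma integrable_cell (phi : 'rV[R]_n * 'rV[R]_n -> R) v :
 (forall q, @upper_xy R n q -> {for q, continuous phi}) -> doms v ->
 (leb R n).-integrable cell (EFin \o (fun a => phi (pt a v))).
Proof.
move=> cphi hv; have [L L0 hL] := period_cell_bounded h B.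
have [K K1 hK] : exists2 K : R, 1 <= K & forall a, cell a -> in_boxes K (zt a v).
 have [/existsP[k _]|/existsPn no] := boolP [exists k : 'I_n, true]; last first.
  by exists 1 => // a _ k; have := no k.
 have [r r0 [K K1 hK]] := box_bound bounded_coordZ coord_dom_open k L hv.
 exists K => // a Ca; have r1 : `|tnth v k - tnth v k| < r by rewrite subrr normr0.
 by have [_] := hK a (tnth v k) (hL a Ca) r1; rewrite updt_id.
have [C C0 hC] := bounded_on_boxes K1 cphi.
apply: (@integrable_bounded _ _ _ _ _ (measurable_period_cell h B_free) (period_cell_fin h B_free) _ C).
 by apply: (@measurable_funS _ _ _ _ setT) => //; exact: (measurable_phi_pt conformal_coordZ cphi hv).
by move=> a /hK; exact: hC.
Qed.

Lemma avg_linear (phi1 phi2 : 'rV[R]_n * 'rV[R]_n -> R) (c1 c2 : R) v :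
 (forall q, @upper_xy R n q -> {for q, continuous phi1}) ->
 (forall q, @upper_xy R n q -> {for q, continuous phi2}) -> doms v ->
 avg cell (fun a => c1 * phi1 (pt a v) + c2 * phi2 (pt a v)) =
 c1 * avg0 coordZ cell phi1 v + c2 * avg0 coordZ cell phi2 v.
Proof.
move=> h1 h2 hv; have i1 := integrable_cell h1 hv; have i2 := integrable_cell h2 hv.
have mc := measurable_period_cell h B_free.
have j1 : (leb R n).-integrable cell (EFin \o (fun a => c1 * phi1 (pt a v))).
 by rewrite (_ : _ \o _ = fun a => (c1%:E * (EFin \o (fun a => phi1 (pt a v))) a)%E)//; exact: integrableZl.
have j2 : (leb R n).-integrable cell (EFin \o (fun a => c2 * phi2 (pt a v))).
 by rewrite (_ : _ \o _ = fun a => (c2%:E * (EFin \o (fun a => phi2 (pt a v))) a)%E)//; exact: integrableZl.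
by rewrite /avg RintegralD// !RintegralZl.
Qed.

Lemma phi_re_continuous q : @upper_xy R n q -> {for q, continuous phi_re}.
Proof. by move=> uq; have [sr _] := u_smooth; have [] := sr [::] q uq. Qed.

Lemma phi_im_continuous q : @upper_xy R n q -> {for q, continuous phi_im}.
Proof. by move=> uq; have [_ si] := u_smooth; have [] := si [::] q uq. Qed.

Lemma laplacian_pt k a v : doms v ->
 let L phi := Im (coordZ k (tnth a k) (tnth v k)) ^+ 2 *
 ('D_(dir_x R k) ('D_(dir_x R k) phi) (pt a v) + 'D_(dir_y R k) ('D_(dir_y R k) phi) (pt a v)) in
 L phi_re = - Re (lam k) * phi_re (pt a v) + Im (lam k) * phi_im (pt a v) /\
 L phi_im = - Im (lam k) * phi_re (pt a v) + (- Re (lam k)) * phi_im (pt a v).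
Proof.
move=> hv L; have up := upper_pt conformal_coordZ a hv.
have e := u_eigen k up; rewrite /laplacian in e.
have py : (pt a v).2 0 k = Im (coordZ k (tnth a k) (tnth v k)) by rewrite !mxE.
rewrite py in e; exact: (eigen_algebra e).
Qed.

Lemma cell_laplacian k v : doms v ->
 avg_laplacian coordZ cell k phi_re v +i* avg_laplacian coordZ cell k phi_im v = - (lam k * cell_avg v).
Proof.
move=> hv; rewrite cell_avgE.
have er : avg_laplacian coordZ cell k phi_re v = - Re (lam k) * avg0 coordZ cell phi_re v + Im (lam k) * avg0 coordZ cell phi_im v.
 rewrite -(avg_linear _ _ phi_re_continuous phi_im_continuous hv); apply: (congr1 (avg cell)).
 by apply/funext=> a; exact: (laplacian_pt k a hv).1.
have ei : avg_laplacian coordZ cell k phi_im v = - Im (lam k) * avg0 coordZ cell phi_re v + (- Re (lam k)) * avg0 coordZ cell phi_im v.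
 rewrite -(avg_linear _ _ phi_re_continuous phi_im_continuous hv); apply: (congr1 (avg cell)).
 by apply/funext=> a; exact: (laplacian_pt k a hv).2.
rewrite er ei; move: (avg0 _ _ _ _) (avg0 _ _ _ _) => p q.
by case: (lam k) => l1 l2; apply: complex_eqP=> /=; ring.
Qed.

Definition cell_avg2 k v : R[i] :=
 avg2 coordZ (fun k => Zv k) (fun k => Zvv k) cell k phi_re v +i* avg2 coordZ (fun k => Zv k) (fun k => Zvv k) cell k phi_im v.

Lemma cell_avg_derive k v (x : R) : doms v -> coord_dom k x ->
 cis_derive (fun x => cell_avg (updt v k x)) x (cell_avg1 k (updt v k x)) /\
 cis_derive (fun x => cell_avg1 k (updt v k x)) x (cell_avg2 k (updt v k x)).
Proof.
move=> hv hx; have hvx := doms_set hv hx; have [sr si] := u_smooth.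
have [L L0 hL] := period_cell_bounded h B.
have mc := measurable_period_cell h B_free; have fc := period_cell_fin h B_free.
have [_ _ r1 r2] := avg_v_derivatives conformal_coordZ bounded_coordZ coord_dom_open mc fc hL k sr hvx.
have [_ _ i1 i2] := avg_v_derivatives conformal_coordZ bounded_coordZ coord_dom_open mc fc hL k si hvx.
split; split.
- by rewrite (_ : (fun s => _) = (fun x' => avg0 coordZ cell phi_re (updt v k x'))); [exact: (is_derive_reset r1)|apply/funext=> x'; rewrite cell_avgE].
- by rewrite (_ : (fun s => _) = (fun x' => avg0 coordZ cell phi_im (updt v k x'))); [exact: (is_derive_reset i1)|apply/funext=> x'; rewrite cell_avgE].
- exact: (is_derive_reset r2).
- exact: (is_derive_reset i2).
Qed.

Lemma cell_avg_ode k v : doms v ->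
 (polar_s (b k) (tnth v k) ^+ 2)%:C * cell_avg2 k v +
  (polar_s (b k) (tnth v k) * polar_ds (b k) (tnth v k))%:C * cell_avg1 k v =
 (polar_s (b k) (tnth v k) ^+ 2 * polar_w (b k) (tnth v k))%:C * (- lam k * cell_avg v).
Proof.
move=> hv; have [sr si] := u_smooth.
have [L L0 hL] := period_cell_bounded h B.
have mc := measurable_period_cell h B_free; have fc := period_cell_fin h B_free.
have er := avg_ode conformal_coordZ bounded_coordZ coord_dom_open mc fc hL sr hv
 (fun t => translation_average (phi := @Re R) k t hv phi_re_continuous).
have ei := avg_ode conformal_coordZ bounded_coordZ coord_dom_open mc fc hL si hv
 (fun t => translation_average (phi := @Im R) k t hv phi_im_continuous).
rewrite mulNr -(cell_laplacian k hv).
by apply: complex_eqP; rewrite /= ?mul0r ?subr0 ?addr0; [exact: er|exact: ei].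
Qed.

Variables (f g : 'I_n -> R -> R[i]).
Hypotheses (f_sol : forall k, f_solution (- lam k) (f k)) (g_sol : forall k, g_solution (- lam k) (g k)).

(** The average is not even in the angle in general, so only its sum with the reflected value is
    determined by the value at 0. *)
Lemma cell_avg_hyp k v : doms v -> b k ->
 cell_avg v + cell_avg (updt v k (- tnth v k)) =
 2%:R * f k (tnth v k) * cell_avg (updt v k 0).
Proof.
move=> hv bk; have hk : - (pi / 2) < tnth v k < pi / 2 by exact: hv.
have := @f_solution_average R (- lam k) (f k) (fun x => cell_avg (updt v k x))
 (fun x => cell_avg1 k (updt v k x)) (f_sol k).
have dom x : - (pi / 2) < x < pi / 2 -> coord_dom k x by move=> hx _.
move=> H; have := H _ _ (tnth v k) hk; rewrite updt_id; apply.
 by move=> t ht; have [] := cell_avg_derive hv (dom t ht).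
move=> t ht; have [_ d2] := cell_avg_derive hv (dom t ht); apply: (eq_cis_derive _ d2).
have e := cell_avg_ode k (doms_set hv (dom t ht)).
rewrite tnth_updt eqxx bk in e; exact: (wave_hyp_algebra e).
Qed.

Lemma cell_avg_ell k v : doms v -> ~~ b k -> 0 < tnth v k ->
 cell_avg v = g k (tnth v k) * cell_avg (updt v k 0).
Proof.
move=> hv bk vk0.
have dom x : coord_dom k x by rewrite /coord_dom (negbTE bk).
(* The polar formula at i is smooth in r on the whole line, so the continuity at 0 that selects the
   regular solution comes from a derivative there. *)
have cont : cis_derive (fun x => cell_avg (updt v k x)) 0 (cell_avg1 k (updt v k 0)).
 by have [] := cell_avg_derive hv (dom 0).
have := @g_solution_average R (- lam k) (g k) (fun x => cell_avg (updt v k x))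
 (fun x => cell_avg1 k (updt v k x)) (g_sol k).
move=> H; have := H _ _ _ _ (tnth v k) vk0; rewrite updt_id; apply.
- by move=> t t0; have [] := cell_avg_derive hv (dom t).
- move=> t t0; have [_ d2] := cell_avg_derive hv (dom t); apply: (eq_cis_derive _ d2).
 have e := cell_avg_ode k (doms_set hv (dom t)).
 rewrite tnth_updt eqxx (negbTE bk) in e.
 have s0 : sinh t != 0 by rewrite gt_eqF ?sinh_gt0.
 exact: (wave_ell_algebra s0 e).
- exact: cvg_at_right_filter (is_derive_continuous cont.1).
- exact: cvg_at_right_filter (is_derive_continuous cont.2).
Qed.

End period_average.

(** * Evaluation of the class integral *)

Section symmetrization.
Variables (R : realType) (n : nat).
Local Notation T1 := (n.-tuple (measurableTypeR R)).
Implicit Types (v : T1) (k : 'I_n) (S : {set 'I_n}).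

Definition flip k v : T1 := updt v k (- tnth v k).

Lemma flipE k v : flip k v = map_fun (fun j t => if j == k then - t else t) v.
Proof.
by apply: eq_from_tnth=> j; rewrite tnth_updt tnth_mktuple; case: eqP=> [->|].
Qed.

Lemma transports_flip k : transports (leb R n) (leb R n) (flip k) (fun=> 1).
Proof.
have E : flip k = map_fun (fun j t => if j == k then - t else t) by apply/funext=> v; exact: flipE.
have mZ j : mfunT (fun t : R => if j == k then - t else t).
 by case: eqP=> _; [apply: continuous_measurable_fun; exact: opp_continuous|exact: measurable_id].
split.
- by rewrite E; exact: measurable_map_fun.
- exact: measurable_cst.
- by [].
move=> g mg g0; rewrite E.
have HK (i : 'I_n) (g1 : R -> \bar R) : mfunT g1 -> (forall x, (0 <= g1 x)%E) ->
  (\int[lebesgue_measure]_x g1 x = \int[lebesgue_measure]_x (g1 (if i == k then (- x)%R else x) * 1))%E.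
 move=> mg1 g10; under [RHS]eq_integral do rewrite mule1.
 by case: eqP=> _ //; exact: ge0_integral_opp.
rewrite (ge0_leb_coordinate_change (fun _ => measurable_cst _) (fun _ _ => ler01) mZ HK mg g0).
by apply: eq_integral=> v _; rewrite big1_eq.
Qed.

Definition zero_on S v : T1 := [tuple (if j \in S then 0 else tnth v j : measurableTypeR R) | j < n].

Lemma zero_on0 v : zero_on finset.set0 v = v.
Proof. by apply: eq_from_tnth=> j; rewrite tnth_mktuple inE. Qed.

Lemma tnth_zero_on S v k : k \notin S -> tnth (zero_on S v) k = tnth v k.
Proof. by move=> kS; rewrite tnth_mktuple (negbTE kS). Qed.

Lemma zero_onU1 S v k : zero_on (k |: S) v = updt (zero_on S v) k 0.
Proof. by apply: eq_from_tnth=> j; rewrite tnth_updt !tnth_mktuple in_setU1; case: eqP. Qed.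

Lemma zero_on_flip S v k : k \notin S -> zero_on S (flip k v) = updt (zero_on S v) k (- tnth v k).
Proof.
move=> kS; apply: eq_from_tnth=> j; rewrite tnth_updt !tnth_mktuple.
by case: eqP=> [->|//]; rewrite (negbTE kS).
Qed.

Variables (b : 'I_n -> bool) (phi : 'I_n -> R -> R[i]) (D : T1 -> Prop) (G W : T1 -> R[i]).
Hypotheses (G_out : forall v, ~ D v -> G v = 0)
 (G_flip : forall k v, b k -> G (flip k v) = G v)
 (W_hyp : forall v k S, D v -> b k -> k \notin S ->
 W (zero_on S v) + W (updt (zero_on S v) k (- tnth v k)) =
 2%:R * phi k (tnth v k) * W (updt (zero_on S v) k 0))
 (W_ell : forall v k S, D v -> ~~ b k -> k \notin S ->
 W (zero_on S v) = phi k (tnth v k) * W (updt (zero_on S v) k 0))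
 (GW_meas : forall S, cmeas (fun v => G v * \prod_(j in S) phi j (tnth v j) * W (zero_on S v)))
 (GW_int : cintegrable (leb R n) setT (fun v => G v * W v)).

(** Coordinates in S are the ones already separated; induction removes one from S. In an elliptic
    coordinate the integrand does not change. In a hyperbolic one the new integrand is the mean of
    the old one and its flip, and the flip preserves both G and the measure. *)
Lemma symmetrize S :
 cintegrable (leb R n) setT (fun v => G v * \prod_(j in S) phi j (tnth v j) * W (zero_on S v)) /\
 cintegral (leb R n) setT (fun v => G v * \prod_(j in S) phi j (tnth v j) * W (zero_on S v)) =
 cintegral (leb R n) setT (fun v => G v * W v).
Proof.
pose H S v := G v * \prod_(j in S) phi j (tnth v j) * W (zero_on S v).
have [c] := ubnP #|S|; elim: c => // c IH in S *; rewrite ltnS => Sc.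
have [->|[k kS]] := set_0Vmem S.
 have E : H finset.set0 = fun v => G v * W v.
  by apply/funext=> v; rewrite /H big_set0 mulr1 zero_on0.
 by rewrite -/(H finset.set0) E.
pose S' := S :\ k.
have SE : S = k |: S' by rewrite finset.setD1K.
have kS' : k \notin S' by rewrite !inE eqxx.
have S'c : (#|S'| < c)%N by move: Sc; rewrite (cardsD1 k S) kS.
have [iS' eS'] := IH S' S'c.
have prodE v : \prod_(j in S) phi j (tnth v j) = phi k (tnth v k) * \prod_(j in S') phi j (tnth v j).
 by rewrite SE big_setU1.
have [bk|bk] := boolP (b k); last first.
 have E : H S = H S'.
  apply/funext=> v; rewrite /H prodE (_ : zero_on S v = updt (zero_on S' v) k 0); last by rewrite SE zero_onU1.
  have [Dv|nDv] := pselect (D v); last by rewrite G_out// !mul0r.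
  by rewrite (W_ell Dv bk kS'); ring.
 by rewrite -/(H S) E.
have iF : cintegrable (leb R n) setT (fun v => H S' (flip k v)).
 have T := transports_flip k; have := (transports_cintegrable T (GW_meas S')).1 iS'.
 by under eq_fun do rewrite mul1r.
have eF : cintegral (leb R n) setT (fun v => H S' (flip k v)) = cintegral (leb R n) setT (H S').
 rewrite [RHS](transports_cintegral (transports_flip k) (GW_meas S')).
 by apply: eq_cintegral => v; rewrite mul1r.
have E v : H S v = 2%:R^-1 * (H S' v + H S' (flip k v)).
 rewrite /H prodE (_ : zero_on S v = updt (zero_on S' v) k 0); last by rewrite SE zero_onU1.
 rewrite zero_on_flip// G_flip//.
 have -> : \prod_(j in S') phi j (tnth (flip k v) j) = \prod_(j in S') phi j (tnth v j).
  apply: eq_bigr=> j jS; rewrite tnth_updt; case: eqP=> [jk|//].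
  by rewrite jk (negbTE kS') in jS.
 have [Dv|nDv] := pselect (D v); last by rewrite G_out// !mul0r addr0 mulr0.
 rewrite -mulrDr (W_hyp Dv bk kS').
 by field.
have iD := cintegrableD iS' iF.
rewrite -/(H S) (_ : H S = fun v => 2%:R^-1 * (H S' v + H S' (flip k v))); last exact/funext/E.
split; first exact: cintegrableZ.
rewrite cintegralZ// cintegralD// eF eS'; by field.
Qed.

End symmetrization.

(** * Fubini and the period integral *)

Section complex_fubini.
Context d1 d2 (X : measurableType d1) (Y : measurableType d2) (R : realType).
Variables (m1 : {sigma_finite_measure set X -> \bar R}) (m2 : {sigma_finite_measure set Y -> \bar R}).

(** The inner integral is finite for almost every y, where taking [fine] changes nothing; the
    exceptional set is null. *)
Lemma real_fubini (F : X * Y -> R) : (m1 \x m2)%E.-integrable setT (fun p => (F p)%:E) ->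
 m2.-integrable setT (fun y => (\int[m1]_x F (x, y))%:E) /\
 \int[(m1 \x m2)%E]_p F p = \int[m2]_y (\int[m1]_x F (x, y)).
Proof.
move=> iF.
have ae : ae_eq m2 setT (fun y => (\int[m1]_x F (x, y))%:E) (fubini_G m1 (fun p => (F p)%:E)).
 have := ae_integrable2 iF; apply: filterS => y iy _.
 by rewrite /fubini_G /Rintegral fineK//; exact: integrable_fin_num.
have mF : mfunT (fun p => (F p)%:E) := measurable_int _ iF.
have mG := measurable_fubini_G iF.
have iG : m2.-integrable setT (fubini_G m1 (fun p => (F p)%:E)).
 apply/integrableP; split; first exact: mG.
 have lt := (integrable21ltyP m1 m2 mF).1 iF; apply: le_lt_trans lt.
 apply: ge0_le_integral => //.
 - exact: measurableT_comp.
 - apply: (measurable_fun_fubini_tonelli_G (fun p => `|(F p)%:E|%E)) => //.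
  exact: measurableT_comp.
 - move=> y _; apply: le_abse_integral => //.
  by apply: (measurableT_comp mF); exact: measurable_pair2.
have mf : mfunT (fun y => (\int[m1]_x F (x, y))%:E).
 by apply/measurable_EFinP; apply: measurableT_comp mG; exact: fine_measurable.
split.
 apply: (le_integrable measurableT mf _ iG) => y _.
 rewrite /Rintegral -/(fubini_G m1 (fun p => (F p)%:E) y).
 by case: (fubini_G _ _ _) => [r| |] //=; rewrite normr0 leey.
rewrite /Rintegral -(integral21_prod_meas1 iF); congr fine.
by apply: ae_eq_integral=> //; apply: filterS ae => y e _; rewrite -e.
Qed.

Lemma cintegral_fubini (F : X * Y -> R[i]) : cintegrable (m1 \x m2)%E setT F ->
 cintegrable m2 setT (fun y => cintegral m1 setT (fun x => F (x, y))) /\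
 cintegral (m1 \x m2)%E setT F = cintegral m2 setT (fun y => cintegral m1 setT (fun x => F (x, y))).
Proof.
move=> [ir ii]; have [jr er] := real_fubini ir; have [ji ei] := real_fubini ii.
by split; [split|rewrite /cintegral er ei].
Qed.

End complex_fubini.

Section boxes.
Variables (R : realType) (m : nat).
Local Notation RT := (measurableTypeR R).
Local Notation T := (m.-tuple RT).

Definition boxes : set (set T) :=
 [set B | exists2 D : 'I_m -> set RT, (forall i, measurable (D i)) & B = [set t | forall i, D i (tnth t i)]].

Lemma measurable_box (D : 'I_m -> set RT) : (forall i, measurable (D i)) ->
 measurable [set t : T | forall i, D i (tnth t i)].
Proof.
move=> mD; rewrite (_ : [set t | _] = \bigcap_(i in [set: 'I_m]) ((fun t : T => tnth t i) @^-1` D i)).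
 apply: fin_bigcap_measurable => // i _; rewrite -[X in measurable X]setTI; exact: measurable_tnth.
by apply/seteqP; split=> a /= H i; [move=> _; exact: H|exact: (H i I)].
Qed.

Lemma measurable_boxesE : (measurable : set (set T)) = <<s boxes >>.
Proof.
apply/seteqP; split=> A.
 apply: smallest_sub; first exact: smallest_sigma_algebra.
 move=> B; rewrite -bigcup_pred => -[i _ [C mC <-]].
 apply: sub_sigma_algebra; exists (fun j => if j == i then C else setT).
  by move=> j; case: eqP.
 rewrite setTI; apply/seteqP; split=> t /= H; first by move=> j; case: eqP=> [->|].
 by have := H i; rewrite eqxx.
apply: smallest_sub; first exact: sigma_algebra_measurable.
by move=> _ [D mD ->]; exact: measurable_box.
Qed.

Lemma boxes_setI : setI_closed boxes.
Proof.
move=> _ _ [D mD ->] [D' mD' ->]; exists (fun i => D i `&` D' i); first by move=> i; exact: measurableI.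
apply/seteqP; split=> [t [H H'] i|t H]; first by split; [exact: H|exact: H'].
by split=> i; have [] := H i.
Qed.

End boxes.

Section select_coordinates.
Variables (R : realType) (n m : nat) (h : 'I_m -> 'I_n).
Hypothesis h_inj : injective h.
Local Notation RT := (measurableTypeR R).

Definition select (a : n.-tuple RT) : m.-tuple RT := [tuple tnth a (h i) | i < m].

Lemma measurable_select : mfunT select.
Proof.
apply/measurable_fun_tnthP=> i; rewrite (_ : _ \o _ = fun a => tnth a (h i)); first exact: measurable_tnth.
by apply/funext=> a /=; rewrite tnth_mktuple.
Qed.

Definition full_turn : set RT := `[(- (pi / 2)), (3 * (pi / 2))[%classic.

Lemma full_turn_length : @lebesgue_measure R full_turn = (2 * pi)%:E.
Proof.
have p0 := pi_gt0 R.
rewrite /full_turn lebesgue_measure_itv /= lte_fin ifT; last by lra.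
by rewrite -EFinB; congr (_%:E); lra.
Qed.

Definition turns : set (n.-tuple RT) := [set a | forall k, k \notin codom h -> full_turn (tnth a k)].

Definition lifted_box (D : 'I_m -> set RT) (k : 'I_n) : set RT :=
 if [pick i | h i == k] is Some i then D i else full_turn.

Lemma lifted_box_h D i : lifted_box D (h i) = D i.
Proof. by rewrite /lifted_box; case: pickP=> [j /eqP /h_inj ->//|/(_ i)]; rewrite eqxx. Qed.

Lemma lifted_box_out D k : k \notin codom h -> lifted_box D k = full_turn.
Proof. by rewrite /lifted_box; case: pickP=> // j /eqP <-; rewrite codom_f. Qed.

Lemma select_box D : [set a | forall i, D i (tnth (select a) i)] `&` turns =
 [set a | forall k, lifted_box D k (tnth a k)].
Proof.
apply/seteqP; split=> a /=.
 move=> [H1 H2] k; have [/codomP[i ->]|hk] := boolP (k \in codom h).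
  by rewrite lifted_box_h; have := H1 i; rewrite tnth_mktuple.
 by rewrite lifted_box_out//; exact: H2.
move=> H; split=> [i|k hk]; first by rewrite tnth_mktuple; have := H (h i); rewrite lifted_box_h.
by have := H k; rewrite lifted_box_out.
Qed.

Lemma measurable_turns : measurable turns.
Proof.
have := select_box (fun=> setT); rewrite (_ : [set a | _] = setT) ?setTI; last by apply/seteqP; split.
move=> ->; apply: measurable_box => k; rewrite /lifted_box; case: pickP=> [i _|_]; [exact: measurableT|exact: measurable_itv].
Qed.

Lemma leb_select_box D : (forall i, measurable (D i)) ->
 (leb R n ([set a | forall i, D i (tnth (select a) i)] `&` turns) =
  ((2 * pi) ^+ (n - m))%:E * leb R m [set t | forall i, D i (tnth t i)])%E.
Proof.
move=> mD; have mL k : measurable (lifted_box D k).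
 by rewrite /lifted_box; case: pickP=> [i _|_]; [exact: mD|exact: measurable_itv].
rewrite select_box leb_box// leb_box// (bigID (mem (codom h))) /= muleC; congr (_ * _)%E.
 rewrite (eq_bigr (fun=> (2 * pi)%:E)); last first.
  by move=> k hk; rewrite lifted_box_out// full_turn_length.
 rewrite prodEFin prodr_const; congr ((_ ^+ _)%:E).
 have := cardC (mem (codom h)); rewrite card_codom// !card_ord => e.
 exact: (esym (canLR (addKn m) (esym e))).
rewrite (eq_bigl (fun k => k \in [set h i | i in 'I_m]%SET)); last first.
 by move=> k; apply/codomP/imsetP; [case=> i ->|case=> i _ ->]; exists i.
by rewrite big_imset /=; [apply: eq_bigr=> i _; rewrite lifted_box_h|move=> i j _ _; exact: h_inj].
Qed.

Definition selected (E : set (m.-tuple RT)) : \bar R := leb R n (select @^-1` E `&` turns).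

Let mpre E : measurable E -> measurable (select @^-1` E).
Proof. by move=> mE; rewrite -[X in measurable X]setTI; exact: measurable_select. Qed.

Let selected0 : selected set0 = 0%E.
Proof. by rewrite /selected preimage_set0 set0I measure0. Qed.

Let selected_ge0 E : (0 <= selected E)%E.
Proof. exact: measure_ge0. Qed.

Let selected_sigma_additive : semi_sigma_additive selected.
Proof.
move=> F mF tF mUF; rewrite /selected preimage_bigcup setI_bigcupl.
apply: measure_semi_sigma_additive.
- by move=> k; apply: measurableI; [exact: mpre|exact: measurable_turns].
- apply/trivIsetP=> /= i j _ _ ij; rewrite setIACA setIid -preimage_setI.
 by move/trivIsetP : tF => /(_ _ _ _ _ ij) ->//; rewrite preimage_set0 set0I.
- rewrite -setI_bigcupl -preimage_bigcup.
 by apply: measurableI; [exact: mpre|exact: measurable_turns].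
Qed.

HB.instance Definition _ := isMeasure.Build _ _ _ selected
 selected0 selected_ge0 selected_sigma_additive.

(** Both sides are measures in E that agree on boxes, a generating system closed under intersection,
    and the boxes [g k] of finite measure exhaust the space. *)
Lemma leb_select (E : set (m.-tuple RT)) : measurable E ->
 (leb R n (select @^-1` E `&` turns) = ((2 * pi) ^+ (n - m))%:E * leb R m E)%E.
Proof.
move=> mE; have p0 : 0 <= (2 * pi) ^+ (n - m) :> R by rewrite exprn_ge0// mulr_ge0// pi_ge0.
pose c := NngNum p0.
pose g (k : nat) : set (m.-tuple RT) := [set t | forall i, `](- k%:R), k%:R[%classic (tnth t i)].
have mI k (i : 'I_m) : measurable (`](- k%:R), k%:R[%classic : set RT) by exact: measurable_itv.
have Gg k : boxes (g k) by exists (fun=> `](- k%:R), k%:R[%classic) => // i; exact: mI.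
have gT : \bigcup_k g k = setT.
 apply/seteqP; split=> // t _.
 exists (Num.truncn (\sum_i `|tnth t i|)).+1 => // i.
 have le : `|tnth t i| <= \sum_i `|tnth t i| by rewrite (bigD1 i)//= lerDl sumr_ge0.
 rewrite /= in_itv /= -ltr_norml; apply: le_lt_trans le _; exact: truncnS_gt.
rewrite -/(selected E) -[RHS]/(mscale c (leb R m) E).
apply: (@measure_unique _ R (m.-tuple RT) (@boxes R m) g) => //.
- exact: measurable_boxesE.
- exact: boxes_setI.
- by move=> _ [D mD ->]; exact: leb_select_box.
- move=> k; suff : (((2 * pi) ^+ (n - m))%:E * leb R m (g k) < +oo)%E by rewrite -(leb_select_box (mI k)).
 rewrite lte_mul_pinfty//.
 have -> : leb R m (g k) = _ := @leb_box R m (fun=> `](- k%:R), k%:R[%classic) (mI k).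
 suff : (0 <= \prod_(i < m) @lebesgue_measure R (`](- k%:R)%R, k%:R%R[%classic : set RT) < +oo)%E by case/andP.
 elim/big_ind: _ => [|x y /andP[x0 hx] /andP[y0 hy]|i _].
 + by rewrite lee_fin ler01 ltry.
 + by rewrite mule_ge0//= lte_mul_pinfty// ge0_fin_numE.
 + by rewrite measure_ge0 /= lebesgue_measure_itv /= lte_fin; case: ifP; rewrite ?ltry// -EFinB ltry.
Qed.

(* Averaging over the turns of the angles identifies leb m with leb n. *)
Definition turn_weight (a : n.-tuple RT) : R := \1_turns a / (2 * pi) ^+ (n - m).

Lemma transports_select : transports (leb R m) (leb R n) select turn_weight.
Proof.
have p0 : 0 < (2 * pi) ^+ (n - m) :> R by rewrite exprn_gt0// mulr_gt0// pi_gt0.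
have w0 a : 0 <= turn_weight a by rewrite mulr_ge0// invr_ge0 ltW.
have mw : mfunT turn_weight.
 by apply: measurable_funM; [apply: measurable_indic; exact: measurable_turns|exact: measurable_cst].
split=> //; first exact: measurable_select.
move=> g mg g0.
have wg : mfunT (fun a => g (select a)) by exact: measurableT_comp mg measurable_select.
rewrite -(@ge0_integral_density _ _ R (leb R n) turn_weight mw w0 (fun a => g (select a))) //.
apply: (@ge0_integral_image _ _ _ _ R select (density (leb R n) mw w0) (leb R m)) => //.
 exact: measurable_select.
move=> E mE; rewrite -[LHS]/(\int[leb R n]_(a in select @^-1` E) (turn_weight a)%:E)%E.
rewrite integral_mkcond.
transitivity (\int[leb R n]_a (((2 * pi) ^+ (n - m))^-1%:E * (\1_(select @^-1` E `&` turns) a)%:E))%E.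
 apply: eq_integral=> a _; rewrite patchE /turn_weight indicI /= !indicE.
 by case: (a \in select @^-1` E); rewrite -EFinM /= ?mul1r ?mul0r ?mulr0// mulrC.
have mEt : measurable (select @^-1` E `&` turns) by apply: measurableI; [exact: mpre|exact: measurable_turns].
rewrite ge0_integralZl//; last by rewrite lee_fin invr_ge0 ltW.
 have -> : (\int[leb R n]_a (\1_(select @^-1` E `&` turns) a)%:E = ((2 * pi) ^+ (n - m))%:E * leb R m E)%E.
  by rewrite integral_indic// setIT; exact: leb_select.
 by rewrite muleA -EFinM mulVf ?mul1e// gt_eqF.
by apply/measurable_EFinP; exact: measurable_indic.
Qed.

End select_coordinates.

Section log_coordinates.
Variables (R : realType) (m : nat).
Local Notation RT := (measurableTypeR R).

Definition log_tuple : m.-tuple RT -> m.-tuple RT := map_fun (fun _ t => ln t).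
Definition log_weight (r : m.-tuple RT) : R := \prod_i (if 0 < tnth r i then (tnth r i)^-1 else 0).

Lemma transports_log : transports (leb R m) (leb R m) log_tuple log_weight.
Proof.
have mw1 : mfunT (fun t : R => if 0 < t then t^-1 else 0).
 by apply: measurable_fun_ifT => //; [exact: measurable_fun_ltr|exact: measurable_invr].
have w10 (t : R) : 0 <= (if 0 < t then t^-1 else 0) by case: ifP=> // /ltW; rewrite invr_ge0.
split.
- by apply: measurable_map_fun => _; exact: measurable_ln.
- apply: measurable_prod => i _; apply: (measurableT_comp mw1); exact: measurable_tnth.
- by move=> r; apply: prodr_ge0 => i _; exact: w10.
move=> g mg g0; rewrite (ge0_leb_coordinate_change (Z := fun _ t => ln t) (fun _ => mw1) (fun _ => w10) (fun _ => @measurable_ln R) _ mg g0)//.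
by move=> i g1; exact: ge0_integral_expR.
Qed.

End log_coordinates.

Section period_integral.
Variables (R : realType) (n m : nat) (rho : PSL2n R n) (h : 'I_m -> 'I_n).
Hypothesis h_inj : injective h.
Variable B : 'M[R]_m.
Hypothesis B_free : row_free B.
Variable u : 'rV[R[i]]_n -> R[i].
Hypothesis u_smooth : csmooth_on (@upper_xy R n) (on_xy u).
Local Notation RT := (measurableTypeR R).
Local Notation zt := (zt (coordZ rho h)).

(** The value of v on the axes and at the elliptic fixed points, where the elliptic angles have no
    effect. *)
Definition origin : n.-tuple RT := [tuple (0 : RT) | _ < n].

Lemma doms_origin : doms (coord_dom h) origin.
Proof.
by move=> k; rewrite tnth_mktuple => _; rewrite oppr_lt0 divr_gt0 ?pi_gt0.
Qed.

Lemma cmeas_zt v : doms (coord_dom h) v -> cmeas (fun a => u (zt a v)).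
Proof.
move=> hv.
have mr := measurable_phi_pt (@conformal_coordZ R n m rho h) (phi_re_continuous u_smooth) hv.
have mi := measurable_phi_pt (@conformal_coordZ R n m rho h) (phi_im_continuous u_smooth) hv.
split.
 by rewrite (_ : (fun a => _) = (fun a => Re (on_xy u (pt (coordZ rho h) a v)))) //; apply/funext=> a; rewrite on_xy_pt.
by rewrite (_ : (fun a => _) = (fun a => Im (on_xy u (pt (coordZ rho h) a v)))) //; apply/funext=> a; rewrite on_xy_pt.
Qed.

Definition embed (l : m.-tuple RT) : n.-tuple RT :=
 [tuple (if [pick i | h i == k] is Some i then tnth l i else 0 : RT) | k < n].

Lemma measurable_embed : mfunT embed.
Proof.
apply/measurable_fun_tnthP=> k.
rewrite (_ : _ \o _ = fun l : m.-tuple RT => if [pick i | h i == k] is Some i then tnth l i else 0).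
 by case: pickP=> [i _|_]; [exact: measurable_tnth|exact: measurable_cst].
by apply/funext=> l /=; rewrite tnth_mktuple.
Qed.

Lemma zt_select a : zt a origin = zt (embed (select h a)) origin.
Proof.
apply/rowP=> k; rewrite !mxE !tnth_mktuple /coordZ; case: pickP=> [i /eqP <-|no].
 by rewrite tnth_mktuple.
have /negbTE hk : k \notin codom h by apply/negP=> /codomP[i ki]; have := no i; rewrite ki eqxx.
by rewrite hk /polar_Z !ell_polar_base.
Qed.

Lemma zt_period_point l : zt (embed l) origin = period_point h rho [tuple (expR (tnth l i) : RT) | i < m].
Proof.
apply/rowP=> k; rewrite !mxE !tnth_mktuple /coordZ /polar_Z; case: pickP=> [i /eqP <-|no].
 by rewrite codom_f hyp_polar_base tnth_mktuple.
have /negbTE hk : k \notin codom h by apply/negP=> /codomP[i ki]; have := no i; rewrite ki eqxx.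
by rewrite hk ell_polar_base.
Qed.

Definition log_period : set (m.-tuple RT) := [set l | parallelotope B (\row_i tnth l i)].

Lemma measurable_log_period : measurable log_period.
Proof.
apply: (@measurable_parallelotope _ _ _ _ _ (fun l : m.-tuple RT => \row_j tnth l j)) => // k.
rewrite (_ : (fun a => _) = fun l : m.-tuple RT => tnth l k); first exact: measurable_tnth.
by apply/funext=> a; rewrite mxE.
Qed.

Definition log_integrand (l : m.-tuple RT) : R[i] := (\1_log_period l)%:C * u (zt (embed l) origin).

Lemma cmeas_log_integrand : cmeas log_integrand.
Proof.
apply: cmeasM; first by apply: cmeas_real; apply: measurable_indic; exact: measurable_log_period.
have [mr mi] := cmeas_zt doms_origin.
split; [exact: (measurableT_comp mr measurable_embed)|exact: (measurableT_comp mi measurable_embed)].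
Qed.

Lemma cell_indic a : \1_(period_cell h B) a = \1_(turns h) a * \1_log_period (select h a) :> R.
Proof.
have E : (\row_j tnth a (h j)) = \row_i tnth (select h a) i :> 'rV[R]_m.
 by apply/rowP=> j; rewrite !mxE tnth_mktuple.
have turnsE : turns h a <-> forall k, k \notin codom h -> - (pi / 2) <= tnth a k < 3 * (pi / 2).
 by split=> H k hk; have := H k hk; rewrite /full_turn /= in_itv.
rewrite !indicE -natrM mulnb; congr (nat_of_bool _)%:R.
apply/idP/andP=> [/set_mem [P1 P2]|[/set_mem P1 /set_mem P2]]; last first.
 by apply/mem_set; split; [rewrite E|exact/turnsE].
by split; apply/mem_set; [exact/turnsE|rewrite /log_period /= -E].
Qed.

Lemma period_integrandE r : (\1_(period_domain B) r)%:C * period_integrand h u rho r =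
 (log_weight r)%:C * log_integrand (log_tuple r).
Proof.
have [pos|npos] := pselect (forall i, 0 < tnth r i); last first.
 rewrite indicE memNset ?mul0r; last by case.
 have [i ri] : exists i, ~ 0 < tnth r i by apply: contrapT => /forallNP H; apply: npos => i; apply: contrapT; exact: H.
 by rewrite /log_weight (bigD1 i)//= ifF ?mul0r//; exact/negP.
rewrite /log_integrand /period_integrand zt_period_point.
have -> : [tuple (expR (tnth (log_tuple r) i) : RT) | i < m] = r.
 by apply: eq_from_tnth=> i; rewrite !tnth_mktuple lnK// posrE.
have -> : log_weight r = \prod_i (tnth r i)^-1 by apply: eq_bigr=> i _; rewrite pos.
have -> : \1_(period_domain B) r = \1_log_period (log_tuple r) :> R; last by ring.
have E : (\row_i ln (tnth r i)) = \row_i tnth (log_tuple r) i :> 'rV[R]_m.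
 by apply/rowP=> j; rewrite !mxE tnth_mktuple.
rewrite !indicE; congr (nat_of_bool _)%:R; apply/idP/idP=> /set_mem P; apply/mem_set.
 by case: P=> _; rewrite /log_period /= E.
by split=> //; rewrite E.
Qed.

(** The integrand depends on the log radii only, so each of the n - m angles contributes 2 pi. The
    substitution l = ln r then turns the rest of the cell into [period_domain]. *)
Lemma cell_avg_origin :
 cintegrable (leb R m) (period_domain B) (period_integrand h u rho) /\
 cell_avg rho h B u origin =
 ((2 * pi) ^+ (n - m))%:C * cintegral (leb R m) (period_domain B) (period_integrand h u rho).
Proof.
have p0 : (2 * pi) ^+ (n - m) != 0 :> R by rewrite expf_neq0// mulf_neq0// gt_eqF ?pi_gt0.
have p0C : ((2 * pi) ^+ (n - m))%:C != 0 :> R[i] by rewrite (inj_eq (@complexI R)).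
have mc := measurable_period_cell h B_free.
have i1 : cintegrable (leb R n) (period_cell h B) (fun a => u (zt a origin)).
 have ir := integrable_cell rho B_free (phi_re_continuous u_smooth) doms_origin.
 have ii := integrable_cell rho B_free (phi_im_continuous u_smooth) doms_origin.
 split.
  by rewrite (_ : (fun a => _) = (EFin \o (fun a => Re (on_xy u (pt (coordZ rho h) a origin))))) //; apply/funext=> a /=; rewrite on_xy_pt.
 by rewrite (_ : (fun a => _) = (EFin \o (fun a => Im (on_xy u (pt (coordZ rho h) a origin))))) //; apply/funext=> a /=; rewrite on_xy_pt.
have E a : (\1_(period_cell h B) a)%:C * u (zt a origin) =
  ((2 * pi) ^+ (n - m))%:C * ((turn_weight h a)%:C * log_integrand (select h a)).
 rewrite cell_indic /turn_weight /log_integrand zt_select !rmorphM /= fmorphV; field.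
 exact: p0C.
have {}i1 := (cintegrable_mkcond (leb R n) (fun a => u (zt a origin)) mc).1 i1.
rewrite (funext E) in i1.
have i2 : cintegrable (leb R n) setT (fun a => (turn_weight h a)%:C * log_integrand (select h a)).
 have := cintegrableZ (((2 * pi) ^+ (n - m))%:C)^-1 i1.
 by rewrite (_ : (fun a => _) = (fun a => (turn_weight h a)%:C * log_integrand (select h a)))//; apply/funext=> a; rewrite mulKf.
have i3 := (transports_cintegrable (transports_select R h_inj) cmeas_log_integrand).2 i2.
have i4 := (transports_cintegrable (transports_log R m) cmeas_log_integrand).1 i3.
have mP : measurable (period_domain B : set (m.-tuple RT)).
 rewrite (_ : period_domain B = [set r : m.-tuple RT | forall i, `]0, +oo[%classic (tnth r i)] `&` @log_tuple R m @^-1` log_period).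
  apply: measurableI; first exact: (@measurable_box R m (fun=> `]0, +oo[%classic) (fun i => measurable_itv _)).
  rewrite -[X in measurable X]setTI; have [mlog _ _ _] := transports_log R m.
  by apply: mlog => //; exact: measurable_log_period.
 have E' r : (\row_i ln (tnth r i)) = \row_i tnth (log_tuple r) i :> 'rV[R]_m.
  by apply/rowP=> j; rewrite !mxE tnth_mktuple.
 apply/seteqP; split=> [r [P1 P2]|r [P1 P2]]; split.
 - by move=> i; rewrite /= in_itv /= andbT; exact: P1.
 - by rewrite /log_period /= -E'.
 - by move=> i; have := P1 i; rewrite /= in_itv /= andbT.
 - by rewrite E'.
split.
 by apply/(cintegrable_mkcond (leb R m) _ mP); rewrite (funext period_integrandE); exact: i4.
rewrite /cell_avg cintegral_mkcond (eq_cintegral _ E) cintegralZ//; congr (_ * _).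
rewrite -(transports_cintegral (transports_select R h_inj) cmeas_log_integrand).
rewrite (transports_cintegral (transports_log R m) cmeas_log_integrand).
by rewrite [RHS]cintegral_mkcond; apply: eq_cintegral => r; rewrite period_integrandE.
Qed.

End period_integral.

(** * Integrability of the mixed integrand *)

Section coordinate_bounds.
Variable R : realType.
Implicit Types (f g : R -> R[i]) (l : R[i]).

Lemma normc_bounded_segment f (c d : R) : {within `[c, d], continuous (fun t => Re (f t))} ->
 {within `[c, d], continuous (fun t => Im (f t))} ->
 exists2 K : R, 0 <= K & forall t, c <= t <= d -> normc (f t) <= K.
Proof.
move=> cr ci; have [cd|dc] := leP c d; last first.
 by exists 0 => // t /andP[h1 h2]; have := lt_le_trans dc (le_trans h1 h2); rewrite ltxx.
have B (r : R -> R) : {within `[c, d], continuous r} -> exists2 K : R, 0 <= K & forall t, c <= t <= d -> `|r t| <= K.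
 move=> cr'; have [t1 _ h1] := EVT_max cd cr'; have [t2 _ h2] := EVT_min cd cr'.
 exists (`|r t1| + `|r t2|); first exact: addr_ge0.
 move=> t ht; have it : t \in `[c, d] by rewrite in_itv.
 have := h1 t it; have := h2 t it; have := ler_norm (r t1); have := lerNnormlW (lexx `|r t2|).
 have := normr_ge0 (r t1); have := normr_ge0 (r t2).
 by rewrite ler_norml => *; apply/andP; split; lra.
have [K1 K10 h1] := B _ cr; have [K2 K20 h2] := B _ ci.
exists (K1 + K2); first exact: addr_ge0.
by move=> t ht; apply: le_trans (normc_le_abs _) _; apply: lerD; [exact: h1|exact: h2].
Qed.

Lemma f_solution_continuous l f : f_solution l f -> forall t, - (pi / 2) < t < pi / 2 ->
 {for t, continuous (fun t => Re (f t))} /\ {for t, continuous (fun t => Im (f t))}.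
Proof.
move=> [_ _ hf] t ht; have [d _ _] := hf t ht; have [d1 d2] := cderive1_cis d.
by split; [exact: is_derive_continuous d1|exact: is_derive_continuous d2].
Qed.

Lemma g_solution_continuous l g : g_solution l g -> forall t, 0 < t ->
 {for t, continuous (fun t => Re (g t))} /\ {for t, continuous (fun t => Im (g t))}.
Proof.
move=> [_ _ _ hf] t ht; have [d _ _] := hf t ht; have [d1 d2] := cderive1_cis d.
by split; [exact: is_derive_continuous d1|exact: is_derive_continuous d2].
Qed.

(** As N > 1, a bound on the displacement keeps cos t away from 0, so t stays in a compact
    subinterval where f is continuous. *)
Lemma hyp_weight_bound l f (N M : R) : f_solution l f -> 1 < N -> exists2 K : R, 0 <= K &
 forall t, - (pi / 2) < t < pi / 2 -> `|hyp_dist t N| <= M ->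
 [/\ `|t| <= K, normc (f t) <= K & `|(cos t ^+ 2)^-1| <= K].
Proof.
move=> fs N1; pose d := N + N^-1 - 2.
have N0 : 0 < N by lra.
have d0 : 0 < d.
 have -> : d = (N - 1) ^+ 2 / N by rewrite /d; field; lra.
 by rewrite divr_gt0// exprn_gt0//; lra.
pose M' := Num.max M 1; have M'1 : 1 <= M' by rewrite le_max lexx orbT.
have M'0 : 0 < M' by lra.
(* A lower bound of cos t, since cos t >= cos^2 t >= d/M'; the minimum with 1 puts it into the
   domain of [acos]. *)
pose e := Num.min 1 (d / M'); have e0 : 0 < e by rewrite lt_min ltr01 divr_gt0.
have e1 : e <= 1 by rewrite ge_min lexx.
have e2 : e <= d / M' by rewrite ge_min lexx orbT.
have ae : -1 <= e <= 1 by lra.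
pose c := acos e.
have cpi : c < pi / 2.
 rewrite ltNge; apply/negP=> h.
 have cB : c \in `[0, pi] by rewrite in_itv /= acos_ge0 ?acos_lepi.
 have pB : pi / 2 \in `[0, (pi : R)] by rewrite in_itv /=; have := pi_ge0 R; lra.
 have := ltr_cos cB pB; rewrite cos_pihalf /c acosK// e0 => H.
 move: h; rewrite le_eqVlt -/c => /orP[/eqP h|h].
  by have := acosK ae; rewrite -/c -h cos_pihalf => h'; rewrite -h' ltxx in e0.
 by rewrite ltNge ltW in H.
have key t : - (pi / 2) < t < pi / 2 -> `|hyp_dist t N| <= M -> `|t| <= c /\ (cos t ^+ 2)^-1 <= M' / d.
 move=> ht; have ct := cos_gt0_pihalf ht; have ct2 : 0 < cos t ^+ 2 by rewrite exprn_gt0.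
 rewrite /hyp_dist -/d gtr0_norm ?divr_gt0// => hM.
 have hM' : d / cos t ^+ 2 <= M' by rewrite le_max hM.
 have h1 : (cos t ^+ 2)^-1 <= M' / d by rewrite ler_pdivlMr// mulrC.
 split=> //; have h2 : e <= cos t.
  have c1 := cos_le1 t; apply: le_trans e2 _; rewrite ler_pdivrMr//.
  move: hM'; rewrite ler_pdivrMr// => h; apply: le_trans h _.
  by rewrite mulrC ler_pM2r// expr2 ger_pMr.
 rewrite leNgt; apply/negP=> ct'.
 have tB : `|t| \in `[0, pi].
  by rewrite in_itv /= normr_ge0 /=; have := pi_ge0 R; move: ht => /andP[t1 t2]; rewrite ler_norml => p0; apply/andP; split; lra.
 have cB : c \in `[0, pi] by rewrite in_itv /= acos_ge0 ?acos_lepi.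
 have := ltr_cos cB tB; rewrite ct' /c acosK// => H.
 have ca : cos `|t| = cos t by have [y0|y0] := ltP t 0; [rewrite ltr0_norm// cosN|rewrite ger0_norm].
 by move: H; rewrite ca ltNge h2.
have c0 : 0 <= c by rewrite acos_ge0.
have inI t : - c <= t <= c -> - (pi / 2) < t < pi / 2 by move=> /andP[t1 t2]; apply/andP; split; lra.
have wc (r : R -> R) : (forall t, - (pi / 2) < t < pi / 2 -> {for t, continuous r}) -> {within `[- c, c], continuous r}.
 move=> cr; apply: continuous_in_subspaceT => t; rewrite inE /= in_itv => /inI; exact: cr.
have [K K0 hK] := normc_bounded_segment (wc _ (fun t ht => (f_solution_continuous fs ht).1)) (wc _ (fun t ht => (f_solution_continuous fs ht).2)).
have Md0 : 0 <= M' / d by rewrite divr_ge0 ?ltW.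
exists (c + K + M' / d); first by rewrite !addr_ge0.
move=> t ht hM; have [h1 h2] := key t ht hM.
have h3 : normc (f t) <= K by apply: hK; rewrite -ler_norml.
split; [lra|lra|].
by rewrite ger0_norm ?invr_ge0 ?sqr_ge0//; lra.
Qed.

(** As sin th is not 0, a bound on the displacement bounds sinh t, and t <= 2 sinh t bounds t
    itself. *)
Lemma ell_weight_bound l g (th M : R) : g_solution l g -> sin th != 0 -> exists2 K : R, 0 <= K &
 forall t, 0 < t -> `|ell_dist t th| <= M ->
 [/\ `|t| <= K, normc (g t) <= K & `|sinh t| <= K].
Proof.
move=> gs s0; pose M' := Num.max M 1; have M'1 : 1 <= M' by rewrite le_max lexx orbT.
have s20 : 0 < sin th ^+ 2 by rewrite exprn_even_gt0.
pose C := M' / sin th ^+ 2 + 1.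
have C0 : 0 < C by rewrite /C; have := divr_gt0 (lt_le_trans ltr01 M'1) s20; lra.
have key t : 0 < t -> `|ell_dist t th| <= M -> sinh t <= C /\ t <= 2 * C.
 move=> t0; have sh := sinh_gt0 t0; rewrite /ell_dist ger0_norm ?sqr_ge0// => hM.
 have hM' : (2 * sinh t * sin th) ^+ 2 <= M' by rewrite le_max hM.
 have h1 : sinh t ^+ 2 <= M' / sin th ^+ 2.
  rewrite ler_pdivlMr//.
  have e4 : (2 * sinh t * sin th) ^+ 2 = 4 * (sinh t ^+ 2 * sin th ^+ 2) by ring.
  have nn : 0 <= sinh t ^+ 2 * sin th ^+ 2 by rewrite mulr_ge0 ?sqr_ge0.
  by move: hM' nn; rewrite e4; move: (sinh t ^+ 2 * _) => q *; lra.
 have h2 : sinh t <= C by rewrite /C; nra.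
 split=> //; apply: le_trans (_ : 2 * sinh t <= _); last by rewrite ler_pM2l.
 have e1 := expR_ge1Dx t; have e2 : expR (- t) <= 1 by rewrite -expR0 ler_expR; lra.
 by rewrite /sinh; lra.
have [_ cr ci _] := gs.
have sub : (`[0, 2 * C]%classic : set R) `<=` `[0, +oo[%classic.
 by move=> x /=; rewrite !in_itv /= andbT => /andP[].
have [K K0 hK] := normc_bounded_segment (continuous_subspaceW sub cr) (continuous_subspaceW sub ci).
exists (2 * C + K); first by lra.
move=> t t0 hM; have [h1 h2] := key t t0 hM; have sh := sinh_gt0 t0.
have h3 : normc (g t) <= K by apply: hK; lra.
by split; rewrite ?gtr0_norm//; lra.
Qed.

End coordinate_bounds.

Section mix_weight.
Variables (R : realType) (n m : nat) (h : 'I_m -> 'I_n)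
 (psi : 'rV[R]_n -> R[i]) (N theta : 'I_n -> R) (lam : 'I_n -> R[i]) (f g : 'I_n -> R -> R[i]).
Hypotheses (psi_smooth : csmooth_on [set: 'rV[R]_n] psi)
 (psi_compact : compact_support psi)
 (N_gt1 : forall k, k \in codom h -> 1 < N k)
 (theta_sin : forall k, k \notin codom h -> sin (theta k) != 0).
Hypotheses (f_sol : forall k, f_solution (- lam k) (f k)) (g_sol : forall k, g_solution (- lam k) (g k)).
Local Notation RT := (measurableTypeR R).
Local Notation b k := (k \in codom h).
Local Notation T1 := (n.-tuple RT).

Definition coord_weight k (t : R) : R := if b k then (cos t ^+ 2)^-1 else sinh t.
Definition coord_sol k (t : R) : R[i] := if b k then f k t else g k t.
Definition coord_dist k (t : R) : R := if b k then hyp_dist t (N k) else ell_dist t (theta k).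
Definition coord_range k : set R := if b k then `](- (pi / 2)), (pi / 2)[%classic else `]0, +oo[%classic.

(** The factor of the integrand that is free of f and g. It is even in the hyperbolic variables, as
    [symmetrize] requires. *)
Definition mix_weight (v : T1) : R[i] :=
 (\1_(mix_domain h) v)%:C * (psi (\row_k coord_dist k (tnth v k)) * (\prod_k coord_weight k (tnth v k))%:C).

Lemma mix_domainE (v : T1) : mix_domain h v <-> forall k, coord_range k (tnth v k).
Proof.
split=> H k; have := H k; rewrite /coord_range; case: ifP=> _; rewrite /= in_itv /= ?andbT //.
Qed.

Lemma measurable_coord_range k : measurable (coord_range k : set RT).
Proof. by rewrite /coord_range; case: ifP=> _; exact: measurable_itv. Qed.

Lemma measurable_mix_domain : measurable (mix_domain h : set T1).
Proof.
rewrite (_ : mix_domain h = [set v : T1 | forall k, coord_range k (tnth v k)]).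
 exact: (measurable_box measurable_coord_range).
by apply/seteqP; split=> v /mix_domainE.
Qed.

Lemma measurable_coord_weight k : mfunT (coord_weight k).
Proof.
have mc := @measurable_cosr R; rewrite /coord_weight; case: (k \in codom h) => /=; last exact: measurable_sinh.
by meas.
Qed.

Lemma measurable_coord_dist k : mfunT (coord_dist k).
Proof.
have ms := @measurable_sinh R; have mc := @measurable_cosr R; rewrite /coord_dist /hyp_dist /ell_dist; by case: (k \in codom h) => /=; meas.
Qed.

Lemma cmeas_mix_weight : cmeas mix_weight.
Proof.
apply: cmeasM; first by apply: cmeas_real; apply: measurable_indic; exact: measurable_mix_domain.
apply: cmeasM; last first.
 apply: cmeas_real; apply: measurable_prod => k _.
 by apply: (measurableT_comp (measurable_coord_weight k)); exact: measurable_tnth.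
have mZ := measurable_map_fun measurable_coord_dist.
have [mr mi] := cmeas_comp (cmeas_row psi_smooth) mZ.
have E v : psi (\row_k coord_dist k (tnth v k)) = psi (to_row (map_fun coord_dist v)).
 by congr psi; apply/rowP=> k; rewrite !mxE tnth_mktuple.
by split; [rewrite (_ : (fun v => _) = (fun v => Re (psi (to_row (map_fun coord_dist v)))))|
 rewrite (_ : (fun v => _) = (fun v => Im (psi (to_row (map_fun coord_dist v)))))] => //;
 apply/funext=> v; rewrite E.
Qed.

Lemma mix_weight_out v : ~ mix_domain h v -> mix_weight v = 0.
Proof. by move=> nv; rewrite /mix_weight indicE memNset// mul0r. Qed.

Lemma mix_weight_flip k v : b k -> mix_weight (flip k v) = mix_weight v.
Proof.
move=> bk; have E j (F : R -> R) : (j = k -> forall t, F (- t) = F t) -> F (tnth (flip k v) j) = F (tnth v j).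
 by rewrite tnth_updt; case: eqP=> [->|//] H; rewrite H.
have Ed j : coord_dist j (tnth (flip k v) j) = coord_dist j (tnth v j).
 by apply: E => -> t; rewrite /coord_dist bk /hyp_dist cosN.
have Ew j : coord_weight j (tnth (flip k v) j) = coord_weight j (tnth v j).
 by apply: E => -> t; rewrite /coord_weight bk cosN.
rewrite /mix_weight; under eq_bigr do rewrite Ew.
have -> : \row_j coord_dist j (tnth (flip k v) j) = \row_j coord_dist j (tnth v j).
 by apply/rowP=> j; rewrite !mxE Ed.
congr (_ %:C * _); rewrite !indicE; congr (nat_of_bool _)%:R.
have R_sym (w : T1) : mix_domain h w -> mix_domain h (flip k w).
 move=> /mix_domainE H; apply/mix_domainE => j; rewrite tnth_updt; case: eqP=> [->|_]; last exact: H.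
 by have := H k; rewrite /coord_range bk /= !in_itv /= => /andP[h1 h2]; apply/andP; split; lra.
have ff : flip k (flip k v) = v by apply: eq_from_tnth=> j; rewrite !tnth_updt eqxx; case: eqP=> [->|//]; rewrite opprK.
by apply/idP/idP=> /set_mem H; apply/mem_set; [rewrite -ff; exact: R_sym|exact: R_sym].
Qed.

Lemma mix_integrandE v : (\1_(mix_domain h) v)%:C * mix_integrand h psi N theta f g v =
 mix_weight v * \prod_k coord_sol k (tnth v k).
Proof.
rewrite /mix_weight /mix_integrand -!mulrA; congr (_ * (_ * _)).
rewrite rmorph_prod -big_split /=; apply: eq_bigr=> k _.
by rewrite /coord_weight /coord_sol; case: ifP=> _; rewrite mulrC.
Qed.

(** The solutions are controlled on their intervals only; the cut makes them measurable on the line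
    and is invisible next to [mix_weight]. *)
Definition cut_solution k (t : R) : R[i] := (\1_(coord_range k) t)%:C * coord_sol k t.

Lemma cmeas_cut_solution k : cmeas (cut_solution k : RT -> R[i]).
Proof.
have oI : open (coord_range k) by rewrite /coord_range; case: ifP=> _; exact: interval_open.
have cont t : coord_range k t -> {for t, continuous (fun t => Re (coord_sol k t))} /\
  {for t, continuous (fun t => Im (coord_sol k t))}.
 rewrite /coord_range /coord_sol; case: ifP=> _; rewrite /= in_itv /= ?andbT => ht.
  exact: (f_solution_continuous (f_sol k) ht).
 exact: (g_solution_continuous (g_sol k) ht).
have M (r : R -> R) : (forall t, coord_range k t -> {for t, continuous r}) ->
  mfunT (fun t : RT => \1_(coord_range k) t * r t).
 move=> cr; rewrite (_ : (fun t => _) = (r : RT -> R) \_ (coord_range k)).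
  apply/(measurable_restrictT _ (measurable_coord_range k)).
  by apply: open_continuous_measurable_fun => // t /set_mem; exact: cr.
 by apply/funext=> t; rewrite patchE indicE; case: ifP; rewrite ?mul1r ?mul0r.
split.
 rewrite (_ : (fun x => _) = (fun t : RT => \1_(coord_range k) t * Re (coord_sol k t))).
  by apply: M => t /cont[].
 by apply/funext=> t; rewrite /cut_solution; case: (coord_sol k t) => x y /=; rewrite mul0r subr0.
rewrite (_ : (fun x => _) = (fun t : RT => \1_(coord_range k) t * Im (coord_sol k t))).
 by apply: M => t /cont[].
by apply/funext=> t; rewrite /cut_solution; case: (coord_sol k t) => x y /=; rewrite mul0r addr0.
Qed.

Lemma mix_weight_cut (S : {set 'I_n}) v : mix_weight v * \prod_(j in S) coord_sol j (tnth v j) =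
 mix_weight v * \prod_(j in S) cut_solution j (tnth v j).
Proof.
have [Dv|nDv] := pselect (mix_domain h v); last by rewrite mix_weight_out// !mul0r.
congr (_ * _); apply: eq_bigr=> j _; rewrite /cut_solution indicE mem_set ?mul1r//.
by move/mix_domainE : Dv; exact.
Qed.

Lemma cmeas_mix_weight_solution (S : {set 'I_n}) :
 cmeas (fun v => mix_weight v * \prod_(j in S) coord_sol j (tnth v j)).
Proof.
rewrite (_ : (fun v => _) = (fun v => mix_weight v * \prod_(j in S) cut_solution j (tnth v j))); last first.
 by apply/funext=> v; exact: mix_weight_cut.
apply: cmeasM; first exact: cmeas_mix_weight.
have -> : (fun v : T1 => \prod_(j in S) cut_solution j (tnth v j)) =
  (fun v => \prod_(j <- enum S) cut_solution j (tnth v j)).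
 by apply/funext=> v; rewrite big_enum.
apply: cmeas_prod => j; exact: (cmeas_comp (cmeas_cut_solution j) (measurable_tnth j)).
Qed.

(** Where [psi] does not vanish all displacements are at most M, which bounds every variable, weight
    and solution: the integrand is bounded with bounded support. *)
Lemma mix_weight_integrable :
 cintegrable (leb R n) setT (fun v => mix_weight v * \prod_k coord_sol k (tnth v k)).
Proof.
have [M M0 hM] := compact_support_bound psi_compact.
have [P P0 hP] := psi_bounded psi_smooth psi_compact.
have /choice[K hK] : forall k, exists K : R, 0 <= K /\ forall t, coord_range k t -> `|coord_dist k t| <= M ->
  [/\ `|t| <= K, normc (coord_sol k t) <= K & `|coord_weight k t| <= K].
 move=> k; rewrite /coord_range /coord_dist /coord_sol /coord_weight.
 have [bk|bk] := boolP (b k).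
  have [K K0 hK] := hyp_weight_bound M (f_sol k) (N_gt1 bk).
  by exists K; split=> // t; rewrite /= in_itv /=; exact: hK.
 have [K K0 hK] := ell_weight_bound M (g_sol k) (theta_sin bk).
 by exists K; split=> // t; rewrite /= in_itv /= andbT; exact: hK.
have K0 k : 0 <= K k by have [] := hK k.
pose D : set T1 := [set v | forall k, `[(- K k), (K k)]%classic (tnth v k)].
have mD : measurable D by exact: (@measurable_box R n (fun k => `[(- K k), (K k)]%classic) (fun k => measurable_itv _)).
have D_fin : (leb R n D < +oo)%E.
 have -> : leb R n D = _ := @leb_box R n (fun k => `[(- K k), (K k)]%classic) (fun k => measurable_itv _).
 suff : (0 <= \prod_(k < n) @lebesgue_measure R (`[(- K k)%R, (K k)%R]%classic : set RT) < +oo)%E by case/andP.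
 elim/big_ind: _ => [|x y /andP[x0 hx] /andP[y0 hy]|i _].
 - by rewrite lee_fin ler01 ltry.
 - by rewrite mule_ge0//= lte_mul_pinfty// ge0_fin_numE.
 - by rewrite measure_ge0 /= lebesgue_measure_itv /= lte_fin; case: ifP; rewrite ?ltry// -EFinB ltry.
have PK0 : 0 <= P * ((\prod_k K k) * \prod_k K k) by rewrite !mulr_ge0// prodr_ge0.
have mF : cmeas (fun v => mix_weight v * \prod_k coord_sol k (tnth v k)).
 have := cmeas_mix_weight_solution [set: 'I_n]%SET.
 by rewrite (_ : (fun v => _) = (fun v => mix_weight v * \prod_k coord_sol k (tnth v k)))//; apply/funext=> v; congr (_ * _); apply: eq_bigl => k; rewrite inE.
apply: (@cintegrable_bounded _ _ _ (leb R n) D (P * ((\prod_k K k) * \prod_k K k))) => // v.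
have [Dv|nDv] := pselect (mix_domain h v); last first.
 by rewrite mix_weight_out// mul0r ComplexField.Normc.normc0 mulr_ge0.
have [p0|pn0] := eqVneq (psi (\row_k coord_dist k (tnth v k))) 0.
 by rewrite /mix_weight p0 mul0r mulr0 mul0r ComplexField.Normc.normc0 mulr_ge0.
have bk k : [/\ `|tnth v k| <= K k, normc (coord_sol k (tnth v k)) <= K k & `|coord_weight k (tnth v k)| <= K k].
 have [_ H] := hK k; apply: H; first by move/mix_domainE : Dv; exact.
 by have := hM _ pn0 k; rewrite mxE.
have -> : \1_D v = 1 :> R.
 by rewrite indicE mem_set// => k; rewrite /= in_itv /= -ler_norml; have [] := bk k.
rewrite mulr1 /mix_weight indicE mem_set// mul1r !ComplexField.Normc.normcM -mulrA.
apply: ler_pM; [exact: normc_nneg|by rewrite mulr_ge0 ?normc_nneg|exact: hP|].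
have nprod (F : 'I_n -> R[i]) : (forall k, normc (F k) <= K k) -> normc (\prod_k F k) <= \prod_k K k.
 move=> H; apply: (big_ind2 (fun (x : R[i]) (y : R) => normc x <= y)) => //.
  by rewrite ComplexField.Normc.normc1.
 by move=> x1 y1 x2 y2 h1 h2; rewrite ComplexField.Normc.normcM ler_pM ?normc_nneg.
apply: ler_pM; rewrite ?normc_nneg//.
 rewrite rmorph_prod; apply: nprod => k /=.
 by rewrite expr0n addr0 sqrtr_sqr; have [] := bk k.
by apply: nprod => k; have [] := bk k.
Qed.

End mix_weight.

(** * Polar form and evaluation of the unfolded integral *)

Section partial_integral.
Context d1 d2 (X : measurableType d1) (Y : measurableType d2) (R : realType).
Variables (m1 : {sigma_finite_measure set X -> \bar R}) (m2 : {sigma_finite_measure set Y -> \bar R}).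

Lemma measurable_partial_Rintegral (F : X * Y -> R) : mfunT F ->
 mfunT (fun y => \int[m1]_x F (x, y)).
Proof.
move=> mF; have mE : mfunT (fun p => (F p)%:E) by exact/measurable_EFinP.
apply: (measurableT_comp (fine_measurable _)) => //.
rewrite (_ : (fun y => _) = (fun y => (\int[m1]_x (fun p => (F p)%:E)^\+ (x, y) - \int[m1]_x (fun p => (F p)%:E)^\- (x, y))%E)).
 apply: emeasurable_funB; apply: measurable_fun_fubini_tonelli_G => //.
  exact: measurable_funepos.
 exact: measurable_funeneg.
apply/funext=> y; rewrite [LHS]integralE; congr (_ - _)%E; apply: eq_integral=> x _; by rewrite !funeposE || rewrite !funenegE.
Qed.

Lemma cmeas_partial_cintegral (F : X * Y -> R[i]) : cmeas F ->
 cmeas (fun y => cintegral m1 setT (fun x => F (x, y))).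
Proof. by move=> [mr mi]; split; [exact: (measurable_partial_Rintegral mr)|exact: (measurable_partial_Rintegral mi)]. Qed.

End partial_integral.

Section polar_transport.
Variables (R : realType) (n : nat) (rho : PSL2n R n) (b : 'I_n -> bool).
Local Notation RT := (measurableTypeR R).
Local Notation T2 := (n.-tuple RT * n.-tuple RT)%type.

Definition polar_map : T2 -> T2 := map_fun2 (fun k => polar (b k)).
Definition polar_weight (q : T2) : R := \prod_k polar_jac (b k) (tnth q.1 k, tnth q.2 k).

Lemma measurable_polar_map : mfunT polar_map.
Proof. by apply: measurable_map_fun2 => k; exact: measurable_polar. Qed.

Lemma polar_jac_ge0 c (q : R * R) : 0 <= polar_jac c q.
Proof. by rewrite /polar_jac; case: c; [exact: hpolar_jac_ge0|exact: ell_polar_jac_ge0]. Qed.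

Lemma measurable_polar_jac c : mfunT (@polar_jac R c).
Proof. by rewrite /polar_jac; case: c; [exact: measurable_hpolar_jac|exact: measurable_ell_polar_jac]. Qed.

Lemma transports_polar : transports (hypm n) (@dxdy R n) (fun q => actT rho (polar_map q)) polar_weight.
Proof.
split.
- exact: measurableT_comp (measurable_actT rho) measurable_polar_map.
- apply: measurable_prod => k _; apply: (measurableT_comp (measurable_polar_jac (b k))).
 exact: measurable_tnth2.
- by move=> q; apply: prodr_ge0 => k _; exact: polar_jac_ge0.
move=> g mg g0; rewrite (actT_invariant rho mg g0).
have mga : mfunT (fun p => g (actT rho p)) by exact: measurableT_comp mg (measurable_actT rho).
rewrite /hypm ge0_integral_density//.
exact: (ge0_leb2_coordinate_change (d := fun _ => @hdens R) (j := fun k => polar_jac (b k)) (Z := fun k => polar (b k))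
 (fun _ => @measurable_hdens R) (fun _ => @hdens_ge0 R) (fun k => measurable_polar_jac (b k)) (fun k => polar_jac_ge0 (b k))
 (fun k => @measurable_polar R (b k)) (fun k g1 mg1 g10 => ge0_integral_polar_coord (b k) mg1 g10) mga (fun p => g0 _)).
Qed.

End polar_transport.

Section zero_on_measurable.
Variables (R : realType) (n : nat).
Lemma measurable_zero_on (S : {set 'I_n}) : mfunT (@zero_on R n S).
Proof.
rewrite (_ : @zero_on R n S = map_fun (fun j t => if j \in S then 0 else t)); last first.
 by apply/funext=> v; apply: eq_from_tnth=> j; rewrite !tnth_mktuple.
by apply: measurable_map_fun => j; case: (j \in S).
Qed.
End zero_on_measurable.

Section wave_measurable.
Variables (R : realType) (n m : nat) (rho : PSL2n R n) (h : 'I_m -> 'I_n).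
Hypothesis h_inj : injective h.
Variable B : 'M[R]_m.
Hypothesis B_free : row_free B.
Variable u : 'rV[R[i]]_n -> R[i].
Hypothesis u_smooth : csmooth_on (@upper_xy R n) (on_xy u).
Local Notation RT := (measurableTypeR R).
Local Notation T2 := (n.-tuple RT * n.-tuple RT)%type.
Local Notation b k := (k \in codom h).
Local Notation zt := (zt (coordZ rho h)).
Local Notation doms := (doms (coord_dom h)).
Local Notation cell := (period_cell h B).

Definition polar_point (q : T2) : T2 := actT rho (polar_map (fun k => b k) q).

Lemma measurable_polar_point : mfunT polar_point.
Proof. exact: measurableT_comp (measurable_actT rho) (measurable_polar_map _). Qed.

Lemma upper_polar_map (q : T2) : doms q.2 -> upper (polar_map (fun k => b k) q).
Proof.
move=> d; apply/upperE => k; rewrite /= tnth_mktuple.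
exact: (polar_im_gt0 (q := (tnth q.1 k, tnth q.2 k)) (d k)).
Qed.

Lemma zpoint_polar_map (q : T2) : zpoint (polar_map (fun k => b k) q) = polar_row h q.1 q.2.
Proof. by apply/rowP=> k; rewrite zpointE !mxE !tnth_mktuple. Qed.

Lemma upper_polar_point (q : T2) : doms q.2 -> upper (polar_point q).
Proof. by move=> d; apply/upper_actT/upper_polar_map. Qed.

Lemma zpoint_polar_point (q : T2) : doms q.2 -> zpoint (polar_point q) = zt q.1 q.2.
Proof.
move=> d; rewrite /polar_point zpoint_actT; last exact: upper_polar_map.
by rewrite zpoint_polar_map -zt_act.
Qed.

(** The indicators give a function measurable on the whole space, as Fubini requires; for v in the
    domain it is [u] cut to the cell. *)
Definition cut_wave (q : T2) : R[i] :=
 (\1_cell q.1)%:C * ((\1_(@upper R n) (polar_point q))%:C * u (zpoint (polar_point q))).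

Lemma cut_waveE (q : T2) : doms q.2 -> cut_wave q = (\1_cell q.1)%:C * u (zt q.1 q.2).
Proof.
move=> d; rewrite /cut_wave zpoint_polar_point//.
have -> : \1_(@upper R n) (polar_point q) = 1 :> R by rewrite indicE mem_set//; exact: upper_polar_point.
by rewrite mul1r.
Qed.

Lemma cmeas_cut_wave : cmeas cut_wave.
Proof.
apply: cmeasM.
 have mc : measurable (cell : set (n.-tuple RT)) by exact: measurable_period_cell.
 by apply/cmeas_real; apply: (measurableT_comp (measurable_indic mc)); exact: measurable_fst.
exact: (cmeas_comp (cmeas_upper u_smooth) measurable_polar_point).
Qed.

Definition cut_average (v : n.-tuple RT) : R[i] := cintegral (leb R n) setT (fun a => cut_wave (a, v)).

Lemma cmeas_cut_average : cmeas cut_average.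
Proof. exact: (cmeas_partial_cintegral _ cmeas_cut_wave). Qed.

Lemma cut_averageE v : doms v -> cut_average v = cell_avg rho h B u v.
Proof.
move=> d; rewrite /cell_avg cintegral_mkcond; apply: eq_cintegral => a.
by rewrite cut_waveE.
Qed.

Lemma doms_zero_on S (v : n.-tuple RT) : doms v -> doms (zero_on S v).
Proof.
move=> d k; rewrite tnth_mktuple; case: (k \in S); last exact: d.
by move=> _; have := pi_gt0 R; lra.
Qed.

Lemma mix_domain_doms (v : n.-tuple RT) : mix_domain h v -> doms v.
Proof. by move=> H k bk; have := H k; rewrite bk. Qed.

End wave_measurable.

Section class_unfolding.
Variables (R : realType) (n : nat) (Gam : set (PSL2n R n)).
Hypotheses (Gam_group : is_subgroup Gam)
 (Gam_discrete : is_discrete Gam).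
Variable F : set 'rV[R[i]]_n.
Hypothesis F_fundamental : is_fundamental_domain Gam F.
Local Notation RT := (measurableTypeR R).
Local Notation T2 := (n.-tuple RT * n.-tuple RT)%type.
Variable gam : PSL2n R n.
Variable D : set T2.
Hypotheses (mD : measurable D)
 (D_cover : forall p, upper p -> exists2 c, centralizer Gam gam c & D (actT c p))
 (D_inj : forall p c c', upper p -> centralizer Gam gam c -> centralizer Gam gam c' ->
 D (actT c p) -> D (actT c' p) -> c = c').
Variables (psi : 'rV[R]_n -> R[i]) (u : 'rV[R[i]]_n -> R[i]).
Hypotheses (psi_smooth : csmooth_on [set: 'rV[R]_n] psi)
 (u_smooth : csmooth_on (@upper_xy R n) (on_xy u))
 (u_invariant : forall g z, Gam g -> @Hn R n z -> u (act g z) = u z).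
Local Notation phi g := (class_fun psi u g).
Hypothesis class_integrable : forall s, conj_class Gam gam s ->
 cintegrable (hypm n) setT (fun p : T2 => (\1_(coords F) p)%:C * phi s (zpoint p)).
Hypothesis class_finite :
 finite_set [set s | conj_class Gam gam s /\ exists2 z, F z & phi s z != 0].

Let F_Hn : F `<=` @Hn R n. Proof. by case: F_fundamental. Qed.
Let mF : measurable (coords F : set T2). Proof. by case: F_fundamental. Qed.

Lemma class_fun_conj g z : Gam g -> @Hn R n z -> phi (g^-1 * gam * g)%g z = phi gam (act g z).
Proof.
move=> Gg Hz; have Hgz : @Hn R n (act g z) by exact: act_Hn.
have Hw : @Hn R n (act (g^-1 * gam * g)%g z) by exact: act_Hn.
rewrite /class_fun u_invariant//; congr (_ * _); rewrite !point_pair_csq; congr psi.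
apply/rowP=> k; rewrite [LHS]mxE [RHS]mxE -(csq_act g Hz Hw k); congr (csq _ _).
by rewrite -act_mul// !mulgA mulgV mul1g act_mul.
Qed.

(** [part] stands for the real or the imaginary part, so that the real unfolding is carried out once
    for both. *)
Lemma unfold_part (part : R[i] -> R) :
 (forall f : T2 -> R[i], cmeas f -> mfunT (fun p => part (f p))) ->
 (forall r z, part (r%:C * z) = r * part z) ->
 (forall s, conj_class Gam gam s ->
  (hypm n).-integrable setT (fun p : T2 => (part ((\1_(coords F) p)%:C * phi s (zpoint p)))%:E)) ->
 let X0 p := (\1_D p)%:C * ((\1_(@upper R n) p)%:C * phi gam (zpoint p)) in
 (hypm n).-integrable setT (fun p : T2 => (part (X0 p))%:E) /\
 rsum (conj_class Gam gam) (fun s => \int[hypm n]_p part ((\1_(coords F) p)%:C * phi s (zpoint p))) =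
 \int[hypm n]_p part (X0 p).
Proof.
move=> pm pZ pI X0.
pose r s (p : T2) := part ((\1_(@upper R n) p)%:C * phi s (zpoint p)).
have part0 : part 0 = 0 by rewrite -[0 in LHS](mul0r (0 : R[i])) -(rmorph0 (real_complex R)) pZ mul0r.
have rE s (p : T2) : part ((\1_(coords F) p)%:C * phi s (zpoint p)) = \1_(coords F) p * r s p.
 by rewrite upper_indic// pZ.
have [||||||I E] := @unfold_class R n Gam Gam_group Gam_discrete F F_fundamental gam D mD D_cover D_inj r
 [set s | conj_class Gam gam s /\ exists2 z, F z & phi s z != 0].
- by move=> s; apply: pm; exact: cmeas_class_fun.
- by move=> s p np; rewrite /r indicE memNset// mul0r.
- move=> g p Gg up; have up' : upper (actT g p) by apply/upper_actT.
 by rewrite /r zpoint_actT// class_fun_conj// !indicE !mem_set.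
- by [].
- move=> s p cs Fp nz; split=> //; exists (zpoint p) => //.
 by apply: contraNneq nz => e0; rewrite /r e0 mulr0 part0.
- by move=> s cs; have := pI s cs; under eq_fun do rewrite rE.
split; first by move: I; under [X in _ -> _.-integrable _ X]eq_fun do rewrite pZ.
rewrite (_ : (fun s => _) = fun s => \int[hypm n]_p (\1_(coords F) p * r s p)); last first.
 by apply/funext=> s; congr fine; apply: eq_integral=> p _; rewrite rE.
by rewrite E; congr fine; apply: eq_integral=> p _; rewrite /X0 pZ.
Qed.

Lemma class_sum_unfold :
 let X0 (p : T2) := (\1_D p)%:C * ((\1_(@upper R n) p)%:C * phi gam (zpoint p)) in
 cintegrable (hypm n) setT X0 /\
 class_sum psi u F (conj_class Gam gam) = cintegral (hypm n) setT X0.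
Proof.
move=> X0.
have ReZ (r : R) (z : R[i]) : Re (r%:C * z) = r * Re z by case: z => ? ?; rewrite /= mul0r subr0.
have ImZ (r : R) (z : R[i]) : Im (r%:C * z) = r * Im z by case: z => ? ?; rewrite /= mul0r addr0.
have [I1 E1] := @unfold_part (@Re R) (fun f mf => mf.1) ReZ (fun s cs => (class_integrable cs).1).
have [I2 E2] := @unfold_part (@Im R) (fun f mf => mf.2) ImZ (fun s cs => (class_integrable cs).2).
split; first by split.
have E s : hintegral F (phi s) = cintegral (hypm n) setT (fun p : T2 => (\1_(coords F) p)%:C * phi s (zpoint p)).
 by rewrite hintegral_hypm//; exact: cmeas_class.
rewrite /class_sum (eq_csum (h := fun s => cintegral (hypm n) setT (fun p : T2 => (\1_(coords F) p)%:C * phi s (zpoint p)))) //.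
by rewrite /csum /cintegral /=; congr (_ +i* _).
Qed.
End class_unfolding.

Section class_integral.
Variables (R : realType) (n m : nat) (Gam : set (PSL2n R n)).
Hypotheses (Gam_group : is_subgroup Gam)
 (Gam_discrete : is_discrete Gam).
Variables (gam rho : PSL2n R n) (h : 'I_m -> 'I_n).
Hypothesis h_inj : injective h.
Variables (N theta : 'I_n -> R).
Hypotheses (gam_hyp : forall k, k \in codom h -> 1 < N k /\ (rho^-1 * gam * rho)%g k = psl2 (dil_mx (N k)))
 (gam_ell : forall k, k \notin codom h ->
 sin (theta k) != 0 /\ (rho^-1 * gam * rho)%g k = psl2 (rot_mx (theta k))).
Variables (gens : 'I_m -> PSL2n R n) (Ng : 'I_m -> 'I_m -> R).
Hypotheses (gens_basis : free_abelian_basis (centralizer Gam gam) gens)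
 (gens_hyp : forall i j, 0 < Ng i j /\
 (rho^-1 * gens i * rho)%g (h j) = psl2 (dil_mx (Ng i j)))
 (gens_ell : forall i k, k \notin codom h ->
 exists phi, (rho^-1 * gens i * rho)%g k = psl2 (rot_mx phi)).
Variables (lam : 'I_n -> R[i]) (u : 'rV[R[i]]_n -> R[i]).
Hypotheses (u_smooth : csmooth_on (@upper_xy R n) (on_xy u))
 (u_invariant : forall g z, Gam g -> @Hn R n z -> u (act g z) = u z)
 (u_eigen : forall k p, @upper_xy R n p -> laplacian k u p + lam k * on_xy u p = 0).
Variable psi : 'rV[R]_n -> R[i].
Hypotheses (psi_smooth : csmooth_on [set: 'rV[R]_n] psi)
 (psi_compact : compact_support psi).
Variables (f g : 'I_n -> R -> R[i]).
Hypotheses (f_sol : forall k, f_solution (- lam k) (f k)) (g_sol : forall k, g_solution (- lam k) (g k)).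
Local Notation RT := (measurableTypeR R).
Local Notation T2 := (n.-tuple RT * n.-tuple RT)%type.
Local Notation T1 := (n.-tuple RT).
Local Notation b k := (k \in codom h).
Local Notation B := (\matrix_(i, j) ln (Ng i j)).
Local Notation cell := (period_cell h B).
Local Notation G := (mix_weight h psi N theta).
Local Notation W := (cell_avg rho h B u).
Local Notation D := (period_tile rho h Ng).
Local Notation zt := (zt (coordZ rho h)).
Local Notation doms := (doms (coord_dom h)).

Let B_free : row_free B.
Proof. exact: (period_matrix_free Gam_group Gam_discrete h_inj gens_basis gens_hyp gens_ell). Qed.

Let class_density (p : T2) : R[i] :=
 (\1_D p)%:C * ((\1_(@upper R n) p)%:C * class_fun psi u gam (zpoint p)).

Lemma coord_distE (q : T2) k : doms q.2 ->
 csq (zt q.1 q.2 0 k) (act gam (zt q.1 q.2) 0 k) = coord_dist h N theta k (tnth q.2 k).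
Proof.
move=> d; have Hp := polar_row_Hn q.1 d.
have e : act gam (act rho (polar_row h q.1 q.2)) = act rho (act (rho^-1 * gam * rho)%g (polar_row h q.1 q.2)).
 by rewrite -act_mul// -[RHS]act_mul// !mulgA mulgV mul1g.
rewrite zt_act e csq_act//; last exact: act_Hn.
rewrite [X in csq _ X]mxE [X in csq X _]mxE [X in moebius _ X]mxE /coord_dist /polar_Z.
have [bk|bk] := boolP (b k).
 have [N1 ->] := gam_hyp bk; rewrite csq_dil//; first by lra.
 by have := d k; rewrite /coord_dom bk.
by have [_ ->] := gam_ell bk; rewrite csq_rot.
Qed.

Lemma period_tile_polar (q : T2) : doms q.2 -> (forall k, ~~ b k -> full_turn (tnth q.1 k)) ->
 \1_D (polar_point rho h q) = \1_cell q.1 :> R.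
Proof.
move=> d tu; have up := upper_polar_map d.
have e : actT rho^-1%g (polar_point rho h q) = polar_map (fun k => b k) q by rewrite actTK.
have E : D (polar_point rho h q) <-> cell q.1.
 rewrite /period_tile /= e.
 have -> : \row_j log_radius (zpoint (polar_map (fun k => b k) q) 0 (h j)) = \row_j tnth q.1 (h j).
  apply/rowP=> j; rewrite [LHS]mxE [RHS]mxE zpoint_polar_map mxE /polar_Z codom_f.
  exact: (log_radius_polar (tnth q.1 (h j), tnth q.2 (h j))).
 split; first by move=> [_ ?]; split=> // k /tu; rewrite /full_turn /= in_itv.
 by move=> [? _]; split=> //; exact: upper_polar_point.
rewrite !indicE; congr (nat_of_bool _)%:R; apply/idP/idP=> /set_mem H; apply/mem_set; exact/E.
Qed.

(** Where some coordinate leaves the polar range, the Jacobian kills the left side, and the weight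
    or the indicator of the cell kills the right side. Elsewhere the Jacobian is the product of the
    weights and the kernel depends on v alone. *)
Lemma class_density_polar (q : T2) :
 (polar_weight (fun k => b k) q)%:C * class_density (polar_point rho h q) = G q.2 * cut_wave rho h B u q.
Proof.
pose ok k := if b k then in_pihalf (tnth q.2 k)
 else (- (pi / 2) <= tnth q.1 k < 3 * (pi / 2)) && (0 < tnth q.2 k).
have [/forallP H|/forallPn[k nk]] := boolP [forall k, ok k]; last first.
 rewrite /polar_weight (bigD1 k)//= {1}/polar_jac.
 have -> : (if b k then hpolar_jac (tnth q.1 k, tnth q.2 k) else ell_polar_jac (tnth q.1 k, tnth q.2 k)) = 0.
  by move: nk; rewrite /ok /hpolar_jac /ell_polar_jac /=; case: ifP=> _ /negbTE ->.
 rewrite mul0r mul0r; have [mv|nmv] := pselect (mix_domain h q.2); last by rewrite mix_weight_out// mul0r.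
 rewrite /cut_wave indicE memNset ?mul0r ?mulr0// => -[_ tu].
 move: nk; rewrite /ok; have := mv k; have := tu k.
 by case: (b k) => [_ |/(_ isT) -> ->]; rewrite // /in_pihalf => ->.
have mv : mix_domain h q.2.
 by move=> k; have := H k; rewrite /ok; case: (b k) => // /andP[].
have d := mix_domain_doms mv.
rewrite cut_waveE// /class_density period_tile_polar//; last first.
 by move=> k /negbTE bk; have := H k; rewrite /ok bk /full_turn /= in_itv /= => /andP[].
have -> : \1_(@upper R n) (polar_point rho h q) = 1 :> R by rewrite indicE mem_set//; exact: upper_polar_point.
have im : \1_(mix_domain h) q.2 = 1 :> R by rewrite indicE mem_set.
rewrite zpoint_polar_point// /mix_weight im !mul1r.
have -> : polar_weight (fun k => b k) q = \prod_k coord_weight h k (tnth q.2 k).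
 apply: eq_bigr=> k _; have := H k; rewrite /ok /polar_jac /coord_weight /hpolar_jac /ell_polar_jac /=.
 by case: (b k) => ->.
rewrite /class_fun point_pair_csq.
have -> : (\row_k csq (zt q.1 q.2 0 k) (act gam (zt q.1 q.2) 0 k)) = \row_k coord_dist h N theta k (tnth q.2 k).
 by apply/rowP=> k; rewrite mxE [RHS]mxE coord_distE.
ring.
Qed.

Lemma cintegrable_cut_wave (v : T1) : doms v ->
 cintegrable (leb R n) setT (fun a => cut_wave rho h B u (a, v)).
Proof.
move=> d; rewrite (_ : (fun a => _) = fun a => (\1_cell a)%:C * on_xy u (pt (coordZ rho h) a v)); last first.
 by apply/funext=> a; rewrite cut_waveE// on_xy_pt.
apply/(cintegrable_mkcond (leb R n) (fun a => on_xy u (pt (coordZ rho h) a v))); first exact: measurable_period_cell.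
split.
 exact: (integrable_cell rho B_free (phi_re_continuous u_smooth) d).
exact: (integrable_cell rho B_free (phi_im_continuous u_smooth) d).
Qed.

Lemma class_density_integral : cintegrable (hypm n) setT class_density ->
 cintegrable (leb R n) setT (fun v => G v * W v) /\
 cintegral (hypm n) setT class_density = cintegral (leb R n) setT (fun v => G v * W v).
Proof.
move=> I; have tr := transports_polar rho (fun k => b k).
have mD : measurable (D : set T2).
 exact: (measurable_period_tile Gam_group Gam_discrete h_inj gens_basis gens_hyp gens_ell).
have mX : cmeas class_density.
 apply: cmeasM; first by apply/cmeas_real/measurable_indic.
 exact: cmeas_class_fun.
have E : (fun q => (polar_weight (fun k => b k) q)%:C * class_density (actT rho (polar_map (fun k => b k) q))) =
 (fun q => G q.2 * cut_wave rho h B u q) by apply/funext=> q; exact: class_density_polar.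
have I2 : cintegrable (leb R n \x leb R n)%E setT (fun q => G q.2 * cut_wave rho h B u q).
 by move/(transports_cintegrable tr mX): I; rewrite E.
have [I3 E3] := cintegral_fubini I2.
have E4 : (fun y => cintegral (leb R n) setT (fun x => G (x, y).2 * cut_wave rho h B u (x, y))) = fun v => G v * W v.
 apply/funext=> v /=; have [mv|nmv] := pselect (mix_domain h v); last first.
  rewrite mix_weight_out//; under eq_fun do rewrite mul0r.
  by rewrite mul0r /cintegral /= /Rintegral integral0.
 rewrite cintegralZ; last by apply: cintegrable_cut_wave; exact: mix_domain_doms.
 by congr (_ * _); apply: cut_averageE; exact: mix_domain_doms.
by split; [rewrite -E4|rewrite (transports_cintegral tr mX) E E3 E4].
Qed.

Lemma mix_weight_wave_measurable (S : {set 'I_n}) : cmeas (fun v : T1 => G v * \prod_(j in S) coord_sol h f g j (tnth v j) * W (zero_on S v)).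
Proof.
rewrite (_ : (fun v => _) = fun v => G v * \prod_(j in S) coord_sol h f g j (tnth v j) * cut_average rho h B u (zero_on S v)); last first.
 apply/funext=> v; have [mv|nmv] := pselect (mix_domain h v); last by rewrite mix_weight_out// !mul0r.
 by rewrite cut_averageE//; apply: doms_zero_on; exact: mix_domain_doms.
apply: cmeasM; first by apply: cmeas_mix_weight_solution; [exact: psi_smooth|exact: f_sol|exact: g_sol].
have mc : cmeas (cut_average rho h B u) by exact: cmeas_cut_average.
exact: (cmeas_comp mc (@measurable_zero_on R n S)).
Qed.

Lemma class_formula : cintegrable (hypm n) setT class_density ->
 let F_gam := cintegral (leb R m) (period_domain B) (period_integrand h u rho) in
 let I_gam := cintegral (leb R n) (mix_domain h) (mix_integrand h psi N theta f g) in
 [/\ cintegrable (leb R m) (period_domain B) (period_integrand h u rho),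
   cintegrable (leb R n) (mix_domain h) (mix_integrand h psi N theta f g) &
   cintegral (hypm n) setT class_density = ((2 * pi) ^+ (n - m))%:C * F_gam * I_gam].
Proof.
move=> I F_gam I_gam.
have [tau [tau_shifts tauB']] := period_vectors h_inj gens_hyp gens_ell.
have tauB i j : tau i (h j) = B i j by rewrite mxE.
have [GWI GWE] := class_density_integral I.
have N1 k : b k -> 1 < N k by move=> /gam_hyp[].
have th0 k : k \notin codom h -> sin (theta k) != 0 by move=> /gam_ell[].
have GI := mix_weight_integrable psi_smooth psi_compact N1 th0 f_sol g_sol.
have [PI PE] := cell_avg_origin rho h_inj B_free u_smooth.
have E v : (\1_(mix_domain h) v)%:C * mix_integrand h psi N theta f g v = G v * \prod_k coord_sol h f g k (tnth v k).
 exact: mix_integrandE.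
have MI : cintegrable (leb R n) (mix_domain h) (mix_integrand h psi N theta f g).
 apply/(cintegrable_mkcond (leb R n) (mix_integrand h psi N theta f g)); first exact: measurable_mix_domain.
 by move: GI; under [X in _ -> cintegrable _ _ X]eq_fun do rewrite E.
have zv (S : {set 'I_n}) (v : T1) k : k \notin S -> doms v -> doms (zero_on S v) /\ tnth (zero_on S v) k = tnth v k.
 by move=> kS d; split; [exact: doms_zero_on|exact: tnth_zero_on].
have Wh (v : T1) k (S : {set 'I_n}) : mix_domain h v -> b k -> k \notin S ->
  W (zero_on S v) + W (updt (zero_on S v) k (- tnth v k)) =
  2%:R * coord_sol h f g k (tnth v k) * W (updt (zero_on S v) k 0).
 move=> mv bk kS; have [d e] := zv S v k kS (mix_domain_doms mv).
 have := cell_avg_hyp Gam_group h_inj gens_basis B_free tau_shifts tauB u_smooth u_invariant u_eigen f_sol d bk.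
 by rewrite e /coord_sol bk.
have We (v : T1) k (S : {set 'I_n}) : mix_domain h v -> ~~ b k -> k \notin S ->
  W (zero_on S v) = coord_sol h f g k (tnth v k) * W (updt (zero_on S v) k 0).
 move=> mv bk kS; have [d e] := zv S v k kS (mix_domain_doms mv).
 have v0 : 0 < tnth (zero_on S v) k by rewrite e; have := mv k; rewrite (negbTE bk).
 have := cell_avg_ell Gam_group h_inj gens_basis B_free tau_shifts tauB u_smooth u_invariant u_eigen g_sol d bk v0.
 by rewrite e /coord_sol (negbTE bk).
(* With S the set of all coordinates, the average is replaced by its value at the origin times the
   product of all solutions. *)
have [_ S1] := symmetrize (@mix_weight_out R n m h psi N theta) (@mix_weight_flip R n m h psi N theta) Wh We
 mix_weight_wave_measurable GWI finset.setT.
split; [exact: PI|exact: MI|]; rewrite [LHS]GWE -[LHS]S1.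
have zT v : zero_on finset.setT v = origin R n by apply: eq_from_tnth=> k; rewrite !tnth_mktuple finset.in_setT.
transitivity (cintegral (leb R n) setT (fun v : T1 => W (origin R n) * (G v * \prod_k coord_sol h f g k (tnth v k)))).
 apply: eq_cintegral.
 move=> v; rewrite zT mulrC; congr (_ * (_ * _)); apply: eq_bigl => k; exact: finset.in_setT.
have -> : I_gam = cintegral (leb R n) setT (fun v : T1 => G v * \prod_k coord_sol h f g k (tnth v k)).
 by rewrite /I_gam cintegral_mkcond; apply: eq_cintegral => v; rewrite E.
transitivity (W (origin R n) * cintegral (leb R n) setT (fun v : T1 => G v * \prod_k coord_sol h f g k (tnth v k))).
 exact: cintegralZ GI.
by rewrite PE.
Qed.

End class_integral.

Lemma rot_elliptic_sin (R : realType) (t : R) : elliptic (psl2 (rot_mx t)) -> sin t != 0.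
Proof.
rewrite /elliptic (psl2_pi (det_rot t)) abs_trace_pi /= /mxtrace !big_ord_recl big_ord0 !mxE /= addr0 => h.
apply/eqP=> s0; have := cos2Dsin2 t; rewrite s0 expr0n /= addr0 => /eqP c1.
have /orP[/eqP e|/eqP e] : (cos t == 1) || (cos t == - 1) by rewrite -sqrf_eq1.
 by move: h; rewrite e ger0_norm ?addr_ge0//; lra.
by move: h; rewrite e -opprD normrN ger0_norm ?addr_ge0//; lra.
Qed.

Theorem theorem2p3 (R : realType) (n : nat) (n_ge2 : (2 <= n)%N)
    (* the group *)
    (Gam : set (PSL2n R n))
    (Gam_group : is_subgroup Gam)
    (Gam_discrete : is_discrete Gam)
    (Gam_irreducible : is_irreducible Gam)
    (Gam_cusp : exists kappa, is_cusp Gam kappa)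
    (* cusps and fundamental domain *)
    (S : set {ffun 'I_n -> option R})
    (S_finite : finite_set S)
    (S_complete : complete_cusps Gam S)
    (sigma : {ffun 'I_n -> option R} -> PSL2n R n)
    (sigma_infty : forall kappa, S kappa ->
       act_bd (sigma kappa) (@infty R n) = kappa)
    (P : {ffun 'I_n -> option R} -> 'M[R]_n)
    (P_basis : forall kappa, S kappa ->
       lattice_basis (P kappa) (transl_set Gam (sigma kappa)))
    (Q : {ffun 'I_n -> option R} -> 'M[R]_(n.-1, n))
    (Q_basis : forall kappa, S kappa ->
       lattice_basis (Q kappa) (log_mult_set Gam (sigma kappa)))
    (C : R) (C_gt0 : 0 < C)
    (C_separates : separated_pieces Gam S sigma P Q C)
    (F0 : set 'rV[R[i]]_n)
    (F0_compact : compact [set p | on_xy F0 p])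
    (F_fundamental : is_fundamental_domain Gam (fdomain S sigma P Q C F0))
    (F_volume : (hvol (fdomain S sigma P Q C F0) < +oo)%E)
    (* the automorphic function *)
    (s : 'I_n -> R[i]) (s_lt1 : forall k, complex.Re (s k) < 1)
    (lam : 'I_n -> R[i]) (lamE : forall k, lam k = s k * (1 - s k))
    (u : 'rV[R[i]]_n -> R[i])
    (u_smooth : csmooth_on (@upper_xy R n) (on_xy u))
    (u_nonconstant : exists z w, [/\ @Hn R n z, @Hn R n w & u z <> u w])
    (u_invariant : forall g z, Gam g -> @Hn R n z -> u (act g z) = u z)
    (u_eigen : forall k p, @upper_xy R n p ->
       laplacian k u p + lam k * on_xy u p = 0)
    (u_growth : forall kappa k z, S kappa -> @Hn R n z ->
       normc (u (act (sigma kappa) (set_im z k t))) / expR (2 * pi * t)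
         @[t --> +oo] --> (0 : R))
    (* the test function and the special functions *)
    (psi : 'rV[R]_n -> R[i])
    (psi_smooth : csmooth_on [set: 'rV[R]_n] psi)
    (psi_compact : compact_support psi)
    (f : 'I_n -> R -> R[i]) (f_sol : forall k, f_solution (- lam k) (f k))
    (g : 'I_n -> R -> R[i]) (g_sol : forall k, g_solution (- lam k) (g k)) :
  let F := fdomain S sigma P Q C F0 in
  let F_upto := fdomain_upto S sigma P Q C F0 in
  let c A X := class_sum psi u (F_upto A) X in
  let T X := class_sum psi u F X in
  let Sigma_mix A := csum (mixed_classes Gam) (c A) in
  [/\ (* all sums and integrals converge absolutely *)
      (forall X, mixed_classes Gam X ->
         class_sum_converges psi u F X /\
         forall A, class_sum_converges psi u (F_upto A) X) /\
      (forall A, csummable (mixed_classes Gam) (c A)),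
      normc (Sigma_mix A - csum (mixed_classes Gam) T) / A
        @[A --> +oo] --> (0 : R),
      finite_set [set X | mixed_classes Gam X /\ T X <> 0] &
      forall (gam : PSL2n R n) (m : nat) (h : 'I_m -> 'I_n),
        mixed Gam gam -> injective h ->
        (forall i, hyperbolic (gam (h i))) ->
        (forall k, k \notin codom h -> elliptic (gam k)) ->
      forall (rho : PSL2n R n) (N theta : 'I_n -> R),
        (forall i, 1 < N (h i) /\
           (rho^-1 * gam * rho)%g (h i) = psl2 (dil_mx (N (h i)))) ->
        (forall k, k \notin codom h -> 0 <= theta k < pi /\
           (rho^-1 * gam * rho)%g k = psl2 (rot_mx (theta k))) ->
      forall (gens : 'I_m -> PSL2n R n) (Ng : 'I_m -> 'I_m -> R),
        free_abelian_basis (centralizer Gam gam) gens ->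
        (forall i j, 0 < Ng i j /\
           (rho^-1 * gens i * rho)%g (h j) = psl2 (dil_mx (Ng i j))) ->
        (forall i k, k \notin codom h ->
           exists phi, (rho^-1 * gens i * rho)%g k = psl2 (rot_mx phi)) ->
      let P_gam := period_domain (\matrix_(i, j) ln (Ng i j)) in
      let F_gam := cintegral (leb R m) P_gam (period_integrand h u rho) in
      let I_gam := cintegral (leb R n) (mix_domain h)
                     (mix_integrand h psi N theta f g) in
      [/\ cintegrable (leb R m) P_gam (period_integrand h u rho),
          cintegrable (leb R n) (mix_domain h)
            (mix_integrand h psi N theta f g) &
          T (conj_class Gam gam) = ((2 * pi) ^+ (n - m))%:C * F_gam * I_gam]].
Proof.
move=> F F_upto c T Sigma_mix.
have n0 : (0 < n)%N by exact: leq_trans n_ge2.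
have F_Hn : F `<=` @Hn R n by case: F_fundamental.
have mF : measurable (coords F : set (n.-tuple (measurableTypeR R) * n.-tuple (measurableTypeR R))) by case: F_fundamental.
have FuF A : F_upto A `<=` F by exact: F_uptoF.
have mFu A : measurable (coords (F_upto A) : set (n.-tuple (measurableTypeR R) * n.-tuple (measurableTypeR R))).
 exact: (measurable_F_upto S_finite P_basis Q_basis F0_compact F_fundamental A).
have cv (D : set 'rV[R[i]]_n) X : D `<=` F -> measurable (coords D : set (n.-tuple (measurableTypeR R) * n.-tuple (measurableTypeR R))) -> mixed_classes Gam X -> class_sum_converges psi u D X.
 move=> DF mD hX.
 by apply: class_sum_cvg hX DF mD; eassumption.
split.
- split.
  by move=> X hX; split; [exact: cv|move=> A; exact: cv].
 move=> A.
 by apply: class_sums_summable (FuF A); eassumption.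
- have [A0 hA0] := class_sum_eventually n0 Gam_group Gam_discrete S_finite S_complete sigma_infty P_basis Q_basis C_gt0 C_separates F0_compact F_fundamental psi_smooth psi_compact u_smooth.
 apply: cvg_near_cst; exists A0; split; first exact: num_real.
 move=> A /ltW hA; have -> : Sigma_mix A = csum (mixed_classes Gam) T by apply: eq_csum => X hX; exact: hA0.
 by rewrite subrr ComplexField.Normc.normc0 mul0r.
- by apply: active_classes_finite (@subset_refl _ F); eassumption.
move=> gam m h gam_mixed h_inj gam_hyperbolic gam_elliptic rho N theta rho_hyp rho_ell gens Ng gens_basis gens_hyp gens_ell P_gam F_gam I_gam.
have Ggam : Gam gam by case: gam_mixed.
have ghyp k : k \in codom h -> 1 < N k /\ (rho^-1 * gam * rho)%g k = psl2 (dil_mx (N k)).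
 by move=> /codomP[i ->].
have gell k : k \notin codom h -> sin (theta k) != 0 /\ (rho^-1 * gam * rho)%g k = psl2 (rot_mx (theta k)).
 move=> hk; have [_ e] := rho_ell k hk; split=> //; apply: rot_elliptic_sin; rewrite -e.
 (* Ellipticity is a condition on the absolute trace, which conjugation by rho preserves; it
    excludes sin theta = 0. *)
 by rewrite /elliptic !mul_ffun_groupE inv_ffun_groupE abs_trace_conj; exact: gam_elliptic.
have mD := measurable_period_tile Gam_group Gam_discrete h_inj gens_basis gens_hyp gens_ell.
have Dc := period_tile_cover Gam_group Gam_discrete h_inj gens_basis gens_hyp gens_ell.
have Di := period_tile_inj Gam_group Gam_discrete h_inj gens_basis gens_hyp gens_ell.
have cmix x : conj_class Gam gam x -> mixed Gam x by move=> [g1 Gg1 <-]; exact: conj_mixed.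
have ci x : conj_class Gam gam x -> cintegrable (hypm n) setT (fun p => (\1_(coords F) p)%:C * class_fun psi u x (zpoint p)).
 move=> /cmix ms.
 by apply: class_fun_cintegrable ms (@subset_refl _ F) mF; eassumption.
have cf : finite_set [set x | conj_class Gam gam x /\ exists2 z, F z & class_fun psi u x z != 0].
 apply: sub_finite_set (mixed_finite n0 Gam_group Gam_discrete S_finite S_complete sigma_infty P_basis Q_basis C_gt0 C_separates F0_compact F_Hn u psi_compact).
 by move=> x [/cmix mx hx].
have [I E] := class_sum_unfold Gam_group Gam_discrete F_fundamental mD Dc Di psi_smooth u_smooth u_invariant ci cf.
have [PI MI EQ] := class_formula Gam_group Gam_discrete h_inj ghyp gell gens_basis gens_hyp gens_ell u_smooth u_invariant u_eigen psi_smooth psi_compact f_sol g_sol I.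
by split; [exact: PI|exact: MI|rewrite [LHS]E [LHS]EQ].
Qed.
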